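(* There are universal constants $C,c\in(0,\infty)$ such that the following holds. Let $\rho>0$, $\zeta\in\mathbb{C}$ with $|\zeta|\le\rho$, and $T\in(0,\infty)$. There is a constant $c'=c'(\rho,\zeta,T)>0$ such that for every $N\ge1$ and every $0<t\le T$, if $(B(t))_{t\ge0}$ is a $(\rho,\zeta)$-Brownian motion on $\mathrm{GL}(N,\mathbb{C})$ and $A$ is an $N\times N$ complex matrix, deterministic or random and independent of $(B(t))_{t\ge0}$, then for any $k\ge C\log N$, with probability at least $1-\exp(-\min\{ck,N^{2/3}\})$, $$\sigma_{N-\ell}(B(t)+A)\ge c'\left(\frac{\ell}{N}\right)^2\qquad\text{for all integers }\ell\text{ with }k\le\ell\le\min\{\sqrt t\,N,\,N-1\}.$$
   Context: $\sigma_1(M)\ge\dots\ge\sigma_N(M)\ge0$ denote the singular values of an $N\times N$ matrix $M$. A Hermitian Brownian motion of size $N$ is a process $(X(t))_{t\ge0}$ of Hermitian $N\times N$ matrices such that the processes $\sqrt N X_{ii}$ ($1\le i\le N$), $\sqrt{2N}\,\mathrm{Re}\,X_{ij}$ and $\sqrt{2N}\,\mathrm{Im}\,X_{ij}$ ($1\le i<j\le N$) are independent standard real Brownian motions. Given $\rho>0$, $|\zeta|\le\rho$, choose $a,b,\theta\in\mathbb{R}$ with $a^2+b^2=\rho$ and $e^{2\mathbf{i}\theta}(a^2-b^2)=\zeta$ (e.g. $a=\sqrt{(\rho+|\zeta|)/2}$, $b=\sqrt{(\rho-|\zeta|)/2}$, $\theta=\frac12\arg\zeta$). The elliptical Brownian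 motion is $W=e^{\mathbf{i}\theta}(aX+\mathbf{i}bY)$ with $X,Y$ independent Hermitian Brownian motions of size $N$; its law depends only on $(\rho,\zeta)$. The $(\rho,\zeta)$-Brownian motion on $\mathrm{GL}(N,\mathbb{C})$ driven by $W$ is the strong solution of the It\^o SDE $B(t)=I+\int_0^tB(s)\,dW(s)+\frac\zeta2\int_0^tB(s)\,ds$. *)

(* Defs.v *)
From HB Require Import structures.
From mathcomp Require Import all_boot all_order all_algebra.
From mathcomp Require Import sesquilinear spectral.
From mathcomp Require Import complex.
From mathcomp Require Import all_classical all_reals all_analysis.

Set Implicit Arguments.
Unset Strict Implicit.
Unset Printing Implicit Defensive.

Import Order.TTheory GRing.Theory Num.Theory.
Import numFieldNormedType.Exports.

Local Open Scope classical_set_scope.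
Local Open Scope ring_scope.
Local Open Scope sesquilinear_scope.

Section Matrices.
Variables (R : realType) (N : nat).
Implicit Type M : 'M[R[i]]_N.

(* The 2N^2 real coordinates of a complex matrix; the boolean selects the
   imaginary part. *)
Definition mx_coord (q : 'I_N * 'I_N * bool) M : R :=
  let z := M q.1.1 q.1.2 in if q.2 then complex.Im z else complex.Re z.

(* squared Hilbert-Schmidt norm *)
Definition hs2 M : R := \sum_q mx_coord q M ^+ 2.

(* [spectral_diag] lists the eigenvalues of the Hermitian matrix M^* M with
   multiplicity, in no particular order. *)
Definition singular_values M : seq R :=
  sort >=%O [seq Num.sqrt (complex.Re (spectral_diag (M ^t* *m M) ord0 i))
            | i <- enum 'I_N].

(* sigma_k, for 1 <= k <= N *)
Definition sigma (k : nat) M : R := nth 0 (singular_values M) k.-1.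

Definition cis (x : R) : R[i] := Complex (cos x) (sin x).

End Matrices.

Section Probability.
Variables (R : realType) (d : measure_display) (Omega : measurableType d).
Variable P : probability Omega R.

Definition sigma_rv (K : Type) (D : set K) (V : K -> Omega -> R) :
    set (set Omega) :=
  <<s \bigcup_(k in D) preimage_set_system setT (V k) measurable >>.

Definition sigma_mx (N : nat) (K : Type) (D : set K)
    (X : K -> Omega -> 'M[R[i]]_N) : set (set Omega) :=
  sigma_rv (D `*` setT) (fun k w => mx_coord k.2 (X k.1 w)).

Definition sigma_mx1 (N : nat) (A : Omega -> 'M[R[i]]_N) : set (set Omega) :=
  sigma_mx [set tt] (fun=> A).

Definition random_matrix (N : nat) (A : Omega -> 'M[R[i]]_N) : Prop :=
  sigma_mx1 A `<=` measurable.

Definition independent2 (G1 G2 : set (set Omega)) : Prop :=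
  forall E1 E2, G1 E1 -> G2 E2 -> P (E1 `&` E2) = (P E1 * P E2)%E.

Definition independent (I : finType) (G : I -> set (set Omega)) : Prop :=
  forall (J : {set I}) (E : I -> set Omega), (forall i, i \in J -> G i (E i)) ->
    P (\bigcap_(i in [set` J]) E i) = (\prod_(i in J) P (E i))%E.

(* All processes below are indexed by R but only constrained, and only used,
   at nonnegative times. *)

Definition standard_brownian_motion (V : R -> Omega -> R) : Prop :=
  [/\ forall t, 0 <= t -> measurable_fun setT (V t),
      {ae P, forall w, V 0 w = 0 /\
                       {within `[0, +oo[, continuous (fun t => V t w)}},
      forall (n : nat) (u : nat -> R), 0 <= u 0%N ->
        (forall i, u i <= u i.+1) ->
        independent (fun i : 'I_n => preimage_set_system setT
          (fun w => V (u i.+1) w - V (u i) w) measurable)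
    & forall s t, 0 <= s -> s < t -> forall U : set R, measurable U ->
        P ((fun w => V t w - V s w) @^-1` U)
        = normal_prob 0 (Num.sqrt (t - s)) U].

(* The N^2 real processes attached to a Hermitian matrix process, stored in one
   array: the (normalized) diagonal entry at (i, i), the real part of X_ij at
   (i, j) and its imaginary part at (j, i), for i < j. *)
Definition hermitian_coord (N : nat) (X : R -> Omega -> 'M[R[i]]_N)
    (p : 'I_N * 'I_N) (t : R) (w : Omega) : R :=
  let: (i, j) := p in
  if i == j then Num.sqrt N%:R * complex.Re (X t w i i)
  else if (i < j)%N then Num.sqrt (2 * N%:R) * complex.Re (X t w i j)
  else Num.sqrt (2 * N%:R) * complex.Im (X t w j i).

Definition hermitian_brownian_motion (N : nat)
    (X : R -> Omega -> 'M[R[i]]_N) : Prop :=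
  [/\ forall t w, 0 <= t -> (X t w) ^t* = X t w,
      forall p, standard_brownian_motion (hermitian_coord X p)
    & independent (fun p => sigma_rv `[0, +oo[ (hermitian_coord X p))].

Definition elliptical_brownian_motion (rho : R) (zeta : R[i]) (N : nat)
    (W : R -> Omega -> 'M[R[i]]_N) : Prop :=
  exists (a b theta : R) (X Y : R -> Omega -> 'M[R[i]]_N),
    [/\ a ^+ 2 + b ^+ 2 = rho,
        cis (2 * theta) * (a ^+ 2 - b ^+ 2)%:C%C = zeta,
        hermitian_brownian_motion X /\ hermitian_brownian_motion Y,
        independent2 (sigma_mx `[0, +oo[ X) (sigma_mx `[0, +oo[ Y)
      & forall t w, 0 <= t ->
          W t w = cis theta *: (a%:C%C *: X t w + ('i%C * b%:C%C) *: Y t w)].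

(* Augmented natural filtration; the null sets are taken measurable so that it
   stays inside the sigma-algebra of Omega even if P is not complete. *)
Definition filtration (N : nat) (W : R -> Omega -> 'M[R[i]]_N) (t : R) :
    set (set Omega) :=
  <<s sigma_mx `[0, t] W `|` [set E | measurable E /\ P E = 0%E] >>.

(* The outer measure agrees with P on measurable sets; it keeps the definition
   meaningful when U is only almost surely equal to a measurable variable. *)
Definition cvg0_in_probability (U : nat -> Omega -> \bar R) : Prop :=
  forall eps : R, 0 < eps ->
    mu_ext P [set w | (eps%:E <= U n w)%E] @[n --> \oo] --> 0%E.

Section Ito.
Variables (N : nat) (W : R -> Omega -> 'M[R[i]]_N).

(* The simple process \sum_(i < m) xi_i 1_(]u_i, u_(i+1)]). *)
Record simple_process := SimpleProcess {
  sp_size : nat;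
  sp_time : nat -> R;
  sp_coef : nat -> Omega -> 'M[R[i]]_N;
  sp_time_ge0 : 0 <= sp_time 0%N;
  sp_time_le : forall i, sp_time i <= sp_time i.+1;
  sp_coef_adapted : forall i,
    sigma_mx1 (sp_coef i) `<=` filtration W (sp_time i);
  sp_coef_bounded : exists K : R,
    forall i w q, `|mx_coord q (sp_coef i w)| <= K }.

Definition sp_eval (S : simple_process) (s : R) (w : Omega) : 'M[R[i]]_N :=
  \sum_(i < sp_size S)
    (if sp_time S i < s <= sp_time S i.+1 then sp_coef S i w else 0).

Definition sp_integral (S : simple_process) (t : R) (w : Omega) :
    'M[R[i]]_N :=
  \sum_(i < sp_size S)
    sp_coef S i w *m (W (Num.min t (sp_time S i.+1)) w
                      - W (Num.min t (sp_time S i)) w).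

(* Z is a version of \int_0^t H dW: the limit in probability of the integrals
   of simple processes approximating H in L^2([0, t]), in probability. *)
Definition is_ito_integral (H : R -> Omega -> 'M[R[i]]_N) (t : R)
    (Z : Omega -> 'M[R[i]]_N) : Prop :=
  exists S : nat -> simple_process,
    cvg0_in_probability (fun n w =>
      (\int[lebesgue_measure]_(s in `[0%R, t])
        (hs2 (sp_eval (S n) s w - H s w)%R)%:E)%E) /\
    cvg0_in_probability (fun n w => (hs2 (sp_integral (S n) t w - Z w))%:E).

End Ito.

Definition time_integral (N : nat) (H : R -> Omega -> 'M[R[i]]_N) (t : R)
    (w : Omega) : 'M[R[i]]_N :=
  \matrix_(i, j) Complex
    (Rintegral lebesgue_measure `[0, t] (fun s => complex.Re (H s w i j)))
    (Rintegral lebesgue_measure `[0, t] (fun s => complex.Im (H s w i j))).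

(* B is adapted to the augmented filtration of W, almost surely continuous, and
   B(t) = I + \int_0^t B dW + (zeta/2) \int_0^t B ds almost surely. *)
Definition strong_solution (zeta : R[i]) (N : nat)
    (W B : R -> Omega -> 'M[R[i]]_N) : Prop :=
  [/\ forall t, 0 <= t -> sigma_mx1 (B t) `<=` filtration W t,
      {ae P, forall w, forall q,
        {within `[0, +oo[, continuous (fun t => mx_coord q (B t w))}}
    & forall t, 0 <= t -> exists2 Z : Omega -> 'M[R[i]]_N,
        is_ito_integral W B t Z &
        {ae P, forall w,
          B t w = 1%:M + Z w + (zeta / 2) *: time_integral B t w}].

Definition GL_brownian_motion (rho : R) (zeta : R[i]) (N : nat)
    (B : R -> Omega -> 'M[R[i]]_N) : Prop :=
  exists2 W : R -> Omega -> 'M[R[i]]_N,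
    elliptical_brownian_motion rho zeta W & strong_solution zeta W B.

End Probability.

(* Main.v *)
Require Import Defs.
From HB Require Import structures.
From mathcomp Require Import all_boot all_order all_algebra.
From mathcomp Require Import sesquilinear spectral complex.
From mathcomp Require Import all_classical all_reals all_analysis.
From mathcomp Require Import measurable_realfun.
From mathcomp Require Import zify ring lra.

(* Fix [l] and put [s = dl^2 (l/N)^2], [r = t - s]. Up to an arbitrarily small
   error, [B(t)] is a product of Euler factors [1 + dW + (zeta/2) dt]. Cut the
   factors of [0, r] into a number [bb] of short blocks that depends on [rho] and
   [T] only: by a union bound over a net of the unit sphere, each block is within
   1/2 of the identity except with probability exponentially small in [N], so
   their product [Q] satisfies [2^-bb |v| <= |Q v| <= 2^bb |v|]. The block over
   [r, t] is [1 + (W(t) - W(r)) + E] with [|E| = O(rho s)]. Since [W(t) - W(r)] is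
   Gaussian and independent of [Q], the value of [sigma_(N-l)] at
   [Q (1 + W(t) - W(r)) + A] is at least of order [2^-bb sqrt(rho s) l/N], that is
   [dl (l/N)^2], except with probability [N e^-l]; the error [Q E], of order
   [dl^2 (l/N)^2], is absorbed by taking [dl] small. It remains to sum over [l]. *)

Set Implicit Arguments.
Unset Strict Implicit.
Unset Printing Implicit Defensive.

Import Order.TTheory GRing.Theory Num.Theory.
Import numFieldNormedType.Exports.

Local Open Scope classical_set_scope.
Local Open Scope ring_scope.
Local Open Scope sesquilinear_scope.

(** * Complex matrices as Euclidean vectors *)

(** The exponent 2 is the outcome of a balance. Over a last interval of length s, the noise lifts
    [sigma (N - l)] to order sqrt(rho s) l/N, while the second-order terms of the product over that
    interval have norm of order rho s. The gain dominates only up to s of order (l/N)^2, so s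
    depends on l, each l is treated separately, and l <= sqrt(t) N is what makes the interval fit
    into [0, t]. The columns of the noise are not independent, because X and Y are Hermitian. To
    test column i, only the variables carrying the index i are released; they also move the other
    columns, but only along e_i, and this direction is projected away. No moment of B is at hand,
    and the stochastic integrals at different times come with unrelated approximating sequences. The
    passage from B to Euler products is therefore made in outer probability. Its accuracy is chosen
    after all other constants, so the estimates used there may depend on N arbitrarily badly, in
    contrast with those for the blocks and the small ball. *)

Section ComplexEuclidean.
Variable R : realType.
Local Notation C := R[i].
Local Notation Re := complex.Re.
Local Notation Im := complex.Im.

Lemma cReD (x y : C) : Re (x + y) = Re x + Re y. Proof. by case: x; case: y. Qed.
Lemma cImD (x y : C) : Im (x + y) = Im x + Im y. Proof. by case: x; case: y. Qed.
Lemma cReN (x : C) : Re (- x) = - Re x. Proof. by case: x. Qed.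
Lemma cImN (x : C) : Im (- x) = - Im x. Proof. by case: x. Qed.
Lemma cReM (x y : C) : Re (x * y) = Re x * Re y - Im x * Im y.
Proof. by case: x; case: y. Qed.
Lemma cImM (x y : C) : Im (x * y) = Re x * Im y + Im x * Re y.
Proof. by case: x; case: y. Qed.
Lemma cReJ (x : C) : Re x^* = Re x. Proof. by case: x. Qed.
Lemma cImJ (x : C) : Im x^* = - Im x. Proof. by case: x. Qed.

Lemma cRe_sum (I : Type) (r : seq I) (P : pred I) (F : I -> C) :
  Re (\sum_(i <- r | P i) F i) = \sum_(i <- r | P i) Re (F i).
Proof. by rewrite (big_morph (@complex.Re R) cReD (erefl : Re (0 : C) = 0)). Qed.
Lemma cIm_sum (I : Type) (r : seq I) (P : pred I) (F : I -> C) :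
  Im (\sum_(i <- r | P i) F i) = \sum_(i <- r | P i) Im (F i).
Proof. by rewrite (big_morph (@complex.Im R) cImD (erefl : Im (0 : C) = 0)). Qed.

Definition sqm (z : C) : R := Re z ^+ 2 + Im z ^+ 2.

Lemma sqm_ge0 z : 0 <= sqm z. Proof. by rewrite addr_ge0 ?sqr_ge0. Qed.
Lemma sqmM x y : sqm (x * y) = sqm x * sqm y.
Proof. rewrite /sqm cReM cImM; ring. Qed.
Lemma sqmJ x : sqm x^* = sqm x. Proof. by rewrite /sqm cReJ cImJ sqrrN. Qed.
Lemma sqm_eq0 z : (sqm z == 0) = (z == 0).
Proof.
rewrite /sqm paddr_eq0 ?sqr_ge0// !sqrf_eq0.
by case: z => a b; rewrite eq_complex.
Qed.
Lemma sqmE (z : C) : (sqm z)%:C%C = z * z^*.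
Proof. by rewrite /sqm add_Re2_Im2 normCK. Qed.
Lemma sqm0 : sqm 0 = 0. Proof. by rewrite /sqm expr0n addr0. Qed.
Lemma sqm_real (x : R) : sqm x%:C%C = x ^+ 2.
Proof. by rewrite /sqm /= expr0n addr0. Qed.

Definition crd m n (q : 'I_m * 'I_n * bool) (A : 'M[C]_(m, n)) : R :=
  if q.2 then Im (A q.1.1 q.1.2) else Re (A q.1.1 q.1.2).

(* [fro] is [hs2] for rectangular matrices; on vectors it is the squared
   Euclidean norm, and [nm] is the norm. *)
Definition fro m n (A : 'M[C]_(m, n)) : R := \sum_q crd q A ^+ 2.
Definition nm m n (A : 'M[C]_(m, n)) : R := Num.sqrt (fro A).

Lemma hs2E n (A : 'M[C]_n) : hs2 A = fro A. Proof. by []. Qed.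

Lemma crdD m n q (A B : 'M[C]_(m, n)) : crd q (A + B) = crd q A + crd q B.
Proof. by rewrite /crd mxE; case: ifP => _; rewrite ?cReD ?cImD. Qed.
Lemma crdN m n q (A : 'M[C]_(m, n)) : crd q (- A) = - crd q A.
Proof. by rewrite /crd mxE; case: ifP => _; rewrite ?cReN ?cImN. Qed.
Lemma crd0 m n (q : 'I_m * 'I_n * bool) : crd q (0 : 'M[C]_(m, n)) = 0.
Proof. by rewrite /crd mxE; case: ifP. Qed.
Lemma crd_sum m n q (I : Type) (r : seq I) (P : pred I) (F : I -> 'M[C]_(m, n)) :
  crd q (\sum_(i <- r | P i) F i) = \sum_(i <- r | P i) crd q (F i).
Proof. by rewrite (big_morph (crd q) (crdD q) (crd0 q)). Qed.
Lemma crd_rZ m n q (x : R) (A : 'M[C]_(m, n)) :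
  crd q (x%:C%C *: A) = x * crd q A.
Proof.
by rewrite /crd mxE; case: ifP => _; rewrite ?cReM ?cImM /=; ring.
Qed.
Lemma crd_inj m n (A B : 'M[C]_(m, n)) : (forall q, crd q A = crd q B) -> A = B.
Proof.
move=> h; apply/matrixP => i j.
have := h (i, j, false); have := h (i, j, true); rewrite /crd /=.
by case: (A i j) => a b; case: (B i j) => c d /= -> ->.
Qed.

Lemma froE m n (A : 'M[C]_(m, n)) : fro A = \sum_i \sum_j sqm (A i j).
Proof.
rewrite /fro -(pair_bigA _ (fun p b => crd (p, b) A ^+ 2))/=.
rewrite -(pair_bigA _ (fun i j => \sum_b crd ((i, j), b) A ^+ 2))/=.
apply: eq_bigr => i _; apply: eq_bigr => j _.
by rewrite big_bool /= /crd/= addrC.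
Qed.

Lemma fro_ge0 m n (A : 'M[C]_(m, n)) : 0 <= fro A.
Proof. by apply: sumr_ge0 => q _; rewrite sqr_ge0. Qed.
Lemma fro0 m n : fro (0 : 'M[C]_(m, n)) = 0.
Proof. by rewrite /fro big1// => q _; rewrite crd0 expr0n. Qed.
Lemma froN m n (A : 'M[C]_(m, n)) : fro (- A) = fro A.
Proof. by apply: eq_bigr => q _; rewrite crdN sqrrN. Qed.
Lemma froZ m n (z : C) (A : 'M[C]_(m, n)) : fro (z *: A) = sqm z * fro A.
Proof.
rewrite !froE mulr_sumr; apply: eq_bigr => i _; rewrite mulr_sumr.
by apply: eq_bigr => j _; rewrite mxE sqmM.
Qed.
Lemma fro_tc m n (A : 'M[C]_(m, n)) : fro (A^t*) = fro A.
Proof.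
rewrite !froE exchange_big/=; apply: eq_bigr => i _; apply: eq_bigr => j _.
by rewrite !mxE sqmJ.
Qed.
Lemma fro_eq0 m n (A : 'M[C]_(m, n)) : fro A = 0 -> A = 0.
Proof.
move=> /eqP; rewrite psumr_eq0; last by move=> q _; rewrite sqr_ge0.
move=> /allP h; apply: crd_inj => q; rewrite crd0.
by have := h q (mem_index_enum _); rewrite sqrf_eq0 => /eqP.
Qed.
Lemma fro_gt0 m n (A : 'M[C]_(m, n)) : A != 0 -> 0 < fro A.
Proof.
move=> A0; rewrite lt_neqAle fro_ge0 andbT eq_sym.
by apply: contra A0 => /eqP/fro_eq0 ->.
Qed.
Lemma crd2_le_fro m n q (A : 'M[C]_(m, n)) : crd q A ^+ 2 <= fro A.
Proof.
rewrite /fro (bigD1 q)//= lerDl; apply: sumr_ge0 => ? _; exact: sqr_ge0.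
Qed.
Lemma sqm_le_fro m n i j (A : 'M[C]_(m, n)) : sqm (A i j) <= fro A.
Proof.
rewrite froE (bigD1 i)//= (bigD1 j)//= -addrA lerDl addr_ge0//.
  by apply: sumr_ge0 => ? _; exact: sqm_ge0.
by apply: sumr_ge0 => ? _; apply: sumr_ge0 => ? _; exact: sqm_ge0.
Qed.

Lemma cauchy_schwarz (I : finType) (f g : I -> R) :
  (\sum_i f i * g i) ^+ 2 <= (\sum_i f i ^+ 2) * (\sum_i g i ^+ 2).
Proof.
have h : 0 <= \sum_i \sum_j (f i * g j - f j * g i) ^+ 2.
  by apply: sumr_ge0 => i _; apply: sumr_ge0 => j _; exact: sqr_ge0.
suff e : \sum_i \sum_j (f i * g j - f j * g i) ^+ 2 =
  2 * ((\sum_i f i ^+ 2) * (\sum_i g i ^+ 2) - (\sum_i f i * g i) ^+ 2).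
  by move: h; rewrite e pmulr_rge0// subr_ge0.
have -> : \sum_i \sum_j (f i * g j - f j * g i) ^+ 2 =
  \sum_i \sum_j (f i ^+ 2 * g j ^+ 2) + \sum_i \sum_j (g i ^+ 2 * f j ^+ 2)
  - 2 * \sum_i \sum_j ((f i * g i) * (f j * g j)).
  rewrite mulr_sumr -big_split/= -sumrB; apply: eq_bigr => i _.
  rewrite mulr_sumr -big_split/= -sumrB; apply: eq_bigr => j _; ring.
rewrite expr2 !big_distrlr/= [X in _ + X - _]exchange_big/=.
set a := \sum_i \sum_j f i ^+ 2 * g j ^+ 2.
have -> : \sum_j \sum_i g i ^+ 2 * f j ^+ 2 = a.
  by apply: eq_bigr => i _; apply: eq_bigr => j _; rewrite mulrC.
ring.
Qed.

Lemma nm_ge0 m n (A : 'M[C]_(m, n)) : 0 <= nm A. Proof. exact: sqrtr_ge0. Qed.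
Lemma nm2 m n (A : 'M[C]_(m, n)) : nm A ^+ 2 = fro A.
Proof. by rewrite sqr_sqrtr// fro_ge0. Qed.
Lemma nm0 m n : nm (0 : 'M[C]_(m, n)) = 0.
Proof. by rewrite /nm fro0 sqrtr0. Qed.
Lemma nmN m n (A : 'M[C]_(m, n)) : nm (- A) = nm A.
Proof. by rewrite /nm froN. Qed.
Lemma nm_tc m n (A : 'M[C]_(m, n)) : nm (A^t*) = nm A.
Proof. by rewrite /nm fro_tc. Qed.
Lemma nm_gt0 m n (A : 'M[C]_(m, n)) : A != 0 -> 0 < nm A.
Proof. by move=> A0; rewrite sqrtr_gt0 fro_gt0. Qed.
Lemma nmZ m n (z : C) (A : 'M[C]_(m, n)) : nm (z *: A) = Num.sqrt (sqm z) * nm A.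
Proof. by rewrite /nm froZ sqrtrM// sqm_ge0. Qed.
Lemma nm_le m n (A : 'M[C]_(m, n)) x : 0 <= x -> (nm A <= x) = (fro A <= x ^+ 2).
Proof. by move=> x0; rewrite -nm2 ler_pXn2r// ?nnegrE ?nm_ge0. Qed.
Lemma nm_lt m n (A : 'M[C]_(m, n)) x : 0 <= x -> (nm A < x) = (fro A < x ^+ 2).
Proof. by move=> x0; rewrite -nm2 ltr_pXn2r// ?nnegrE ?nm_ge0. Qed.

Lemma nmD m n (A B : 'M[C]_(m, n)) : nm (A + B) <= nm A + nm B.
Proof.
rewrite nm_le ?addr_ge0 ?nm_ge0// sqrrD !nm2.
have -> : fro (A + B) = fro A + (\sum_q crd q A * crd q B) *+ 2 + fro B.
  rewrite /fro -sumrMnl -!big_split/=; apply: eq_bigr => q _.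
  by rewrite crdD sqrrD.
rewrite lerD2r lerD2l lerMn2r orFb.
apply: (le_trans (ler_norm _)); rewrite -(ler_pXn2r (ltn0Sn 1)) ?nnegrE//;
  last by rewrite mulr_ge0 ?nm_ge0.
by rewrite real_normK ?num_real// exprMn !nm2; exact: cauchy_schwarz.
Qed.
Lemma nmB m n (A B : 'M[C]_(m, n)) : nm A - nm B <= nm (A - B).
Proof. by rewrite lerBlDr -{1}(subrK B A) nmD. Qed.
Lemma nm_sum m n (I : Type) (r : seq I) (P : pred I) (F : I -> 'M[C]_(m, n)) :
  nm (\sum_(i <- r | P i) F i) <= \sum_(i <- r | P i) nm (F i).
Proof.
elim/big_rec2: _ => [|i x y _ h]; first by rewrite nm0.
by apply: (le_trans (nmD _ _)); rewrite lerD2l.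
Qed.

(** Weighted Young inequality. The free parameter matters: with [e] the length of a time step,
    adding an increment multiplies a squared norm by 1 + O(e) only, which is what the discrete
    Gronwall argument iterates. *)
Lemma sqrD_le (x y e : R) : 0 < e ->
  (x + y) ^+ 2 <= (1 + e) * x ^+ 2 + (1 + e^-1) * y ^+ 2.
Proof.
move=> e0; rewrite -subr_ge0.
have -> : (1 + e) * x ^+ 2 + (1 + e^-1) * y ^+ 2 - (x + y) ^+ 2 =
  e^-1 * (e * x - y) ^+ 2 by field; rewrite gt_eqF.
by rewrite mulr_ge0 ?sqr_ge0// invr_ge0 ltW.
Qed.
Lemma froD_le m n (A B : 'M[C]_(m, n)) e : 0 < e ->
  fro (A + B) <= (1 + e) * fro A + (1 + e^-1) * fro B.
Proof.
move=> e0; rewrite /fro !mulr_sumr -big_split/=; apply: ler_sum => q _.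
by rewrite crdD sqrD_le.
Qed.
Lemma froD2 m n (A B : 'M[C]_(m, n)) : fro (A + B) <= 2 * fro A + 2 * fro B.
Proof. by have := froD_le A B ltr01; rewrite invr1. Qed.

(** With c the sum, [sqm c] is the real part of its product with its conjugate, a real sum over the
    indices and over real and imaginary parts. The real inequality applied to that sum has [sqm c]
    as a factor on both sides. *)
Lemma sqm_sumM (I : finType) (a b : I -> C) :
  sqm (\sum_k a k * b k) <= (\sum_k sqm (a k)) * (\sum_k sqm (b k)).
Proof.
set c := \sum_k _.
have [->|c0] := eqVneq c 0.
  by rewrite sqm0 mulr_ge0 ?sumr_ge0// => k _; exact: sqm_ge0.
have sc : 0 < sqm c by rewrite lt_neqAle sqm_ge0 eq_sym sqm_eq0 c0.
rewrite -(ler_pM2l sc).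
have {1 2}-> : sqm c = \sum_(q : I * bool)
    (if q.2 then - Im (c^* * a q.1) else Re (c^* * a q.1)) *
    (if q.2 then Im (b q.1) else Re (b q.1)).
  rewrite -(pair_bigA _ (fun k s => (if s then - Im (c^* * a k) else Re (c^* * a k)) *
    (if s then Im (b k) else Re (b k))))/=.
  have -> : sqm c = Re (c^* * c) by rewrite mulrC -sqmE.
  rewrite {2}/c mulr_sumr cRe_sum; apply: eq_bigr => k _.
  by rewrite big_bool/= mulrA cReM; ring.
rewrite -expr2; apply: (le_trans (cauchy_schwarz _ _)).
rewrite -(pair_bigA _ (fun k (s : bool) =>
  (if s then - Im (c^* * a k) else Re (c^* * a k)) ^+ 2))/=.
rewrite -(pair_bigA _ (fun k (s : bool) =>
  (if s then Im (b k) else Re (b k)) ^+ 2))/=.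
have -> : \sum_i \sum_(j : bool) (if j then - Im (c^* * a i) else Re (c^* * a i)) ^+ 2 =
   sqm c * \sum_i sqm (a i).
  rewrite mulr_sumr; apply: eq_bigr => k _.
  by rewrite big_bool/= sqrrN addrC -[LHS]/(sqm _) sqmM sqmJ.
rewrite -mulrA le_eqVlt; apply/orP; left; apply/eqP; congr (_ * (_ * _)).
by apply: eq_bigr => k _; rewrite big_bool/= addrC.
Qed.

Lemma froM m n p (A : 'M[C]_(m, n)) (B : 'M[C]_(n, p)) :
  fro (A *m B) <= fro A * fro B.
Proof.
rewrite !froE [X in _ <= _ * X]exchange_big/= mulr_suml; apply: ler_sum => i _.
rewrite mulr_sumr; apply: ler_sum => j _; rewrite mxE; exact: sqm_sumM.
Qed.
Lemma nmM m n p (A : 'M[C]_(m, n)) (B : 'M[C]_(n, p)) :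
  nm (A *m B) <= nm A * nm B.
Proof.
by rewrite nm_le ?mulr_ge0 ?nm_ge0// exprMn !nm2 froM.
Qed.

Lemma fro_mxtr m n (A : 'M[C]_(m, n)) : (fro A)%:C%C = \tr (A *m A^t*).
Proof.
rewrite froE /mxtrace rmorph_sum; apply: eq_bigr => i _.
rewrite mxE rmorph_sum; apply: eq_bigr => j _ /=.
by rewrite !mxE -sqmE.
Qed.
Lemma fro_rv n (x : 'rV[C]_n) : (fro x)%:C%C = (x *m x^t*) 0 0.
Proof. by rewrite fro_mxtr /mxtrace big_ord1. Qed.

Lemma fro_unitary m n p (x : 'M[C]_(m, n)) (U : 'M[C]_(n, p)) :
  U \is unitarymx -> fro (x *m U) = fro x.
Proof.
move=> /unitarymxP h; apply: complexI.
by rewrite !fro_mxtr trmx_mul map_mxM mulmxA -(mulmxA x) h mulmx1.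
Qed.
Lemma nm_unitary m n p (x : 'M[C]_(m, n)) (U : 'M[C]_(n, p)) :
  U \is unitarymx -> nm (x *m U) = nm x.
Proof. by move=> h; rewrite /nm fro_unitary. Qed.

End ComplexEuclidean.

(** * Singular values *)

Section SingularValues.
Variable R : realType.
Local Notation C := R[i].

(** Trades an order statistic for a count, which does not see the order: the eigenvalues in
    [spectral_diag] come unsorted. *)
Lemma le_nth_sort (L : seq R) (e : R) j : (j < size L)%N ->
  (e <= nth 0 (sort >=%O L) j) = (j < count (fun x => (e <= x)%R) L)%N.
Proof.
move=> jL; rewrite -(permP (permEl (perm_sort >=%O L))).
have jS : (j < size (sort >=%O L))%N by rewrite size_sort.
have sS : sorted >=%O (sort >=%O L) by apply: sort_sorted; exact: ge_total.
move: (sort _ _) jS sS => S jS sS.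
have mono a b : (a <= b)%N -> (b < size S)%N -> nth 0 S b <= nth 0 S a.
  move=> ab bS; have := sorted_leq_nth (@ge_trans _ R) (@ge_refl _ R) 0 sS.
  by move=> /(_ a b); apply => //; rewrite inE (leq_ltn_trans ab).
rewrite -{2}(cat_take_drop j S) count_cat.
apply/idP/idP => h.
- have -> : count (fun x => e <= x) (take j S) = j.
    rewrite -[RHS](size_takel (ltnW jS)); apply/eqP; rewrite -all_count.
    apply/(all_nthP 0) => i; rewrite size_takel ?(ltnW jS)// => ij.
    by rewrite nth_take// (le_trans h)// mono// ltnW.
  by rewrite (drop_nth 0 jS)/= h -addn1 leq_add2l.
- apply: contraLR h => /negbTE h; rewrite -leqNgt.
  have -> : count (fun x => e <= x) (drop j S) = 0%N.
    apply/eqP; rewrite -leqn0 leqNgt -has_count; apply/negP.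
    move=> /hasP[z /(nthP 0)-[j0 + <-]]; rewrite size_drop nth_drop; move: j0 => i ij ei.
    have : e <= nth 0 S j.
      by apply: (le_trans ei); rewrite mono ?leq_addr// -ltn_subRL.
    by rewrite h.
  by rewrite addn0 (leq_trans (count_size _ _))// size_take jS.
Qed.

Section Fixed.
Variables (N : nat) (M : 'M[C]_N).

Let A := M^t* *m M.
Let U := spectralmx A.
Let s i : R := Num.sqrt (complex.Re (spectral_diag A ord0 i)).

Let Uu : U \is unitarymx. Proof. exact: spectral_unitarymx. Qed.

Let Aspec : A = invmx U *m diag_mx (spectral_diag A) *m U.
Proof.
apply/orthomx_spectralP/normalmxP.
by rewrite /A trmx_mul map_mxM trmxCK.
Qed.

Let form_spec (x : 'rV[C]_N) :
  (fro (x *m U *m M^t*))%:C%C =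
  \sum_i spectral_diag A ord0 i * (sqm (x 0 i))%:C%C.
Proof.
pose d := spectral_diag A; have Ad : A = U^t* *m diag_mx d *m U.
  by rewrite {1}Aspec invmx_unitary.
rewrite fro_rv trmx_mul map_mxM trmxCK mulmxA -(mulmxA (x *m U)) -/A -/d Ad.
rewrite trmx_mul map_mxM; have UU := unitarymxP Uu.
rewrite !mulmxA -(mulmxA x U) UU mulmx1.
rewrite -(mulmxA _ U) UU mulmx1 mul_mx_diag mxE.
apply: eq_bigr => i _; rewrite !mxE sqmE; ring.
Qed.

Let sE (x : 'rV[C]_N) :
  fro (x *m U *m M^t*) = \sum_i s i ^+ 2 * sqm (x 0 i).
Proof.
have h (y : 'rV[C]_N) : fro (y *m U *m M^t*) =
    \sum_i complex.Re (spectral_diag A ord0 i) * sqm (y 0 i).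
  have := congr1 (@complex.Re R) (form_spec y); rewrite cRe_sum /= => ->.
  by apply: eq_bigr => i _; rewrite cReM /= mulr0 subr0.
rewrite h; apply: eq_bigr => i _; rewrite sqr_sqrtr//.
(* The form at the i-th basis vector is the i-th eigenvalue; being a squared norm it is nonnegative,
   so [s i] squares back to it. *)
have := fro_ge0 ((delta_mx 0 i : 'rV_N) *m U *m M^t*); rewrite h (bigD1 i)//= big1.
  by rewrite !mxE !eqxx addr0 /sqm /= expr0n expr1n addr0 mulr1.
by move=> j /negbTE ji; rewrite !mxE eqxx ji sqm0 mulr0.
Qed.

Let rws (P : pred 'I_N) : 'M[C]_(#|P|, N) := rowsub enum_val U.

Let rws_mul P (x : 'rV[C]_(#|P|)) :
  x *m rws P = x *m rowsub enum_val 1%:M *m U.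
Proof. by rewrite -mulmxA mul_rowsub_mx mul1mx. Qed.

Let rws_coef P (x : 'rV[C]_(#|P|)) i :
  ~~ P i -> (x *m rowsub enum_val 1%:M : 'rV_N) 0 i = 0.
Proof.
move=> Pi; rewrite mxE big1// => a _; rewrite !mxE.
case: eqP => [e|]; last by rewrite mulr0.
by move: (enum_valP a) Pi; rewrite e -[i \in P]/(P i) => ->.
Qed.

Let rws_unitary P : rws P \is unitarymx.
Proof.
apply/row_unitarymxP => a b; rewrite !row_rowsub.
have /row_unitarymxP -> := Uu.
by rewrite (inj_eq enum_val_inj).
Qed.

Let sigma_count k e : (0 < k <= N)%N ->
  (e <= sigma k M) = (k <= #|[pred i | (e <= s i)%R]|)%N.
Proof.
move=> /andP[k0 kN]; rewrite /sigma le_nth_sort; last first.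
  by rewrite size_map size_enum_ord prednK.
rewrite prednK// count_map enumT cardE /enum_mem size_filter.
by congr (_ <= _)%N; apply: eq_count.
Qed.

(** First half of Courant-Fischer: the space is spanned by the eigenvectors with [s i < e]. Vectors
    are rows, so [x *m V *m M^t*] is the adjoint of [M *m v], where v is the adjoint of [x *m V]. *)
Lemma sigma_lt_space k (e : R) : (0 < k <= N)%N -> 0 < e -> sigma k M < e ->
  exists r (V : 'M[C]_(r, N)), [/\ (N < r + k)%N, V \is unitarymx &
    forall x : 'rV_r, x != 0 -> nm (x *m V *m M^t*) < e * nm (x *m V)].
Proof.
move=> kN e0; rewrite ltNge sigma_count// -ltnNge => h.
pose P : pred 'I_N := [pred i | s i < e].
exists #|P|, (rws P); split.
- have := cardC P; rewrite card_ord => {1}<-; rewrite ltn_add2l.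
  apply: leq_trans h; rewrite ltnS; apply: subset_leq_card.
  by apply/fintype.subsetP => i; rewrite !inE -leNgt.
- exact: rws_unitary.
- move=> x x0; have := rws_unitary P => Vu.
  have y0 : nm (x *m rws P) = nm x by rewrite nm_unitary.
  rewrite nm_lt; last by rewrite mulr_ge0 ?nm_ge0 ?(ltW e0).
  rewrite exprMn nm2.
  rewrite !rws_mul sE fro_unitary//.
  set y := x *m _; have yx : fro y = fro x.
    by rewrite -(fro_unitary x Vu) rws_mul fro_unitary.
  have term i : 0 <= e ^+ 2 * sqm (y 0 i) - s i ^+ 2 * sqm (y 0 i).
    rewrite subr_ge0; have [Pi|Pi] := boolP (P i).
      by rewrite ler_wpM2r ?sqm_ge0// ler_pXn2r ?nnegrE ?sqrtr_ge0// ltW.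
    by rewrite rws_coef// sqm0 !mulr0.
  rewrite froE big_ord1 mulr_sumr -subr_gt0 -sumrB lt0r sumr_ge0// andbT.
  rewrite psumr_neq0//.
  have : 0 < fro y by rewrite yx fro_gt0.
  rewrite froE big_ord1 => /lt0r_neq0; rewrite psumr_neq0; last first.
    by move=> i _; exact: sqm_ge0.
  move=> /hasP[i _ /= yi]; apply/hasP; exists i; rewrite ?mem_index_enum//=.
  rewrite subr_gt0 ltr_pM2r//.
  rewrite ltr_pXn2r ?nnegrE ?sqrtr_ge0//; last exact: ltW.
  have [//|Pi] := boolP (P i).
  by move: yi; rewrite rws_coef// sqm0 ltxx.
Qed.

(** Second half of Courant-Fischer: otherwise at least k eigenvectors have [s i >= e], and by
    dimensions their span meets the row space of [V], where the two inequalities contradict each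
    other. *)
Lemma space_sigma_lt k (e : R) r (V : 'M[C]_(r, N)) : (0 < k <= N)%N -> 0 < e ->
  (N < r + k)%N -> V \is unitarymx ->
  (forall x : 'rV_r, x != 0 -> nm (x *m V *m M^t*) < e * nm (x *m V)) ->
  sigma k M < e.
Proof.
move=> kN e0 rk Vu h; rewrite ltNge sigma_count//; apply/negP => k1.
pose P : pred 'I_N := [pred i | e <= s i].
have rV := mxrank_unitary Vu; have rP := mxrank_unitary (rws_unitary P).
have : (V :&: rws P)%MS != 0.
  rewrite -mxrank_eq0 -lt0n.
  have := mxrank_sum_cap V (rws P); rewrite rV rP => e1.
  have := rank_leq_col (V + rws P)%MS.
  have: (N < r + #|P|)%N by apply: (leq_trans rk); rewrite leq_add2l.
  by rewrite -e1; case: (\rank (V :&: _)) => // ; rewrite addn0 => a b;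
     move: (leq_trans a b); rewrite ltnn.
move=> /rowV0Pn[y]; rewrite sub_capmx => /andP[/submxP[x yx] /submxP[z yz]] y0.
have x0 : x != 0 by apply: contra y0 => /eqP x0; rewrite yx x0 mul0mx.
have := h x x0; rewrite -yx; apply/negP; rewrite -leNgt.
rewrite -(ler_pXn2r (ltn0Sn 1)) ?nnegrE ?mulr_ge0 ?nm_ge0 ?(ltW e0)//.
rewrite exprMn !nm2 yz !rws_mul sE fro_unitary// froE big_ord1 mulr_sumr.
apply: ler_sum => i _; have [Pi|Pi] := boolP (P i).
  by rewrite ler_wpM2r ?sqm_ge0// ler_pXn2r ?nnegrE ?sqrtr_ge0// ltW.
by rewrite rws_coef// sqm0 !mulr0.
Qed.

Lemma sigma_ge0 k : 0 <= sigma k M.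
Proof.
rewrite /sigma; set L := singular_values M.
have [h|h] := ltnP k.-1 (size L); last by rewrite nth_default.
have : nth 0 L k.-1 \in L by exact: mem_nth.
by rewrite mem_sort => /mapP[i _ ->]; exact: sqrtr_ge0.
Qed.

End Fixed.

(** The space that witnesses [sigma k M < e] also witnesses [sigma k M' < e']. The bounds below for
    perturbations and for products are instances. *)
Lemma sigma_lt_comparison N k (M M' : 'M[C]_N) (e e' : R) : (0 < k <= N)%N ->
  0 < e -> 0 < e' ->
  (forall v : 'cV[C]_N, v != 0 -> nm (M *m v) < e * nm v ->
     nm (M' *m v) < e' * nm v) ->
  sigma k M < e -> sigma k M' < e'.
Proof.
move=> kN e0 e0' h /(sigma_lt_space kN e0)[r [V [rk Vu hV]]].
apply: (space_sigma_lt kN e0' rk Vu) => x x0.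
have hx := hV x x0.
have y0 : (x *m V) ^t* != 0.
  apply: contraTneq hx => y0; rewrite -(trmxCK (x *m V)) y0.
  by rewrite trmx0 map_mx0 mul0mx !nm0 mulr0 ltxx.
have := h _ y0; rewrite !nm_tc.
have tr (B : 'M[C]_N) : nm (B *m (x *m V)^t*) = nm (x *m V *m B^t*).
  by rewrite -nm_tc trmx_mul map_mxM trmxCK.
by rewrite !tr; exact.
Qed.

Lemma sigma_perturb N k (M E : 'M[C]_N) (e : R) : (0 < k <= N)%N -> 0 <= e ->
  (forall v : 'cV[C]_N, nm (E *m v) <= e * nm v) ->
  sigma k M <= sigma k (M + E) + e.
Proof.
move=> kN e0 hE; apply/ler_addgt0Pr => d d0; apply/ltW.
have s0 := sigma_ge0 (M + E) k.
apply: (@sigma_lt_comparison _ _ (M + E) M (sigma k (M + E) + d) _ kN).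
- by rewrite ltr_wpDl.
- by rewrite ltr_wpDl// addr_ge0.
- move=> v v0 h; have -> : M *m v = (M + E) *m v - E *m v.
    by rewrite mulmxDl addrK.
  apply: (le_lt_trans (nmD _ _)); rewrite nmN.
  rewrite addrAC mulrDl ltr_leD//.
- by rewrite ltrDl.
Qed.

Lemma sigma_lipschitz N k (M M' : 'M[C]_N) : (0 < k <= N)%N ->
  sigma k M <= sigma k M' + nm (M - M').
Proof.
move=> kN; have -> : nm (M - M') = nm (M' - M) by rewrite -nmN opprB.
have {1}-> : M' = M + (M' - M) by rewrite addrC subrK.
by apply: sigma_perturb => //; [exact: nm_ge0|move=> v; exact: nmM].
Qed.

Lemma sigma_mull N k (Q M : 'M[C]_N) (b : R) : (0 < k <= N)%N -> 0 < b ->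
  (forall v : 'cV[C]_N, b * nm v <= nm (Q *m v)) ->
  b * sigma k M <= sigma k (Q *m M).
Proof.
move=> kN b0 hQ; apply/ler_addgt0Pr => d d0; apply/ltW.
have s0 := sigma_ge0 (Q *m M) k; set s := sigma k _ + d.
have sp : 0 < s by rewrite ltr_wpDl.
rewrite -ltr_pdivlMl// mulrC.
apply: (@sigma_lt_comparison _ _ (Q *m M) M s _ kN) => //.
- by rewrite divr_gt0.
- move=> v v0 h; rewrite mulrAC ltr_pdivlMr// mulrC.
  by apply: (le_lt_trans (hQ _)); rewrite mulmxA.
- by rewrite ltrDl.
Qed.

End SingularValues.

(** * Gaussian increments *)

Section Freezing.
Context d (T : measurableType d) (R : realType) (P : probability T R).
Local Open Scope ereal_scope.

(** By independence the joint law is the product of the marginals, so Fubini-Tonelli applies; the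
    inner variable w' plays the role of an independent copy. *)
Lemma freezing d1 d2 (T1 : measurableType d1) (T2 : measurableType d2)
    (X1 : T -> T1) (X2 : T -> T2) (f : T1 * T2 -> \bar R) :
  measurable_fun setT X1 -> measurable_fun setT X2 ->
  (forall A B, measurable A -> measurable B ->
     P (X1 @^-1` A `&` X2 @^-1` B) = P (X1 @^-1` A) * P (X2 @^-1` B)) ->
  measurable_fun setT f -> (forall z, 0 <= f z) ->
  \int[P]_w f (X1 w, X2 w) = \int[P]_w \int[P]_w' f (X1 w, X2 w').
Proof.
move=> mX1 mX2 ind mf f0.
pose Y1 : {mfun T >-> T1} := mfun_Sub (mem_set mX1).
pose Y2 : {mfun T >-> T2} := mfun_Sub (mem_set mX2).
have mX : measurable_fun setT (fun w => (X1 w, X2 w)).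
  exact: measurable_fun_pair.
pose Y : {mfun T >-> (T1 * T2)%type} := mfun_Sub (mem_set mX).
transitivity (\int[distribution P Y]_z f z).
  by rewrite ge0_integral_distribution.
transitivity (\int[distribution P Y1 \x distribution P Y2]_z f z).
  apply: eq_measure_integral => A mA _; apply/esym.
  by apply: product_measure_unique => // B1 B2 mB1 mB2; exact: ind.
rewrite fubini_tonelli1// ge0_integral_distribution//=; last 2 first.
- exact: measurable_fun_fubini_tonelli_F.
- by move=> x; apply: integral_ge0 => y _; exact: f0.
apply: eq_integral => w _; rewrite /fubini_F /= ge0_integral_distribution//.
by apply: measurableT_comp => //; exact: measurable_pair1.
Qed.

Lemma measurable_freezing d1 d2 (T1 : measurableType d1) (T2 : measurableType d2)
    (X1 : T -> T1) (X2 : T -> T2) (f : T1 * T2 -> \bar R) :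
  measurable_fun setT X1 -> measurable_fun setT X2 ->
  measurable_fun setT f -> (forall z, 0 <= f z) ->
  measurable_fun setT (fun w => \int[P]_w' f (X1 w, X2 w')).
Proof.
move=> mX1 mX2 mf f0.
pose Y2 : {mfun T >-> T2} := mfun_Sub (mem_set mX2).
rewrite (_ : (fun w => _) = (fun z => \int[distribution P Y2]_y f (z, y)) \o X1).
  apply: measurableT_comp => //.
  exact: (@measurable_fun_fubini_tonelli_F _ _ _ _ _ (distribution P Y2) f).
apply/funext => w /=; rewrite ge0_integral_distribution//.
by apply: measurableT_comp => //; exact: measurable_pair1.
Qed.

Lemma g_sigma_id_measurable (G : set (set T)) : <<s G >> `<=` measurable ->
  measurable_fun setT (id : T -> g_sigma_algebraType G).
Proof. by move=> h _ B mB; rewrite setTI preimage_id; exact: h. Qed.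

(** Both random variables are the identity of the sample space, seen with two different
    sigma-algebras. No random vector has to be named: it is enough that [f] is jointly measurable
    for the two sigma-algebras. *)
Lemma freezing_sub (G1 G2 : set (set T))
    (f : g_sigma_algebraType G1 * g_sigma_algebraType G2 -> \bar R) :
  <<s G1 >> `<=` measurable -> <<s G2 >> `<=` measurable ->
  independent2 P <<s G1 >> <<s G2 >> ->
  measurable_fun setT f -> (forall z, 0 <= f z) ->
  \int[P]_w f (w, w) = \int[P]_w \int[P]_w' f (w, w').
Proof.
move=> h1 h2 ind mf f0.
apply: (freezing (X1 := id : T -> g_sigma_algebraType G1)
  (X2 := id : T -> g_sigma_algebraType G2)) => //.
- exact: g_sigma_id_measurable.
- exact: g_sigma_id_measurable.
Qed.

(** The pi-lambda theorem, applied once to each side: for a fixed event B, the restriction of P to B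
    and the multiple P(B) P are finite measures that agree on the pi-system. *)
Lemma independent2_pi (C1 C2 : set (set T)) :
  C1 `<=` measurable -> C2 `<=` measurable -> C1 setT -> C2 setT ->
  setI_closed C1 -> setI_closed C2 ->
  (forall A B, C1 A -> C2 B -> P (A `&` B) = P A * P B) ->
  independent2 P <<s C1 >> <<s C2 >>.
Proof.
move=> m1 m2 T1 T2 I1 I2 ind.
have key (C : set (set T)) (B : set T) : C `<=` measurable -> C setT ->
    setI_closed C -> measurable B ->
    (forall A, C A -> P (A `&` B) = P A * P B) ->
    forall A, <<s C >> A -> P (A `&` B) = P A * P B.
  move=> mC CT CI mB h A sA.
  pose r : {nonneg R} := NngNum (fine_ge0 (measure_ge0 P B)).
  have rE : r%:num%:E = P B by rewrite /= fineK// fin_num_measure.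
  transitivity (mrestr P mB A) => //.
  rewrite muleC -rE -[RHS]/(mscale r P A).
  apply: (g_sigma_algebra_measure_unique C mC (fun=> setT)) => //.
  - by rewrite bigcup_const//; exists 0%N.
  - by move=> A' CA'; rewrite /= /mrestr /mscale /= fineK ?fin_num_measure// muleC h.
  - move=> _; rewrite /=  /mrestr setTI; exact: (le_lt_trans (probability_le1 P mB) (ltry _)).
have sm (C : set (set T)) : C `<=` measurable -> <<s C >> `<=` measurable.
  by move=> mC; apply: smallest_sub => //; exact: sigma_algebra_measurable.
move=> A B sA sB; rewrite setIC muleC.
apply: (key C2) => //; first exact: sm sA.
move=> B' CB'; rewrite setIC muleC.
by apply: (key C1) => //; [exact: m2|move=> A' CA'; exact: ind].
Qed.

End Freezing.

Section GaussianIntegrals.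
Variable R : realType.
Local Notation mu := (@lebesgue_measure R).

Lemma integral_normal_prob (s : R) (f : R -> \bar R) : s != 0 ->
  measurable_fun setT f -> (forall x, 0 <= f x)%E ->
  (\int[normal_prob 0%R s]_x f x = \int[mu]_x (f x * (normal_pdf 0 s x)%:E))%E.
Proof.
move=> s0 mf f0; have dom := normal_prob_dominates (0 : R) s.
rewrite -(Radon_Nikodym_SigmaFinite.change_of_variables dom)//.
apply: ae_eq_integral => //.
- apply: emeasurable_funM => //.
  exact: (measurable_int mu (Radon_Nikodym_SigmaFinite.f_integrable dom)).
- apply: emeasurable_funM => //.
  by apply/measurable_EFinP; exact: measurable_normal_pdf.
- apply: ae_eqe_mul2l; apply: integral_ae_eq => //.
  + exact: Radon_Nikodym_SigmaFinite.f_integrable.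
  + by apply/measurable_EFinP; exact: measurable_normal_pdf.
  + move=> A _ mA; rewrite -Radon_Nikodym_SigmaFinite.f_integral//.
Qed.

(** Completing the square: the integrand times the density is a constant times the normal density
    with mean [m'] and standard deviation [s']. The case a = 0 is the exponential moment. *)
Lemma normal_laplace (s a b c : R) : 0 < s -> 0 <= a ->
  let k := 1 + 2 * a * s ^+ 2 in
  (\int[normal_prob 0 s]_x (expR (- (a * x ^+ 2 + 2 * b * x + c)))%:E =
   ((Num.sqrt k)^-1 * expR (- c + 2 * b ^+ 2 * s ^+ 2 / k))%:E)%E.
Proof.
move=> s0 a0 k; have k0 : 0 < k.
  by rewrite ltr_pwDl// mulr_ge0 ?sqr_ge0// mulr_ge0.
have sk0 : 0 < Num.sqrt k by rewrite sqrtr_gt0.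
have skn : Num.sqrt k != 0 by rewrite gt_eqF.
have sn : s != 0 by rewrite gt_eqF.
set s' := s / Num.sqrt k; set m' := - 2 * b * s ^+ 2 / k.
have s'n : s' != 0 by rewrite mulf_neq0// invr_eq0.
rewrite integral_normal_prob//; last first.
  apply/measurable_EFinP; apply: measurableT_comp => //=.
  apply: measurable_funN; apply: measurable_funD => //.
  by apply: measurable_funD; apply: measurable_funM => //.
set K := (_ * expR _)%R.
transitivity (\int[mu]_x (K%:E * (normal_pdf m' s' x)%:E))%E.
  apply: eq_integral => x _; rewrite -!EFinM; congr EFin.
  rewrite !normal_pdfE// /normal_fun /K.
  have -> : normal_peak s' = Num.sqrt k * normal_peak s.
    rewrite /normal_peak /s'.
    have -> : (s / Num.sqrt k) ^+ 2 * pi *+ 2 = k^-1 * (s ^+ 2 * pi *+ 2).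
      by rewrite expr_div_n sqr_sqrtr ?(ltW k0)// [_ / k]mulrC -mulrA -mulrnAr.
    by rewrite sqrtrM ?invr_ge0 ?ltW// sqrtrV ?ltW// invfM invrK.
  rewrite [LHS]mulrCA -[RHS]mulrA [X in _ = _ * X]mulrCA [RHS]mulrA -mulrA.
  rewrite (mulKf skn); congr (_ * _).
  rewrite -!expRD; congr expR.
  rewrite /m' /s' subr0 expr_div_n sqr_sqrtr ?(ltW k0)//.
  rewrite -[s ^+ 2 *+ 2]mulr_natl -[s ^+ 2 / k *+ 2]mulr_natl.
  have kn : k != 0 by rewrite gt_eqF.
  have ak : a = (k - 1) / 2 / s ^+ 2 by rewrite /k; field.
  clearbody k; rewrite ak.
  by field; rewrite kn sn.
rewrite ge0_integralZl//=; last 3 first.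
- by apply/measurable_EFinP; exact: measurable_normal_pdf.
- by move=> x _; rewrite lee_fin normal_pdf_ge0.
- by rewrite lee_fin mulr_ge0 ?invr_ge0 ?expR_ge0 ?sqrtr_ge0.
by rewrite integral_normal_pdf mule1.
Qed.

(** Deduced from [normal_laplace]: with u = 1/(n+1), the functions f/(1 + u f) increase to f, and
    each is at most (1 - exp(-u f))/u, whose integral is explicit. *)
Lemma normal_second_moment (s b c : R) : 0 < s ->
  (\int[normal_prob 0 s]_x ((c + b * x) ^+ 2)%:E <=
   (c ^+ 2 + b ^+ 2 * s ^+ 2)%:E)%E.
Proof.
move=> s0; set f := fun x => (c + b * x) ^+ 2.
have mf : measurable_fun setT f.
  by apply: measurable_funX; apply: measurable_funD => //; exact: measurable_funM.
have f0 x : 0 <= f x by exact: sqr_ge0.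
pose g (n : nat) x : R := f x / (1 + f x / n.+1%:R).
have p1 n x : 0 < 1 + f x / n.+1%:R by rewrite ltr_pwDl// divr_ge0.
have mg n : measurable_fun setT (g n).
  apply: continuous_measurable_fun => x.
  have cf : f x1 @[x1 --> x] --> f x.
    rewrite /f !expr2; apply: cvgM; (apply: cvgD; first exact: cvg_cst);
      (apply: cvgM; first exact: cvg_cst); exact: cvg_id.
  apply: cvgM => //; apply: cvgV; first by rewrite gt_eqF.
  by apply: cvgD; [exact: cvg_cst|apply: cvgM => //; exact: cvg_cst].
have g0 n x : 0 <= g n x by rewrite divr_ge0// ltW.
have gn x : {homo g ^~ x : n m / (n <= m)%N >-> n <= m}.
  move=> n m nm; rewrite ler_wpM2l// lef_pV2 ?posrE// lerD2l.
  by rewrite ler_wpM2l// lef_pV2 ?posrE// ler_nat.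
have gf x : g n x @[n --> \oo] --> f x.
  rewrite -[X in _ --> X]divr1 -[X in _ / X](addr0 1).
  apply: cvgM; first exact: cvg_cst.
  apply: cvgV; first by rewrite addr0.
  apply: cvgD; first exact: cvg_cst.
  rewrite -(mulr0 (f x)); apply: cvgM; first exact: cvg_cst.
  exact: cvg_harmonic.
have -> : (\int[normal_prob 0 s]_x (f x)%:E =
    limn (fun n => \int[normal_prob 0 s]_x (g n x)%:E))%E.
  rewrite -monotone_convergence//.
  - apply: eq_integral => x _; apply/esym/cvg_lim => //.
    by apply: cvg_EFin; [exact: nearW|exact: gf].
  - by move=> n; apply/measurable_EFinP; exact: mg.
  - by move=> n x _; rewrite lee_fin.
  - by move=> x _ n m nm; rewrite lee_fin gn.
apply: lime_le.
  apply: ereal_nondecreasing_is_cvgn => n m nm; apply: ge0_le_integral => //.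
  - by move=> x _; rewrite lee_fin.
  - by apply/measurable_EFinP; exact: mg.
  - by apply/measurable_EFinP; exact: mg.
  - by move=> x _; rewrite lee_fin gn.
apply: nearW => n; pose u : R := n.+1%:R^-1.
have u0 : 0 < u by rewrite invr_gt0.
have gle x : g n x <= u^-1 * (1 - expR (- (u * f x))).
  rewrite ler_pdivrMr// -/u -mulrA ler_pdivlMl//.
  have h : expR (- (u * f x)) <= (1 + f x * u)^-1.
    rewrite expRN lef_pV2 ?posrE ?expR_gt0//; first by rewrite mulrC expR_ge1Dx.
    exact: p1.
  apply: (@le_trans _ _ ((1 - (1 + f x * u)^-1) * (1 + f x * u))).
    by rewrite mulrBl mul1r mulVf ?gt_eqF ?p1//; lra.
  by rewrite ler_wpM2r ?(ltW (p1 _ _))// lerD2l lerN2.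
apply: (@le_trans _ _ (\int[normal_prob 0 s]_x
    (u^-1 * (1 - expR (- (u * f x))))%:E)%E).
  apply: ge0_le_integral => //.
  - by move=> x _; rewrite lee_fin.
  - by apply/measurable_EFinP; exact: mg.
  - apply/measurable_EFinP; apply: measurable_funM => //.
    apply: measurable_funB => //; apply: measurableT_comp => //=.
    by apply: measurable_funN; exact: measurable_funM.
  - by move=> x _; rewrite lee_fin.
pose e x := expR (- (u * f x)).
have me : measurable_fun setT e.
  apply: measurableT_comp => //=.
  by apply: measurable_funN; exact: measurable_funM.
have ie : (normal_prob 0 s).-integrable setT (EFin \o e).
  apply: (@le_integrable _ _ _ _ _ measurableT _ (cst 1%:E)) => //.
  - exact/measurable_EFinP.
  - move=> x _ /=; rewrite lee_fin ger0_norm ?expR_ge0// normr1.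
    by rewrite -expR0 ler_expR oppr_le0 mulr_ge0// ltW.
  - exact: finite_measure_integrable_cst.
under eq_integral do rewrite EFinM.
rewrite integralZl//; last first.
  have : (normal_prob 0 s).-integrable setT (cst 1%:E \- (EFin \o e))%E.
    apply: integrableB => //; exact: finite_measure_integrable_cst.
  by apply: eq_integrable.
under eq_integral do rewrite EFinB.
rewrite integralB_EFin//=; last exact: finite_measure_integrable_cst.
rewrite integral_cst//= probability_setT mule1.
have -> : (\int[normal_prob 0 s]_x (e x)%:E =
  ((Num.sqrt (1 + 2 * (u * b ^+ 2) * s ^+ 2))^-1 *
   expR (- (u * c ^+ 2) + 2 * (u * b * c) ^+ 2 * s ^+ 2 /
     (1 + 2 * (u * b ^+ 2) * s ^+ 2)))%:E)%E.
  rewrite -normal_laplace//; last by rewrite mulr_ge0 ?sqr_ge0// ltW.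
  apply: eq_integral => x _; congr (expR _)%:E; rewrite /f; ring.
set v := b ^+ 2 * s ^+ 2; have v0 : 0 <= v by rewrite mulr_ge0 ?sqr_ge0.
set k := 1 + _; have kE : k = 1 + 2 * u * v by rewrite /k /v; ring.
have uv : 0 <= u * v by rewrite mulr_ge0// ltW.
have k1 : 1 <= k by rewrite kE; lra.
rewrite -EFinB -EFinM lee_fin ler_pdivrMl//.
have c2 : 0 <= c ^+ 2 by exact: sqr_ge0.
(* First-order lower bounds for the two factors A and B of the Laplace transform. Since A <= 1, A B
   >= A (1 - u c^2) >= 1 - u v - u c^2. *)
have h1 : 1 - u * v <= (Num.sqrt k)^-1.
  have sk : Num.sqrt k <= 1 + u * v.
    rewrite -[leRHS]ger0_norm; last lra.
    by rewrite -sqrtr_sqr ler_wsqrtr// kE; nra.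
  have sk0 : 0 < Num.sqrt k by rewrite sqrtr_gt0; lra.
  rewrite -[leRHS]mul1r ler_pdivlMr//.
  have [h|h] := leP 0 (1 - u * v); nra.
have h2 : 1 - u * c ^+ 2 <= expR (- (u * c ^+ 2) + 2 * (u * b * c) ^+ 2 * s ^+ 2 / k).
  apply: le_trans (expR_ge1Dx _); rewrite lerD2l lerDl divr_ge0//; last lra.
  by rewrite mulr_ge0 ?sqr_ge0// mulr_ge0 ?sqr_ge0.
have s1 : 0 <= (Num.sqrt k)^-1 by rewrite invr_ge0 sqrtr_ge0.
have s2 : (Num.sqrt k)^-1 <= 1.
  by rewrite invf_le1 ?sqrtr_gt0 ?(lt_le_trans ltr01)// -sqrtr1 ler_wsqrtr.
have uc : 0 <= u * c ^+ 2 by rewrite mulr_ge0// ltW.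
move: h1 h2; set A := _^-1 in s1 s2 *; set B := expR _ => h1 h2.
have : A * (1 - u * c ^+ 2) <= A * B by rewrite ler_wpM2l.
nra.
Qed.

End GaussianIntegrals.

Lemma sub_g_sigma_measurable d (T : Type) (T' : measurableType d)
    (pT : pointedType) (G1 G2 : set (set pT)) (f : pT -> T') :
  G1 `<=` <<s G2 >> ->
  measurable_fun setT (f : g_sigma_algebraType G1 -> T') ->
  measurable_fun setT (f : g_sigma_algebraType G2 -> T').
Proof.
move=> h mf _ B mB; have : <<s G1 >> (setT `&` f @^-1` B) by apply: mf.
by apply: smallest_sub; [exact: smallest_sigma_algebra|exact: h].
Qed.

Lemma g_sigma_measurable_fun d d' (T : measurableType d)
    (T' : measurableType d') (G : set (set T)) (f : T -> T') :
  <<s G >> `<=` measurable ->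
  measurable_fun setT (f : g_sigma_algebraType G -> T') ->
  measurable_fun setT f.
Proof. by move=> h mf _ B mB; apply: h; apply: mf. Qed.

(** * Independent normal variables given a sigma-algebra *)

Section GaussianStep.
Context d (T : measurableType d) (R : realType) (P : probability T R).
Variables (K : finType) (G : set (set T)) (x : K -> T -> R) (D : R).

(* [x] is a family of independent centered normal variables of variance [D],
   independent of the sigma-algebra generated by [G]. *)
Definition gaussian_step : Prop :=
  [/\ <<s G >> `<=` measurable, forall k, measurable_fun setT (x k) &
      forall E (U : K -> set R), <<s G >> E -> (forall k, measurable (U k)) ->
      P (E `&` \bigcap_k (x k @^-1` U k)) =
      (P E * \prod_k normal_prob 0 (Num.sqrt D) (U k))%E].

(** Generators of what is known when the variables in [J] are revealed on top of [G]. Revealing all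
    but one ([predC1 k]) serves to integrate variables out one at a time; revealing all but those
    with a given matrix index serves the small ball estimate. *)
Definition past (J : pred K) : set (set T) :=
  <<s G >> `|` \bigcup_(k in [set k | J k]) preimage_set_system setT (x k) measurable.

Hypothesis gs : gaussian_step.
Hypothesis D0 : 0 < D.

Let sG : <<s G >> `<=` measurable. Proof. by case: gs. Qed.
Let mx k : measurable_fun setT (x k). Proof. by case: gs. Qed.

Lemma past_measurable J : <<s past J >> `<=` measurable.
Proof.
apply: smallest_sub; first exact: sigma_algebra_measurable.
move=> A [/sG//|[k _ [B mB <-]]]; exact: mx.
Qed.

Lemma past_x (J : pred K) k : J k ->
  measurable_fun setT (x k : g_sigma_algebraType (past J) -> R).
Proof.
by move=> Jk _ B mB; apply: sub_sigma_algebra; right; exists k => //; exists B.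
Qed.

Lemma past_G J d' (T' : measurableType d') (f : T -> T') :
  measurable_fun setT (f : g_sigma_algebraType G -> T') ->
  measurable_fun setT (f : g_sigma_algebraType (past J) -> T').
Proof.
move=> mf _ B mB; apply: sub_sigma_algebra; left; exact: mf.
Qed.

Let cyl (J : pred K) : set (set T) :=
  [set A | exists E (U : K -> set R), [/\ <<s G >> E,
     forall k, measurable (U k), forall k, ~~ J k -> U k = setT &
     A = E `&` \bigcap_k (x k @^-1` U k)]].

Let cylT J : cyl J setT.
Proof.
exists setT, (fun=> setT); split => //.
- exact: (@measurableT _ (g_sigma_algebraType G)).
- by rewrite bigcapT ?setIT// => i _; rewrite preimage_setT.
Qed.

Let cylI J : setI_closed (cyl J).
Proof.
move=> _ _ [E [U [sE mU UJ ->]]] [E' [U' [sE' mU' UJ' ->]]].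
exists (E `&` E'), (fun k => U k `&` U' k); split.
- exact: (@measurableI _ (g_sigma_algebraType G)).
- by move=> k; exact: measurableI.
- by move=> k kJ; rewrite UJ// UJ'// setIT.
- rewrite setIACA -bigcapI; congr (_ `&` _).
Qed.

Let cylm J : cyl J `<=` measurable.
Proof.
move=> _ [E [U [sE mU _ ->]]]; apply: measurableI; first exact: sG.
apply: fin_bigcap_measurable => // k _.
by rewrite -[_ @^-1` _]setTI; exact: mx.
Qed.

Let past_cyl J : <<s past J >> `<=` <<s cyl J >>.
Proof.
apply: smallest_sub; first exact: smallest_sigma_algebra.
move=> A [sA|[k Jk [B mB <-]]]; apply: sub_sigma_algebra.
- exists A, (fun=> setT); split => //.
  by rewrite bigcapT ?setIT// => i _; rewrite preimage_setT.
- exists setT, (fun k' => if k' == k then B else setT); split => //.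
  + exact: (@measurableT _ (g_sigma_algebraType G)).
  + by move=> k'; case: ifP.
  + by move=> k'; case: eqP => // ->; rewrite Jk.
  + rewrite !setTI; apply/seteqP; split => w /=.
      by move=> xB k' _ /=; case: eqP => // ->.
    by move=> /(_ k I) /=; rewrite eqxx.
Qed.

Lemma gaussian_step_prob E (U : K -> set R) :
  <<s G >> E -> (forall k, measurable (U k)) ->
  P (E `&` \bigcap_k (x k @^-1` U k)) =
  (P E * \prod_k normal_prob 0 (Num.sqrt D) (U k))%E.
Proof. by case: gs => _ _; exact. Qed.

Lemma gaussian_step_law k U : measurable U ->
  P (x k @^-1` U) = normal_prob 0 (Num.sqrt D) U.
Proof.
move=> mU.
have := @gaussian_step_prob setT (fun k' => if k' == k then U else setT).
rewrite probability_setT mul1e setTI.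
have -> : \bigcap_k0 x k0 @^-1` (if k0 == k then U else setT) = x k @^-1` U.
  apply/seteqP; split => w /=.
    by move=> /(_ k I) /=; rewrite eqxx.
  by move=> xB k' _ /=; case: eqP => // ->.
move=> ->; last 2 first.
- exact: (@measurableT _ (g_sigma_algebraType G)).
- by move=> k'; case: ifP.
rewrite (bigD1 k)//= eqxx big1 ?mule1// => k' /negbTE ->.
exact: probability_setT.
Qed.

(** Both sigma-algebras are generated by pi-systems of cylinders. In an intersection of two
    cylinders, one of the two constraints on each variable is trivial, so the product of normal
    probabilities splits. *)
Lemma past_independent (J1 J2 : pred K) : (forall k, J1 k -> ~~ J2 k) ->
  independent2 P <<s past J1 >>
    <<s \bigcup_(k in [set k | J2 k]) preimage_set_system setT (x k) measurable >>.
Proof.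
move=> J12 A B /past_cyl sA sB.
pose cyl2 : set (set T) :=
  [set A | exists U : K -> set R, [/\ forall k, measurable (U k),
     forall k, ~~ J2 k -> U k = setT & A = \bigcap_k (x k @^-1` U k)]].
have sB' : <<s cyl2 >> B.
  move: B sB; apply: smallest_sub; first exact: smallest_sigma_algebra.
  move=> _ [k Jk [B mB <-]]; apply: sub_sigma_algebra.
  exists (fun k' => if k' == k then B else setT); split => //.
  - by move=> k'; case: ifP.
  - by move=> k'; case: eqP => // ->; rewrite Jk.
  - rewrite !setTI; apply/seteqP; split => w /=.
      by move=> xB k' _ /=; case: eqP => // ->.
    by move=> /(_ k I) /=; rewrite eqxx.
apply: (independent2_pi (C1 := cyl J1) (C2 := cyl2)) sA sB' => //.
- move=> _ [U [mU _ ->]]; apply: fin_bigcap_measurable => // k _.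
  by rewrite -[_ @^-1` _]setTI; exact: mx.
- exists (fun=> setT); split => //.
  by rewrite bigcapT// => i _; rewrite preimage_setT.
- move=> _ _ [U [mU UJ ->]] [U' [mU' UJ' ->]].
  exists (fun k => U k `&` U' k); split.
  + by move=> k; exact: measurableI.
  + by move=> k kJ; rewrite UJ// UJ'// setIT.
  + by rewrite -bigcapI.
- move=> _ _ [E [U [sE mU UJ ->]]] [U' [mU' UJ' ->]].
  rewrite -setIA -bigcapI.
  under eq_bigcapr do rewrite -preimage_setI.
  rewrite !gaussian_step_prob//; last by move=> k; exact: measurableI.
  have -> : P (\bigcap_k (x k @^-1` U' k)) =
      (\prod_k normal_prob 0 (Num.sqrt D) (U' k))%E.
    rewrite -[X in P X]setTI gaussian_step_prob ?probability_setT ?mul1e//.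
    exact: (@measurableT _ (g_sigma_algebraType G)).
  rewrite -muleA -big_split/=; congr (_ * _)%E; apply: eq_bigr => k _.
  have [J1k|/UJ ->] := boolP (J1 k).
    by rewrite (UJ' k) ?J12// setIT [in RHS]probability_setT mule1.
  by rewrite setTI [in RHS]probability_setT mul1e.
Qed.

(** Given [G] and all other variables, [x k] keeps its normal law, so it can be integrated out with
    the rest frozen. *)
Lemma gaussian_elim k (f : g_sigma_algebraType (past (predC1 k)) * measurableTypeR R -> \bar R) :
  measurable_fun setT f -> (forall z, 0 <= f z)%E ->
  (\int[P]_w f (w, x k w) =
   \int[P]_w \int[normal_prob 0 (Num.sqrt D)]_y f (w, y))%E.
Proof.
move=> mf f0; have mxk : @measurable_fun _ _ T (measurableTypeR R) setT (x k) := mx k.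
pose X := @mfun_Sub _ _ T (measurableTypeR R) (x k) (mem_set mxk).
transitivity (\int[P]_w \int[P]_w' f (w, x k w'))%E.
  apply: (freezing (X1 := id : T -> g_sigma_algebraType (past (predC1 k)))) => //.
  - exact: g_sigma_id_measurable (@past_measurable _).
  - move=> A B mA mB; rewrite preimage_id.
    have := @past_independent (predC1 k) (pred1 k); apply => //.
    apply: sub_sigma_algebra; exists k; first exact: eqxx.
    by exists B => //; rewrite setTI.
apply: eq_integral => w _.
have mfw : measurable_fun setT (fun y => f (w, y)).
  apply: (measurableT_comp mf); exact: measurable_fun_pair.
rewrite -[LHS]/(\int[P]_w' ((fun y => f (w, y)) \o X) w')%E.
rewrite -(ge0_integral_distribution X mfw)//.
by apply: eq_measure_integral => A mA _; exact: gaussian_step_law.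
Qed.

Let sD0 : 0 < Num.sqrt D. Proof. by rewrite sqrtr_gt0. Qed.
Let sDD : Num.sqrt D ^+ 2 = D. Proof. by rewrite sqr_sqrtr// ltW. Qed.

Let msum (J : pred K) (r : seq K) (c : K -> T -> R) :
  (forall k, measurable_fun setT (c k : g_sigma_algebraType G -> R)) ->
  (forall k, k \in r -> J k) ->
  measurable_fun setT ((fun w => \sum_(k <- r) c k w * x k w) :
     g_sigma_algebraType (past J) -> R).
Proof.
move=> mc; elim: r => [|k r IH] rJ.
  by under eq_fun do rewrite big_nil; exact: measurable_cst.
under eq_fun do rewrite big_cons; apply: measurable_funD.
  apply: measurable_funM; first exact: past_G (mc k).
  by apply: past_x; apply: rJ; rewrite mem_head.
by apply: IH => k' kr; apply: rJ; rewrite inE kr orbT.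
Qed.

Let notin_predC1 (k : K) (r : seq K) : k \notin r ->
  forall k', k' \in r -> predC1 k k'.
Proof. by move=> kr k' k'r /=; apply: contraNneq kr => <-. Qed.

Let mfst (J : pred K) (f : T -> R) :
  measurable_fun setT (f : g_sigma_algebraType (past J) -> R) ->
  measurable_fun setT
   ((fun z => f z.1) : g_sigma_algebraType (past J) * measurableTypeR R -> R).
Proof. by move=> mf; exact: (measurableT_comp mf measurable_fst). Qed.

(** [A] varies in the induction: integrating out [x k] adds D/2 times the square of [c k] to the
    exponent, a term which is again measurable for [G]. *)
Lemma gaussian_exp_seq (r : seq K) (A : T -> R) (c : K -> T -> R) : uniq r ->
  measurable_fun setT (A : g_sigma_algebraType G -> R) ->
  (forall k, measurable_fun setT (c k : g_sigma_algebraType G -> R)) ->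
  (\int[P]_w (expR (A w + \sum_(k <- r) c k w * x k w))%:E =
   \int[P]_w (expR (A w + D / 2 * \sum_(k <- r) c k w ^+ 2))%:E)%E.
Proof.
elim: r A => [|k r IH] A.
  by move=> _ _ _; apply: eq_integral => w _; rewrite !big_nil mulr0.
move=> /= /andP[kr ur] mA mc.
pose S w := A w + \sum_(k <- r) c k w * x k w.
have mS : measurable_fun setT (S : g_sigma_algebraType (past (predC1 k)) -> R).
  by apply: measurable_funD; [exact: past_G|apply: msum => //; exact: notin_predC1].
pose f (z : g_sigma_algebraType (past (predC1 k)) * R) : \bar R :=
  (expR (S z.1 + c k z.1 * z.2))%:E.
transitivity (\int[P]_w f (w, x k w))%E.
  by apply: eq_integral => w _; rewrite big_cons /f /S/= -addrA [c k w * _ + _]addrC.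
rewrite gaussian_elim//; first last.
- by move=> z; rewrite lee_fin expR_ge0.
- apply/measurable_EFinP; apply: measurableT_comp => //; apply: measurable_funD.
    exact: mfst.
  by apply: measurable_funM; [apply: mfst; exact: past_G (mc k)|exact: measurable_snd].
transitivity (\int[P]_w (expR ((A w + D / 2 * c k w ^+ 2) +
    \sum_(k <- r) c k w * x k w))%:E)%E.
  apply: eq_integral => w _; rewrite /f /=.
  transitivity (\int[normal_prob 0 (Num.sqrt D)]_y (expR (- (0 * y ^+ 2 +
    2 * (- c k w / 2) * y + - S w)))%:E)%E.
    by apply: eq_integral => y _; congr (expR _)%:E; field.
  rewrite (normal_laplace (- c k w / 2) (- S w) sD0 (lexx 0)) sDD.
  rewrite mulr0 mul0r addr0 sqrtr1 invr1 mul1r.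
  by congr (expR _)%:E; rewrite /S; field.
rewrite (IH _ ur _ mc); last first.
  apply: measurable_funD; first exact: mA.
  apply: measurable_funM; first exact: measurable_cst.
  exact: (measurable_funX 2 (mc k)).
by apply: eq_integral => w _; rewrite big_cons mulrDr addrA.
Qed.

(** [B] stores the variances of the variables already integrated out. Every integrand is
    nonnegative, so no integrability of the coefficients has to be assumed. *)
Lemma gaussian_square_seq (r : seq K) (A B : T -> R) (c : K -> T -> R) : uniq r ->
  measurable_fun setT (A : g_sigma_algebraType G -> R) ->
  measurable_fun setT (B : g_sigma_algebraType G -> R) ->
  (forall w, 0 <= B w) ->
  (forall k, measurable_fun setT (c k : g_sigma_algebraType G -> R)) ->
  (\int[P]_w ((A w + \sum_(k <- r) c k w * x k w) ^+ 2 + B w)%:E <=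
   \int[P]_w (A w ^+ 2 + D * \sum_(k <- r) c k w ^+ 2 + B w)%:E)%E.
Proof.
elim: r B => [|k r IH] B.
  move=> _ _ _ _ _; rewrite le_eqVlt; apply/orP; left; apply/eqP.
  by apply: eq_integral => w _; rewrite !big_nil mulr0 !addr0.
move=> /= /andP[kr ur] mA mB B0 mc.
pose S w := A w + \sum_(k <- r) c k w * x k w.
have mS : measurable_fun setT (S : g_sigma_algebraType (past (predC1 k)) -> R).
  by apply: measurable_funD; [exact: past_G|apply: msum => //; exact: notin_predC1].
pose f (z : g_sigma_algebraType (past (predC1 k)) * R) : \bar R :=
  ((S z.1 + c k z.1 * z.2) ^+ 2 + B z.1)%:E.
have -> : (\int[P]_w ((A w + \sum_(k <- k :: r) c k w * x k w) ^+ 2 + B w)%:E =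
    \int[P]_w f (w, x k w))%E.
  by apply: eq_integral => w _; rewrite big_cons /f /S/= -addrA [c k w * _ + _]addrC.
have mD : measurable_fun setT
    ((fun w => D * c k w ^+ 2 + B w) : g_sigma_algebraType G -> R).
  apply: measurable_funD => //; apply: measurable_funM => //.
  exact: (measurable_funX 2 (mc k)).
have D1 w : 0 <= D * c k w ^+ 2 + B w.
  by rewrite addr_ge0// mulr_ge0 ?sqr_ge0// ltW.
rewrite gaussian_elim//; first last.
- by move=> z; rewrite lee_fin addr_ge0// sqr_ge0.
- apply/measurable_EFinP; apply: measurable_funD; last first.
    by apply: (mfst (f := B)); exact: past_G.
  apply: measurable_funX; apply: measurable_funD; first exact: mfst.
  by apply: measurable_funM; [apply: mfst; exact: past_G (mc k)|exact: measurable_snd].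
apply: (@le_trans _ _ (\int[P]_w (S w ^+ 2 + (D * c k w ^+ 2 + B w))%:E)%E).
  have mS' : measurable_fun setT (S : T -> R).
    by apply: (g_sigma_measurable_fun (@past_measurable (predC1 k))).
  apply: ge0_le_integral => //.
  - by move=> w _; apply: integral_ge0 => y _; rewrite lee_fin addr_ge0// sqr_ge0.
  - have mf : measurable_fun setT (fun z : T * measurableTypeR R => f (z.1, z.2)).
      apply/measurable_EFinP; apply: measurable_funD; last first.
        apply: (measurableT_comp (g_sigma_measurable_fun sG mB) measurable_fst).
      apply: measurable_funX; apply: measurable_funD.
        exact: (measurableT_comp mS' measurable_fst).
      apply: measurable_funM; last exact: measurable_snd.
      exact: (measurableT_comp (g_sigma_measurable_fun sG (mc k)) measurable_fst).
    have f0 z : (0 <= f (z.1, z.2))%E by rewrite lee_fin addr_ge0// sqr_ge0.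
    exact: (@measurable_fun_fubini_tonelli_F _ _ T (measurableTypeR R) R
      (normal_prob 0 (Num.sqrt D)) _ mf f0).
  - apply/measurable_EFinP; apply: measurable_funD; first exact: measurable_funX.
    exact: g_sigma_measurable_fun mD.
  - move=> w _; rewrite /f /=.
    under eq_integral do rewrite EFinD.
    rewrite ge0_integralD//=; last 3 first.
    + by move=> y _; rewrite lee_fin sqr_ge0.
    + apply/measurable_EFinP; apply: measurable_funX; apply: measurable_funD => //.
    + by move=> y _; rewrite lee_fin.
    rewrite integral_cst//= probability_setT mule1 addrA EFinD leeD2r//.
    apply: (le_trans (normal_second_moment _ _ sD0)).
    by rewrite sDD [D * _]mulrC.
apply: (le_trans (IH (fun w => D * c k w ^+ 2 + B w) ur mA mD D1 mc)).
rewrite le_eqVlt; apply/orP; left; apply/eqP.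
by apply: eq_integral => w _; rewrite big_cons; congr EFin; ring.
Qed.

Lemma gaussian_exp (A : T -> R) (c : K -> T -> R) :
  measurable_fun setT (A : g_sigma_algebraType G -> R) ->
  (forall k, measurable_fun setT (c k : g_sigma_algebraType G -> R)) ->
  (\int[P]_w (expR (A w + \sum_k c k w * x k w))%:E =
   \int[P]_w (expR (A w + D / 2 * \sum_k c k w ^+ 2))%:E)%E.
Proof. by move=> mA mc; rewrite gaussian_exp_seq// index_enum_uniq. Qed.

Lemma gaussian_square (A : T -> R) (c : K -> T -> R) :
  measurable_fun setT (A : g_sigma_algebraType G -> R) ->
  (forall k, measurable_fun setT (c k : g_sigma_algebraType G -> R)) ->
  (\int[P]_w ((A w + \sum_k c k w * x k w) ^+ 2)%:E <=
   \int[P]_w (A w ^+ 2 + D * \sum_k c k w ^+ 2)%:E)%E.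
Proof.
move=> mA mc.
have := @gaussian_square_seq (index_enum K) A (cst 0) c (index_enum_uniq K) mA.
under eq_integral do rewrite addr0.
under [X in (_ -> _ -> _ -> _ <= X)%E]eq_integral do rewrite addr0.
by apply.
Qed.

End GaussianStep.

(** * Rank-one updates and Gaussian expectations of quadratic forms *)

Section QuadraticForms.
Variable R : realType.

Definition qf n (S : 'M[R]_n) (w : 'cV[R]_n) : R := (w^T *m S *m w) 0 0.
Definition bf n (S : 'M[R]_n) (u v : 'cV[R]_n) : R := (u^T *m S *m v) 0 0.

Lemma bfDl n (S : 'M[R]_n) u u' v : bf S (u + u') v = bf S u v + bf S u' v.
Proof. by rewrite /bf linearD !mulmxDl [LHS]mxE. Qed.
Lemma bfDr n (S : 'M[R]_n) u v v' : bf S u (v + v') = bf S u v + bf S u v'.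
Proof. by rewrite /bf mulmxDr [LHS]mxE. Qed.
Lemma bfZl n (S : 'M[R]_n) a u v : bf S (a *: u) v = a * bf S u v.
Proof. by rewrite /bf linearZ -!scalemxAl [LHS]mxE. Qed.
Lemma bfZr n (S : 'M[R]_n) a u v : bf S u (a *: v) = a * bf S u v.
Proof. by rewrite /bf -scalemxAr [LHS]mxE. Qed.
Lemma bfC n (S : 'M[R]_n) u v : S^T = S -> bf S u v = bf S v u.
Proof.
move=> sS; rewrite /bf.
have -> : u^T *m S *m v = (v^T *m S *m u)^T by rewrite !trmx_mul trmxK sS mulmxA.
by rewrite mxE.
Qed.

Definition posdef n (A : 'M[R]_n) := A^T = A /\ forall v : 'cV_n, v != 0 -> 0 < qf A v.

Lemma qf_ge0 n (A : 'M[R]_n) v : posdef A -> 0 <= qf A v.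
Proof.
move=> [_ h]; have [->|v0] := eqVneq v 0; last exact/ltW/h.
by rewrite /qf mulmx0 mxE.
Qed.

Lemma posdef_unit n (A : 'M[R]_n) : posdef A -> A \in unitmx.
Proof.
move=> [sA h]; rewrite -row_free_unit -kermx_eq0; apply/negPn/negP => k0.
have /rowV0Pn[u uk u0] := k0.
move: uk => /sub_kermxP uA; have := h u^T; rewrite trmx_eq0 => /(_ u0).
by rewrite /qf trmxK uA mul0mx mxE ltxx.
Qed.

Lemma qf_invmx_ge0 n (A : 'M[R]_n) v : posdef A -> 0 <= qf (invmx A) v.
Proof.
move=> pA; have uA := posdef_unit pA; have := qf_ge0 (invmx A *m v) pA.
rewrite /qf trmx_mul trmx_inv (proj1 pA).
by rewrite -(mulmxA v^T (invmx A) A) mulVmx// mulmx1 mulmxA.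
Qed.

Lemma qf_rank1 n (g v : 'cV[R]_n) : qf (g *m g^T) v = (g^T *m v) 0 0 ^+ 2.
Proof.
rewrite /qf !mulmxA -mulmxA -[v^T *m g]trmxK trmx_mul trmxK.
by rewrite mxE big_ord1 !mxE expr2.
Qed.

Lemma posdef_rank1 n (A : 'M[R]_n) (g : 'cV_n) (e : R) : posdef A -> 0 <= e ->
  posdef (A + e *: (g *m g^T)).
Proof.
move=> [sA h] e0; split.
  by rewrite linearD linearZ/= trmx_mul trmxK sA.
move=> v v0; rewrite /qf mulmxDr mulmxDl mxE -scalemxAr -scalemxAl [X in _ + X]mxE.
rewrite -/(qf A v) -/(qf (g *m g^T) v) qf_rank1 ltr_wpDr ?h//.
by rewrite mulr_ge0 ?sqr_ge0.
Qed.

(** Matrix determinant lemma: one block matrix [B] has two factorizations into block triangular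
    matrices, and each gives one side. *)
Lemma det_1_rank1 n (u : 'cV[R]_n) (v : 'rV[R]_n) :
  \det (1%:M + u *m v) = 1 + (v *m u) 0 0.
Proof.
pose B := block_mx (1%:M : 'M[R]_n) (- u) v (1%:M : 'M[R]_1).
have e1 : B = block_mx (1%:M : 'M[R]_n) 0 v 1%:M *m
   block_mx (1%:M : 'M[R]_n) (- u) 0 (1%:M + v *m u).
  rewrite mulmx_block ?mul1mx ?mulmx1 ?mul0mx ?mulmx0 ?mul1mx ?mulmx1 ?mul0mx ?mulmx0 !addr0.
  by rewrite mulmxN addrC addrK.
have e2 : B = block_mx (1%:M + u *m v) (- u) 0 (1%:M : 'M[R]_1) *m
   block_mx (1%:M : 'M[R]_n) 0 v (1%:M : 'M[R]_1).
  rewrite mulmx_block ?mul1mx ?mulmx1 ?mul0mx ?mulmx0 ?mul1mx ?mulmx1 ?mul0mx ?mulmx0 !add0r.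
  by rewrite mulNmx addrK.
have := congr1 determinant e1; rewrite e2 !det_mulmx !det_ublock !det_lblock.
rewrite !det1 !mul1r !mulr1 => ->.
by rewrite [LHS]det_mx11 mxE [X in X + _]mxE eqxx.
Qed.

Section Rank1.
Variables (n : nat) (A : 'M[R]_n) (g : 'cV[R]_n) (e : R).
Hypotheses (pA : posdef A) (e0 : 0 <= e).
Let A' := A + e *: (g *m g^T).
Let S := invmx A.
Let k := 1 + e * qf S g.

Lemma det_rank1 : \det A' = \det A * k.
Proof.
have uA := posdef_unit pA.
have -> : A' = A *m (1%:M + (e *: (S *m g)) *m g^T).
  by rewrite mulmxDr mulmx1 -scalemxAl -scalemxAr -mulmxA mulKVmx.
by rewrite det_mulmx det_1_rank1 -scalemxAr mxE mulmxA.
Qed.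

Let k0 : 0 < k.
Proof. by rewrite ltr_pwDl// mulr_ge0// qf_invmx_ge0. Qed.

Lemma qf_sherman_morrison w :
  qf (invmx A') w = qf S w - e / k * (g^T *m S *m w) 0 0 ^+ 2.
Proof.
have uA := posdef_unit pA; have uA' := posdef_unit (posdef_rank1 g pA e0).
have sS : S^T = S by rewrite trmx_inv (proj1 pA).
have -> : invmx A' = S - (e / k) *: (S *m g *m (g^T *m S)).
  apply: (can_inj (mulKmx uA')); rewrite mulmxV//.
  rewrite /A' mulmxBr !mulmxDl mulmxV// -!scalemxAr -!scalemxAl.
  rewrite !mulmxA mulmxV// mul1mx -(mulmxA g).
  have -> : g *m (g^T *m S) *m g *m g^T *m S = (qf S g) *: (g *m (g^T *m S)).
    have -> : g *m (g^T *m S) *m g = (qf S g) *: g.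
      rewrite -mulmxA [g^T *m S *m g]mx11_scalar -[RHS]mul_mx_scalar.
      by congr (_ *m _%:M); rewrite /qf.
    by rewrite -!scalemxAl -mulmxA.
  set Z := g *m (g^T *m S).
  rewrite !scalerA -[1%:M in LHS]addr0 -addrA; congr (_ + _).
  rewrite -scalerDl -scalerBl -[LHS](scale0r Z); congr (_ *: _).
  have -> : e - (e / k + e / k * e * qf S g) = e - e / k * k by rewrite /k; ring.
  by rewrite mulfVK ?gt_eqF// subrr.
rewrite /qf mulmxBr mulmxBl -scalemxAr -scalemxAl [LHS]mxE [X in _ + X = _]mxE.
rewrite [X in _ - X = _]mxE; congr (_ - _ * _); 
have -> : w^T *m (S *m g *m (g^T *m S)) *m w = (w^T *m S *m g) *m (g^T *m S *m w).
  by rewrite !mulmxA.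
rewrite mxE big_ord1 -/(bf S w g) -/(bf S g w) bfC// expr2.
Qed.
End Rank1.
End QuadraticForms.

Section GaussianQuadratic.
Context d (T : measurableType d) (R : realType) (P : probability T R).
Variables (K : finType) (G : set (set T)) (x : K -> T -> R) (D : R).
Hypothesis gs : gaussian_step P G x D.
Hypothesis D0 : 0 < D.

(* Integrating out the variables one at a time, the matrix of the quadratic form
   undergoes rank-one updates (Sherman-Morrison), and the normalizing factors
   telescope into a ratio of determinants. *)
Lemma gaussian_quadratic_seq (r : seq K) n (g : K -> 'cV[R]_n) (c : 'cV[R]_n)
    (A : 'M[R]_n) : uniq r -> posdef A -> 0 < \det A ->
  (\int[P]_w (expR (- qf (invmx A) (c + \sum_(k <- r) x k w *: g k)))%:E <=
   ((Num.sqrt (\det (A + (2 * D) *: \sum_(k <- r) g k *m (g k)^T) / \det A))^-1)%:E)%E.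
Proof.
have sD0 : 0 < Num.sqrt D by rewrite sqrtr_gt0.
have sDD : Num.sqrt D ^+ 2 = D by rewrite sqr_sqrtr// ltW.
elim: r A => [|k r IH] A /=.
  move=> _ pA dA; rewrite big_nil scaler0 addr0 divff ?gt_eqF// sqrtr1 invr1.
  under eq_integral do rewrite big_nil addr0.
  rewrite integral_cst//= probability_setT mule1 lee_fin.
  by rewrite -expR0 ler_expR oppr_le0 qf_invmx_ge0.
move=> /andP[kr ur] pA dA.
pose S := invmx A; pose al := qf S (g k).
pose W w := c + \sum_(k <- r) x k w *: g k.
pose be w := ((g k)^T *m S *m W w) 0 0.
have al0 : 0 <= al by exact: qf_invmx_ge0.
have sS : S^T = S by rewrite trmx_inv (proj1 pA).
have qfD v y : qf S (v + y *: g k) = al * y ^+ 2 + 2 * bf S (g k) v * y + qf S v.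
  rewrite /al -![qf _ _]/(bf _ _ _) bfDl !bfDr bfZl !bfZr (bfC v (g k))//.
  by rewrite bfZl; ring.
have mWi i : measurable_fun setT ((fun w => W w i 0) :
    g_sigma_algebraType (past G x (predC1 k)) -> R).
  have -> : (fun w => W w i 0) = (fun w => c i 0 + \sum_(k <- r) x k w * g k i 0).
    apply/funext => w; rewrite mxE summxE; congr (_ + _).
    by apply: eq_bigr => j _; rewrite mxE.
  apply: measurable_funD => //.
  have hr k' : k' \in r -> predC1 k k' by move=> k'r /=; apply: contraNneq kr => <-.
  elim: r hr {W be IH kr ur qfD} => [|k' r IH] hr.
    by under eq_fun do rewrite big_nil; exact: measurable_cst.
  under eq_fun do rewrite big_cons; apply: measurable_funD.
    by apply: measurable_funM => //; apply: past_x; apply: hr; rewrite mem_head.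
  by apply: IH => k'' kr; apply: hr; rewrite inE kr orbT.
have mlin (v : 'rV[R]_n) : measurable_fun setT ((fun w => (v *m W w) 0 0) :
    g_sigma_algebraType (past G x (predC1 k)) -> R).
  under eq_fun do rewrite mxE.
  elim: (index_enum _) => [|j s IHs].
    by under eq_fun do rewrite big_nil; exact: measurable_cst.
  under eq_fun do rewrite big_cons; apply: measurable_funD => //.
  exact: measurable_funM.
have mq : measurable_fun setT ((fun w => qf S (W w)) :
    g_sigma_algebraType (past G x (predC1 k)) -> R).
  rewrite /qf; under eq_fun do rewrite -mulmxA mxE.
  elim: (index_enum _) => [|j s IHs].
    by under eq_fun do rewrite big_nil; exact: measurable_cst.
  under eq_fun do rewrite big_cons; apply: measurable_funD => //.
  apply: measurable_funM; first by under eq_fun do rewrite mxE; exact: mWi.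
  have -> : (fun w => (S *m W w) j 0) = (fun w => (row j S *m W w) 0 0).
    by apply/funext => w; rewrite -row_mul [RHS]mxE.
  exact: mlin.
pose f (z : g_sigma_algebraType (past G x (predC1 k)) * measurableTypeR R) : \bar R :=
  (expR (- (al * z.2 ^+ 2 + 2 * be z.1 * z.2 + qf S (W z.1))))%:E.
have -> : (\int[P]_w (expR (- qf S (c + \sum_(k0 <- k :: r) x k0 w *: g k0)))%:E =
    \int[P]_w f (w, x k w))%E.
  apply: eq_integral => w _; rewrite /f /= -qfD big_cons /W.
  by rewrite -addrA [_ *: g k + _]addrC.
rewrite (gaussian_elim gs)//; first last.
- by move=> z; rewrite lee_fin expR_ge0.
- apply/measurable_EFinP; apply: measurableT_comp => //; apply: measurable_funN.
  apply: measurable_funD; last exact: (measurableT_comp mq measurable_fst).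
  apply: measurable_funD.
    by apply: measurable_funM => //; apply: measurable_funX; exact: measurable_snd.
  apply: measurable_funM; last exact: measurable_snd.
  apply: measurable_funM => //; exact: (measurableT_comp (mlin _) measurable_fst).
pose e := 2 * D; have e0 : 0 <= e by rewrite mulr_ge0// ltW.
pose A' := A + e *: (g k *m (g k)^T); pose kk := 1 + e * al.
have kk0 : 0 < kk by rewrite ltr_pwDl// mulr_ge0.
have dA' : \det A' = \det A * kk by exact: det_rank1.
have -> : (\int[P]_w \int[normal_prob 0 (Num.sqrt D)]_y f (w, y) =
    \int[P]_w (((Num.sqrt kk)^-1)%:E *
      (expR (- qf (invmx A') (c + \sum_(k <- r) x k w *: g k)))%:E))%E.
  apply: eq_integral => w _; rewrite /f/=.
  rewrite (normal_laplace (be w) (qf S (W w)) sD0 al0) sDD.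
  have -> : 1 + 2 * al * D = kk by rewrite /kk /e; ring.
  rewrite -EFinM; congr (_ * expR _)%:E.
  rewrite qf_sherman_morrison// -/S -/al -/kk -/(W w) -/(bf S (g k) (W w)).
  have -> : bf S (g k) (W w) = be w by [].
  by rewrite /e; ring.
have mE : measurable_fun setT (fun w => (expR (- qf (invmx A')
    (c + \sum_(k <- r) x k w *: g k)))%:E).
  have sP := past_measurable gs (J := predC1 k).
  have -> : (fun w => (expR (- qf (invmx A') (c + \sum_(k <- r) x k w *: g k)))%:E) =
    (fun w => (expR (- (qf S (W w) - e / kk * be w ^+ 2)))%:E).
    by apply/funext => w; rewrite qf_sherman_morrison.
  apply/measurable_EFinP; apply: measurableT_comp => //; apply: measurable_funN.
  apply: measurable_funB; first exact: (g_sigma_measurable_fun sP mq).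
  apply: measurable_funM => //; apply: measurable_funX.
  exact: (g_sigma_measurable_fun sP (mlin _)).
rewrite ge0_integralZl//.
have dA'0 : 0 < \det A' by rewrite dA' mulr_gt0.
apply: (@le_trans _ _ (((Num.sqrt kk)^-1)%:E * ((Num.sqrt (\det (A' + (2 * D) *:
    \sum_(k <- r) g k *m (g k)^T) / \det A'))^-1)%:E)%E).
  apply: lee_wpmul2l; first by rewrite lee_fin invr_ge0 sqrtr_ge0.
  by apply: IH => //; exact: posdef_rank1.
rewrite -EFinM lee_fin -invfM -sqrtrM ?(ltW kk0)// big_cons scalerDr addrA -/e -/A'.
rewrite dA'; set X := \det (A' + _); clearbody kk X.
have -> // : kk * (X / (\det A * kk)) = X / \det A.
by field; rewrite !gt_eqF.
Qed.
End GaussianQuadratic.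

(** * Elliptical Gaussian matrices *)

Section MeasurableMatrices.
Variable R : realType.
Local Notation C := R[i].
Context d (T : measurableType d).

(** The sigma-algebra is carried by the type of the domain, so adaptedness is the same predicate
    with a [g_sigma_algebraType] as domain. *)
Definition mfm m n (f : T -> 'M[C]_(m, n)) :=
  forall q, measurable_fun setT (fun w => crd q (f w)).

Lemma mfm_cst m n (A : 'M[C]_(m, n)) : mfm (fun=> A).
Proof. by move=> q; exact: measurable_cst. Qed.
Lemma mfmD m n (f g : T -> 'M[C]_(m, n)) : mfm f -> mfm g ->
  mfm (fun w => f w + g w).
Proof.
move=> mf mg q; under eq_fun do rewrite crdD; exact: measurable_funD.
Qed.
Lemma mfmN m n (f : T -> 'M[C]_(m, n)) : mfm f -> mfm (fun w => - f w).
Proof.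
move=> mf q; under eq_fun do rewrite crdN; exact: measurable_funN.
Qed.
Lemma mfm_sum m n (I : Type) (r : seq I) (f : I -> T -> 'M[C]_(m, n)) :
  (forall i, mfm (f i)) -> mfm (fun w => \sum_(i <- r) f i w).
Proof.
move=> mf q; under eq_fun do rewrite crd_sum.
by apply: (@measurable_sum _ _ _ _ _ _ (fun i w => crd q (f i w))) => i; exact: mf.
Qed.
Lemma mfm_rZ m n (x : T -> R) (f : T -> 'M[C]_(m, n)) :
  measurable_fun setT x -> mfm f -> mfm (fun w => (x w)%:C%C *: f w).
Proof.
move=> mx mf q; under eq_fun do rewrite crd_rZ; exact: measurable_funM.
Qed.
Lemma measurable_fun_sum_fin (I : Type) (r : seq I) (f : I -> T -> R) :
  (forall i, measurable_fun setT (f i)) ->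
  measurable_fun setT (fun w => \sum_(i <- r) f i w).
Proof. by move=> mf; exact: (@measurable_sum _ _ _ _ _ _ f). Qed.
Lemma mfmM m n p (f : T -> 'M[C]_(m, n)) (g : T -> 'M[C]_(n, p)) :
  mfm f -> mfm g -> mfm (fun w => f w *m g w).
Proof.
move=> mf mg [[i j] b].
have -> : (fun w => crd (i, j, b) (f w *m g w)) = (fun w => \sum_k
   if b then crd (i, k, false) (f w) * crd (k, j, true) (g w) +
             crd (i, k, true) (f w) * crd (k, j, false) (g w)
   else crd (i, k, false) (f w) * crd (k, j, false) (g w) -
        crd (i, k, true) (f w) * crd (k, j, true) (g w)).
  apply/funext => w; rewrite /crd mxE /=.
  by case: b; rewrite ?cRe_sum ?cIm_sum; apply: eq_bigr => k _;
    rewrite ?cReM ?cImM.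
apply: measurable_fun_sum_fin => k; case: b.
  by apply: measurable_funD; apply: measurable_funM.
by apply: measurable_funB; apply: measurable_funM.
Qed.
Lemma mfm_fro m n (f : T -> 'M[C]_(m, n)) : mfm f ->
  measurable_fun setT (fun w => fro (f w)).
Proof.
move=> mf; apply: measurable_fun_sum_fin => q; exact: measurable_funX.
Qed.
Lemma mfm_nm m n (f : T -> 'M[C]_(m, n)) : mfm f ->
  measurable_fun setT (fun w => nm (f w)).
Proof.
move=> mf; apply: measurableT_comp (mfm_fro mf).
by apply: continuous_measurable_fun; exact: sqrt_continuous.
Qed.

Definition ratmx m n (v : {ffun 'I_m * 'I_n -> rat * rat}) : 'M[C]_(m, n) :=
  \matrix_(i, j) Complex (ratr (v (i, j)).1) (ratr (v (i, j)).2).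

(** Entries equal to 0 or 1 are reproduced exactly: the bad vectors of the small ball estimate are
    normalized by such entries, and the normalization must survive rational approximation. *)
Lemma ratmx_dense m n (A : 'M[C]_(m, n)) (e : R) : 0 < e ->
  exists v : {ffun 'I_m * 'I_n -> rat * rat},
    nm (A - ratmx v) < e /\ (forall i j, A i j = 0 -> ratmx v i j = 0) /\
    (forall i j, A i j = 1 -> ratmx v i j = 1).
Proof.
move=> e0.
have [K K0 hK] : exists2 K : R, 0 < K & K * (#|{: 'I_m * 'I_n * bool}|)%:R < e ^+ 2.
  exists (e ^+ 2 / (#|{: 'I_m * 'I_n * bool}|.+1)%:R).
    by rewrite divr_gt0// exprn_gt0.
  rewrite mulrAC ltr_pdivrMr// ltr_pM2l ?exprn_gt0//.
  by rewrite ltr_nat.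
pose g (z : C) : rat * rat := if z == 0 then (0, 0) else if z == 1 then (1, 0) else
   (xget 0 [set q : rat | `|complex.Re z - ratr q| < Num.sqrt K],
    xget 0 [set q : rat | `|complex.Im z - ratr q| < Num.sqrt K]).
have sK : 0 < Num.sqrt K by rewrite sqrtr_gt0.
have ap (x : R) : exists q : rat, `|x - ratr q| < Num.sqrt K.
  have [q] := @rat_in_itvoo R (x - Num.sqrt K) (x + Num.sqrt K) ltac:(lra).
  by rewrite in_itv/= => /andP[h1 h2]; exists q; rewrite ltr_norml; lra.
exists [ffun p => g (A p.1 p.2)]; split; [|split].
- rewrite nm_lt ?(ltW e0)// /fro; apply: le_lt_trans hK.
  rewrite mulr_natr -sumr_const; apply: ler_sum => -[[i j] b] _.
  rewrite -[leRHS](sqr_sqrtr (ltW K0)) -real_normK ?num_real//.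
  rewrite ler_pXn2r ?nnegrE ?sqrtr_ge0// /crd !mxE ffunE /g /=.
  case: eqP => [->|_]; first by case: b; rewrite /= rmorph0 subr0 normr0 ltW.
  case: eqP => [->|_]; first by case: b; rewrite /= ?rmorph0 ?rmorph1 subrr normr0 ltW.
  case: b; rewrite ?cImD ?cReD ?cImN ?cReN /=.
    have [q hq] := ap (complex.Im (A i j)).
    by apply: ltW; case: xgetP => [y _ //|/(_ q)].
  have [q hq] := ap (complex.Re (A i j)).
  by apply: ltW; case: xgetP => [y _ //|/(_ q)].
- by move=> i j Aij; rewrite mxE ffunE /g/= Aij eqxx/= rmorph0.
- by move=> i j Aij; rewrite mxE ffunE /g/= Aij oner_eq0 eqxx/= rmorph0 rmorph1.
Qed.

(** A sublevel set is a countable union of balls, with rational centres and with radii 1/(k+1) small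
    enough for the Lipschitz bound to keep them inside. *)
Lemma lipschitz_measurable n (F : 'M[C]_n -> R) (f : T -> 'M[C]_n) :
  (forall A B, F A <= F B + nm (A - B)) -> mfm f ->
  measurable_fun setT (fun w => F (f w)).
Proof.
move=> lipF mf; apply: (measurability _ (RGenInftyO.measurableE R)) => //.
move=> _ [_ [s ->] <-]; rewrite setTI.
have -> : (fun w => F (f w)) @^-1` `]-oo, s[%classic =
    \bigcup_(p : {ffun 'I_n * 'I_n -> rat * rat} * nat)
      [set w | (F (ratmx p.1) < s - p.2.+1%:R^-1) && (nm (f w - ratmx p.1) < p.2.+1%:R^-1)].
  apply/seteqP; split => w /=; rewrite in_itv/=.
    move=> Fs; have [k hk] : exists k, 2 * k.+1%:R^-1 < s - F (f w).
      have e0 : 0 < (s - F (f w)) / 2 by rewrite divr_gt0// subr_gt0.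
      have [k _ hk] := near_infty_natSinv_lt (PosNum e0).
      by exists k; have := hk k (leqnn k) => /=; rewrite ltr_pdivlMr// mulrC.
    have k0 : 0 < k.+1%:R^-1 :> R by rewrite invr_gt0.
    have [v [hv _]] := ratmx_dense (f w) k0.
    exists (v, k) => //=; rewrite hv andbT.
    have := lipF (ratmx v) (f w); rewrite -nmN opprB => h.
    move: hk hv h; rewrite mulr_natl mulr2n; move: (_^-1) (nm _) => x y hk hv h.
    by rewrite ltrBrDr (le_lt_trans (lerD h (lexx _)))// -addrA -ltrBrDl (lt_trans _ hk)// ltrD2r.
  move=> [[v k] _ /= /andP[h1 h2]].
  by apply: (le_lt_trans (lipF _ (ratmx v))); have := ltrD h1 h2; rewrite subrK.
apply: countable_bigcupT_measurable => [|[v k]]; first exact: countableP.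
rewrite /=; have [h|h] := boolP (F (ratmx v) < s - k.+1%:R^-1); last first.
  by rewrite (_ : [set _ | _] = set0)//; apply/seteqP; split.
rewrite /= -[X in measurable X]setTI.
apply: (measurable_fun_ltr (f := fun w => nm (f w - ratmx v)) (g := cst _)) => //.
by apply: mfm_nm; apply: mfmD => //; exact: mfm_cst.
Qed.

Lemma sigma_measurable n k (f : T -> 'M[C]_n) : (0 < k <= n)%N -> mfm f ->
  measurable_fun setT (fun w => sigma k (f w)).
Proof.
by move=> kn; apply: lipschitz_measurable => A B; exact: sigma_lipschitz.
Qed.

End MeasurableMatrices.

(** * Real coordinates of the elliptical noise *)

Section HermitianBasis.
Variables (R : realType) (N : nat).
Local Notation C := R[i].

(* The Hermitian matrix multiplying the coordinate [hermitian_coord _ p]. *)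
Definition herm_basis (p : 'I_N * 'I_N) : 'M[C]_N :=
  if p.1 == p.2 then (Num.sqrt N%:R)^-1%:C%C *: delta_mx p.1 p.1
  else if (p.1 < p.2)%N then
    (Num.sqrt (2 * N%:R))^-1%:C%C *: (delta_mx p.1 p.2 + delta_mx p.2 p.1)
  else (Num.sqrt (2 * N%:R))^-1%:C%C *: ('i%C *: (delta_mx p.2 p.1 - delta_mx p.1 p.2)).

(** [false] selects the process X and [true] the process Y. *)
Definition ell_coef (a b theta : R) (s : bool) : C :=
  if s then cis theta * ('i%C * b%:C%C) else cis theta * a%:C%C.

Definition ell_basis a b theta (k : 'I_N * 'I_N * bool) : 'M[C]_N :=
  ell_coef a b theta k.2 *: herm_basis k.1.

Lemma sqm_cis (x : R) : sqm (cis x) = 1.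
Proof. by rewrite /sqm /= cos2Dsin2. Qed.

Lemma sqm_ell_coef a b theta s :
  sqm (ell_coef a b theta s) = if s then b ^+ 2 else a ^+ 2.
Proof.
case: s; rewrite /ell_coef !sqmM sqm_cis mul1r ?sqm_real//.
by rewrite [sqm 'i%C]/sqm /= expr0n expr1n add0r mul1r.
Qed.

Lemma form_delta (v : 'rV[C]_N) (y : 'cV[C]_N) i j :
  (v *m delta_mx i j *m y) 0 0 = v 0 i * y j 0.
Proof.
rewrite mxE (bigD1 j)//= big1 ?addr0; last first.
  move=> l /negbTE lj; rewrite mxE big1 ?mul0r// => k _.
  by rewrite mxE lj andbF mulr0.
rewrite mxE (bigD1 i)//= big1 ?addr0; last first.
  by move=> k /negbTE ki; rewrite mxE ki /= mulr0.
by rewrite mxE !eqxx mulr1.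
Qed.

(** The left-hand side is the variance per unit of time of the real part of the linear form v W y.
    An off-diagonal coordinate mixes two products of entries of v and y, and they are separated by
    (p + q)^2/2 <= p^2 + q^2. *)
Lemma ell_form_bound a b theta (v : 'rV[C]_N) (y : 'cV[C]_N) : (0 < N)%N ->
  \sum_k complex.Re ((v *m ell_basis a b theta k *m y) 0 0) ^+ 2 <=
  (a ^+ 2 + b ^+ 2) / N%:R * (fro v * fro y).
Proof.
move=> N0; have N0R : 0 < N%:R :> R by rewrite ltr0n.
have key (c : C) : \sum_p complex.Re (c * (v *m herm_basis p *m y) 0 0) ^+ 2 <=
    sqm c / N%:R * (fro v * fro y).
  pose z i j := c * (v 0 i * y j 0).
  have -> : sqm c / N%:R * (fro v * fro y) = N%:R^-1 * \sum_i \sum_j sqm (z i j).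
    rewrite !froE big_ord1 exchange_big big_ord1 mulrAC mulrC; congr (_ * _).
    rewrite big_distrlr/= mulr_sumr; apply: eq_bigr => i _.
    by rewrite mulr_sumr; apply: eq_bigr => j _; rewrite /z !sqmM.
  (* Off the diagonal, [u i j + u' j i] is [sqm (z i j)]: real and imaginary parts sit at transposed
     positions, so the indices of [u'] are exchanged before comparing term by term. *)
  pose u (i j : 'I_N) : R := if i == j then complex.Re (z i j) ^+ 2
    else if (i < j)%N then complex.Re (z i j) ^+ 2 else complex.Im (z i j) ^+ 2.
  pose u' (i j : 'I_N) : R := if i == j then 0
    else if (i < j)%N then complex.Re (z j i) ^+ 2 else complex.Im (z j i) ^+ 2.
  have sN : (Num.sqrt N%:R)^-1 ^+ 2 = N%:R^-1 :> R.
    by rewrite exprVn sqr_sqrtr// ler0n.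
  have s2N : (Num.sqrt (2 * N%:R))^-1 ^+ 2 = 2^-1 * N%:R^-1 :> R.
    by rewrite exprVn sqr_sqrtr ?invfM// mulr_ge0.
  have N10 : 0 < N%:R^-1 :> R by rewrite invr_gt0.
  have hsq (p q : R) : 2^-1 * (p + q) ^+ 2 <= p ^+ 2 + q ^+ 2.
    rewrite -subr_ge0 (_ : _ - _ = 2^-1 * (p - q) ^+ 2); last by field.
    by rewrite mulr_ge0// sqr_ge0.
  apply: (@le_trans _ _ (\sum_i \sum_j N%:R^-1 * (u i j + u' i j))).
    rewrite [leRHS](pair_bigA _ (fun i j => N%:R^-1 * (u i j + u' i j)))/=.
    apply: ler_sum => -[i j] _ /=.
    rewrite /herm_basis /u /u' /=; case: (eqVneq i j) => [<-|ij].
      rewrite addr0 -scalemxAr -scalemxAl mxE form_delta.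
      by rewrite mulrCA -/(z i i) cReM /= mul0r subr0 exprMn sN.
    case: ifP => _.
      rewrite -scalemxAr -scalemxAl mxE mulmxDr mulmxDl [X in _ * (_ * X)]mxE !form_delta.
      rewrite mulrCA mulrDr -/(z i j) -/(z j i).
      rewrite cReM /= mul0r subr0 exprMn s2N cReD -mulrA [leLHS]mulrCA.
      by rewrite ler_pM2l// hsq.
    rewrite -scalemxAr -scalemxAl mxE -scalemxAr -scalemxAl [X in _ * (_ * X)]mxE.
    rewrite mulmxBr mulmxBl [X in _ * (_ * (_ * X))]mxE [X in _ * (_ * (_ * (_ + X)))]mxE !form_delta.
    rewrite mulrCA [c * (_ * _)]mulrCA mulrBr -/(z i j) -/(z j i).
    rewrite cReM /= mul0r subr0 exprMn s2N cReM /= mul0r add0r mul1r sqrrN cImD cImN -mulrA [leLHS]mulrCA.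
    by rewrite ler_pM2l// [leRHS]addrC -(sqrrN (complex.Im (z i j))) hsq.
  under eq_bigr do rewrite -mulr_sumr; rewrite -mulr_sumr ler_pM2l//.
  under eq_bigr do rewrite big_split/=; rewrite big_split/= [X in _ + X]exchange_big/=.
  rewrite -big_split/=; apply: ler_sum => i _; rewrite -big_split/=.
  apply: ler_sum => j _; rewrite /u /u' /sqm eq_sym.
  case: (eqVneq j i) => [->|ij]; first by rewrite addr0 lerDl sqr_ge0.
  case: (ltnP i j) => h; first by rewrite ltnNge (ltnW h).
  have -> : (j < i)%N by rewrite ltn_neqAle h andbT; exact: ij.
  by rewrite addrC.
rewrite -(pair_bigA _ (fun p s => complex.Re ((v *m ell_basis a b theta (p, s) *m y) 0 0) ^+ 2))/=.
rewrite exchange_big big_bool/=.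
have h s : \sum_p complex.Re ((v *m ell_basis a b theta (p, s) *m y) 0 0) ^+ 2 <=
    sqm (ell_coef a b theta s) / N%:R * (fro v * fro y).
  apply: le_trans (key _); rewrite le_eqVlt; apply/orP; left; apply/eqP; apply: eq_bigr => p _.
  by rewrite /ell_basis/= -scalemxAr -scalemxAl mxE.
apply: (le_trans (lerD (h true) (h false))).
by rewrite -mulrDl -mulrDl !sqm_ell_coef [b ^+ 2 + _]addrC.
Qed.

Lemma herm_basis_col p i : (p.1 != i) && (p.2 != i) -> col i (herm_basis p) = 0.
Proof.
move=> /andP[/negbTE h1 /negbTE h2]; apply/colP => l; rewrite !mxE /herm_basis.
case: ifP => _; last case: ifP => _; rewrite !mxE ![i == _]eq_sym ?h1 ?h2 ?andbF;
  by rewrite ?addr0 ?subr0 ?mulr0.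
Qed.

(** With the previous lemma, this isolates column i: the coordinates that drive it touch any other
    column only in row i. *)
Lemma herm_basis_col_i p i j : (p.1 == i) || (p.2 == i) -> j != i ->
  exists z, col j (herm_basis p) = z *: delta_mx i 0.
Proof.
move=> pi ji; exists (herm_basis p i j); apply/colP => l; rewrite !mxE /herm_basis.
have jiE := negbTE ji.
case: (eqVneq l i) => [->|/negbTE li]; first by rewrite eqxx mulr1.
rewrite /= mulr0; case: p pi => p1 p2 /=.
case: (eqVneq p1 p2) => [<-|p12 pi].
  by rewrite orbb => /eqP ->; rewrite !mxE li /= mulr0.
have [h1 h2] : (l == p1) && (j == p2) = false /\ (l == p2) && (j == p1) = false.
  move: pi => /orP[] /eqP e; subst; rewrite ?li ?jiE ?andbF//; split=> //.
by case: ifP => _; rewrite !mxE h1 h2 ?addr0 ?subr0 ?mulr0.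
Qed.
End HermitianBasis.

(** * Small ball estimate *)

Section OrthonormalKernel.
Variable R : realType.
Local Notation C := R[i].

Lemma orthonormal_kernel r n m (Z : 'M[C]_(r, n)) : (m + \rank Z <= r)%N ->
  exists2 F : 'M[C]_(m, r), F \is unitarymx & F *m Z = 0.
Proof.
move=> h; pose B := row_base (kermx Z).
have rB : \rank (kermx Z) = (r - \rank Z)%N by exact: mxrank_ker.
have fB : row_free B by exact: row_base_free.
have Br : (\rank (kermx Z) <= r)%N by exact: rank_leq_row.
have mB : (m <= \rank (kermx Z))%N by rewrite rB leq_subRL 1?addnC// (leq_trans _ h)// leq_addl.
pose S := schmidt B.
have Su : S \is unitarymx by exact: schmidt_unitarymx.
have SZ : S *m Z = 0.
  have /submxP[X ->] : (S <= kermx Z)%MS.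
    by rewrite (eqmx_schmidt_free fB) eq_row_base.
  by rewrite -mulmxA mulmx_ker mulmx0.
exists (rowsub (widen_ord mB) S).
  apply/row_unitarymxP => i j; rewrite !row_rowsub.
  have /row_unitarymxP -> := Su.
  by congr (_%:R); congr nat_of_bool; apply/eqP/eqP => [[e]|->//]; apply/val_inj.
by rewrite mul_rowsub_mx SZ; apply/matrixP => k l; rewrite !mxE.
Qed.

End OrthonormalKernel.

Lemma block_mx_sum (R : realType) m (I : Type) (r : seq I) (A1 A2 A3 A4 : I -> 'M[R]_m) :
  \sum_(j <- r) block_mx (A1 j) (A2 j) (A3 j) (A4 j) =
  block_mx (\sum_(j <- r) A1 j) (\sum_(j <- r) A2 j)
    (\sum_(j <- r) A3 j) (\sum_(j <- r) A4 j).
Proof.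
elim: r => [|j r IH]; first by rewrite !big_nil block_mx0.
by rewrite !big_cons IH add_block_mx.
Qed.

Lemma sum_cross (V : nmodType) n (i : 'I_n) (f : 'I_n -> 'I_n -> V) :
  (forall p q, p != i -> q != i -> f p q = 0) -> f i i = 0 ->
  \sum_p \sum_q f p q = \sum_j (f i j + f j i).
Proof.
move=> f0 fii; rewrite (bigD1 i)//= big_split/=; congr (_ + _).
rewrite [RHS](bigD1 i)//= fii add0r; apply: eq_bigr => p pi.
by rewrite (bigD1 i)//= big1 ?addr0// => q; exact: f0.
Qed.

Section SmallBallVector.
Context d (T : measurableType d) (R : realType) (P : probability T R).
Variables (N : nat) (G : set (set T)) (x : 'I_N * 'I_N * bool -> T -> R) (D : R).
Variables (a b theta : R).
Local Notation C := R[i].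
Hypothesis gs : gaussian_step P G x D.
Hypothesis D0 : 0 < D.
Hypothesis N0 : (0 < N)%N.
Let rho := a ^+ 2 + b ^+ 2.
Hypothesis rho0 : 0 < rho.
Let kap := rho * D / N%:R.

Definition ell_noise (w : T) : 'M[C]_N :=
  \sum_k (x k w)%:C%C *: ell_basis a b theta k.

Definition realify m (z : 'cV[C]_m) : 'cV[R]_(m + m) :=
  col_mx (map_mx (@complex.Re R) z) (map_mx (@complex.Im R) z).

Lemma realifyD m (z z' : 'cV[C]_m) : realify (z + z') = realify z + realify z'.
Proof.
rewrite /realify add_col_mx; congr col_mx; apply/matrixP => i j;
  by rewrite !mxE ?cReD ?cImD.
Qed.
Lemma realify0 m : realify (0 : 'cV[C]_m) = 0.
Proof.
by rewrite /realify -[RHS]vsubmxK; congr col_mx; apply/matrixP => i j; rewrite !mxE.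
Qed.
Lemma realifyZ m (t : R) (z : 'cV[C]_m) : realify (t%:C%C *: z) = t *: realify z.
Proof.
rewrite /realify scale_col_mx; congr col_mx; apply/matrixP => i j;
  by rewrite !mxE ?cReM ?cImM /=; ring.
Qed.
Lemma realify_sum m (I : Type) (r : seq I) (z : I -> 'cV[C]_m) :
  realify (\sum_(i <- r) z i) = \sum_(i <- r) realify (z i).
Proof. exact: (big_morph _ (@realifyD m) (realify0 m)). Qed.
Lemma realify_fro m (z : 'cV[C]_m) : ((realify z)^T *m realify z) 0 0 = fro z.
Proof.
rewrite /realify tr_col_mx mul_row_col !mxE froE -big_split/=.
by apply: eq_bigr => i _; rewrite !mxE big_ord1 /sqm !expr2.
Qed.

Let outer m (z : 'cV[C]_m) : 'M[R]_(m + m) := realify z *m (realify z)^T.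

(** The two real coordinates of an off-diagonal entry act along c z and along i c z. Their joint
    covariance does not see the phase of c, so the small ball estimate depends on rho but not on
    zeta. *)
Lemma outer_pair m (c : C) (z : 'cV[C]_m) :
  outer (c *: z) + outer ((c * 'i%C) *: z) = sqm c *: (outer z + outer ('i%C *: z)).
Proof.
rewrite /outer /realify !tr_col_mx !mul_col_row !add_block_mx !scale_block_mx.
by congr block_mx; apply/matrixP => i j; rewrite !mxE !big_ord1 !mxE /sqm
  ?cReM ?cImM ?cReM ?cImM/= ?cReM ?cImM /=; ring.
Qed.

(** Orthonormality of the rows of [F] in real coordinates: the real parts of the scalar products
    give the diagonal blocks, the imaginary parts the other two. *)
Lemma outer_unitary m (F : 'M[C]_(m, N)) : F \is unitarymx ->
  \sum_j (outer (col j F) + outer ('i%C *: col j F)) = 1%:M.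
Proof.
move=> /unitarymxP FF.
have E i i' : \sum_j F i j * (F i' j)^* = (i == i')%:R.
  have := congr1 (fun M : 'M[C]_m => M i i') FF; rewrite !mxE => <-.
  by apply: eq_bigr => j _; rewrite !mxE.
have ER i i' : \sum_j (complex.Re (F i j) * complex.Re (F i' j) +
    complex.Im (F i j) * complex.Im (F i' j)) = (i == i')%:R.
  have := congr1 (@complex.Re R) (E i i'); rewrite cRe_sum.
  have -> : complex.Re ((i == i')%:R : C) = (i == i')%:R by case: (i == i').
  by move=> <-; apply: eq_bigr => j _; rewrite cReM cReJ cImJ; ring.
have EI i i' : \sum_j (complex.Im (F i j) * complex.Re (F i' j) -
    complex.Re (F i j) * complex.Im (F i' j)) = 0.
  have := congr1 (@complex.Im R) (E i i'); rewrite cIm_sum.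
  have -> : complex.Im ((i == i')%:R : C) = 0 by case: (i == i').
  move=> h; rewrite -[RHS]h; apply: eq_bigr => j _; rewrite cImM cReJ cImJ; ring.
have EI' i i' : \sum_j (complex.Re (F i j) * complex.Im (F i' j) -
    complex.Im (F i j) * complex.Re (F i' j)) = 0.
  by have h := EI i' i; rewrite -[RHS]h; apply: eq_bigr => j _; ring.
rewrite scalar_mx_block.
under eq_bigr do rewrite /outer /realify !tr_col_mx !mul_col_row add_block_mx.
rewrite block_mx_sum; congr block_mx; apply/matrixP => i j; rewrite summxE !mxE.
- by rewrite -ER; apply: eq_bigr => k _; rewrite !mxE !big_ord1 !mxE !cReM /=; ring.
- have h := EI' i j; rewrite -[RHS]h.
  by apply: eq_bigr => k _; rewrite !mxE !big_ord1 !mxE !cReM !cImM /=; ring.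
- by have h := EI i j; rewrite -[RHS]h; apply: eq_bigr => k _; rewrite !mxE !big_ord1 !mxE !cReM !cImM /=; ring.
- by rewrite -ER; apply: eq_bigr => k _; rewrite !mxE !big_ord1 !mxE !cImM /=; ring.
Qed.

(** Exponential Chebyshev inequality. [F] times column i of the noise is an isotropic Gaussian
    vector in R^(2m), of variance kap/2 in each coordinate; the condition [col i F = 0] discards the
    diagonal entry, which has another covariance structure. This gives the bound exp(lam t) (1 + lam
    kap)^(-m). *)
Lemma small_ball_vector m i (F : 'M[C]_(m, N)) (c : 'cV[C]_m) (t : R) :
  F \is unitarymx -> col i F = 0 -> 
  t <= m%:R * kap / (expR 3 - 1) ->
  (P [set w | (fro (c + F *m col i (ell_noise w)) < t)%R] <= (expR (- 2 * m%:R))%:E)%E.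
Proof.
move=> Fu Fi ht.
have N0R : 0 < N%:R :> R by rewrite ltr0n.
have kap0 : 0 < kap by rewrite divr_gt0// mulr_gt0.
have e31 : 0 < expR 3 - 1 :> R by rewrite subr_gt0 -expR0 ltr_expR.
(* Chosen so that 1 + lam kap = exp 3; as lam t <= m, the bound becomes exp(m - 3 m). *)
pose lam := (expR 3 - 1) / kap; have lam0 : 0 < lam by rewrite divr_gt0.
pose g k := realify (F *m col i (ell_basis a b theta k)).
pose z w := c + F *m col i (ell_noise w).
have zE w : realify (z w) = realify c + \sum_k x k w *: g k.
  rewrite /z realifyD; congr (_ + _); rewrite /ell_noise.
  rewrite linear_sum/= mulmx_sumr realify_sum; apply: eq_bigr => k _.
  by rewrite linearZ/= -scalemxAr realifyZ.
have gsum : \sum_k g k *m (g k)^T = (rho / (2 * N%:R)) *: 1%:M.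
  rewrite -(pair_bigA _ (fun p s => g (p, s) *m (g (p, s))^T))/= exchange_big/= big_bool/=.
  pose TT (cc : C) p := outer (cc *: (F *m col i (herm_basis R p))).
  have Tsum cc : \sum_p TT cc p = (sqm cc / (2 * N%:R)) *: 1%:M.
    pose s2 := (Num.sqrt (2 * N%:R))^-1 : R.
    have Fd j l : F *m col i (delta_mx j l) = if l == i then col j F else 0.
      case: (eqVneq l i) => [->|li].
        by rewrite colE mul_delta_mx_cond eqxx mulr1n -colE.
      by rewrite colE mul_delta_mx_cond (negbTE li) mulr0n mulmx0.
    have LZ (c0 : C) (A : 'M[C]_N) : F *m col i (c0 *: A) = c0 *: (F *m col i A).
      by rewrite linearZ/= -scalemxAr.
    have LD (A B : 'M[C]_N) : F *m col i (A + B) = F *m col i A + F *m col i B.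
      by rewrite linearD/= mulmxDr.
    have LN (A : 'M[C]_N) : F *m col i (- A) = - (F *m col i A).
      by rewrite linearN/= mulmxN.
    have oN z' : outer (- z' : 'cV_m) = outer z'.
      have -> : - z' = (-1)%:C%C *: z' by rewrite rmorphN1 scaleN1r.
      by rewrite /outer realifyZ scaleN1r linearN/= mulmxN mulNmx opprK.
    have o0 : outer (0 : 'cV[C]_m) = 0 by rewrite /outer realify0 mul0mx.
    have Tii : TT cc (i, i) = 0.
      rewrite /TT /herm_basis/= eqxx linearZ/= -scalemxAr Fd eqxx Fi.
      by rewrite !scaler0 o0.
    (* Real and imaginary part of one off-diagonal entry. Which of the two positions carries which
       part depends on the order of i and j; the sign that appears in one order is invisible to
       [outer]. *)
    have Tpair j : TT cc (i, j) + TT cc (j, i) =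
        sqm (cc * s2%:C%C) *: (outer (col j F) + outer ('i%C *: col j F)).
      case: (eqVneq j i) => [->|ji].
        by rewrite Tii Fi scaler0 o0 !addr0 scaler0.
      rewrite -outer_pair /TT /herm_basis/= eq_sym (negbTE ji).
      case: ifP => h; case: ifP => h'.
      - by exfalso; move: (ltn_trans h h'); rewrite ltnn.
      - rewrite !(LZ, LD, LN).
        rewrite !Fd !eqxx (negbTE ji) add0r sub0r -/s2 !scalerN oN !scalerA.
        by congr (_ + outer (_ *: _)); ring.
      - rewrite [LHS]addrC !(LZ, LD, LN).
        rewrite !Fd !eqxx (negbTE ji) addr0 subr0 -/s2 !scalerA.
        by congr (_ + outer (_ *: _)); ring.
      - by exfalso; move: ji; rewrite -val_eqE/= neq_ltn h h'.
    have T0 p1 p2 : p1 != i -> p2 != i -> TT cc (p1, p2) = 0.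
      move=> h1 h2.
      have hc : col i (herm_basis R (p1, p2)) = 0.
        by apply: herm_basis_col; rewrite /= h1.
      by rewrite /TT hc mulmx0 scaler0 o0.
    rewrite -(pair_bigA _ (fun p1 p2 => TT cc (p1, p2)))/=.
    rewrite (@sum_cross _ _ i (fun p1 p2 => TT cc (p1, p2)) T0 Tii).
    rewrite (eq_bigr _ (fun j _ => Tpair j)).
    rewrite -scaler_sumr outer_unitary// sqmM sqm_real; congr (_ * _ *: _).
    by rewrite /s2 exprVn sqr_sqrtr// mulr_ge0.
  have gT s p : g (p, s) *m (g (p, s))^T = TT (ell_coef a b theta s) p.
    by rewrite /g /TT /outer /ell_basis/= linearZ/= -scalemxAr.
  have gTs s : \sum_p g (p, s) *m (g (p, s))^T =
      ((if s then b ^+ 2 else a ^+ 2) / (2 * N%:R)) *: 1%:M.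
    rewrite -(sqm_ell_coef a b theta s) -Tsum; apply: eq_bigr => p _; exact: gT.
  have ab : b ^+ 2 / (2 * N%:R) + a ^+ 2 / (2 * N%:R) = rho / (2 * N%:R).
    by rewrite /rho -mulrDl addrC.
  refine (etrans (f_equal2 (fun u v => u + v) (gTs true) (gTs false)) _).
  refine (etrans (esym (scalerDl _ _ _)) _).
  exact: (f_equal (fun u => u *: (1%:M : 'M[R]_(m + m))) ab).
have [sG mx _] := gs.
have mz : mfm z.
  apply: mfmD; first exact: mfm_cst.
  apply: mfmM; first exact: mfm_cst.
  have -> : (fun w => col i (ell_noise w)) =
      (fun w => \sum_k (x k w)%:C%C *: col i (ell_basis a b theta k)).
    apply/funext => w; rewrite /ell_noise linear_sum/=; apply: eq_bigr => k _.
    by rewrite linearZ.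
  by apply: mfm_sum => k; apply: mfm_rZ => //; exact: mfm_cst.
have mE : measurable [set w | (fro (z w) < t)%R].
  rewrite -[X in measurable X]setTI.
  apply: (measurable_fun_ltr (f := fun w => fro (z w)) (g := cst t)) => //.
  exact: mfm_fro.
rewrite -[X in P X]setIT -integral_indic//.
apply: (@le_trans _ _ (\int[P]_w ((expR (lam * t))%:E * (expR (- (lam * fro (z w))))%:E))%E).
  apply: ge0_le_integral => //.
  - by apply/measurable_EFinP; exact: measurable_indic.
  - apply/measurable_EFinP; apply: measurable_funM => //.
    apply: measurableT_comp => //; apply: measurable_funN.
    by apply: measurable_funM => //; exact: mfm_fro.
  - move=> w _; rewrite -EFinM lee_fin -expRD indicE.
    have [|_] := boolP (w \in _); last by rewrite expR_ge0.
    rewrite inE/= => fz; rewrite -expR0 ler_expR -mulrBr mulr_ge0 ?ltW//.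
    by rewrite subr_gt0.
rewrite ge0_integralZl//; last first.
  apply/measurable_EFinP.
  apply: measurableT_comp => //; apply: measurable_funN.
  by apply: measurable_funM => //; exact: mfm_fro.
pose A := lam^-1 *: (1%:M : 'M[R]_(m + m)).
have iA : invmx A = lam *: 1%:M.
  by rewrite /A invmxZ ?invmx1 ?invrK// unitmxZ ?unitmx1// unitfE invr_eq0 gt_eqF.
have qA v : qf (invmx A) v = lam * (v^T *m v) 0 0.
  by rewrite /qf iA -scalemxAr mulmx1 -scalemxAl mxE.
have pA : posdef A.
  split; first by rewrite /A linearZ/= trmx1.
  move=> v v0; rewrite /qf /A -scalemxAr mulmx1 -scalemxAl mxE mulr_gt0 ?invr_gt0//.
  rewrite mxE lt0r sumr_ge0 ?andbT; last by move=> k _; rewrite mxE -expr2 sqr_ge0.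
  apply: contra v0 => /eqP/psumr_eq0P h; apply/eqP/colP => k.
  have := h _ k isT; rewrite !mxE -expr2 => /(_ _)/eqP; rewrite sqrf_eq0 => e.
  by apply/eqP/e => l _; rewrite !mxE -expr2 sqr_ge0.
have dA : \det A = lam^-1 ^+ (m + m) by rewrite /A detZ det1 mulr1.
have dA0 : 0 < \det A by rewrite dA exprn_gt0// invr_gt0.
have h := gaussian_quadratic_seq gs D0 g (realify c) (index_enum_uniq _) pA dA0.
rewrite (eq_integral (fun w => (expR (- qf (invmx A)
    (realify c + \sum_(k <- index_enum _) x k w *: g k)))%:E)); last first.
  by move=> w _; rewrite qA -zE realify_fro.
apply: (le_trans (lee_wpmul2l _ h)); first by rewrite lee_fin expR_ge0.
have -> : A + 2 * D *: (\sum_(k <- index_enum _) g k *m (g k)^T) =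
    (lam^-1 * expR 3) *: 1%:M.
  rewrite gsum scalerA -scalerDl; congr (_ *: _).
  have -> : 2 * D * (rho / (2 * N%:R)) = kap by rewrite /kap; field; rewrite gt_eqF.
  rewrite /lam invfM invrK; field; rewrite gt_eqF//.
rewrite detZ det1 mulr1 dA -expr_div_n -EFinM lee_fin.
have -> : lam^-1 * expR 3 / lam^-1 = expR 3 by rewrite mulrAC divff ?mul1r// invr_eq0 gt_eqF.
have -> : Num.sqrt (expR 3 ^+ (m + m)) = expR (3 * m%:R) :> R.
  by rewrite exprD -expr2 sqrtr_sqr ger0_norm ?exprn_ge0 ?expR_ge0// -expRM_natr.
rewrite -expRN -expRD ler_expR.
have : lam * t <= m%:R.
  rewrite /lam mulrAC ler_pdivrMr// mulrC; move: ht; rewrite ler_pdivlMr// => /le_trans; exact.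
lra.
Qed.

End SmallBallVector.

Lemma prob_bigcup_fin d (T : measurableType d) (R : realType) (P : probability T R)
    (I : finType) (F : I -> set T) (e : R) : (forall i, measurable (F i)) ->
  (forall i, P (F i) <= e%:E)%E ->
  (P (\bigcup_i F i) <= (#|I|%:R * e)%:E)%E.
Proof.
move=> mF PF.
have [i0 _|h] := pickP (@predT I); last first.
  have -> : \bigcup_i F i = set0.
    by apply/seteqP; split => // w; case=> i; have := h i.
  by rewrite measure0 eq_card0 ?mul0r// => i; have := h i.
- pose A n := F (nth i0 (enum I) n).
  have -> : \bigcup_i F i = \big[setU/set0]_(n < #|I|) A n.
    apply/seteqP; split => w; rewrite -bigcup_mkord; last by move=> [n _ h]; exists (nth i0 (enum I) n).
    move=> [i _ Fi]; exists (enum_rank i); first by rewrite /= ltn_ord.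
    by rewrite /A -enum_val_nth enum_rankK.
  apply: (@le_trans _ _ (\sum_(n < #|I|) P (A n))%E).
    by apply: Boole_inequality => n _; exact: mF.
  apply: (@le_trans _ _ (\sum_(n < #|I|) e%:E)%E).
    by apply: lee_sum => n _; exact: PF.
  by rewrite sumEFin sumr_const card_ord mulr_natl.
Qed.

Section SmallBall.
Context d (T : measurableType d) (R : realType) (P : probability T R).
Variables (N : nat) (G : set (set T)) (x : 'I_N * 'I_N * bool -> T -> R) (D : R).
Variables (a b theta : R).
Local Notation C := R[i].
Hypothesis gs : gaussian_step P G x D.
Hypothesis D0 : 0 < D.
Hypothesis N0 : (0 < N)%N.
Let rho := a ^+ 2 + b ^+ 2.
Hypothesis rho0 : 0 < rho.
Let kap := rho * D / N%:R.
Local Notation noise := (ell_noise x a b theta).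

Lemma fro_unitary_contract m n (F : 'M[C]_(m, n)) (y : 'cV[C]_n) :
  F \is unitarymx -> fro (F *m y) <= fro y.
Proof.
move=> Fu; set u := F *m y.
have e : (fro u)%:C%C = (u^t* *m F *m y) 0 0.
  by rewrite -fro_tc fro_rv trmxCK -mulmxA.
have := le_trans (sqm_le_fro 0 0 (u^t* *m F *m y)) (froM _ _).
rewrite -e sqm_real (fro_unitary _ Fu) fro_tc.
have [->|u0] := eqVneq (fro u) 0; first by rewrite fro_ge0.
by rewrite expr2 ler_pM2l// lt_neqAle eq_sym u0 fro_ge0.
Qed.

(* Some vector with last [m] coordinates zero and [i]-th coordinate [1] is nearly
   in the kernel of [M]; rational vectors make this a countable union. *)
Definition bad_index m (t : R) i (M : 'M[C]_N) (v : {ffun 'I_N * 'I_1 -> rat * rat}) : Prop :=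
  [/\ forall j : 'I_N, (N - m <= j)%N -> ratmx R v j 0 = 0, ratmx R v i 0 = 1 &
    fro (M *m ratmx R v) < t].

(** [F] kills the columns of [M0] with index below N - m other than i, so the image of a bad vector
    seen through [F] is column i alone, with coefficient 1. The perturbation moves the killed
    columns along e_i, which [F] kills as well. These are N - m conditions, and they leave room for
    m rows. *)
Lemma bad_index_small_ball m (t : R) (i : 'I_N) (M0 : 'M[C]_N) :
  (m <= N)%N -> (i < N - m)%N ->
  exists F : 'M[C]_(m, N), [/\ F \is unitarymx, col i F = 0 &
   forall (E : 'M[C]_N) v, (forall j, j != i -> exists z : C, col j E = z *: delta_mx i 0) ->
    bad_index m t i (M0 + E) v -> fro (F *m col i M0 + F *m col i E) < t].
Proof.
move=> mN im.
(* Column i is replaced by e_i, so that killing the columns of [Z'] includes killing the direction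
   in which the other columns move. *)
pose Z' : 'M[C]_N := \matrix_(k, j) if j == i then (k == i)%:R else M0 k j.
pose Z := Z' *m (pid_mx (N - m) : 'M[C]_N).
have colZ (j : 'I_N) : (j < N - m)%N -> col j Z = col j Z'.
  move=> jm; rewrite /Z colE -mulmxA colE; congr (_ *m _).
  rewrite -colE; apply/matrixP => k l; rewrite !mxE (ord1 l) andbT -val_eqE/=.
  by case: (eqVneq (k : nat) j) => [->|//]; rewrite jm.
have rZ : (\rank Z <= N - m)%N.
  apply: (leq_trans (mxrankM_maxr _ _)); by rewrite rank_pid_mx// leq_subr.
have [|F Fu FZ] := @orthonormal_kernel R N N m Z; first by have := leq_add (leqnn m) rZ; rewrite subnKC.
have Fcol (j : 'I_N) : (j < N - m)%N -> F *m col j Z' = 0.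
  by move=> jm; rewrite -colZ// colE mulmxA FZ mul0mx.
have Fi : F *m delta_mx i 0 = 0 :> 'cV_m.
  rewrite -[RHS](Fcol i)//; congr (_ *m _); apply/matrixP => k l; rewrite !mxE eqxx.
  by have -> : l = 0 by [exact/ord1]; rewrite eqxx andbT.
exists F; split => //; first by rewrite colE.
move=> E u hE [u0 ui hu]; apply: le_lt_trans hu.
apply: le_trans (fro_unitary_contract _ Fu).
have -> : (M0 + E) *m ratmx R u = \sum_j ratmx R u j 0 *: col j (M0 + E).
  apply/matrixP => k l; rewrite !mxE summxE; apply: eq_bigr => j _.
  by rewrite !mxE mulrC (ord1 l).
rewrite (bigD1 i)//= ui scale1r.
rewrite [F *m (_ + _)]mulmxDr mulmx_sumr big1 ?addr0; last first.
  move=> j ji; rewrite -scalemxAr.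
  have [jm|jm] := leqP (N - m) j; first by rewrite u0// scale0r.
  have [z ->] : exists z : C, col j (M0 + E) = col j Z' + z *: delta_mx i 0.
    have [z hz] := hE j ji; exists z; rewrite linearD/= hz; congr (_ + _).
    by apply/matrixP => k l; rewrite !mxE (negbTE ji).
  by rewrite mulmxDr Fcol// -scalemxAr Fi scaler0 addr0 scaler0.
by rewrite [col i (_ + _)]linearD/= mulmxDr.
Qed.

Let near_i i : pred ('I_N * 'I_N * bool) := fun k => (k.1.1 == i) || (k.1.2 == i).

(** Conditioning on the other columns would change the law of column i. Instead, the variables
    without the index i are frozen ([n1]): they determine [F], while the others ([n2]) produce
    column i and move the remaining columns along e_i only. *)
Lemma small_ball_index m (t : R) (i : 'I_N) (M0 : 'M[C]_N) : (m <= N)%N -> (i < N - m)%N ->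
  t <= m%:R * kap / (expR 3 - 1) ->
  measurable [set w | exists v, bad_index m t i (M0 + noise w) v] /\
  (P [set w | exists v, bad_index m t i (M0 + noise w) v] <= (expR (- 2 * m%:R))%:E)%E.
Proof.
move=> mN im ht; have [sG mx _] := gs.
pose J1 := predC (near_i i).
pose J2 := near_i i.
pose G1 := past G x J1.
pose G2 := \bigcup_(k in [set k | J2 k]) preimage_set_system setT (x k) measurable.
pose n1 w : 'M[C]_N := \sum_k (if J1 k then x k w else 0)%:C%C *: ell_basis a b theta k.
pose n2 w : 'M[C]_N := \sum_k (if J2 k then x k w else 0)%:C%C *: ell_basis a b theta k.
have nE w : noise w = n1 w + n2 w.
  rewrite /ell_noise -big_split/=; apply: eq_bigr => k _; rewrite -scalerDl /J1/= -/(J2 k).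
  by case: (J2 k); rewrite /= ?add0r ?addr0.
have ind : independent2 P <<s G1 >> <<s G2 >>.
  by apply: (past_independent gs) => k.
have sG1 : <<s G1 >> `<=` measurable by exact: past_measurable gs _.
have sG2 : <<s G2 >> `<=` measurable.
  apply: smallest_sub; first exact: sigma_algebra_measurable.
  by move=> A [k _ [B mB <-]]; exact: mx.
have [S mS SE] : exists2 S : set (g_sigma_algebraType G1 * g_sigma_algebraType G2),
    measurable S & forall w w', S (w, w') <->
      exists v, bad_index m t i (M0 + (n1 w + n2 w')) v.
  pose S := [set p : g_sigma_algebraType G1 * g_sigma_algebraType G2 |
    exists v, bad_index m t i (M0 + (n1 p.1 + n2 p.2)) v].
  exists S; last by [].
  have -> : S = \bigcup_v [set p | bad_index m t i (M0 + (n1 p.1 + n2 p.2)) v].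
    by apply/seteqP; split => p /= [v h]; [exists v|exists v].
  apply: countable_bigcupT_measurable => [|v]; first exact: countableP.
  have [h|h] := pselect ((forall j : 'I_N, (N - m <= j)%N -> ratmx R v j 0 = 0) /\ ratmx R v i 0 = 1); last first.
    rewrite (_ : [set _ | _] = set0)//; apply/seteqP; split => p //= [h1 h2 _].
    by apply: h.
  have -> : [set p | bad_index m t i (M0 + (n1 p.1 + n2 p.2)) v] =
     [set p : g_sigma_algebraType G1 * g_sigma_algebraType G2 |
       fro ((M0 + (n1 p.1 + n2 p.2)) *m ratmx R v) < t].
    by apply/seteqP; split => p /=; [case|case: h => h1 h2; split].
  rewrite -[X in measurable X]setTI.
  apply: (measurable_fun_ltr
    (f := fun p : g_sigma_algebraType G1 * g_sigma_algebraType G2 =>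
      fro ((M0 + (n1 p.1 + n2 p.2)) *m ratmx R v)) (g := cst t)) => //.
  apply: mfm_fro; apply: mfmM; last exact: mfm_cst.
  apply: mfmD; first exact: mfm_cst.
  apply: mfmD.
  - apply: mfm_sum => k; apply: mfm_rZ; last exact: mfm_cst.
    case Jk : (J1 k); last exact: measurable_cst.
    apply: (measurableT_comp (f := x k : g_sigma_algebraType G1 -> R)) => //.
    exact: past_x.
  - apply: mfm_sum => k; apply: mfm_rZ; last exact: mfm_cst.
    case Jk : (J2 k); last exact: measurable_cst.
    apply: (measurableT_comp (f := x k : g_sigma_algebraType G2 -> R)) => //.
    by move=> _ B mB; apply: sub_sigma_algebra; exists k => //; exists B.
have m1 : measurable_fun setT (fun w : T => (w, w) : g_sigma_algebraType G1 * g_sigma_algebraType G2).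
  apply: measurable_fun_pair.
    by move=> _ B mB; rewrite setTI; exact: sG1.
  by move=> _ B mB; rewrite setTI; exact: sG2.
set B := [set w | _].
have BE : B = (fun w : T => (w, w) : g_sigma_algebraType G1 * g_sigma_algebraType G2) @^-1` S.
  apply/seteqP; split => w; rewrite /B /= nE => h; first by apply/SE.
  by move: h => /SE.
have mB : measurable B by have := m1 measurableT _ mS; rewrite setTI BE.
clearbody B.
split; first exact: mB.
have -> : P B = (\int[P]_w (\1_S (w, w))%:E)%E.
  transitivity (\int[P]_w (\1_B w)%:E)%E; last first.
    by apply: eq_integral => w _; rewrite BE /indic.
  by rewrite integral_indic; [rewrite setIT|exact: measurableT|exact: mB].
rewrite (freezing_sub (f := fun p => (\1_S p)%:E) sG1 sG2 ind); last 2 first.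
- by apply/measurable_EFinP; exact: measurable_indic.
- by move=> p; rewrite lee_fin.
have key w : (\int[P]_w' (\1_S (w, w'))%:E <= (expR (- 2 * m%:R))%:E)%E.
  have [F [Fu Fi hF]] := @bad_index_small_ball m t i (M0 + n1 w) mN im.
  have mV : measurable [set w' | fro (F *m col i (M0 + n1 w) + F *m col i (noise w')) < t].
    rewrite -[X in measurable X]setTI.
    apply: (measurable_fun_ltr (f := fun w' => fro (F *m col i (M0 + n1 w) + F *m col i (noise w'))) (g := cst t)) => //.
    apply: mfm_fro; apply: mfmD; first exact: mfm_cst.
    apply: mfmM; first exact: mfm_cst.
    have -> : (fun w => col i (noise w)) =
        (fun w => \sum_k (x k w)%:C%C *: col i (ell_basis a b theta k)).
      apply/funext => w0; rewrite /ell_noise linear_sum/=; apply: eq_bigr => k _.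
      by rewrite linearZ.
    by apply: mfm_sum => k; apply: mfm_rZ => //; exact: mfm_cst.
  have hP : (P [set w' | (fro (F *m col i (M0 + n1 w) + F *m col i (noise w')) < t)%R]
      <= (expR (- 2 * m%:R))%:E)%E by exact: (small_ball_vector theta gs D0 N0 rho0 _ Fu Fi ht).
  apply: (le_trans _ hP) => {hP}.
  set V := [set w' | _] in mV *.
  have -> : P V = (\int[P]_w' (\1_V w')%:E)%E.
    by rewrite integral_indic; [rewrite setIT|exact: measurableT|exact: mV].
  have mSw : measurable [set w' : T | S (w, w')].
    have E : xsection S w = [set w' | S (w, w')].
      by apply/seteqP; split => w' /=; rewrite /xsection/= ?inE.
    have mS' : measurable (xsection S w : set (g_sigma_algebraType G2)).
      exact: measurable_xsection.
    by have := sG2 _ mS'; rewrite E.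
  apply: ge0_le_integral => //.
  - apply/measurable_EFinP.
    rewrite (_ : (fun _ => _) = \1_[set w' | S (w, w')]); first exact: measurable_indic.
    by apply/funext => w'; rewrite !indicE; congr (_%:R); congr nat_of_bool; apply/idP/idP; rewrite !inE.
  - by apply/measurable_EFinP; exact: measurable_indic.
  move=> w' _; rewrite lee_fin !indicE.
  have [|_] := boolP ((w, w') \in S); last by case: (_ \in _).
  rewrite inE => /SE[v hv]; rewrite mem_set//=; rewrite /V/=.
  (* Frozen variables do not enter column i, so there the full noise of the copy w' may be used, the
     form to which [small_ball_vector] applies. *)
  have -> : col i (noise w') = col i (n2 w').
    rewrite nE linearD/= (_ : col i (n1 w') = 0) ?add0r//.
    rewrite /n1 linear_sum/= big1// => k _.
    case: ifPn => Jk; last by rewrite scale0r linear0.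
    rewrite linearZ/= /ell_basis linearZ/= herm_basis_col ?scaler0//.
    by move: Jk; rewrite /J1/= negb_or.
  apply: (hF _ v); last by rewrite -addrA.
  move=> j ji.
  have hz k : exists z : C, col j ((if J2 k then x k w' else 0)%:C%C *: ell_basis a b theta k)
      = z *: delta_mx i 0.
    case: ifPn => Jk; last by exists 0; rewrite !scale0r linear0.
    have [z hz] := herm_basis_col_i R Jk ji.
    by rewrite linearZ/= /ell_basis linearZ/= hz !scalerA; eexists.
  have [z zE] := choice hz; exists (\sum_k z k).
  by rewrite scaler_suml /n2 linear_sum/=; apply: eq_bigr => k _.
apply: (le_trans (y := \int[P]_w (expR (- 2 * m%:R))%:E)%E).
  apply: ge0_le_integral => //.
  - by move=> w _; apply: integral_ge0 => w' _; rewrite lee_fin.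
  - apply: (@measurable_freezing _ _ _ P _ _ (g_sigma_algebraType G1)
      (g_sigma_algebraType G2) id id (fun p => (\1_S p)%:E)).
    + exact: g_sigma_id_measurable.
    + exact: g_sigma_id_measurable.
    + by apply/measurable_EFinP; exact: measurable_indic.
    + by move=> z; rewrite lee_fin.
by rewrite integral_cst// [X in (_ * X)%E]probability_setT mule1.
Qed.

(* A space of dimension [l + 1] on which [M] is small contains one of dimension
   at least [l + 1 - m] that vanishes on the last [m] coordinates. The projections
   of the basis vectors onto it have squared norms [p j] summing to its dimension,
   so [N * p j >= l + 1 - m] for some [j], and that projection is bad for [j]. *)
Lemma sigma_ge_of_not_bad (M : 'M[C]_N) m l (t e : R) :
  (forall i : 'I_N, (i < N - m)%N -> ~ exists v, bad_index m t i M v) ->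
  (l < N)%N -> (m <= l)%N -> 0 < t -> 0 < e ->
  N%:R * e ^+ 2 < (l.+1 - m)%:R * t -> e <= sigma (N - l) M.
Proof.
move=> hbad lN ml t0 e0 hNe.
(* Absence of bad vectors in homogeneous form. A vector violating it can be normalized at i, and the
   strict inequality leaves room to replace it by a rational one. *)
have s1 (v : 'cV[C]_N) i : (forall j : 'I_N, (N - m <= j)%N -> v j 0 = 0) ->
    t * sqm (v i 0) <= fro (M *m v).
  move=> v0; have [vi|vi] := eqVneq (v i 0) 0.
    by rewrite vi sqm0 mulr0 fro_ge0.
  have im : (i < N - m)%N by rewrite ltnNge; apply: contra vi => /v0 ->.
  pose u := (v i 0)^-1 *: v.
  have vE : v = v i 0 *: u by rewrite scalerA divff// scale1r.
  rewrite [X in _ <= fro (_ *m X)]vE -scalemxAr froZ mulrC ler_wpM2l ?sqm_ge0//.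
  rewrite leNgt; apply/negP => hlt.
  have st0 : 0 <= Num.sqrt t by exact: sqrtr_ge0.
  have hlt' : nm (M *m u) < Num.sqrt t by rewrite nm_lt ?st0 ?sqr_sqrtr ?(ltW t0).
  have nM1 : 0 < 1 + nm M by rewrite ltr_pwDl// nm_ge0.
  have d0 : 0 < (Num.sqrt t - nm (M *m u)) / (1 + nm M).
    by rewrite divr_gt0// subr_gt0.
  have [r [hr [r0 r1]]] := ratmx_dense u d0.
  apply: (hbad i im); exists r; split.
  - by move=> j /v0 vj; apply: r0; rewrite /u mxE vj mulr0.
  - by apply: r1; rewrite /u mxE mulVf.
  - suff : nm (M *m ratmx R r) < Num.sqrt t by rewrite nm_lt ?st0 ?sqr_sqrtr ?(ltW t0).
    have -> : M *m ratmx R r = M *m u + M *m (ratmx R r - u) by rewrite -mulmxDr addrC subrK.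
    apply: (le_lt_trans (nmD _ _)); rewrite -ltrBrDl.
    apply: (le_lt_trans (nmM _ _)).
    have -> : nm (ratmx R r - u) = nm (u - ratmx R r) by rewrite -nmN opprB.
    have : nm (u - ratmx R r) * (1 + nm M) < Num.sqrt t - nm (M *m u).
      by rewrite -ltr_pdivlMr.
    apply: le_lt_trans; rewrite mulrC ler_wpM2l ?nm_ge0// lerDr//.
have kN : (0 < N - l <= N)%N by rewrite subn_gt0 lN leq_subr.
rewrite leNgt; apply/negP => /(sigma_lt_space kN e0)[r [V [rN Vu hV]]].
have lr : (l < r)%N.
  by move: rN; rewrite -(ltn_add2r l) -addnA subnK ?(ltnW lN)// addnC ltn_add2r.
pose Z := V *m (copid_mx (N - m) : 'M[C]_N).
have mN : (m <= N)%N by exact: leq_trans ml (ltnW lN).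
have rZ : (\rank Z <= m)%N.
  apply: (leq_trans (mxrankM_maxr _ _)).
  by rewrite rank_copid_mx ?leq_subr// subKn.
have [|F Fu FZ] := @orthonormal_kernel R r N (r - m) Z.
  by rewrite (leq_trans (leq_add (leqnn _) rZ))// subnK// (leq_trans ml)// ltnW.
have [U UE] : exists U, U = F *m V by eexists.
have Uu : U \is unitarymx.
  apply/unitarymxP; rewrite UE trmx_mul map_mxM mulmxA -(mulmxA F) (unitarymxP Vu).
  by rewrite mulmx1 (unitarymxP Fu).
have U0 i (j : 'I_N) : (N - m <= j)%N -> U i j = 0.
  move=> mj; move: FZ; rewrite /Z mulmxA -UE /copid_mx mulmxBr mulmx1.
  move=> /eqP; rewrite subr_eq0 => /eqP ->; rewrite mxE big1// => k _.
  rewrite [X in _ * X]mxE; case: (eqVneq (k : nat) j) => [->|_]; last by rewrite mulr0.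
  by rewrite ltnNge mj mulr0.
pose p (j : 'I_N) := fro (col j U).
have pE : \sum_j p j = (r - m)%:R.
  have <- : fro U = (r - m)%:R.
    have := fro_mxtr U; rewrite (unitarymxP Uu) mxtrace1 => h.
    by have := congr1 (@complex.Re R) h; rewrite /= -(rmorph_nat (real_complex R)).
  rewrite [RHS]froE [RHS]exchange_big/=; apply: eq_bigr => j _; rewrite /p froE.
  by apply: eq_bigr => i _; rewrite big_ord1 mxE.
have pj j : t * p j <= e ^+ 2.
  have [->|pj0] := eqVneq (p j) 0; first by rewrite mulr0 sqr_ge0.
  have pj1 : 0 < p j by rewrite lt_neqAle eq_sym pj0 fro_ge0.
  (* [y *m U] is the projection of e_j onto the row space of [U]: its squared norm and its j-th
     coordinate are both [p j]. *)
  pose y : 'rV[C]_(r - m) := (col j U)^t*.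
  have fy : fro (y *m U) = p j by rewrite fro_unitary// fro_tc.
  have y0 : y *m F != 0.
    apply: contraNN pj0 => /eqP h; rewrite -fy UE mulmxA h mul0mx fro0//.
  have := hV _ y0; have -> : y *m F *m V = y *m U by rewrite UE mulmxA.
  move=> h.
  have yUj : (y *m U) 0 j = (p j)%:C%C.
    by rewrite fro_mxtr mxtrace_mulC /mxtrace big_ord1 !mxE; apply: eq_bigr => k _; rewrite !mxE.
  have tE k : ((y *m U)^t*) k 0 = ((y *m U) 0 k)^* by rewrite [LHS]mxE [X in X^*]mxE.
  have U0' (k : 'I_N) : (N - m <= k)%N -> (y *m U) 0 k = 0.
    by move=> mk; rewrite mxE big1// => i _; rewrite U0// mulr0.
  have : t * p j ^+ 2 <= e ^+ 2 * p j.
    have := @s1 ((y *m U)^t*) j; rewrite tE yUj sqmJ sqm_real => hs.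
    apply: le_trans (hs _) _ => //.
      by move=> k mk; rewrite tE U0'// conjC0.
    have : nm ((M *m (y *m U)^t*)^t*) < e * nm (y *m U).
      by move: h; rewrite trmx_mul map_mxM trmxCK.
    rewrite nm_lt ?mulr_ge0 ?nm_ge0 ?(ltW e0)// fro_tc exprMn nm2 fy; exact: ltW.
  by rewrite expr2 mulrA ler_pM2r.
have : t * (r - m)%:R <= N%:R * e ^+ 2.
  rewrite -pE mulr_sumr; apply: le_trans (ler_sum _ (fun j _ => pj j)) _.
  by rewrite sumr_const card_ord mulr_natl.
apply/negP; rewrite -ltNge; apply: (lt_le_trans hNe).
by rewrite mulrC ler_pM2l// ler_nat leq_sub2r.
Qed.

(** The factor N is the cost of the union over the index i. The parameter m is free: it sets the
    exponent but is subtracted from the dimension l + 1; it is later taken about l/2. *)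
Lemma small_ball_sigma (M0 : 'M[C]_N) m l (e : R) :
  (l < N)%N -> (m <= l)%N -> (0 < m)%N -> 0 < e ->
  N%:R * e ^+ 2 < (l.+1 - m)%:R * (m%:R * kap / (expR 3 - 1)) ->
  (P [set w | (sigma (N - l) (M0 + noise w) < e)%R] <=
    (N%:R * expR (- 2 * m%:R))%:E)%E.
Proof.
move=> lN ml m0 e0 hNe.
set t := m%:R * kap / (expR 3 - 1).
have t0 : 0 < t.
  have e31 : 0 < expR 3 - 1 :> R by rewrite subr_gt0 -expR0 ltr_expR.
  by rewrite /t divr_gt0// mulr_gt0 ?ltr0n// divr_gt0 ?ltr0n// mulr_gt0.
have mN : (m <= N)%N by exact: leq_trans ml (ltnW lN).
pose B (i : 'I_N) : set T := if (i < N - m)%N then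
  [set w | exists v, bad_index m t i (M0 + noise w) v] else set0.
have hB (i : 'I_N) : measurable (B i) /\ (P (B i) <= (expR (- 2 * m%:R))%:E)%E.
  rewrite /B; case: ifP => im; first exact: small_ball_index.
  by rewrite measure0 lee_fin expR_ge0.
have := prob_bigcup_fin (fun i => (hB i).1) (fun i => (hB i).2).
rewrite card_ord; apply: le_trans.
have [sG mx _] := gs.
apply: le_measure; rewrite ?inE.
- rewrite -[X in measurable X]setTI.
  apply: (measurable_fun_ltr (f := fun w => sigma (N - l) (M0 + noise w)) (g := cst e)) => //.
  apply: sigma_measurable; first by rewrite subn_gt0 lN leq_subr.
  apply: mfmD; first exact: mfm_cst.
  by apply: mfm_sum => k; apply: mfm_rZ => //; exact: mfm_cst.
- by apply: fin_bigcup_measurable => // i _; exact: (hB i).1.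
move=> w /=; apply: contraPP => h; apply/negP; rewrite -leNgt.
apply: (@sigma_ge_of_not_bad _ m l t) => // i im hv.
by apply: h; exists i => //; rewrite /B im.
Qed.

End SmallBall.

(** * Multiplication by an adapted matrix *)

Section AdaptedSmallBall.
Context d (T : measurableType d) (R : realType) (P : probability T R).
Variables (N : nat) (G : set (set T)) (x : 'I_N * 'I_N * bool -> T -> R) (D : R).
Variables (a b theta : R).
Local Notation C := R[i].
Hypothesis gs : gaussian_step P G x D.
Hypothesis D0 : 0 < D.
Hypothesis N0 : (0 < N)%N.
Let rho := a ^+ 2 + b ^+ 2.
Hypothesis rho0 : 0 < rho.
Let kap := rho * D / N%:R.
Local Notation noise := (ell_noise x a b theta).

(** Reduces a condition on all vectors to countably many, which makes the corresponding event
    measurable. *)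
Lemma rat_lower_bound n (Q : 'M[C]_n) (e : R) : 0 <= e ->
  (forall r, e * nm (ratmx R r : 'cV_n) <= nm (Q *m (ratmx R r : 'cV_n))) ->
  forall v : 'cV[C]_n, e * nm v <= nm (Q *m v).
Proof.
move=> e0 h v; apply/ler_addgt0Pr => g g0.
have h1 : 0 < 1 + e + nm Q by rewrite ltr_pwDl// ?nm_ge0// ltr_pwDl.
have [r [hr _]] := ratmx_dense v (divr_gt0 g0 h1).
set u := ratmx R r in hr.
have hu : e * nm u <= nm (Q *m u) by exact: h.
have hv : nm v <= nm u + nm (v - u) by rewrite -{1}(subrK u v) addrC nmD.
have hQ : nm (Q *m u) <= nm (Q *m v) + nm Q * nm (v - u).
  have -> : Q *m u = Q *m v - Q *m (v - u) by rewrite mulmxBr opprB addrC subrK.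
  apply: (le_trans (nmD _ _)); rewrite nmN lerD2l; exact: nmM.
apply: (le_trans (ler_wpM2l e0 hv)); rewrite mulrDr.
apply: (le_trans (lerD (le_trans hu hQ) (lexx _))).
rewrite -addrA lerD2l -mulrDl.
have : nm (v - u) * (1 + e + nm Q) <= g by rewrite -ler_pdivlMr// ltW.
apply: le_trans; rewrite mulrC ler_wpM2l ?nm_ge0//; lra.
Qed.

Lemma small_ball_sigma_mul (Q : T -> 'M[C]_N) (A : 'M[C]_N) m l (c e : R) :
  mfm (Q : g_sigma_algebraType G -> _) -> (l < N)%N -> (m <= l)%N -> (0 < m)%N ->
  0 < e -> 0 < c ->
  N%:R * e ^+ 2 < (l.+1 - m)%:R * (m%:R * kap / (expR 3 - 1)) ->
  exists2 B : set T, measurable B /\ (P B <= (N%:R * expR (- 2 * m%:R))%:E)%E &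
    forall w, (forall v : 'cV[C]_N, c * nm v <= nm (Q w *m v)) ->
      sigma (N - l) (Q w *m (1%:M + noise w) + A) < c * e -> B w.
Proof.
move=> mQ lN ml m0 e0 c0 hNe; have [sG mx _] := gs.
pose G2 := \bigcup_(k in [set k | predT k]) preimage_set_system setT (x k) measurable.
have ind : independent2 P <<s past G x pred0 >> <<s G2 >>.
  by apply: (past_independent gs) => k.
have ind' : independent2 P <<s G >> <<s G2 >>.
  move=> E1 E2 h1 h2; apply: ind => //.
  by move: h1; apply: smallest_sub; [exact: smallest_sigma_algebra|
     move=> E GE; apply: sub_sigma_algebra; left; exact: sub_sigma_algebra].
have sG2 : <<s G2 >> `<=` measurable.
  apply: smallest_sub; first exact: sigma_algebra_measurable.
  by move=> E [k _ [B mB <-]]; exact: mx.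
have lN' : (0 < N - l <= N)%N by rewrite subn_gt0 lN leq_subr.
have [S mS SE] : exists2 S : set (g_sigma_algebraType G * g_sigma_algebraType G2),
    measurable S & forall w w', S (w, w') <->
      (forall v : 'cV[C]_N, c * nm v <= nm (Q w *m v)) /\
      sigma (N - l) (Q w *m (1%:M + noise w') + A) < c * e.
  pose S1 := [set p : g_sigma_algebraType G * g_sigma_algebraType G2 |
    forall v : 'cV[C]_N, c * nm v <= nm (Q p.1 *m v)].
  pose S2 := [set p : g_sigma_algebraType G * g_sigma_algebraType G2 |
    sigma (N - l) (Q p.1 *m (1%:M + noise p.2) + A) < c * e].
  have mQ1 : mfm (fun p : g_sigma_algebraType G * g_sigma_algebraType G2 => Q p.1).
    by move=> q; apply: (measurableT_comp (mQ q)).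
  exists (S1 `&` S2); last by [].
  apply: measurableI.
    have -> : S1 = \bigcap_(r : {ffun 'I_N * 'I_1 -> rat * rat})
        [set p | c * nm (ratmx R r) <= nm (Q p.1 *m ratmx R r)].
      apply/seteqP; split => p /= h; first by move=> r _; exact: h.
      by apply: rat_lower_bound (ltW c0) _ => r; exact: h.
    rewrite -[X in measurable X]setCK setC_bigcap; apply: measurableC.
    apply: countable_bigcupT_measurable => [|r]; first exact: countableP.
    apply: measurableC.
    rewrite -[X in measurable X]setTI.
    apply: (measurable_fun_le (f := cst (c * nm (ratmx R r)))
      (g := fun p : g_sigma_algebraType G * g_sigma_algebraType G2 => nm (Q p.1 *m ratmx R r))) => //.
    by apply: mfm_nm; apply: mfmM => //; exact: mfm_cst.
  rewrite -[X in measurable X]setTI.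
  apply: (measurable_fun_ltr (f := fun p : g_sigma_algebraType G * g_sigma_algebraType G2 =>
    sigma (N - l) (Q p.1 *m (1%:M + noise p.2) + A)) (g := cst (c * e))) => //.
  apply: sigma_measurable => //; apply: mfmD; last exact: mfm_cst.
  apply: mfmM => //; apply: mfmD; first exact: mfm_cst.
  apply: mfm_sum => k; apply: mfm_rZ; last exact: mfm_cst.
  apply: (measurableT_comp (f := x k : g_sigma_algebraType G2 -> R)) => //.
  by move=> _ B mB; apply: sub_sigma_algebra; exists k => //; exists B.
have m1 : measurable_fun setT (fun w : T => (w, w) : g_sigma_algebraType G * g_sigma_algebraType G2).
  apply: measurable_fun_pair.
    by move=> _ B mB; rewrite setTI; exact: sG.
  by move=> _ B mB; rewrite setTI; exact: sG2.
pose B := (fun w : T => (w, w) : g_sigma_algebraType G * g_sigma_algebraType G2) @^-1` S.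
have mB : measurable B by have := m1 measurableT _ mS; rewrite setTI.
exists B; last by move=> w h1 h2; apply/SE.
split; first exact: mB.
have -> : P B = (\int[P]_w (\1_S (w, w))%:E)%E.
  transitivity (\int[P]_w (\1_B w)%:E)%E; last first.
    by apply: eq_integral => w _; rewrite /B /indic.
  by rewrite integral_indic; [rewrite setIT|exact: measurableT|exact: mB].
rewrite (freezing_sub (f := fun p => (\1_S p)%:E) sG sG2 ind'); last 2 first.
- by apply/measurable_EFinP; exact: measurable_indic.
- by move=> p; rewrite lee_fin.
have key w : (\int[P]_w' (\1_S (w, w'))%:E <= (N%:R * expR (- 2 * m%:R))%:E)%E.
  have [hw|hw] := pselect (forall v : 'cV[C]_N, c * nm v <= nm (Q w *m v)); last first.
    rewrite (eq_integral (cst 0%E)) ?integral0 ?lee_fin ?mulr_ge0 ?expR_ge0//.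
    move=> w' _; rewrite indicE memNset//= => /SE[h _]; exact: hw.
  have uQ : Q w \in unitmx.
    rewrite -unitmx_tr -row_free_unit -kermx_eq0; apply/eqP/row_matrixP => i.
    rewrite row0; set u := row i _.
    have hu : u *m (Q w)^T = 0 by rewrite /u -row_mul mulmx_ker row0.
    have : Q w *m u^T = 0 by apply: trmx_inj; rewrite trmx_mul trmxK hu trmx0.
    have := hw u^T => /[swap] ->; rewrite nm0 pmulr_rle0// => h.
    apply: trmx_inj; rewrite trmx0; apply: contraTeq h => /nm_gt0.
    by rewrite -ltNge.
  pose M0 := 1%:M + invmx (Q w) *m A.
  have hP : (P [set w' | (sigma (N - l) (M0 + noise w') < e)%R] <=
      (N%:R * expR (- 2 * m%:R))%:E)%E.
    exact: (small_ball_sigma theta gs D0 N0 rho0).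
  apply: (le_trans _ hP) => {hP}.
  set V := [set w' | _].
  have mV : measurable V.
    rewrite -[X in measurable X]setTI.
    apply: (measurable_fun_ltr (f := fun w => sigma (N - l) (M0 + noise w)) (g := cst e)) => //.
    apply: sigma_measurable => //.
    apply: mfmD; first exact: mfm_cst.
    by apply: mfm_sum => k; apply: mfm_rZ => //; exact: mfm_cst.
  have -> : P V = (\int[P]_w' (\1_V w')%:E)%E.
    by rewrite integral_indic; [rewrite setIT|exact: measurableT|exact: mV].
  have mSw : measurable [set w' : T | S (w, w')].
    have E : xsection S w = [set w' | S (w, w')].
      by apply/seteqP; split => w' /=; rewrite /xsection/= ?inE.
    have mS' : measurable (xsection S w : set (g_sigma_algebraType G2)).
      exact: measurable_xsection.
    by have := sG2 _ mS'; rewrite E.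
  apply: ge0_le_integral => //.
  - apply/measurable_EFinP.
    rewrite (_ : (fun _ => _) = \1_[set w' | S (w, w')]); first exact: measurable_indic.
    by apply/funext => w'; rewrite !indicE; congr (_%:R); congr nat_of_bool; apply/idP/idP; rewrite !inE.
  - by apply/measurable_EFinP; exact: measurable_indic.
  move=> w' _; rewrite lee_fin !indicE.
  have [|_] := boolP ((w, w') \in S); last by case: (_ \in _).
  rewrite inE => /SE[_ hlt]; rewrite mem_set//=; rewrite /V/=.
  rewrite -(ltr_pM2l c0); apply: le_lt_trans hlt.
  apply: (le_trans (sigma_mull _ lN' c0 hw)).
  have -> // : Q w *m (M0 + noise w') = Q w *m (1%:M + noise w') + A.
  by rewrite /M0 addrAC [LHS]mulmxDr mulmxA mulmxV// mul1mx.
apply: (le_trans (y := \int[P]_w (N%:R * expR (- 2 * m%:R))%:E)%E).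
  apply: ge0_le_integral => //.
  - by move=> w _; apply: integral_ge0 => w' _; rewrite lee_fin.
  - apply: (@measurable_freezing _ _ _ P _ _ (g_sigma_algebraType G)
      (g_sigma_algebraType G2) id id (fun p => (\1_S p)%:E)).
    + exact: g_sigma_id_measurable.
    + exact: g_sigma_id_measurable.
    + by apply/measurable_EFinP; exact: measurable_indic.
    + by move=> z; rewrite lee_fin.
by rewrite integral_cst// [X in (_ * X)%E]probability_setT mule1.
Qed.

End AdaptedSmallBall.

(** * Norm of a short product of Euler factors *)

Section Net.
Variable R : realType.
Local Notation C := R[i].

Lemma geometric_half (n : nat) : \sum_(i < n) (2^-1 : R) ^+ i <= 2.
Proof.
have -> : \sum_(i < n) (2^-1 : R) ^+ i = 2 - 2 * 2^-1 ^+ n.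
  elim: n => [|n IH]; first by rewrite big_ord0 expr0 mulr1 subrr.
  by rewrite big_ord_recr/= IH exprS; lra.
by rewrite gerBl mulr_ge0// exprn_ge0.
Qed.

(* Integer points f of Z^I (sign and modulus) are counted with weight
   2^-|f|_1. *)
Lemma card_lattice_ball (I : finType) (M L : nat) :
  #|[pred f : {ffun I -> bool * 'I_M} | (\sum_i (f i).2 <= L)%N]|%:R <=
  2 ^+ L * 4 ^+ #|I| :> R.
Proof.
rewrite -sum1_card natr_sum.
apply: (@le_trans _ _ (\sum_(f : {ffun I -> bool * 'I_M}) 2 ^+ L * \prod_i (2^-1 : R) ^+ (f i).2)).
  rewrite big_mkcond/=; apply: ler_sum => f _; rewrite inE.
  case: ifP => h; last by rewrite mulr_ge0 ?exprn_ge0// prodr_ge0// => i _; rewrite exprn_ge0.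
  rewrite (prodrXr (2^-1 : R)).
  rewrite exprVn -(ler_pM2r (x := 2 ^+ (\sum_i (f i).2)%N)) ?exprn_gt0//.
  by rewrite mul1r mulfVK ?expf_neq0// ler_weXn2l// ler1n.
rewrite -mulr_sumr ler_pM2l ?exprn_gt0//.
rewrite -(bigA_distr_bigA (fun (i : I) (p : bool * 'I_M) => (2^-1 : R) ^+ p.2))/=.
rewrite prodr_const; apply: lerXn2r; rewrite ?nnegrE//.
  by apply: sumr_ge0 => p _; rewrite exprn_ge0.
rewrite -(pair_bigA _ (fun (s : bool) (i : 'I_M) => (2^-1 : R) ^+ i))/= big_bool/=.
by have := geometric_half M; lra.
Qed.

(** The net consists of the points of the lattice of mesh h in the unit ball. One of them lies
    within 1/2 of the normalized adjoint of u, so the real part loses at most half of the norm. The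
    count is 2^(8 n) 4^(2 n) = 4096^n. *)
Lemma norming_net n : (0 < n)%N ->
  exists (J : finType) (y : J -> 'cV[C]_n), [/\ #|J|%:R <= 4096 ^+ n :> R,
    forall j, fro (y j) <= 1 &
    forall u : 'rV[C]_n, exists j, nm u <= 2 * complex.Re ((u *m y j) 0 0)].
Proof.
move=> n0; have n0R : 0 < n%:R :> R by rewrite ltr0n.
(* In a lattice point of norm at most 1 the integer coordinates have sum of squares at most h^-2 = 8
   n, hence their moduli also have sum at most 8 n. *)
pose L := (8 * n)%N.
pose F := {ffun 'I_n * bool -> bool * 'I_L.+1}.
pose h : R := (2 * Num.sqrt (2 * n%:R))^-1.
have h0 : 0 < h by rewrite invr_gt0 mulr_gt0// sqrtr_gt0 mulr_gt0.
have h2 : h ^+ 2 = (8 * n%:R)^-1.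
  by rewrite /h exprVn exprMn sqr_sqrtr ?mulr_ge0//; congr (_^-1); ring.
pose sg (p : bool * 'I_L.+1) : R := h * ((-1) ^+ p.1 * (p.2)%:R).
pose pt (f : F) : 'cV[C]_n := \col_i Complex (sg (f (i, false))) (sg (f (i, true))).
pose J := {f : F | (\sum_i (f i).2 <= L)%N && (fro (pt f) <= 1)}.
exists J, (fun j => pt (val j)); split.
- rewrite card_sig.
  apply: (@le_trans _ _ (2 ^+ L * 4 ^+ #|{: 'I_n * bool}|)).
    apply: (le_trans _ (@card_lattice_ball _ _ _)); rewrite ler_nat.
    by apply: subset_leq_card; apply/fintype.subsetP => f; rewrite !inE => /andP[].
  rewrite card_prod card_ord card_bool /L exprM mulnC exprM -exprMn.
  by rewrite (_ : 2 ^+ 8 * 4 ^+ 2 = 4096 :> R)//; ring.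
- by move=> [f /= /andP[]].
move=> u; pose t : 'cV[C]_n := (nm u)^-1%:C%C *: u^t*.
have ft : fro t <= 1.
  rewrite /t froZ fro_tc sqm_real -nm2 -exprMn.
  by have [->|u0] := eqVneq (nm u) 0; rewrite ?mulr0 ?expr0n// mulVf// expr1n.
(* Rounding towards zero keeps the point in the unit ball; the error is at most h in each of the 2 n
   real coordinates, which is 1/2 in norm. *)
pose mq q : nat := Num.truncn (`|crd q t| / h).
have mqP q : (mq q)%:R * h <= `|crd q t| < (mq q)%:R * h + h.
  have /truncn_itv/andP[h1' h2'] : 0 <= `|crd q t| / h by rewrite divr_ge0// ltW.
  rewrite -ler_pdivlMr// h1' /= -[X in _ + X]mul1r -mulrDl -ltr_pdivrMr//.
  by rewrite natr1.
have Q1 : \sum_q ((mq q)%:R * h) ^+ 2 <= 1.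
  apply: le_trans ft; apply: ler_sum => q _; rewrite -[leRHS]real_normK ?num_real//.
  have /andP[h1' _] := mqP q; apply: lerXn2r => //; rewrite nnegrE// mulr_ge0// ltW//.
have Q2 : (\sum_q mq q <= L)%N.
  rewrite -(ler_nat R) natr_sum.
  apply: (@le_trans _ _ (\sum_q (mq q)%:R ^+ 2)).
    apply: ler_sum => q _; rewrite -natrX ler_nat; case: (mq q) => // m.
    by rewrite -{1}(expn1 m.+1) leq_pexp2l.
  have : (\sum_q (mq q)%:R ^+ 2) * h ^+ 2 <= 1.
    by rewrite mulr_suml; under eq_bigr do rewrite -exprMn.
  by rewrite h2 /L natrM ler_pdivrMr ?mulr_gt0// mul1r.
have mL q : (mq q < L.+1)%N.
  by rewrite ltnS (leq_trans _ Q2)// (bigD1 q)//= leq_addr.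
pose f : F := [ffun p => (crd (p.1, 0, p.2) t < 0, Ordinal (mL (p.1, 0, p.2)))].
have cpt q : crd q (pt f) = h * ((-1) ^+ (crd q t < 0)%R * (mq q)%:R).
  by case: q => -[i j] b; rewrite (ord1 j) /crd mxE; case: b; rewrite /= /sg ffunE.
have fpt : fro (pt f) <= 1.
  apply: le_trans Q1; apply: ler_sum => q _.
  by rewrite cpt !exprMn -signr_odd sqrr_sign mul1r mulrC.
have fd : fro (t - pt f) <= (2^-1) ^+ 2.
  apply: (@le_trans _ _ (\sum_(q : 'I_n * 'I_1 * bool) h ^+ 2)); last first.
    rewrite sumr_const !card_prod !card_ord card_bool muln1 -[X in X <= _]mulr_natl natrM h2.
    rewrite ler_pdivrMr ?mulr_gt0//; lra.
  apply: ler_sum => q _; rewrite crdD crdN cpt -[leLHS]real_normK ?num_real//.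
  apply: lerXn2r; rewrite ?nnegrE// ?(ltW h0)//.
  have /andP[h1' h2'] := mqP q; move: h1' h2'.
  rewrite [h * _]mulrC -mulrA.
  case: (ltP (crd q t) 0) => c0; rewrite ?expr1 ?expr0 ?mulN1r ?mul1r.
    rewrite [`|crd q t|]ltr0_norm// => h1' h2'.
    rewrite opprK ler_norml; apply/andP; split; lra.
  rewrite [`|crd q t|]ger0_norm// => h1' h2'.
  rewrite ler_norml; apply/andP; split; lra.
have Jf : (\sum_i (f i).2 <= L)%N && (fro (pt f) <= 1).
  rewrite fpt andbT; apply: leq_trans Q2.
  rewrite -(pair_bigA _ (fun q b => mq (q, b)))/= -(pair_bigA _ (fun i j => \sum_b mq ((i, j), b))%N)/=.
  have -> : (\sum_i (f i).2 = \sum_(i < n) \sum_b (f (i, b)).2)%N.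
    by rewrite pair_big/=; apply: eq_bigr => -[].
  apply: leq_sum => i _; rewrite big_ord1; apply: leq_sum => b _.
  by rewrite ffunE.
exists (exist _ f Jf) => /=.
have [u0|u0] := eqVneq u 0; first by rewrite u0 nm0 mul0mx mxE mulr0.
have nu : 0 < nm u by exact: nm_gt0.
have -> : u *m pt f = u *m t - u *m (t - pt f) by rewrite mulmxBr opprB addrC subrK.
have RB (A B : 'M[C]_(1, 1)) :
    complex.Re ((A - B) 0 0) = complex.Re (A 0 0) - complex.Re (B 0 0).
  by rewrite !mxE cReD cReN.
rewrite RB mulrBr.
have -> : complex.Re ((u *m t) 0 0) = nm u.
  rewrite /t -scalemxAr mxE -fro_rv -nm2 cReM /= mul0r subr0 expr2 mulrA mulVf ?gt_eqF//.
  by rewrite mul1r.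
have hz : complex.Re ((u *m (t - pt f)) 0 0) <= nm u / 2.
  have h3 : nm (u *m (t - pt f)) <= nm u / 2.
    apply: (le_trans (nmM _ _)); rewrite ler_pM2l// nm_le ?invr_ge0//.
  apply: le_trans h3; rewrite -[leLHS]/(crd (0, 0, false) (u *m (t - pt f))).
  apply: (le_trans (ler_norm _)); rewrite -sqrtr_sqr ler_sqrt ?fro_ge0//.
  exact: crd2_le_fro.
lra.
Qed.

End Net.

(** * Exponential tails of adapted linear forms *)

Section ExpBound.
Context d (T : measurableType d) (R : realType) (P : probability T R).
Variables (N : nat) (G : nat -> set (set T)) (x : nat -> 'I_N * 'I_N * bool -> T -> R).
Variables (D : nat -> R) (a b theta : R).
Local Notation C := R[i].
Hypothesis gs : forall j, gaussian_step P (G j) (x j) (D j).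
Hypothesis D0 : forall j, 0 < D j.
Hypothesis N0 : (0 < N)%N.
Hypothesis GG : forall j, G j `<=` <<s G j.+1 >>.
Let rho := a ^+ 2 + b ^+ 2.
Hypothesis rho0 : 0 < rho.
Local Notation noise j := (ell_noise (x j) a b theta).
Hypothesis xG : forall j, mfm (noise j : g_sigma_algebraType (G j.+1) -> _).

Lemma adapted_next d' (T' : measurableType d') j (f : T -> T') :
  measurable_fun setT (f : g_sigma_algebraType (G j) -> T') ->
  measurable_fun setT (f : g_sigma_algebraType (G j.+1) -> T').
Proof. exact: (@sub_g_sigma_measurable _ T _ T (G j) (G j.+1) f (@GG j)). Qed.

Definition linear_form (v : nat -> T -> 'rV[C]_N) (y : 'cV[C]_N) n w : R :=
  \sum_(j < n) complex.Re ((v j w *m noise j w *m y) 0 0).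

Lemma linear_form_adapted (v : nat -> T -> 'rV[C]_N) y n :
  (forall j, mfm (v j : g_sigma_algebraType (G j) -> _)) ->
  measurable_fun setT (linear_form v y n : g_sigma_algebraType (G n) -> R).
Proof.
move=> mv; elim: n => [|n IH].
  rewrite (_ : linear_form _ _ _ = cst 0); first exact: measurable_cst.
  by apply/funext => w; rewrite /linear_form big_ord0.
rewrite (_ : linear_form _ _ _ = (fun w => linear_form v y n w +
    complex.Re ((v n w *m noise n w *m y) 0 0))).
  apply: measurable_funD; first exact: adapted_next.
  have : mfm ((fun w => v n w *m noise n w *m y) : g_sigma_algebraType (G n.+1) -> _).
    apply: mfmM; last exact: mfm_cst.
    apply: mfmM; last exact: xG.
    by move=> q; apply: adapted_next; exact: mv.
  by move=> /(_ (0, 0, false)).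
by apply/funext => w; rewrite /linear_form big_ord_recr.
Qed.

(** Exponential supermartingale: given [G n] the last increment is Gaussian, of variance controlled
    by [ell_form_bound]. The coefficients must be uniformly bounded, hence the stopping of the
    product below. *)
Lemma linear_form_exp (v : nat -> T -> 'rV[C]_N) y n (al lam : R) : 0 <= al ->
  (forall j, mfm (v j : g_sigma_algebraType (G j) -> _)) ->
  (forall j w, fro (v j w) <= al) -> fro y <= 1 ->
  (\int[P]_w (expR (lam * linear_form v y n w))%:E <=
   (expR (lam ^+ 2 / 2 * (rho / N%:R) * al * \sum_(j < n) D j))%:E)%E.
Proof.
move=> al0 mv vb yb; have N0R : 0 < N%:R :> R by rewrite ltr0n.
elim: n => [|n IH].
  rewrite big_ord0 mulr0 expR0 (eq_integral (cst 1%E)) ?integral_cst ?mul1e//.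
    exact: probability_le1.
  by move=> w _; rewrite /linear_form big_ord0 mulr0 expR0.
have [sG mx _] := gs n.
pose c k w := lam * complex.Re ((v n w *m ell_basis a b theta k *m y) 0 0).
have mA : measurable_fun setT ((fun w => lam * linear_form v y n w) : g_sigma_algebraType (G n) -> R).
  by apply: measurable_funM => //; exact: linear_form_adapted.
have mc k : measurable_fun setT (c k : g_sigma_algebraType (G n) -> R).
  apply: measurable_funM => //.
  have : mfm ((fun w => v n w *m ell_basis a b theta k *m y) : g_sigma_algebraType (G n) -> _).
    by apply: mfmM; [apply: mfmM => //; exact: mfm_cst|exact: mfm_cst].
  by move=> /(_ (0, 0, false)).
have E w : lam * linear_form v y n.+1 w =
    lam * linear_form v y n w + \sum_k c k w * x n k w.
  rewrite /linear_form big_ord_recr/= mulrDr; congr (_ + _).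
  rewrite /ell_noise mulmx_sumr mulmx_suml summxE cRe_sum mulr_sumr.
  apply: eq_bigr => k _; rewrite -scalemxAr -scalemxAl mxE cReM /= mul0r subr0 /c.
  by rewrite mulrCA mulrC.
under eq_integral do rewrite E.
rewrite (gaussian_exp (gs n) (D0 n) mA mc).
have cb w : \sum_k c k w ^+ 2 <= lam ^+ 2 * (rho / N%:R * al).
  rewrite /c; under eq_bigr do rewrite exprMn.
  rewrite -mulr_sumr ler_wpM2l ?sqr_ge0//.
  apply: (le_trans (ell_form_bound _ _ _ _ _ N0)).
  rewrite ler_wpM2l ?divr_ge0 ?(ltW rho0)//.
  by rewrite -[al]mulr1 ler_pM ?fro_ge0.
set K := lam ^+ 2 / 2 * (rho / N%:R) * al in IH *.
have mL := g_sigma_measurable_fun sG mA.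
apply: (@le_trans _ _ (\int[P]_w ((expR (K * D n))%:E * (expR (lam * linear_form v y n w))%:E))%E).
  apply: ge0_le_integral => //.
  - apply/measurable_EFinP; apply: measurableT_comp => //.
    apply: measurable_funD => //; apply: measurable_funM => //.
    apply: measurable_fun_sum_fin => k; apply: measurable_funX.
    exact: g_sigma_measurable_fun sG (mc k).
  - apply: measurable_funeM; apply/measurable_EFinP; exact: measurableT_comp.
  move=> w _; rewrite -EFinM lee_fin -expRD ler_expR addrC lerD2r.
  apply: (@le_trans _ _ (D n / 2 * (lam ^+ 2 * (rho / N%:R * al)))).
    by rewrite ler_wpM2l// divr_ge0// ltW.
  by rewrite /K le_eqVlt; apply/orP; left; apply/eqP; field; rewrite gt_eqF.
rewrite ge0_integralZl//; last by apply/measurable_EFinP; exact: measurableT_comp.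
rewrite big_ord_recr/= mulrDr expRD [X in (_ <= X)%E]EFinM muleC.
by apply: lee_wpmul2r IH; rewrite lee_fin expR_ge0.
Qed.

(** Chernoff's bound, with the value of [lam] that minimizes the exponent. *)
Lemma linear_form_tail (v : nat -> T -> 'rV[C]_N) y n (al u : R) : 0 < al -> 0 <= u ->
  (forall j, mfm (v j : g_sigma_algebraType (G j) -> _)) ->
  (forall j w, fro (v j w) <= al) -> fro y <= 1 ->
  (P [set w | (u <= linear_form v y n.+1 w)%R] <=
   (expR (- (u ^+ 2 * N%:R / (2 * rho * al * \sum_(j < n.+1) D j))))%:E)%E.
Proof.
move=> al0 u0 mv vb yb; have N0R : 0 < N%:R :> R by rewrite ltr0n.
set s := \sum_(j < n.+1) D j.
have s0 : 0 < s.
  by rewrite /s big_ord_recl ltr_pwDl// sumr_ge0// => j _; exact: ltW.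
pose lam := u * N%:R / (rho * al * s).
have lam0 : 0 <= lam by rewrite divr_ge0 ?mulr_ge0// ltW// !mulr_gt0.
have [sG _ _] := gs n.+1.
have mL := g_sigma_measurable_fun sG (@linear_form_adapted v y n.+1 mv).
set V := [set w | _].
have mV : measurable V.
  rewrite -[X in measurable X]setTI.
  by apply: (measurable_fun_ler (f := cst u) (g := linear_form v y n.+1)).
have -> : P V = (\int[P]_w (\1_V w)%:E)%E.
  by rewrite integral_indic; [rewrite setIT|exact: measurableT|exact: mV].
apply: (@le_trans _ _ (\int[P]_w ((expR (- (lam * u)))%:E * (expR (lam * linear_form v y n.+1 w))%:E))%E).
  apply: ge0_le_integral => //.
  - by apply/measurable_EFinP; exact: measurable_indic.
  - apply: measurable_funeM; apply/measurable_EFinP; apply: measurableT_comp => //.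
    exact: measurable_funM.
  move=> w _; rewrite -EFinM lee_fin -expRD indicE.
  have [|_] := boolP (w \in V); last by rewrite expR_ge0.
  rewrite inE /V/= => h; rewrite -expR0 ler_expR addrC subr_ge0 ler_wpM2l//.
rewrite ge0_integralZl//; last first.
  by apply/measurable_EFinP; apply: measurableT_comp => //; exact: measurable_funM.
apply: (le_trans (lee_wpmul2l _ (@linear_form_exp v y n.+1 al lam (ltW al0) mv vb yb))).
  by rewrite lee_fin expR_ge0.
rewrite -EFinM lee_fin -expRD ler_expR -/s le_eqVlt; apply/orP; left; apply/eqP.
by rewrite /lam; field; rewrite !gt_eqF.
Qed.

End ExpBound.

Section BlockBound.
Context d (T : measurableType d) (R : realType) (P : probability T R).
Variables (N : nat) (G : nat -> set (set T)) (x : nat -> 'I_N * 'I_N * bool -> T -> R).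
Variables (D : nat -> R) (a b theta : R) (z : R[i]).
Local Notation C := R[i].
Hypothesis gs : forall j, gaussian_step P (G j) (x j) (D j).
Hypothesis D0 : forall j, 0 < D j.
Hypothesis N0 : (0 < N)%N.
Hypothesis GG : forall j, G j `<=` <<s G j.+1 >>.
Let rho := a ^+ 2 + b ^+ 2.
Hypothesis rho0 : 0 < rho.
Hypothesis zrho : Num.sqrt (sqm z) <= rho / 2.
Local Notation noise j := (ell_noise (x j) a b theta).
Hypothesis xG : forall j, mfm (noise j : g_sigma_algebraType (G j.+1) -> _).

Definition euler_step j w : 'M[C]_N := 1%:M + (noise j w + (z * (D j)%:C%C)%:M).

(** New factors enter on the right, as in dB = B dW. The last interval therefore stands to the right
    of a matrix that is known when it begins. *)
Fixpoint euler_prod n w : 'M[C]_N :=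
  if n is n'.+1 then euler_prod n' w *m euler_step n' w else 1%:M.

Lemma euler_step_adapted j : mfm (euler_step j : g_sigma_algebraType (G j.+1) -> _).
Proof.
apply: mfmD; first exact: mfm_cst.
by apply: mfmD; [exact: xG|exact: mfm_cst].
Qed.

Lemma euler_prod_adapted n : mfm (euler_prod n : g_sigma_algebraType (G n) -> _).
Proof.
elim: n => [|n IH]; first exact: mfm_cst.
apply: mfmM; last exact: euler_step_adapted.
by move=> q; apply: adapted_next.
Qed.

Section Stopped.
Variables (x0 : 'rV[C]_N) (cc : R).

(** The image of [x0] under the product, frozen once it has left the ball of squared radius [cc]
    around [x0]. The indicator [ind] switches the coefficients off outside the ball, so that they
    are bounded. *)
Fixpoint stopped n w : 'rV[C]_N :=
  if n is n'.+1 then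
    if fro (stopped n' w - x0) <= cc then stopped n' w *m euler_step n' w
    else stopped n' w
  else x0.

Let ind n w : R := if fro (stopped n w - x0) <= cc then 1 else 0.
(** [al] is the coefficient of the noise in the displacement; [be] is the one left when the
    first-order term, with [x0] as coefficient, is subtracted. *)
Let al n w := (ind n w)%:C%C *: stopped n w.
Let be n w := (ind n w)%:C%C *: (stopped n w - x0).

Lemma stoppedE n w : stopped n w = x0 + \sum_(j < n) al j w *m noise j w
  + \sum_(j < n) (z * (D j)%:C%C) *: al j w.
Proof.
elim: n => [|n IH]; first by rewrite !big_ord0 !addr0.
rewrite !big_ord_recr/= /al /ind; case: ifP => h; last first.
  by rewrite scale0r mul0mx scaler0 !addr0.
rewrite scale1r /euler_step !mulmxDr mulmx1 mul_mx_scalar {1}IH.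
by rewrite -!addrA; congr (_ + (_ + _)); rewrite addrCA.
Qed.

Lemma stopped_stays n w : fro (stopped n w - x0) <= cc ->
  forall j, (j <= n)%N -> fro (stopped j w - x0) <= cc.
Proof.
elim: n => [|n IH] h j; first by rewrite leqn0 => /eqP ->.
rewrite leq_eqVlt => /predU1P[->//|]; rewrite ltnS; apply: IH.
case: (boolP (fro (stopped n w - x0) <= cc)) => // hn.
by move: h; rewrite /= (negbTE hn) (negbTE hn).
Qed.

Lemma stopped_prod n w : fro (stopped n w - x0) <= cc ->
  stopped n w = x0 *m euler_prod n w.
Proof.
elim: n => [|n IH] h; first by rewrite /= mulmx1.
have h' := stopped_stays h (leqnSn n).
by rewrite /= h' IH// mulmxA.
Qed.

Lemma stopped_adapted n : mfm (stopped n : g_sigma_algebraType (G n) -> _) /\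
  measurable_fun setT (ind n : g_sigma_algebraType (G n) -> R).
Proof.
have key k : mfm (stopped k : g_sigma_algebraType (G k) -> _) ->
    measurable_fun setT (ind k : g_sigma_algebraType (G k) -> R).
  move=> mk; apply: measurable_fun_ifT => //.
  apply: measurable_fun_ler => //.
  by apply: mfm_fro; apply: mfmD => //; exact: mfm_cst.
elim: n => [|n [IH1 IH2]]; first by split; [exact: mfm_cst|apply: key; exact: mfm_cst].
suff h : mfm (stopped n.+1 : g_sigma_algebraType (G n.+1) -> _) by split => //; exact: key.
have -> : stopped n.+1 = (fun w => stopped n w +
    (ind n w)%:C%C *: (stopped n w *m (euler_step n w - 1%:M))).
  apply/funext => w /=; rewrite /ind; case: ifP => h; last by rewrite scale0r addr0.
  by rewrite scale1r mulmxBr mulmx1 addrC subrK.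
have m1 : mfm (stopped n : g_sigma_algebraType (G n.+1) -> _).
  by move=> q; apply: adapted_next.
apply: mfmD => //; apply: mfm_rZ; first exact: adapted_next.
apply: mfmM => //; apply: mfmD; first exact: euler_step_adapted.
by apply: mfmN; exact: mfm_cst.
Qed.

Lemma al_adapted n : mfm (al n : g_sigma_algebraType (G n) -> _).
Proof. by have [h1 h2] := stopped_adapted n; apply: mfm_rZ. Qed.

Lemma be_adapted n : mfm (be n : g_sigma_algebraType (G n) -> _).
Proof.
have [h1 h2] := stopped_adapted n; apply: mfm_rZ => //.
by apply: mfmD => //; exact: mfm_cst.
Qed.

Hypothesis cc0 : 0 <= cc.

Lemma be_bound n w : fro (be n w) <= cc.
Proof.
rewrite /be /ind; case: ifP => h; first by rewrite scale1r.
by rewrite scale0r fro0.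
Qed.

Lemma al_bound n w : fro x0 <= 1 -> fro (al n w) <= (1 + Num.sqrt cc) ^+ 2.
Proof.
move=> x1; rewrite -nm_le ?addr_ge0 ?sqrtr_ge0// /al /ind.
case: ifP => h; last by rewrite scale0r nm0 addr_ge0 ?sqrtr_ge0.
rewrite scale1r -(subrK x0 (stopped n w)) addrC.
apply: (le_trans (nmD _ _)); apply: lerD; first by rewrite nm_le// expr1n.
by rewrite /nm ler_sqrt.
Qed.

(** A bootstrap: the bounds put the stopped vector inside the ball at time n, as 4/5 rr from the
    noise and 5/32 rr from the drift are less than rr. So it was never stopped and is the true
    product. The remainder is of second order because its noise coefficients are themselves
    displacements, of norm at most rr. *)
Lemma stopped_good n w (rr : R) (J : Type) (y : J -> 'cV[C]_N) :
  let s := \sum_(j < n) D j in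
  (forall u : 'rV[C]_N, exists j, nm u <= 2 * complex.Re ((u *m y j) 0 0)) ->
  fro x0 <= 1 -> cc = rr ^+ 2 -> 0 < rr -> rr <= 4^-1 -> 4 * (rho * s) <= rr -> 
  (forall j, linear_form x a b theta al (y j) n w < 2 / 5 * rr) ->
  (forall j, linear_form x a b theta be (y j) n w < rr ^+ 2) ->
  nm (x0 *m (euler_prod n w - 1%:M)) <= rr /\
  nm (x0 *m (euler_prod n w - 1%:M - \sum_(j < n) noise j w)) <=
    2 * rr ^+ 2 + rho * s.
Proof.
move=> s hy x1 ccE rr0 rr4 hs hal hbe.
have sc : Num.sqrt cc = rr by rewrite ccE sqrtr_sqr gtr0_norm.
have s0 : 0 <= s by rewrite sumr_ge0// => j _; exact: ltW.
have alb j : nm (al j w) <= 5 / 4.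
  have := al_bound j w x1; rewrite sc -nm_le ?addr_ge0 ?(ltW rr0)//.
  by move=> /le_trans; apply; lra.
have drift : nm (\sum_(j < n) (z * (D j)%:C%C) *: al j w) <= 5 / 8 * (rho * s).
  apply: (le_trans (nm_sum _ _ _)).
  rewrite /s mulr_sumr mulr_sumr; apply: ler_sum => j _; rewrite nmZ sqmM sqm_real.
  rewrite sqrtrM ?sqm_ge0// sqrtr_sqr gtr0_norm//.
  apply: (@le_trans _ _ (rho / 2 * D j * (5 / 4))).
    apply: ler_pM => //; rewrite ?mulr_ge0 ?sqrtr_ge0 ?nm_ge0 ?(ltW (D0 j))//.
    by rewrite ler_wpM2r// ltW.
  by rewrite le_eqVlt; apply/orP; left; apply/eqP; field.
have form (v : nat -> T -> 'rV[C]_N) r : (forall j, linear_form x a b theta v (y j) n w < r) ->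
    nm (\sum_(j < n) v j w *m noise j w) <= 2 * r.
  move=> hv; have [j hj] := hy (\sum_(j < n) v j w *m noise j w).
  apply: (le_trans hj); rewrite ler_pM2l// (le_trans _ (ltW (hv j)))//.
  by rewrite /linear_form mulmx_suml summxE cRe_sum.
have inside : fro (stopped n w - x0) <= cc.
  rewrite ccE -nm_le ?(ltW rr0)// stoppedE.
  have -> : x0 + \sum_(j < n) al j w *m noise j w + \sum_(j < n) (z * (D j)%:C%C) *: al j w - x0
    = \sum_(j < n) al j w *m noise j w + \sum_(j < n) (z * (D j)%:C%C) *: al j w.
    by rewrite -(addrA x0) [LHS]addrC addKr.
  apply: (le_trans (nmD _ _)); have := form _ _ hal; move: drift hs; lra.
have sE := stopped_prod inside.
split; first by rewrite mulmxBr mulmx1 -sE nm_le ?(ltW rr0)// -ccE.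
rewrite !mulmxBr mulmx1 -sE {1}stoppedE mulmx_sumr.
have -> : x0 + \sum_(j < n) al j w *m noise j w + \sum_(j < n) (z * (D j)%:C%C) *: al j w - x0
    - \sum_(j < n) x0 *m noise j w =
    \sum_(j < n) be j w *m noise j w + \sum_(j < n) (z * (D j)%:C%C) *: al j w.
  have gen (p q r t : 'rV[C]_N) : p + q + r - p - t = q - t + r.
    by rewrite -(addrA p q r) [p + (q + r) - p]addrC addKr addrAC.
  rewrite gen; congr (_ + _).
  rewrite -sumrB; apply: eq_bigr => j _; rewrite -mulmxBl; congr (_ *m _).
  rewrite /be /al /ind (stopped_stays inside) ?scale1r//.
  by rewrite ltnW.
apply: (le_trans (nmD _ _)); have := form _ _ hbe; move: drift (mulr_ge0 (ltW rho0) s0); lra.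
Qed.

End Stopped.

(** [stopped_good] is applied with both [x0] and the test vectors in the net, which costs two
    families of events indexed by pairs of net points. [K] is the inflation that lets the tail
    exp(-K N/20) compete with the 4096^(2 N) pairs. *)
Lemma block_bound n (K : R) : 1 <= K -> 
  let s := \sum_(j < n.+1) D j in 16 * (rho * K * s) <= 1 ->
  exists2 F : set T, measurable F /\
     (P F <= (2 * (4096 ^+ N) ^+ 2 * expR (- (K * N%:R / 20)))%:E)%E &
   forall w, ~ F w ->
     (forall v : 'cV[C]_N, nm ((euler_prod n.+1 w - 1%:M) *m v) <= 2^-1 * nm v) /\
     (forall v : 'cV[C]_N, nm ((euler_prod n.+1 w - 1%:M - \sum_(j < n.+1) noise j w) *m v)
        <= 6 * K * (rho * s) * nm v).
Proof.
move=> K1 s hs; have N0R : 0 < N%:R :> R by rewrite ltr0n.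
have K0 : 0 < K by exact: lt_le_trans K1.
have s0 : 0 < s.
  by rewrite /s big_ord_recl ltr_pwDl// sumr_ge0// => j _; exact: ltW.
have rs0 : 0 < rho * s by exact: mulr_gt0.
pose cc := rho * K * s; have cc0 : 0 < cc by rewrite !mulr_gt0.
(* The squared radius is the natural scale rho s inflated by [K]; the condition on [s] says that the
   radius is at most 1/4. *)
pose rr := Num.sqrt cc; have rr0 : 0 < rr by rewrite sqrtr_gt0.
have ccE : cc = rr ^+ 2 by rewrite sqr_sqrtr// ltW.
have rr4 : rr <= 4^-1.
  by rewrite -(ler_pXn2r (n := 2))// ?nnegrE ?(ltW rr0)// -ccE; move: hs; rewrite -/cc; lra.
have hs4 : 4 * (rho * s) <= rr.
  have h1 : rho * s <= rr ^+ 2.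
    rewrite -ccE /cc mulrAC -[leLHS]mulr1 ler_pM2l//.
  have : rr ^+ 2 <= rr * 4^-1 by rewrite expr2 ler_pM2l.
  by move: h1; lra.
have [J [y [cardJ y1 hy]]] := norming_net R N0.
(* [true] marks the events for the displacement ([al]), [false] those for the second-order remainder
   ([be]). *)
pose ev (p : J * J * bool) : set T := [set w |
  let x0 := (y p.1.1)^t* in
  let v := if p.2 then fun n w => (if fro (stopped x0 cc n w - x0) <= cc then 1 else 0)%:C%C *: stopped x0 cc n w
     else fun n w => (if fro (stopped x0 cc n w - x0) <= cc then 1 else 0)%:C%C *: (stopped x0 cc n w - x0) in
  (if p.2 then 2 / 5 * rr else rr ^+ 2) <= linear_form x a b theta v (y p.1.2) n.+1 w].
have [sG _ _] := gs n.+1.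
have mev p : measurable (ev p).
  rewrite -[X in measurable X]setTI.
  apply: (measurable_fun_ler (f := cst _)) => //.
  apply: (g_sigma_measurable_fun sG); apply: linear_form_adapted => // j.
  by case: p.2; [exact: al_adapted|exact: be_adapted].
have Pev p : (P (ev p) <= (expR (- (K * N%:R / 20)))%:E)%E.
  case: p => -[i j] []; pose x0 := (y i)^t*.
    pose v n0 w := (if fro (stopped x0 cc n0 w - x0) <= cc then 1 else 0)%:C%C *: stopped x0 cc n0 w.
    have hT := @linear_form_tail _ _ _ P _ _ _ _ a b theta gs D0 N0 GG rho0 xG v (y j) n ((5 / 4) ^+ 2) (2 / 5 * rr).
    apply: le_trans (hT _ _ _ _ _) _ => {hT} //.
    - by rewrite mulr_ge0// ltW.
    - exact: al_adapted.
    - move=> k w; apply: (le_trans (al_bound (ltW cc0) _ _ _)); first by rewrite fro_tc.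
      by apply: lerXn2r; rewrite ?nnegrE ?addr_ge0 ?sqrtr_ge0// -/rr; lra.
    - rewrite lee_fin ler_expR lerN2 exprMn -ccE -/s.
      have -> : (2 / 5) ^+ 2 * cc * N%:R / (2 * (a ^+ 2 + b ^+ 2) * (5 / 4) ^+ 2 * s) =
          32 / 625 * (K * N%:R).
        by rewrite /cc -/rho; field; rewrite !gt_eqF.
      by rewrite mulrC ler_pM2r ?mulr_gt0//; lra.
  pose v n0 w := (if fro (stopped x0 cc n0 w - x0) <= cc then 1 else 0)%:C%C *: (stopped x0 cc n0 w - x0).
  have hT := @linear_form_tail _ _ _ P _ _ _ _ a b theta gs D0 N0 GG rho0 xG v (y j) n cc (rr ^+ 2).
  apply: le_trans (hT _ _ _ _ _) _ => {hT} //.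
  - by rewrite sqr_ge0.
  - exact: be_adapted.
  - by move=> k w; apply: be_bound (ltW cc0) _ _.
  - rewrite lee_fin ler_expR lerN2 -ccE -/s.
    have -> : cc ^+ 2 * N%:R / (2 * (a ^+ 2 + b ^+ 2) * cc * s) = 2^-1 * (K * N%:R).
      by rewrite /cc -/rho; field; rewrite !gt_eqF.
    by rewrite mulrC ler_pM2r ?mulr_gt0//; lra.
exists (\bigcup_p ev p).
  split; first by apply: fin_bigcup_measurable => // p _; exact: mev.
  apply: (le_trans (prob_bigcup_fin mev Pev)); rewrite lee_fin.
  rewrite ler_pM2r ?expR_gt0// !card_prod card_bool !natrM mulrC ler_pM2l//.
  by rewrite expr2 ler_pM.
move=> w hw.
have good i : nm ((y i)^t* *m (euler_prod n.+1 w - 1%:M)) <= rr /\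
    nm ((y i)^t* *m (euler_prod n.+1 w - 1%:M - \sum_(j < n.+1) noise j w)) <=
    2 * rr ^+ 2 + rho * s.
  apply: (stopped_good (ltW cc0) (y := y)) => //; first by rewrite fro_tc.
    by move=> j; rewrite ltNge; apply/negP => h; apply: hw; exists (i, j, true).
  by move=> j; rewrite ltNge; apply/negP => h; apply: hw; exists (i, j, false).
(* Duality: a net point norms [E *m v] up to a factor 2, and in the scalar product it can be moved
   to the left of [E]. *)
have op (E : 'M[C]_N) r : (forall i, nm ((y i)^t* *m E) <= r) ->
    forall v : 'cV[C]_N, nm (E *m v) <= 2 * r * nm v.
  move=> hE v; have [i hi] := hy ((E *m v)^t*).
  rewrite -nm_tc; apply: (le_trans hi); rewrite -mulrA ler_pM2l//.
  have -> : complex.Re (((E *m v)^t* *m y i) 0 0) = complex.Re (((y i)^t* *m E *m v) 0 0).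
    rewrite -[LHS]cReJ; congr complex.Re.
    transitivity ((((E *m v)^t* *m y i)^t*) 0 0); first by rewrite [RHS]mxE [X in _ = X^*]mxE.
    by rewrite trmx_mul map_mxM trmxCK mulmxA.
  apply: (@le_trans _ _ (nm ((y i)^t* *m E *m v))).
    rewrite -[leLHS]/(crd (0, 0, false) ((y i)^t* *m E *m v)).
    apply: (le_trans (ler_norm _)); rewrite -sqrtr_sqr ler_sqrt ?fro_ge0//.
    exact: crd2_le_fro.
  by apply: (le_trans (nmM _ _)); rewrite ler_wpM2r ?nm_ge0.
split => v.
  apply: (le_trans (op _ _ (fun i => (good i).1) v)).
  by rewrite ler_wpM2r ?nm_ge0//; lra.
apply: (le_trans (op _ _ (fun i => (good i).2) v)).
rewrite ler_wpM2r ?nm_ge0// -ccE /cc.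
have : rho * s <= rho * s * K by rewrite -[leLHS]mulr1 ler_pM2l.
have -> : rho * K * s = rho * s * K by rewrite mulrAC.
lra.
Qed.

End BlockBound.

(** * Increments of the elliptical Brownian motion *)

Section Independence.
Context d (T : measurableType d) (R : realType) (P : probability T R).

Definition null_sets : set (set T) := [set E | measurable E /\ P E = 0%E].

Lemma sub_smallest_sigma (G1 G2 : set (set T)) : G1 `<=` <<s G2 >> -> <<s G1 >> `<=` <<s G2 >>.
Proof. by move=> h; apply: smallest_sub => //; exact: smallest_sigma_algebra. Qed.

(** Needed because the filtration is augmented. Null events can be adjoined to the pi-system, since
    on them both sides of the product formula vanish. *)
Lemma independent2_null (G1 G2 : set (set T)) :
  <<s G1 >> `<=` measurable -> <<s G2 >> `<=` measurable ->
  independent2 P <<s G1 >> <<s G2 >> ->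
  independent2 P <<s G1 `|` null_sets >> <<s G2 >>.
Proof.
move=> m1 m2 ind; pose C1 : set (set T) := [set A | <<s G1 >> A \/ null_sets A].
suff h : independent2 P <<s C1 >> <<s <<s G2 >> >>.
  move=> A B hA hB; apply: h; last exact: sub_sigma_algebra.
  move: A hA; apply: sub_smallest_sigma => A [GA|nA]; apply: sub_sigma_algebra.
    by left; exact: sub_sigma_algebra.
  by right.
apply: independent2_pi => //.
- by move=> A [/m1//|[]].
- by left; exact: (@measurableT _ (g_sigma_algebraType G1)).
- exact: (@measurableT _ (g_sigma_algebraType G2)).
- have nI A B : null_sets A -> measurable B -> null_sets (A `&` B).
    move=> [mA PA] mB; split; first exact: measurableI.
    by apply: subset_measure0 PA => //; exact: measurableI.
  move=> A B [hA|hA] [hB|hB].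
  + by left; exact: (@measurableI _ (g_sigma_algebraType G1)).
  + by right; rewrite setIC; apply: nI => //; exact: m1.
  + by right; apply: nI => //; exact: m1.
  + by right; apply: nI => //; case: hB.
- by move=> A B; exact: (@measurableI _ (g_sigma_algebraType G2)).
move=> A B [hA|[mA PA]] hB; first exact: ind.
rewrite PA mul0e; apply: subset_measure0 PA => //.
by apply: measurableI => //; exact: m2.
Qed.

(** A Brownian motion vanishes at time 0 only almost surely, so its value at a later time is a sum
    of increments only up to a null set. *)
Lemma ae_eq_preimage (G : set (set T)) (f g : T -> R) (B : set R) :
  <<s G >> `<=` measurable -> measurable_fun setT f -> measurable B ->
  measurable_fun setT (g : g_sigma_algebraType G -> R) ->
  {ae P, forall w, f w = g w} -> <<s G `|` null_sets >> (f @^-1` B).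
Proof.
move=> mG mf mB mg [Z [mZ PZ hZ]].
have GG' : <<s G >> `<=` <<s G `|` null_sets >>.
  by apply: sub_smallest_sigma => A GA; apply: sub_sigma_algebra; left.
have nZ : <<s G `|` null_sets >> Z by apply: sub_sigma_algebra; right.
have -> : f @^-1` B = (g @^-1` B `\` Z) `|` (f @^-1` B `&` Z).
  apply/seteqP; split => w /=.
    have [wZ|wZ] := pselect (Z w); first by right.
    move=> fB; left; split => //; suff <- : f w = g w by [].
    by apply: contrapT => h; apply: wZ; exact: hZ.
  move=> [[gB wZ]|[]//]; suff -> : f w = g w by [].
  by apply: contrapT => h; apply: wZ; exact: hZ.
apply: (@measurableU _ (g_sigma_algebraType (G `|` null_sets))).
  apply: (@measurableD _ (g_sigma_algebraType (G `|` null_sets))) => //.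
  by apply: GG'; rewrite -[X in <<s _ >> X]setTI; exact: mg.
apply: sub_sigma_algebra; right; split.
  by apply: measurableI => //; rewrite -[X in measurable X]setTI; exact: mf.
apply: subset_measure0 PZ => //.
by apply: measurableI => //; rewrite -[X in measurable X]setTI; exact: mf.
Qed.

Lemma independent_but_one (I : finType) (x : I -> T -> R) (i0 : I) :
  (forall i, measurable_fun setT (x i)) ->
  independent P (fun i => preimage_set_system setT (x i) measurable) ->
  independent2 P
    <<s \bigcup_(i in [set i | i != i0]) preimage_set_system setT (x i) measurable >>
    <<s preimage_set_system setT (x i0) measurable >>.
Proof.
move=> mx ind A B hA hB.
pose cyl : set (set T) := [set A | exists U : I -> set R,
  [/\ forall i, measurable (U i), U i0 = setT & A = \bigcap_i (x i @^-1` U i)]].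
have prodE (U : I -> set R) : (forall i, measurable (U i)) ->
    P (\bigcap_i (x i @^-1` U i)) = (\prod_i P (x i @^-1` U i))%E.
  move=> mU; have := ind [set: I]%SET (fun i => x i @^-1` U i).
  rewrite (_ : \bigcap_(i in _) _ = \bigcap_i (x i @^-1` U i)); last first.
    by apply/seteqP; split => w h i hi; apply: h; rewrite /= ?inE.
  move=> ->; last by move=> i _; exists (U i) => //; rewrite setTI.
  by apply: eq_bigl => i; rewrite inE.
have hA' : <<s cyl >> A.
  move: A hA; apply: sub_smallest_sigma => A [i /= ii0 [U mU <-]].
  apply: sub_sigma_algebra; exists (fun j => if j == i then U else setT); split.
  - by move=> j; case: ifP.
  - by rewrite eq_sym (negbTE ii0).
  - rewrite setTI; apply/seteqP; split => w /=.
      by move=> h j _ /=; case: eqP => // ->.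
    by move=> /(_ i Logic.I) /=; rewrite eqxx.
apply: (independent2_pi (C1 := cyl) (C2 := preimage_set_system setT (x i0) measurable)) hA' hB.
- move=> _ [U [mU _ ->]]; apply: fin_bigcap_measurable => // i _.
  by rewrite -[_ @^-1` _]setTI; exact: mx.
- by move=> _ [U mU <-]; exact: mx.
- by exists (fun=> setT); split => //; rewrite bigcapT.
- by exists setT; [exact: measurableT|rewrite setTI].
- move=> _ _ [U [mU U0 ->]] [U' [mU' U0' ->]].
  exists (fun k => U k `&` U' k); split.
  + by move=> k; exact: measurableI.
  + by rewrite U0 U0' setIT.
  + by rewrite -bigcapI.
- move=> _ _ [U mU <-] [U' mU' <-]; exists (U `&` U'); first exact: measurableI.
  by rewrite !setTI.
move=> _ _ [U [mU U0 ->]] [V mV <-]; rewrite setTI.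
pose U' i := if i == i0 then V else U i.
have -> : \bigcap_i (x i @^-1` U i) `&` (x i0 @^-1` V) = \bigcap_i (x i @^-1` U' i).
  apply/seteqP; split => w /=.
    by move=> [h1 h2] i _; rewrite /U'/=; case: eqP => [->//|_]; exact: h1.
  move=> h; split; last by have := h i0 Logic.I; rewrite /U' eqxx.
  by move=> i _; have := h i Logic.I; rewrite /U' /=; case: eqP => [->|//]; rewrite U0.
rewrite !prodE//; last by move=> i; rewrite /U'; case: ifP.
rewrite (bigD1 i0)//= [in RHS](bigD1 i0)//= U0 preimage_setT probability_setT mul1e.
rewrite muleC /U' eqxx; congr (_ * _)%E; apply: eq_bigr => i /negbTE ii0.
by rewrite ii0.
Qed.

(** The definition speaks of finitely many increments. Events that depend on finitely many times
    form a pi-system generating the past, and after sorting these times the values are sums of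
    increments, null sets aside. *)
Lemma brownian_past_independent (V : R -> T -> R) (u v : R) :
  standard_brownian_motion P V -> 0 <= u -> u < v ->
  independent2 P (sigma_rv `[0, u] V)
    <<s preimage_set_system setT (fun w => V v w - V u w) measurable >>.
Proof.
move=> [mV V0 indV _] u0 uv; have v0 : 0 <= v by exact: le_trans (ltW uv).
pose pre (ts : seq R) : set (set T) :=
  \bigcup_(t in [set t | t \in ts]) preimage_set_system setT (V t) measurable.
pose C1 : set (set T) := [set A | exists ts : seq R,
  (forall t, t \in ts -> 0 <= t <= u) /\ <<s pre ts >> A].
have mpre ts : (forall t, t \in ts -> 0 <= t <= u) -> <<s pre ts >> `<=` measurable.
  move=> hts; apply: smallest_sub; first exact: sigma_algebra_measurable.
  by move=> A [t /= /hts/andP[t0 _] [B mB <-]]; exact: mV.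
have preS ts ts' : {subset ts <= ts'} -> <<s pre ts >> `<=` <<s pre ts' >>.
  move=> h; apply: sub_smallest_sigma => A [t /= tts hA]; apply: sub_sigma_algebra.
  by exists t => //=; exact: h.
move=> A B hA hB.
have hA' : <<s C1 >> A.
  move: A hA; apply: sub_smallest_sigma => A [t /= tu hA]; apply: sub_sigma_algebra.
  exists [:: t]; split; first by move=> t'; rewrite inE => /eqP ->; move: tu; rewrite in_itv.
  by apply: sub_sigma_algebra; exists t => //=; rewrite inE.
have mvu : measurable_fun setT (fun w => V v w - V u w).
  by apply: measurable_funB; apply: mV.
apply: (independent2_pi (C1 := C1)
  (C2 := preimage_set_system setT (fun w => V v w - V u w) measurable)) hA' hB.
- by move=> E [ts [hts hE]]; exact: mpre hE.
- by move=> _ [U mU <-]; exact: mvu.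
- by exists [::]; split => //; exact: (@measurableT _ (g_sigma_algebraType (pre [::]))).
- by exists setT; [exact: measurableT|rewrite setTI].
- move=> E E' [ts [hts hE]] [ts' [hts' hE']]; exists (ts ++ ts'); split.
    by move=> t; rewrite mem_cat => /orP[/hts|/hts'].
  apply: (@measurableI _ (g_sigma_algebraType (pre (ts ++ ts')))).
    by apply: preS hE => t h; rewrite mem_cat h.
  by apply: preS hE' => t h; rewrite mem_cat h orbT.
- move=> _ _ [U mU <-] [U' mU' <-]; exists (U `&` U'); first exact: measurableI.
  by rewrite !setTI.
move=> E F [ts [hts hE]] hF.
pose s := sort <=%R [:: 0, u & ts].
(* The default value of [nth] is v: the sorted times end with u at index n, so the step after them
   runs from u to v. *)
pose tm i := nth v s i.
have sz : size s = (size ts).+2 by rewrite size_sort.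
have ss : sorted <=%R s by apply: sort_sorted; exact: le_total.
have ms t : t \in s -> 0 <= t <= u.
  rewrite mem_sort !inE => /predU1P[->|/predU1P[->|/hts//]]; first by rewrite lexx.
  by rewrite u0 lexx.
have tm0 i : 0 <= tm i.
  have [h|h] := ltnP i (size s); last by rewrite /tm nth_default.
  by have /ms/andP[] : tm i \in s by exact: mem_nth.
have tmS i : tm i <= tm i.+1.
  have [h|h] := ltnP i.+1 (size s); first exact: (sortedP v ss).
  rewrite [tm i.+1]/tm [leRHS]nth_default//.
  have [h'|h'] := ltnP i (size s); last by rewrite /tm nth_default.
  by have /ms/andP[_ h2] : tm i \in s by [exact: mem_nth]; exact: le_trans (ltW uv).
have tmle i j : (i <= j)%N -> tm i <= tm j.
  move=> ij; rewrite -(subnK ij); elim: (j - i)%N => [//|k IH].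
  by rewrite addSn; exact: le_trans (tmS _).
have tm00 : tm 0%N = 0.
  apply/eqP; rewrite eq_le tm0 andbT.
  have zs : 0 \in s by rewrite mem_sort inE eqxx.
  have -> : 0 = tm (index 0 s) :> R by rewrite /tm nth_index.
  exact: tmle.
pose n := (size ts).+1.
have tmn : tm n = u.
  apply/eqP; rewrite eq_le; apply/andP; split.
    by have /ms/andP[] : tm n \in s by apply: mem_nth; rewrite sz.
  have us : u \in s by rewrite mem_sort !inE eqxx orbT.
  have -> : u = tm (index u s) by rewrite /tm nth_index.
  by apply: tmle; rewrite -ltnS -/(size ts).+2 -sz index_mem.
have tmn1 : tm n.+1 = v by rewrite /tm nth_default// sz.
pose x (i : 'I_n.+1) w := V (tm i.+1) w - V (tm i) w.
have mx i : measurable_fun setT (x i) by apply: measurable_funB; exact: mV.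
have := @independent_but_one 'I_n.+1 x ord_max mx (indV n.+1 tm (tm0 0%N) tmS).
set Gx := \bigcup_(i in _) _.
have -> : x ord_max = fun w => V v w - V u w by apply/funext => w; rewrite /x /= tmn tmn1.
have mGx : <<s Gx >> `<=` measurable.
  apply: smallest_sub; first exact: sigma_algebra_measurable.
  by move=> _ [i _ [U mU <-]]; exact: mx.
move=> /independent2_null; apply => //.
- apply: smallest_sub; first exact: sigma_algebra_measurable.
  by move=> _ [U mU <-]; exact: mvu.
- move: E hE; apply: sub_smallest_sigma => _ [t /= tts [U mU <-]]; rewrite setTI.
  have tss : t \in s by rewrite mem_sort !inE tts !orbT.
  have it : (index t s < n.+1)%N by rewrite -sz index_mem.
  apply: (@ae_eq_preimage Gx (V t) (fun w => \sum_(j < index t s) (V (tm j.+1) w - V (tm j) w))) => //.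
  + by apply: mV; have /andP[] := ms _ tss.
  + apply: measurable_fun_sum_fin => j.
    have jn : (j < n.+1)%N by exact: ltn_trans (ltn_ord j) it.
    move=> _ U' mU'; apply: sub_sigma_algebra; exists (Ordinal jn); last by exists U'.
    by rewrite /= -val_eqE/= neq_ltn (leq_trans (ltn_ord j)).
  + apply: filterS V0 => w [Vw _].
    rewrite -(big_mkord predT (fun j => V (tm j.+1) w - V (tm j) w)) telescope_sumr//.
    by rewrite tm00 Vw subr0 /tm nth_index.
- exact: sub_sigma_algebra.
Qed.

End Independence.

Section EllipticalGaussian.
Context d (T : measurableType d) (R : realType) (P : probability T R).
Variable N : nat.
Hypothesis N0 : (0 < N)%N.
Local Notation C := R[i].

Lemma hermitian_coord_decomp (X : R -> T -> 'M[C]_N) t w : (X t w)^t* = X t w ->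
  X t w = \sum_p (hermitian_coord X p t w)%:C%C *: herm_basis R p.
Proof.
move=> hX; have Xji i j : X t w j i = (X t w i j)^*.
  by rewrite -{1}hX !mxE.
have sN : Num.sqrt N%:R != 0 :> R by rewrite gt_eqF// sqrtr_gt0 ltr0n.
have s2N : Num.sqrt (2 * N%:R) != 0 :> R by rewrite gt_eqF// sqrtr_gt0 mulr_gt0// ltr0n.
have cE (z z' : C) : complex.Re z = complex.Re z' -> complex.Im z = complex.Im z' -> z = z'.
  by case: z; case: z' => ? ? ? ? /= -> ->.
apply/matrixP => i j; rewrite summxE.
have H0 p : p != (i, j) -> p != (j, i) -> herm_basis R p i j = 0.
  case: p => p q; rewrite !xpair_eqE /herm_basis /= !(eq_sym _ i) !(eq_sym _ j) => h1 h2.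
  case: (eqVneq p q) h1 h2 => [->|_] h1 h2.
    by rewrite !mxE (negbTE h1) mulr0.
  have e1 : delta_mx p q i j = 0 :> C by rewrite mxE (negbTE h1).
  have e2 : delta_mx q p i j = 0 :> C by rewrite mxE andbC (negbTE h2).
  case: ifP => _; rewrite mxE [X in _ * X]mxE ?[X in _ * (_ * X)]mxE ?[X in _ * (_ * (_ + X))]mxE e1 e2.
    by rewrite addr0 mulr0.
  by rewrite subr0 !mulr0.
rewrite (bigD1 (i, j))//= mxE.
have [ij|ij] := eqVneq i j.
  rewrite big1 ?addr0; last first.
    by move=> p pij; rewrite mxE H0 ?mulr0//; move: pij; rewrite ij.
  rewrite -ij /hermitian_coord /herm_basis /= eqxx !mxE !eqxx mulr1.
  have := Xji i i; move: (X t w i i) => [p q] /= [] hq.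
  apply: cE; rewrite ?cReM ?cImM /=.
    by rewrite mulr0 subr0 mulrAC divff ?mul1r.
  by move: hq; rewrite !(mulr0, mul0r, addr0); lra.
rewrite (bigD1 (j, i))/=; last by rewrite xpair_eqE negb_and eq_sym ij.
rewrite big1 ?addr0; last by move=> p /andP[p1 p2]; rewrite mxE H0 ?mulr0.
have ji : (j == i) = false by rewrite eq_sym (negbTE ij).
rewrite mxE /hermitian_coord /herm_basis /= (negbTE ij) ji.
have mZ (c : C) (A : 'M[C]_N) : (c *: A) i j = c * A i j by rewrite mxE.
have mD (A B : 'M[C]_N) : (A + B) i j = A i j + B i j by rewrite mxE.
have mN (A : 'M[C]_N) : (- A) i j = - A i j by rewrite mxE.
have dij : delta_mx i j i j = 1 :> C by rewrite mxE !eqxx.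
have dji : delta_mx j i i j = 0 :> C by rewrite mxE (negbTE ij).
case: ltngtP => h; last by move: ij; rewrite -val_eqE /= h eqxx.
- rewrite !(mZ, mD, mN) dij dji addr0 subr0 !mulr1.
  move: (X t w i j) => [p q]; apply: cE; rewrite ?(cReD, cImD, cReM, cImM) /=; field; exact: s2N.
- rewrite !(mZ, mD, mN) dij dji !add0r mulrN1 mulr1 (Xji i j).
  move: (X t w i j) => [p q]; apply: cE; rewrite ?(cReD, cImD, cReM, cImM) /=; field; exact: s2N.
Qed.

Variables (rho : R) (zeta : C) (W : R -> T -> 'M[C]_N).

Definition filtration_gen (t : R) : set (set T) :=
  sigma_mx `[0, t] W `|` null_sets P.

(** The past of [W] is contained in the joint past of the 2 N^2 real coordinates, generated by
    intersections of one past event for each coordinate. On these the product formula holds: the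
    coordinates are independent, and inside each one [brownian_past_independent] separates past and
    increment. *)
Lemma elliptical_gaussian_step : elliptical_brownian_motion P rho zeta W ->
  exists a b theta (V : 'I_N * 'I_N * bool -> R -> T -> R),
  [/\ a ^+ 2 + b ^+ 2 = rho,
    forall t w, 0 <= t -> W t w = \sum_k (V k t w)%:C%C *: ell_basis a b theta k,
    forall t k, 0 <= t -> measurable_fun setT (V k t) &
    forall u v, 0 <= u -> u < v ->
      gaussian_step P (filtration_gen u) (fun k w => V k v w - V k u w) (v - u)].
Proof.
move=> [a [b [theta [X [Y [abE _ [[hX bX iX] [hY bY iY]] XY WE]]]]]].
pose V (k : 'I_N * 'I_N * bool) t w := hermitian_coord (if k.2 then Y else X) k.1 t w.
have bV k : standard_brownian_motion P (V k) by rewrite /V; case: k.2.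
have mV t k : 0 <= t -> measurable_fun setT (V k t) by have [h _ _ _] := bV k; exact: h.
have WV t w : 0 <= t -> W t w = \sum_k (V k t w)%:C%C *: ell_basis a b theta k.
  move=> t0; have S s (U : R -> T -> 'M[C]_N) : (U t w)^t* = U t w ->
      \sum_p (hermitian_coord U p t w)%:C%C *: ell_basis a b theta (p, s) = ell_coef a b theta s *: U t w.
    move=> /hermitian_coord_decomp ->; rewrite scaler_sumr; apply: eq_bigr => p _.
    by rewrite /ell_basis !scalerA mulrC.
  rewrite -(pair_bigA _ (fun p s => (V (p, s) t w)%:C%C *: ell_basis a b theta (p, s)))/=.
  rewrite exchange_big big_bool /= (S true Y (hY t w t0)) (S false X (hX t w t0)) WE//.
  by rewrite scalerDr !scalerA addrC.
exists a, b, theta, V; split => // u v u0 uv; have v0 : 0 <= v by exact: le_trans (ltW uv).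
pose x (k : 'I_N * 'I_N * bool) w := V k v w - V k u w.
have mx k : measurable_fun setT (x k) by apply: measurable_funB; exact: mV.
pose F k : set (set T) := sigma_rv `[0, u] (V k).
pose Full k : set (set T) := sigma_rv `[0, +oo[ (V k).
have FFull k : F k `<=` Full k.
  apply: sub_smallest_sigma => A [t /=]; rewrite in_itv/= => /andP[t0 _] hA.
  by apply: sub_sigma_algebra; exists t => //=; rewrite in_itv/= t0.
have mFull k : Full k `<=` measurable.
  apply: smallest_sub; first exact: sigma_algebra_measurable.
  by move=> A [t /=]; rewrite in_itv/= andbT => t0 [B mB <-]; exact: mV.
have coord_sub (Z : R -> T -> 'M[C]_N) p A :
    sigma_rv `[0, +oo[ (hermitian_coord Z p) A -> sigma_mx `[0, +oo[ Z A.
  apply: sub_smallest_sigma => {}A [t /= t0 [B mB <-]].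
  set G := \bigcup_(k in _) _.
  suff : measurable_fun setT (hermitian_coord Z p t : g_sigma_algebraType G -> R) by move=> h; exact: h.
  have mq q : measurable_fun setT ((fun w => mx_coord q (Z t w)) : g_sigma_algebraType G -> R).
    by move=> _ B' mB'; apply: sub_sigma_algebra; exists (t, q) => //; exists B'.
  case: p => i j; rewrite /hermitian_coord.
  have mi (A1 A2 A3 : T -> R) (b1 b2 : bool) : measurable_fun setT (A1 : g_sigma_algebraType G -> R) ->
    measurable_fun setT (A2 : g_sigma_algebraType G -> R) -> measurable_fun setT (A3 : g_sigma_algebraType G -> R) ->
    measurable_fun setT ((fun w => if b1 then A1 w else if b2 then A2 w else A3 w) : g_sigma_algebraType G -> R).
    by case: b1; case: b2.
  apply: mi; apply: measurable_funM => //.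
  - exact: (mq (i, i, false)).
  - exact: (mq (i, j, false)).
  - exact: (mq (j, i, true)).
have prodE (H : 'I_N * 'I_N * bool -> set T) : (forall k, Full k (H k)) ->
    P (\bigcap_k H k) = (\prod_k P (H k))%E.
  move=> hH.
  have -> : \bigcap_k H k = \bigcap_p H (p, false) `&` \bigcap_p H (p, true).
    apply/seteqP; split => w h; first by split => p _; exact: h.
    by move=> [p []] _; [exact: h.2|exact: h.1].
  have one (Z : R -> T -> 'M[C]_N) s : Z = (if s then Y else X) -> hermitian_brownian_motion P Z ->
      P (\bigcap_p H (p, s)) = (\prod_p P (H (p, s)))%E /\
      sigma_mx `[0, +oo[ Z (\bigcap_p H (p, s)).
    move=> ZE [_ _ iZ].
    have hHs p : sigma_rv `[0, +oo[ (hermitian_coord Z p) (H (p, s)).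
      by rewrite ZE; exact: hH (p, s).
    split; last first.
      apply: (@fin_bigcap_measurable _ (g_sigma_algebraType
        (\bigcup_(k in `[0, +oo[ `*` setT) preimage_set_system setT (fun w => mx_coord k.2 (Z k.1 w)) measurable))) => //.
      by move=> p _; exact: coord_sub (hHs p).
    have := iZ [set: 'I_N * 'I_N]%SET (fun p => H (p, s)).
    rewrite (_ : \bigcap_(i in _) _ = \bigcap_p H (p, s)); last first.
      by apply/seteqP; split => w h i hi; apply: h; rewrite /= ?inE.
    move=> ->; last by move=> p _; exact: hHs.
    by apply: eq_bigl => p; rewrite inE.
  have [PX sX] := one X false erefl (And3 hX bX iX).
  have [PY sY] := one Y true erefl (And3 hY bY iY).
  rewrite XY// PX PY.
  rewrite [RHS](eq_bigr (fun k => P (H (k.1, k.2)))); last by case.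
  rewrite -(pair_bigA _ (fun p s => P (H (p, s))))/=.
  by under [RHS]eq_bigr do rewrite big_bool/= muleC; rewrite big_split.
pose C1 : set (set T) := [set A | exists2 E : _ -> set T, (forall k, F k (E k)) & A = \bigcap_k E k].
have mF k : F k `<=` measurable by move=> A /FFull/mFull.
have mC1 : C1 `<=` measurable.
  by move=> _ [E hE ->]; apply: fin_bigcap_measurable => // k _; exact: mF (hE k).
have FC1 k : F k `<=` C1.
  move=> A hA; exists (fun k' => if k' == k then A else setT).
    by move=> k'; case: eqP => [->//|_]; exact: (@measurableT _ (g_sigma_algebraType
      (\bigcup_(t in `[0, u]) preimage_set_system setT (V k' t) measurable))).
  apply/seteqP; split => w /=; first by move=> hw k' _; case: ifP.
  by move=> /(_ k Logic.I); rewrite eqxx.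
have WC1 : sigma_mx `[0, u] W `<=` <<s C1 >>.
  apply: sub_smallest_sigma => _ [[t q] [/= tu _] [B mB <-]].
  have t0 : 0 <= t by move: tu; rewrite in_itv/= => /andP[].
  suff : measurable_fun setT ((fun w => mx_coord q (W t w)) : g_sigma_algebraType C1 -> R) by move=> h; exact: h.
  have : mfm ((fun w => \sum_k (V k t w)%:C%C *: ell_basis a b theta k) : g_sigma_algebraType C1 -> _).
    apply: mfm_sum => k; apply: mfm_rZ; last exact: mfm_cst.
    move=> _ B' mB'; apply: sub_sigma_algebra; apply: (FC1 k); apply: sub_sigma_algebra.
    by exists t => //; exists B'.
  move=> /(_ q); congr measurable_fun; apply/funext => w; by rewrite WV.
have mfil : <<s filtration_gen u >> `<=` measurable.
  apply: smallest_sub; first exact: sigma_algebra_measurable.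
  move=> A [/WC1 hA|[]//]; move: A hA; apply: smallest_sub => //; exact: sigma_algebra_measurable.
split => // E U hE mU.
pose A := \bigcap_k (x k @^-1` U k).
have mA : measurable A.
  by apply: fin_bigcap_measurable => // k _; rewrite -[X in measurable X]setTI; exact: mx.
have Vt k t : 0 <= t -> measurable_fun setT (V k t : g_sigma_algebraType
    (\bigcup_(t in `[0, +oo[) preimage_set_system setT (V k t) measurable) -> R).
  by move=> t0 _ B mB; apply: sub_sigma_algebra; exists t; [rewrite /= in_itv/= t0|exists B].
have xFull k : Full k (x k @^-1` U k).
  have : measurable_fun setT (x k : g_sigma_algebraType
      (\bigcup_(t in `[0, +oo[) preimage_set_system setT (V k t) measurable) -> R).
    by apply: measurable_funB; exact: Vt.
  by move=> h; rewrite -[X in Full k X]setTI; exact: h.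
have lawx k : P (x k @^-1` U k) = normal_prob 0 (Num.sqrt (v - u)) (U k).
  by have [_ _ _ h] := bV k; exact: h.
have PA : P A = (\prod_k normal_prob 0 (Num.sqrt (v - u)) (U k))%E.
  by rewrite prodE//; apply: eq_bigr => k _; exact: lawx.
rewrite -PA.
(* For the fixed event [A] this family is already a pi-system, so no structure of the increments is
   needed on this side. *)
pose C2 : set (set T) := [set B | B = A \/ B = setT].
have mC2 : C2 `<=` measurable by move=> B [->|->].
have mC1' : <<s C1 >> `<=` measurable.
  by apply: smallest_sub => //; exact: sigma_algebra_measurable.
have mC2' : <<s C2 >> `<=` measurable.
  by apply: smallest_sub => //; exact: sigma_algebra_measurable.
have ind : independent2 P <<s C1 >> <<s C2 >>.
  apply: independent2_pi => //.
  - exists (fun=> setT); last by rewrite bigcapT.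
    by move=> k; exact: (@measurableT _ (g_sigma_algebraType
      (\bigcup_(t in `[0, u]) preimage_set_system setT (V k t) measurable))).
  - by right.
  - move=> _ _ [E1 h1 ->] [E2 h2 ->]; exists (fun k => E1 k `&` E2 k); last by rewrite -bigcapI.
    move=> k; exact: (@measurableI _ (g_sigma_algebraType
      (\bigcup_(t in `[0, u]) preimage_set_system setT (V k t) measurable)) _ _ (h1 k) (h2 k)).
  - by move=> B B' [->|->] [->|->]; rewrite ?setIid ?setIT ?setTI; [left|left|left|right].
  move=> _ _ [E1 h1 ->] [->|->]; last by rewrite setIT probability_setT mule1.
  rewrite /A -bigcapI prodE; last first.
    move=> k; exact: (@measurableI _ (g_sigma_algebraType
      (\bigcup_(t in `[0, +oo[) preimage_set_system setT (V k t) measurable)) _ _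
      (FFull k _ (h1 k)) (xFull k)).
  rewrite (prodE E1); last by move=> k; exact: FFull (h1 k).
  rewrite (prodE (fun k => x k @^-1` U k))// -big_split/=; apply: eq_bigr => k _.
  apply: (brownian_past_independent (bV k) u0 uv); first exact: h1.
  by apply: sub_sigma_algebra; exists (U k) => //; rewrite setTI.
apply: (independent2_null mC1' mC2' ind); last by apply: sub_sigma_algebra; left.
move: E hE; apply: sub_smallest_sigma => E [/WC1 hE|nE]; last by apply: sub_sigma_algebra; right.
by move: E hE; apply: sub_smallest_sigma => E hE; apply: sub_sigma_algebra; left.
Qed.

End EllipticalGaussian.

(** * Convergence of the Euler products *)

Section Small.
Context d (T : measurableType d) (R : realType) (P : probability T R).

(* [A] has outer probability at most [e]; no measurability of [A] is required. *)
Definition small (A : set T) (e : R) :=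
  exists F, [/\ measurable F, A `<=` F & (P F <= e%:E)%E].

Lemma smallS A A' e : A `<=` A' -> small A' e -> small A e.
Proof. by move=> h [F [mF AF PF]]; exists F; split => //; exact: subset_trans AF. Qed.

Lemma smallU A A' e e' : small A e -> small A' e' -> small (A `|` A') (e + e').
Proof.
move=> [F [mF AF PF]] [F' [mF' AF' PF']]; exists (F `|` F'); split.
- exact: measurableU.
- exact: setUSS.
- by rewrite EFinD; apply: (le_trans (measureU2 _ mF mF')); exact: leeD.
Qed.

Lemma small_ae (Q : T -> Prop) : {ae P, forall w, Q w} -> small [set w | ~ Q w] 0.
Proof. by move=> [Z [mZ PZ hZ]]; exists Z; split => //; rewrite PZ. Qed.

Lemma small_measure A e : measurable A -> small A e -> (P A <= e%:E)%E.
Proof.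
move=> mA [F [mF AF PF]]; apply: le_trans PF; apply: le_measure; rewrite ?inE//.
Qed.

Lemma small_of_measure A e : measurable A -> (P A <= e%:E)%E -> small A e.
Proof. by move=> mA PA; exists A; split. Qed.

Lemma small_bigU (A : nat -> set T) n e : (forall i, (i < n)%N -> small (A i) e) ->
  small [set w | exists2 i, (i < n)%N & A i w] (n%:R * e).
Proof.
elim: n => [|n IH] h.
  exists set0; split => //; last by rewrite measure0 mul0r.
  by move=> w; case=> i; rewrite ltn0.
have := smallU (IH (fun i hi => h i (leqW hi))) (h n (ltnSn n)).
rewrite -{2}[e]mul1r -mulrDl natr1; apply: smallS => w; case=> i.
rewrite ltnS leq_eqVlt => /predU1P[->|hi] Aw; first by right.
by left; exists i.
Qed.

Lemma small_mu_ext A e : (mu_ext P A < e%:E)%E -> small A e.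
Proof.
move=> /ereal_inf_lt[_ [F [mF AF] <-] h]; exists (\bigcup_k F k); split => //.
  exact: bigcup_measurable.
apply: (le_trans _ (ltW h)); apply: generalized_Boole_inequality => //.
exact: bigcup_measurable.
Qed.

Lemma cvg0_small (U : nat -> T -> \bar R) eps e : cvg0_in_probability P U ->
  0 < eps -> 0 < e ->
  exists n0, forall n, (n0 <= n)%N -> small [set w | (eps%:E <= U n w)%E] e.
Proof.
move=> /[apply] h e0.
have /h[n0 _ hn] : nbhs (0%E : \bar R) [set y | (y < e%:E)%E].
  by apply: (@open_ereal_lt' R 0%E e%:E); rewrite lte_fin.
by exists n0 => n /hn /= ?; exact: small_mu_ext.
Qed.

End Small.

(** * Continuous paths: moduli of continuity and Riemann sums *)

Section Continuity.
Variable R : realType.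
Implicit Types f : R -> R.

Lemma within_dist f x e : {within `[0, +oo[, continuous f} -> 0 <= x -> 0 < e ->
  exists2 d, 0 < d & forall y, 0 <= y -> `|y - x| < d -> `|f x - f y| < e.
Proof.
move=> /subspace_continuousP cf x0 e0.
have : f @ within `[0, +oo[ (nbhs x) --> f x.
  by apply: cf; rewrite /= in_itv/= x0.
move=> /cvgr_dist_lt/(_ e e0) [d /= d0 hd].
exists d => // y y0 yx; apply: (hd y); first by rewrite /= distrC.
by rewrite /= in_itv/= y0.
Qed.

Lemma within_unif f b e : {within `[0, +oo[, continuous f} -> 0 < e ->
  exists2 d, 0 < d & forall x y, 0 <= x <= b -> 0 <= y -> `|y - x| < d -> `|f x - f y| <= e.
Proof.
move=> cf e0.
have /compact_near_coveringP h := @segment_compact R 0 b.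
have /= := h R (0^'+) (fun d x => forall y, 0 <= x -> 0 <= y -> `|y - x| < d -> `|f x - f y| <= e) _.
have key (x : R) : x \in `[0, b] ->
    \forall x' \near x & d \near 0^'+, forall y, 0 <= x' -> 0 <= y -> `|y - x'| < d -> `|f x' - f y| <= e.
  rewrite in_itv/= => /andP[x0 xb].
  have e2 : 0 < e / 2 by exact: divr_gt0.
  have [d d0 hd] := within_dist cf x0 e2.
  have d2 : 0 < d / 2 by exact: divr_gt0.
  exists ([set x' | `|x' - x| < d / 2], [set dd | dd < d / 2]) => /=.
    split; last exact: nbhs_right_lt.
    by exists (d / 2) => //= x'; rewrite /ball/= distrC.
  move=> [x' dd] [/= hx' hdd] y x'0 y0 yx'.
  have h1 : `|f x - f x'| < e / 2.
    by apply: hd => //; apply: (lt_le_trans hx'); rewrite ler_pdivrMr// mulr2n mulrDr mulr1 lerDl ltW.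
  have h2 : `|f x - f y| < e / 2.
    apply: hd => //; rewrite -(subrK x' y) -addrA.
    apply: (le_lt_trans (ler_normD _ _)); have := lt_trans yx' hdd; move: hx'; lra.
  rewrite -(subrK (f x) (f x')) -addrA; apply: (le_trans (ler_normD _ _)).
  by rewrite distrC; move: (ltW h1) (ltW h2); lra.
have FF : Filter (0 : R)^'+ by exact: _.
move=> /(_ FF key) hd.
have [d [d0 hd']] : exists d, 0 < d /\ `[0, b]%classic `<=` (fun x => forall y, 0 <= x -> 0 <= y -> `|y - x| < d -> `|f x - f y| <= e).
  near (0 : R)^'+ => d; exists d; split; first by near: d; exact: nbhs_right_gt.
  by near: d.
exists d => // x y /andP[x0 xb] y0 yx; apply: hd' => //.
by rewrite /= in_itv/= x0.
Unshelve. all: by end_near. Qed.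

Lemma within_integrable f u v : {within `[0, +oo[, continuous f} -> 0 <= u ->
  lebesgue_measure.-integrable `[u, v] (EFin \o f).
Proof.
move=> cf u0; apply: continuous_compact_integrable; first exact: segment_compact.
apply: continuous_subspaceW cf => x /=; rewrite !in_itv/= => /andP[ux _].
by rewrite andbT (le_trans u0).
Qed.

Lemma Rintegral_increment f u v c e : {within `[0, +oo[, continuous f} -> 0 <= u -> u <= v ->
  (forall s, u <= s -> s <= v -> `|f s - c| <= e) ->
  `|Rintegral lebesgue_measure `[0, v] f - Rintegral lebesgue_measure `[0, u] f - (v - u) * c|
    <= e * (v - u).
Proof.
move=> cf u0 uv h.
have i0 := within_integrable (u := 0) v cf (lexx 0).
rewrite Rintegral_itvB//.
have iS (g : R -> R) : lebesgue_measure.-integrable `[0, v] (EFin \o g) ->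
    lebesgue_measure.-integrable `]u, v] (EFin \o g).
  apply: integrableS => //; apply: subset_itv; rewrite bnd_simp//.
have iuv := iS _ i0.
have cfc : {within `[0, +oo[, continuous (fun t => f t - c)}.
  by move=> x; apply: cvgB; [exact: cf|exact: cvg_cst].
have cst (r : R) : Rintegral lebesgue_measure `]u, v] (fun=> r) = r * (v - u).
  rewrite Rintegral_cst// [X in fine X]lebesgue_measure_itv/= lte_fin.
  case: ltP => uv'; first by rewrite -EFinB.
  by have -> : v = u by [apply/le_anti; rewrite uv']; rewrite subrr.
have icst (r : R) : lebesgue_measure.-integrable `]u, v] (EFin \o (fun=> r)).
  apply: iS; apply: within_integrable => //; apply: continuous_subspaceT => x.
  exact: cvg_cst.
rewrite (_ : (v - u) * c = Rintegral lebesgue_measure `]u, v] (fun=> c)); last by rewrite cst mulrC.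
rewrite -RintegralB//; apply: (le_trans (le_normr_Rintegral _ _)) => //.
  by apply: iS; exact: within_integrable.
rewrite -cst; apply: le_Rintegral => //.
- apply: iS; apply: within_integrable => //.
  by move=> x; apply: cvg_norm; exact: cfc.
- by move=> s /=; rewrite in_itv/= => /andP[us sv]; apply: h => //; exact: ltW.
Qed.

Lemma step_integral (f : R -> R) (p : nat -> R) (c : nat -> R) n :
  (forall j, p j < p j.+1) ->
  measurable_fun `[p 0%N, p n] f -> (forall s, 0 <= f s) ->
  (forall j s, (j < n)%N -> p j < s -> s <= p j.+1 -> c j <= f s) ->
  ((\sum_(j < n) (p j.+1 - p j) * c j)%:E <=
  \int[lebesgue_measure]_(s in `[p 0%N, p n]) (f s)%:E)%E.
Proof.
move=> pS; have p0 k : p 0%N <= p k.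
  by elim: k => // k IH; apply: (le_trans IH); exact: ltW.
elim: n => [|n IH] mf f0 hc.
  by rewrite big_ord0; apply: integral_ge0 => s _; rewrite lee_fin.
have E : `[p 0%N, p n.+1]%classic = `[p 0%N, p n]%classic `|` `]p n, p n.+1]%classic.
  by rewrite -itv_bndbnd_setU// bnd_simp// ltW.
have mf1 : measurable_fun `[p 0%N, p n] f.
  by apply: measurable_funS mf => //; rewrite E; exact: subsetUl.
have mf2 : measurable_fun `]p n, p n.+1] f.
  by apply: measurable_funS mf => //; rewrite E; exact: subsetUr.
rewrite E ge0_integral_setU//; last 3 first.
- by rewrite -E; exact/measurable_EFinP.
- by move=> s _; rewrite lee_fin.
- apply/disj_setPS => s [] /=; rewrite !in_itv/= => /andP[_ h1] /andP[h2 _].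
  by move: (lt_le_trans h2 h1); rewrite ltxx.
rewrite big_ord_recr/= EFinD; apply: leeD.
  by apply: IH => // j s jn; apply: hc; exact: ltnW.
(* [c n] may be negative, and the comparison of integrals is made between nonnegative functions. *)
apply: (@le_trans _ _ (\int[lebesgue_measure]_(s in `]p n, p n.+1]) (Num.max (c n) 0)%:E)%E).
  rewrite integral_cst// [X in (_ * X)%E]lebesgue_measure_itv/= lte_fin pS -EFinB -EFinM lee_fin.
  by rewrite mulrC ler_pM2r ?subr_gt0// le_max lexx.
apply: ge0_le_integral => //.
- by move=> s _; rewrite lee_fin le_max lexx orbT.
- exact/measurable_EFinP.
move=> s /=; rewrite in_itv/= => /andP[s1 s2]; rewrite lee_fin ge_max f0 andbT.
exact: hc.
Qed.

Lemma perturbed_distance_lt (x y x' y' m m' u : R) : x < x' -> x' < x + m -> y < y' ->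
  y' < y + m' -> m <= (u - `|y - x|) / 2 -> m' <= (u - `|y - x|) / 2 -> `|y - x| < u ->
  `|y' - x'| < u.
Proof.
move=> h1 h2 h3 h4 h5 h6 h7.
have -> : y' - x' = (y - x) + ((y' - y) - (x' - x)) by ring.
apply: (le_lt_trans (ler_normD _ _)); rewrite -ltrBrDl ltr_norml.
by apply/andP; split; move: h1 h2 h3 h4 h5 h6 h7; move: (`|y - x|) => v; lra.
Qed.

Lemma third_of_excess (g om v : R) : g <= (g - om) / 3 + v + (g - om) / 3 -> om < g -> om < v.
Proof. lra. Qed.

End Continuity.

Section Modulus.
Context d (T : measurableType d) (R : realType) (P : probability T R).
Variables (N : nat) (B : R -> T -> 'M[R[i]]_N).
Hypothesis mB : forall t, 0 <= t -> mfm (B t).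
Hypothesis cB : {ae P, forall w, forall q,
  {within `[0, +oo[, continuous (fun t => mx_coord q (B t w))}}.

(** Over rational times, failure of the modulus at scale 1/(k+1) is a measurable event. These events
    decrease in k, and their intersection is null because paths are uniformly continuous on compact
    intervals. Continuity carries the bound from rational to real times. *)
Lemma modulus_small (b om e : R) : 0 < om -> 0 < e ->
  exists2 dl, 0 < dl & small P [set w | ~ (
    (forall q, {within `[0, +oo[, continuous (fun t => crd q (B t w))}) /\
    forall q x y, 0 <= x <= b -> 0 <= y <= b -> `|y - x| < dl ->
      `|crd q (B x w) - crd q (B y w)| <= om)] e.
Proof.
move=> om0 e0; have [Z [mZ PZ hZ]] := cB.
pose I := ('I_N * 'I_N * bool * (rat * rat))%type.
(* Times near b are approximated by rationals from the right; [b + 1] leaves room for them. *)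
pose ok k (i : I) := [&& 0 <= ratr i.2.1 :> R, ratr i.2.1 <= b + 1 :> R, 0 <= ratr i.2.2 :> R &
   `|ratr i.2.2 - ratr i.2.1| < k.+1%:R^-1 :> R].
pose A k := \bigcup_(i : I) [set w | ok k i && (om < `|crd i.1 (B (ratr i.2.1) w) - crd i.1 (B (ratr i.2.2) w)|)].
have mA k : measurable (A k).
  apply: countable_bigcupT_measurable => [|i]; first exact: countableP.
  have [h|h] := boolP (ok k i); last first.
    by rewrite (_ : [set _ | _] = set0)//; apply/seteqP; split.
  rewrite /= -[X in measurable X]setTI.
  apply: (measurable_fun_ltr (f := cst om) (g := fun w => `|crd i.1 (B (ratr i.2.1) w) - crd i.1 (B (ratr i.2.2) w)|)) => //.
  have /and4P[h1 _ h2 _] := h.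
  apply: measurableT_comp => //; apply: measurable_funB; exact: mB.
have AS : nonincreasing_seq A.
  apply/nonincreasing_seqP => k; apply/subsetPset => w [i _ /= /andP[/and4P[h1 h2 h3 h4] h5]].
  exists i => //=; rewrite h5 andbT; apply/and4P; split => //.
  by apply: (lt_le_trans h4); rewrite lef_pV2 ?posrE// ler_nat.
have AZ : \bigcap_k A k `<=` Z.
  move=> w Aw; apply: hZ => cw.
  have : forall q, exists d, 0 < d /\ forall x y, 0 <= x <= b + 1 -> 0 <= y -> `|y - x| < d ->
      `|crd q (B x w) - crd q (B y w)| <= om.
    by move=> q; have [dd d0 hd] := within_unif (b + 1) (cw q) om0; exists dd.
  move=> /choice[dd hd].
  pose dm := \big[Order.min/1]_q dd q.
  have dm0 : 0 < dm by rewrite /dm; elim/big_ind: _ => // [x y x0 y0|q _]; [rewrite lt_min x0|exact: (hd q).1].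
  have [k _ hk] := near_infty_natSinv_lt (PosNum dm0).
  have [[q [x y]] _ /= /andP[/and4P[/= h1 h2 h3 h4]]] := Aw k Logic.I.
  rewrite ltNge => /negP; apply; apply: (hd q).2 => //; first by rewrite h1.
  apply: (lt_trans h4); apply: (lt_le_trans (hk k (leqnn k))).
  by rewrite /= /dm; exact: bigmin_le_cond.
have PA : P (A k) @[k --> \oo] --> 0%E.
  have -> : 0%E = P (\bigcap_k A k).
    apply/esym; apply: subset_measure0 PZ => //; exact: bigcapT_measurable.
  apply: nonincreasing_cvg_mu => //; last exact: bigcapT_measurable.
  by rewrite (le_lt_trans (probability_le1 _ _))// ltry.
have [k0 hk0] : exists k, (P (A k) < e%:E)%E.
  have /PA[k _ hk] : nbhs (0%E : \bar R) [set y | (y < e%:E)%E].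
    by apply: (@open_ereal_lt' R 0%E e%:E); rewrite lte_fin.
  by exists k; exact: hk k (leqnn k).
exists k0.+1%:R^-1; first by rewrite invr_gt0.
exists (A k0 `|` Z); split.
- exact: measurableU.
- move=> w hw; apply: contrapT => hAZ; apply: hw.
  have cw q : {within `[0, +oo[, continuous (fun t => crd q (B t w))}.
    by move: q; apply: contrapT => h; apply: hAZ; right; exact: hZ.
  split => // q x y /andP[x0 xb] /andP[y0 yb] yx; rewrite leNgt; apply/negP => hlt.
  apply: hAZ; left.
  (* A third of the excess is spent at each of the two endpoints, so at least a third is left at the
     rational times. *)
  set g := `|_ - _| in hlt; pose ga := (g - om) / 3.
  have ga0 : 0 < ga by rewrite divr_gt0// subr_gt0.
  have [d1 d10 hd1] := within_dist (cw q) x0 ga0.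
  have [d2 d20 hd2] := within_dist (cw q) y0 ga0.
  pose sl := (k0.+1%:R^-1 - `|y - x|) / 2.
  have sl0 : 0 < sl by rewrite divr_gt0// subr_gt0.
  pose m1 := Num.min d1 (Num.min sl 1); have m10 : 0 < m1 by rewrite !lt_min d10 sl0 ltr01.
  pose m2 := Num.min d2 sl; have m20 : 0 < m2 by rewrite !lt_min d20 sl0.
  have [a] := @rat_in_itvoo R x (x + m1) ltac:(by rewrite ltrDl).
  rewrite in_itv/= => /andP[a1 a2].
  have [c] := @rat_in_itvoo R y (y + m2) ltac:(by rewrite ltrDl).
  rewrite in_itv/= => /andP[c1 c2].
  have m1d : m1 <= d1 by rewrite ge_min lexx.
  have m1s : m1 <= sl by rewrite !ge_min lexx orbT.
  have m11 : m1 <= 1 by rewrite !ge_min lexx !orbT.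
  have m2d : m2 <= d2 by rewrite ge_min lexx.
  have m2s : m2 <= sl by rewrite !ge_min lexx orbT.
  exists (q, (a, c)) => //=; apply/andP; split.
    rewrite /ok /=; apply/and4P; split.
    + by rewrite (le_trans x0)// ltW.
    + by apply: ltW; apply: (lt_le_trans a2); exact: lerD.
    + by rewrite (le_trans y0)// ltW.
    + exact: perturbed_distance_lt a1 a2 c1 c2 m1s m2s yx.
  have h1 : `|crd q (B x w) - crd q (B (ratr a) w)| < ga.
    apply: hd1; first by rewrite (le_trans x0)// ltW.
    by rewrite gtr0_norm ?subr_gt0// ltrBlDl (lt_le_trans a2)// lerD2l.
  have h2 : `|crd q (B y w) - crd q (B (ratr c) w)| < ga.
    apply: hd2; first by rewrite (le_trans y0)// ltW.
    by rewrite gtr0_norm ?subr_gt0// ltrBlDl (lt_le_trans c2)// lerD2l.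
  have hg : g <= ga + `|crd q (B (ratr a) w) - crd q (B (ratr c) w)| + ga.
    rewrite /g; set X := crd q (B x w) in h1 *; set Y := crd q (B y w) in h2 *.
    set X' := crd q (B (ratr a) w) in h1 *; set Y' := crd q (B (ratr c) w) in h2 *.
    have -> : X - Y = (X - X') + (X' - Y') - (Y - Y') by ring.
    apply: (le_trans (ler_normB _ _)); apply: lerD; last exact: ltW.
    by apply: (le_trans (ler_normD _ _)); rewrite lerD2r ltW.
  exact: third_of_excess hg hlt.
- rewrite -[e]addr0 EFinD.
apply: (le_trans (measureU2 _ (mA k0) mZ)); apply: leeD; first exact: ltW.
  by rewrite le_eqVlt; apply/orP; left; apply/eqP; exact: PZ.
Qed.

End Modulus.

Lemma markov_small d (T : measurableType d) (R : realType) (P : probability T R)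
    (f : T -> R) (K eta : R) : measurable_fun setT f -> (forall w, 0 <= f w) ->
  (\int[P]_w (f w)%:E <= K%:E)%E -> 0 < eta -> small P [set w | eta <= f w] (K / eta).
Proof.
move=> mf f0 hK eta0; set V := [set w | _].
have mV : measurable V.
  rewrite -[X in measurable X]setTI.
  by apply: (measurable_fun_ler (f := cst eta) (g := f)).
apply: small_of_measure => //.
have PV : (eta%:E * P V <= K%:E)%E.
  apply: le_trans hK.
  have -> : P V = (\int[P]_w (\1_V w)%:E)%E.
    by rewrite integral_indic; [rewrite setIT|exact: measurableT|exact: mV].
  rewrite -ge0_integralZl//; last 2 first.
  - by apply/measurable_EFinP; exact: measurable_indic.
  - by rewrite lee_fin ltW.
  apply: ge0_le_integral => //.
  - by move=> w _; rewrite -EFinM lee_fin mulr_ge0// ltW.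
  - by apply: measurable_funeM; apply/measurable_EFinP; exact: measurable_indic.
  - exact/measurable_EFinP.
  move=> w _; rewrite -EFinM lee_fin indicE; have [|_] := boolP (w \in V).
    by rewrite inE /V/= mulr1.
  by rewrite mulr0.
have fP : P V \is a fin_num by exact: fin_num_measure.
move: PV; rewrite -(fineK fP) -EFinM !lee_fin => h.
by rewrite ler_pdivlMr// mulrC.
Qed.

(** * Second moments and maximal inequalities for stochastic sums *)

Section StochasticSums.
Context d (T : measurableType d) (R : realType) (P : probability T R).
Variables (N : nat) (G : nat -> set (set T)) (x : nat -> 'I_N * 'I_N * bool -> T -> R).
Variables (D : nat -> R) (a b theta : R).
Local Notation C := R[i].
Hypothesis gs : forall j, gaussian_step P (G j) (x j) (D j).
Hypothesis D0 : forall j, 0 < D j.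
Hypothesis GG : forall j, G j `<=` <<s G j.+1 >>.
Local Notation noise j := (ell_noise (x j) a b theta).
Hypothesis xG : forall j, mfm (noise j : g_sigma_algebraType (G j.+1) -> _).

(** A crude constant for the second moment of a product with the noise. It enters only the
    convergence of the Euler products, where N is fixed. *)
Definition basis_mass : R := \sum_k fro (ell_basis a b theta k : 'M[C]_N).

Lemma basis_mass_ge0 : 0 <= basis_mass.
Proof. by apply: sumr_ge0 => k _; exact: fro_ge0. Qed.

Lemma adapted_measurable m n j (f : T -> 'M[C]_(m, n)) :
  mfm (f : g_sigma_algebraType (G j) -> _) -> mfm f.
Proof. by move=> mf q; have [sG _ _] := gs j; exact: g_sigma_measurable_fun sG (mf q). Qed.

Lemma ito_step j (b0 a0 : T -> 'M[C]_N) :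
  mfm (b0 : g_sigma_algebraType (G j) -> _) -> mfm (a0 : g_sigma_algebraType (G j) -> _) ->
  (\int[P]_w (fro (b0 w + a0 w *m noise j w))%:E <=
   \int[P]_w (fro (b0 w) + D j * basis_mass * fro (a0 w))%:E)%E.
Proof.
move=> mb ma; have [sG mx _] := gs j.
pose c q k w := crd q (a0 w *m ell_basis a b theta k).
have mc q k : measurable_fun setT (c q k : g_sigma_algebraType (G j) -> R).
  have : mfm ((fun w => a0 w *m ell_basis a b theta k) : g_sigma_algebraType (G j) -> _).
    by apply: mfmM => //; exact: mfm_cst.
  exact.
have mcT q k : measurable_fun setT (c q k) by exact: g_sigma_measurable_fun sG (mc q k).
have mbT q : measurable_fun setT (fun w => crd q (b0 w)) by exact: g_sigma_measurable_fun sG (mb q).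
have E w : (fro (b0 w + a0 w *m noise j w))%:E =
    (\sum_q ((crd q (b0 w) + \sum_k c q k w * x j k w) ^+ 2)%:E)%E.
  rewrite sumEFin; congr (_%:E); apply: eq_bigr => q _; congr (_ ^+ 2).
  rewrite crdD; congr (_ + _); rewrite /ell_noise mulmx_sumr crd_sum.
  by apply: eq_bigr => k _; rewrite -scalemxAr crd_rZ mulrC.
under eq_integral do rewrite E.
rewrite ge0_integral_sum//; last first.
- by move=> q w _; rewrite lee_fin sqr_ge0.
- move=> q; apply/measurable_EFinP; apply: measurable_funX; apply: measurable_funD => //.
  by apply: measurable_fun_sum_fin => k; exact: measurable_funM.
have m2 q : measurable_fun setT (fun w => crd q (b0 w) ^+ 2 + D j * \sum_k c q k w ^+ 2).
  apply: measurable_funD; first exact: measurable_funX.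
  apply: measurable_funM => //; apply: measurable_fun_sum_fin => k; exact: measurable_funX.
have g2 q w : 0 <= crd q (b0 w) ^+ 2 + D j * \sum_k c q k w ^+ 2.
  by rewrite addr_ge0 ?sqr_ge0// mulr_ge0 ?(ltW (D0 j))// sumr_ge0// => k _; rewrite sqr_ge0.
apply: (@le_trans _ _ (\sum_q \int[P]_w (crd q (b0 w) ^+ 2 + D j * \sum_k c q k w ^+ 2)%:E)%E).
  by apply: lee_sum => q _; exact: (gaussian_square (gs j) (D0 j) (mb q) (mc q)).
rewrite -ge0_integral_sum//; last 2 first.
- by move=> q; apply/measurable_EFinP.
- by move=> q w _; rewrite lee_fin.
apply: ge0_le_integral => //.
- by move=> w _; apply: sume_ge0 => q _; rewrite lee_fin.
- by apply: emeasurable_sum => q; apply/measurable_EFinP.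
- apply/measurable_EFinP; apply: measurable_funD.
    by apply: mfm_fro; exact: adapted_measurable mb.
  by apply: measurable_funM => //; apply: mfm_fro; exact: adapted_measurable ma.
move=> w _; rewrite sumEFin lee_fin big_split/= lerD2l -mulr_sumr -mulrA ler_wpM2l ?(ltW (D0 j))//.
rewrite exchange_big/= /basis_mass mulr_suml; apply: ler_sum => k _.
by rewrite mulrC; exact: froM.
Qed.

Lemma partial_sum_adapted J n (b0 : T -> 'M[C]_N) (a0 : nat -> T -> 'M[C]_N) :
  mfm (b0 : g_sigma_algebraType (G J) -> _) ->
  (forall j, mfm (a0 j : g_sigma_algebraType (G j) -> _)) ->
  mfm ((fun w => b0 w + \sum_(i < n) a0 (J + i)%N w *m noise (J + i)%N w)
     : g_sigma_algebraType (G (J + n)) -> _).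
Proof.
move=> mb ma; elim: n => [|n IH].
  by under eq_fun do rewrite big_ord0 addr0; rewrite addn0.
rewrite addnS; under eq_fun do rewrite big_ord_recr/= addrA.
apply: mfmD; first by move=> q; apply: adapted_next.
by apply: mfmM; [move=> q; apply: (adapted_next GG); exact: ma|exact: xG].
Qed.

Lemma ito_sum J n (b0 : T -> 'M[C]_N) (a0 : nat -> T -> 'M[C]_N) :
  mfm (b0 : g_sigma_algebraType (G J) -> _) ->
  (forall j, mfm (a0 j : g_sigma_algebraType (G j) -> _)) ->
  (\int[P]_w (fro (b0 w + \sum_(i < n) a0 (J + i)%N w *m noise (J + i)%N w))%:E <=
   \int[P]_w (fro (b0 w) + basis_mass * \sum_(i < n) D (J + i)%N * fro (a0 (J + i)%N w))%:E)%E.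
Proof.
move=> mb ma; have mbT := adapted_measurable mb.
have maT j : mfm (a0 j) by exact: adapted_measurable (ma j).
elim: n => [|n IH].
  under eq_integral do rewrite big_ord0 addr0.
  by under [leRHS]eq_integral do rewrite big_ord0 mulr0 addr0.
under eq_integral do rewrite big_ord_recr/= addrA.
have hI := @ito_step (J + n)%N _ (a0 (J + n)%N) (@partial_sum_adapted J n b0 a0 mb ma) (ma _).
apply: (le_trans hI).
have mS : measurable_fun setT (fun w => fro (b0 w + \sum_(i < n) a0 (J + i)%N w *m noise (J + i)%N w)).
  by apply: mfm_fro; exact: adapted_measurable (@partial_sum_adapted J n b0 a0 mb ma).
under eq_integral do rewrite EFinD.
rewrite ge0_integralD//; last 4 first.
- by move=> w _; rewrite lee_fin fro_ge0.
- exact/measurable_EFinP.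
- by move=> w _; rewrite lee_fin !mulr_ge0 ?fro_ge0 ?basis_mass_ge0// ltW.
- by apply/measurable_EFinP; apply: measurable_funM => //; exact: mfm_fro.
under [leRHS]eq_integral do rewrite big_ord_recr/= mulrDr addrA EFinD.
rewrite [leRHS]ge0_integralD//.
- by apply: leeD IH _; under eq_integral do rewrite [D _ * basis_mass]mulrC -mulrA.
- move=> w _; rewrite lee_fin addr_ge0 ?fro_ge0// mulr_ge0 ?basis_mass_ge0//.
  by apply: sumr_ge0 => i _; rewrite mulr_ge0 ?fro_ge0// ltW.
- apply/measurable_EFinP; apply: measurable_funD; first exact: mfm_fro.
  apply: measurable_funM => //; apply: measurable_fun_sum_fin => i.
  by apply: measurable_funM => //; exact: mfm_fro.
- by move=> w _; rewrite lee_fin !mulr_ge0 ?fro_ge0 ?basis_mass_ge0// ltW.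
- apply/measurable_EFinP; apply: measurable_funM => //.
  by apply: measurable_funM => //; exact: mfm_fro.
Qed.

Section Truncation.
Variables (a0 : nat -> T -> 'M[C]_N) (dl : R).
Hypothesis ma : forall j, mfm (a0 j : g_sigma_algebraType (G j) -> _).

Definition energy n w : R := \sum_(i < n) D i * fro (a0 i w).

(** The test uses the energy including step j. It is still measurable at the beginning of that step,
    because [a0 j] is, and so the total energy after truncation never exceeds [dl]. *)
Definition truncated j w : 'M[C]_N :=
  (if energy j.+1 w <= dl then 1 else 0)%:C%C *: a0 j w.

Lemma energy_le m n w : (m <= n)%N -> energy m w <= energy n w.
Proof.
move=> mn; rewrite -(subnK mn); elim: (n - m)%N => // k IH; apply: (le_trans IH).
by rewrite addSn /energy big_ord_recr/= lerDl mulr_ge0 ?fro_ge0// ltW.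
Qed.

Lemma energy_adapted n : measurable_fun setT (energy n.+1 : g_sigma_algebraType (G n) -> R).
Proof.
elim: n => [|n IH].
  by rewrite (_ : energy 1 = (fun w => D 0%N * fro (a0 0%N w)));
    [apply: measurable_funM => //; exact: mfm_fro|apply/funext => w; rewrite /energy big_ord1].
rewrite (_ : energy n.+2 = (fun w => energy n.+1 w + D n.+1 * fro (a0 n.+1 w))); last first.
  by apply/funext => w; rewrite /energy big_ord_recr.
apply: measurable_funD; first exact: adapted_next.
by apply: measurable_funM => //; exact: mfm_fro.
Qed.

Lemma truncated_adapted j : mfm (truncated j : g_sigma_algebraType (G j) -> _).
Proof.
apply: mfm_rZ => //; apply: measurable_fun_ifT => //.
by apply: measurable_fun_ler => //; exact: energy_adapted.
Qed.

Lemma truncated_eq n j w : energy n w <= dl -> (j < n)%N -> truncated j w = a0 j w.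
Proof.
move=> h jn; rewrite /truncated ifT ?scale1r//.
exact: le_trans (energy_le w jn) h.
Qed.

Lemma truncated_energy n w : 0 <= dl -> \sum_(j < n) D j * fro (truncated j w) <= dl.
Proof.
move=> dl0; elim: n => [|n IH]; first by rewrite big_ord0.
rewrite big_ord_recr/=; have [h|h] := boolP (energy n.+1 w <= dl); last first.
  by rewrite {2}/truncated (negbTE h) scale0r fro0 mulr0 addr0.
rewrite (eq_bigr (fun j : 'I_n => D j * fro (a0 j w))); last first.
  by move=> j _; rewrite (truncated_eq h)// ltnS ltnW.
by rewrite (truncated_eq h)//; move: h; rewrite /energy big_ord_recr.
Qed.

End Truncation.

(* Truncating the coefficients once their energy exceeds [dl] bounds the second
   moment of the sum, without assuming any moment of the [a0 j]. *)
Lemma lenglart (a0 : nat -> T -> 'M[C]_N) n (dl eta e : R) :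
  (forall j, mfm (a0 j : g_sigma_algebraType (G j) -> _)) -> 0 <= dl -> 0 < eta ->
  small P [set w | dl < \sum_(j < n) D j * fro (a0 j w)] e ->
  small P [set w | eta <= fro (\sum_(j < n) a0 j w *m noise j w)] (e + basis_mass * dl / eta).
Proof.
move=> ma dl0 eta0 he.
pose t0 := truncated a0 dl.
have mt j : mfm (t0 j : g_sigma_algebraType (G j) -> _) by exact: truncated_adapted.
have m0 : mfm ((fun=> 0) : g_sigma_algebraType (G 0) -> 'M[C]_N) by exact: mfm_cst.
have hs : small P [set w | eta <= fro (\sum_(j < n) t0 j w *m noise j w)] (basis_mass * dl / eta).
  apply: markov_small => //.
  - have := adapted_measurable (@partial_sum_adapted 0 n _ t0 m0 mt).
    under eq_fun do rewrite add0r; exact: mfm_fro.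
  - by move=> w; exact: fro_ge0.
  - have := @ito_sum 0 n _ t0 m0 mt; under eq_integral do rewrite add0r; move=> /le_trans; apply.
    apply: (@le_trans _ _ (\int[P]_w (basis_mass * dl)%:E)%E); last first.
      by rewrite integral_cst// -[leRHS]mule1 lee_wpmul2l ?probability_le1// lee_fin mulr_ge0 ?basis_mass_ge0.
    apply: ge0_le_integral => //.
    + move=> w _; rewrite lee_fin fro0 add0r mulr_ge0 ?basis_mass_ge0// sumr_ge0// => i _.
      by rewrite mulr_ge0 ?fro_ge0// ltW.
    + apply/measurable_EFinP; under eq_fun do rewrite fro0 add0r.
      apply: measurable_funM => //; apply: measurable_fun_sum_fin => i.
      by apply: measurable_funM => //; apply: mfm_fro; exact: adapted_measurable (mt _).
    + move=> w _; rewrite lee_fin fro0 add0r ler_wpM2l ?basis_mass_ge0//.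
      exact: truncated_energy.
apply: smallS (smallU he hs) => w /= hw.
have [h|h] := leP (\sum_(j < n) D j * fro (a0 j w)) dl; last by left.
right; move: hw; congr (_ <= fro _); apply: eq_bigr => j _; congr (_ *m _).
by rewrite /t0 (@truncated_eq _ _ n)//.
Qed.

(* The sum is stopped when its norm first reaches [eta]; the stopping indicator
   is a product of indicators, hence adapted. *)
Lemma lenglart_max (a0 : nat -> T -> 'M[C]_N) n (dl eta e : R) :
  (forall j, mfm (a0 j : g_sigma_algebraType (G j) -> _)) -> 0 <= dl -> 0 < eta ->
  small P [set w | dl < \sum_(j < n) D j * fro (a0 j w)] e ->
  small P [set w | exists2 k, (k <= n)%N & eta <= fro (\sum_(j < k) a0 j w *m noise j w)]
    (e + basis_mass * dl / eta).
Proof.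
move=> ma dl0 eta0 he.
pose X k w := \sum_(j < k) a0 j w *m noise j w.
pose ind k w : R := if fro (X k w) < eta then 1 else 0.
pose c j w : R := \prod_(k < j.+1) ind k w.
pose s0 j w := (c j w)%:C%C *: a0 j w.
have mX k : mfm (X k : g_sigma_algebraType (G k) -> _).
  have m0 : mfm ((fun=> 0) : g_sigma_algebraType (G 0) -> 'M[C]_N) by exact: mfm_cst.
  by have := @partial_sum_adapted 0 k _ a0 m0 ma; under eq_fun do rewrite add0r.
have mI k : measurable_fun setT (ind k : g_sigma_algebraType (G k) -> R).
  by apply: measurable_fun_ifT => //; apply: measurable_fun_ltr => //; exact: mfm_fro.
have mc j : measurable_fun setT (c j : g_sigma_algebraType (G j) -> R).
  elim: j => [|j IH].
    by rewrite (_ : c 0%N = ind 0%N)//; apply/funext => w; rewrite /c big_ord1.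
  rewrite (_ : c j.+1 = fun w => c j w * ind j.+1 w); last first.
    by apply/funext => w; rewrite /c big_ord_recr.
  apply: measurable_funM => //.
  exact: adapted_next.
have ms j : mfm (s0 j : g_sigma_algebraType (G j) -> _) by exact: mfm_rZ.
have c1 j w : (forall k, (k <= j)%N -> fro (X k w) < eta) -> c j w = 1.
  by move=> h; apply: big1 => k _; rewrite /ind h// -ltnS.
have c0 j k w : (k <= j)%N -> eta <= fro (X k w) -> c j w = 0.
  rewrite -ltnS => kj h; rewrite /c (bigD1 (Ordinal kj))//= /ind ltNge h/= mul0r//.
have c01 j w : c j w = 1 \/ c j w = 0.
  have [/existsP[k hk]|] := boolP [exists k : 'I_j.+1, eta <= fro (X k w)].
    by right; apply: (c0 j k); rewrite // -ltnS.
  rewrite negb_exists => /forallP h; left; apply: c1 => k kj.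
  by rewrite ltNge; exact: (h (Ordinal (kj : (k < j.+1)%N))).
have hs : small P [set w | dl < \sum_(j < n) D j * fro (s0 j w)] e.
  apply: smallS he => w /= /lt_le_trans; apply; apply: ler_sum => j _.
  rewrite ler_wpM2l ?(ltW (D0 j))// /s0; have [->|->] := c01 j w; first by rewrite scale1r.
  by rewrite scale0r fro0 fro_ge0.
apply: smallS (lenglart ms dl0 eta0 hs) => w /= [k kn hk].
have hex : exists k, eta <= fro (X k w) by exists k.
case: (ex_minnP hex) => k' hk' kmin.
suff -> : \sum_(j < n) s0 j w *m noise j w = X k' w by [].
have kn' : (k' <= n)%N by apply: leq_trans (kmin _ hk) kn.
rewrite /X (big_ord_widen n (fun j => a0 j w *m noise j w) kn') [RHS]big_mkcond/=.
apply: eq_bigr => j _; rewrite /s0; have [jk|jk] := ltnP j k'.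
  rewrite c1 ?scale1r// => i ij; rewrite ltNge; apply/negP => /kmin.
  by rewrite leqNgt (leq_ltn_trans ij jk).
by rewrite (c0 j k')// scale0r mul0mx.
Qed.

End StochasticSums.

(** * Time grids and simple processes *)

Section Grid.
Variable R : realType.
Implicit Types (p : nat -> R) (t : R).

Lemma grid_le p i j : (forall j, p j < p j.+1) -> (i <= j)%N -> p i <= p j.
Proof.
move=> pS ij; rewrite -(subnK ij); elim: (j - i)%N => [//|k IH].
by rewrite addSn; apply: (le_trans IH); exact: ltW.
Qed.

Lemma grid_lt p i j : (forall j, p j < p j.+1) -> (i < j)%N -> p i < p j.
Proof. by move=> pS ij; apply: (lt_le_trans (pS i)); exact: grid_le. Qed.

Lemma grid_inj p i j : (forall j, p j < p j.+1) -> p i = p j -> i = j.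
Proof.
move=> pS pij; have [h|h|//] := ltngtP i j.
  by have := grid_lt pS h; rewrite pij ltxx.
by have := grid_lt pS h; rewrite pij ltxx.
Qed.

Lemma grid_lt_iff p i j : (forall j, p j < p j.+1) -> (p i < p j) = (i < j)%N.
Proof.
move=> pS; apply/idP/idP; last exact: grid_lt.
by apply: contraTT; rewrite -leqNgt -leNgt; exact: grid_le.
Qed.

Lemma grid_exists (L : seq R) t : 0 < t -> exists p n, [/\ forall j, p j < p j.+1,
  p 0%N = 0, p n = t, forall tau j, tau \in L -> (j < n)%N -> ~ (p j < tau < p j.+1) &
  forall tau, tau \in L -> 0 <= tau <= t -> exists2 j, (j <= n)%N & p j = tau].
Proof.
move=> t0.
pose s := sort <=%R (undup [:: 0, t & [seq x <- L | 0 <= x <= t]]).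
have us : uniq s by rewrite sort_uniq undup_uniq.
have ss : sorted <%R s by rewrite sort_lt_sorted undup_uniq.
have ms x : (x \in s) = (x \in [:: 0, t & [seq x <- L | 0 <= x <= t]]).
  by rewrite mem_sort mem_undup.
have sb x : x \in s -> 0 <= x <= t.
  rewrite ms !inE => /predU1P[->|/predU1P[->|]]; first by rewrite lexx ltW.
    by rewrite (ltW t0) lexx.
  by rewrite mem_filter => /andP[].
have zs : 0 \in s by rewrite ms inE eqxx.
have ts : t \in s by rewrite ms !inE eqxx orbT.
have sz : (0 < size s)%N by case: (s) zs.
pose n := (size s).-1.
have nE : n.+1 = size s by rewrite prednK.
(* Beyond t the grid continues with unit steps, so that it is strictly increasing on all of nat and
   no later statement on increments needs an index bound. *)
pose p j := if (j < size s)%N then nth 0 s j else t + (j - n)%:R.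
have pin j : (j < size s)%N -> p j \in s by rewrite /p => h; rewrite h mem_nth.
have pidx x : x \in s -> p (index x s) = x.
  by move=> xs; rewrite /p index_mem xs nth_index.
have pS0 j : (j.+1 < size s)%N -> p j < p j.+1.
  move=> h; rewrite /p h (ltnW h); exact: (sortedP 0 ss).
have ple i j : (i <= j)%N -> (j < size s)%N -> p i <= p j.
  move=> ij js; rewrite -(subnK ij) in js *; elim: (j - i)%N js => [//|k IH] js.
  rewrite addSn in js *; apply: (le_trans (IH (ltnW js))); exact/ltW/pS0.
have pn : p n = t.
  apply/eqP; rewrite eq_le; apply/andP; split.
    by have /sb/andP[] := pin n ltac:(by rewrite -nE).
  rewrite -{1}(pidx t ts); apply: ple; last by rewrite -nE.
  by rewrite -ltnS nE index_mem.
have p0 : p 0%N = 0.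
  apply/eqP; rewrite eq_le; apply/andP; split; last by have /sb/andP[] := pin 0%N sz.
  by rewrite -[leRHS](pidx 0 zs); apply: ple => //; rewrite index_mem.
have pS j : p j < p j.+1.
  have [h|h] := ltnP j.+1 (size s); first exact: pS0.
  have [h'|h'] := ltnP j (size s).
    have -> : j = n by apply/eqP; rewrite -eqSS nE eqn_leq h' h.
    by rewrite pn /p -nE ltnn subSnn ltrDl.
  rewrite /p !ltnNge h h' /= ltrD2l ltr_nat subSn// -ltnS nE.
  by rewrite (leq_trans h').
exists p, n; split => //.
- move=> tau j tL jn /andP[h1 h2].
  have js : (j < size s)%N by rewrite -nE ltnW.
  have js1 : (j.+1 < size s)%N by rewrite -nE ltnS.
  have tausL : tau \in s.
    rewrite ms !inE mem_filter tL andbT.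
    have /sb/andP[a1 _] := pin _ js; have /sb/andP[_ a2] := pin _ js1.
    by rewrite (ltW (le_lt_trans a1 h1)) (ltW (lt_le_trans h2 a2)) !orbT.
  move: h1 h2; rewrite -(pidx _ tausL) !grid_lt_iff// ltnS => a1 a2.
  by move: (leq_trans a1 a2); rewrite ltnn.
- move=> tau tL tb; have tausL : tau \in s by rewrite ms !inE mem_filter tL tb !orbT.
  exists (index tau s); last exact: pidx.
  by rewrite -ltnS nE index_mem.
Qed.

End Grid.

Section Chain.
Context d (T : measurableType d) (R : realType) (P : probability T R).
Variables (N : nat) (W : R -> T -> 'M[R[i]]_N) (a b theta : R).
Variable V : 'I_N * 'I_N * bool -> R -> T -> R.
Hypothesis WV : forall t w, 0 <= t -> W t w = \sum_k (V k t w)%:C%C *: ell_basis a b theta k.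
Hypothesis gsV : forall u v, 0 <= u -> u < v ->
  gaussian_step P (filtration_gen P W u) (fun k w => V k v w - V k u w) (v - u).
Variable p : nat -> R.
Hypothesis pS : forall j, p j < p j.+1.
Hypothesis p0 : 0 <= p 0%N.

Definition incr j k w := V k (p j.+1) w - V k (p j) w.
Let G j := filtration_gen P W (p j).

Lemma grid_ge0 j : 0 <= p j.
Proof. by apply: (le_trans p0); exact: grid_le. Qed.

Lemma filtration_genS s t : s <= t -> filtration_gen P W s `<=` <<s filtration_gen P W t >>.
Proof.
move=> st A [hA|nA]; last by apply: sub_sigma_algebra; right.
apply: sub_sigma_algebra; left; move: A hA; apply: sub_smallest_sigma => A.
move=> [[u q] [/= us _] hA]; apply: sub_sigma_algebra; exists (u, q) => //; split => //=.
by move: us; rewrite !in_itv/= => /andP[-> us]; exact: le_trans st.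
Qed.

Lemma chain_gs j : gaussian_step P (G j) (incr j) (p j.+1 - p j).
Proof. by apply: gsV => //; exact: grid_ge0. Qed.

Lemma chain_D0 j : 0 < p j.+1 - p j. Proof. by rewrite subr_gt0. Qed.

Lemma chain_GG j : G j `<=` <<s G j.+1 >>.
Proof. by apply: filtration_genS; exact: ltW. Qed.

Lemma noise_incr j w : ell_noise (incr j) a b theta w = W (p j.+1) w - W (p j) w.
Proof.
rewrite !WV ?grid_ge0// -sumrB; apply: eq_bigr => k _.
by rewrite -scalerBl /incr rmorphB.
Qed.

Lemma mfm_of_sigma (G' : set (set T)) (f : T -> 'M[R[i]]_N) :
  sigma_mx1 f `<=` <<s G' >> -> mfm (f : g_sigma_algebraType G' -> _).
Proof.
move=> h q _ A mA; apply: h; apply: sub_sigma_algebra.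
by exists (tt, q) => //; exists A => //; rewrite setTI.
Qed.

Lemma W_adapted s t : 0 <= s <= t -> mfm (W s : g_sigma_algebraType (filtration_gen P W t) -> _).
Proof.
move=> st q _ A mA; apply: sub_sigma_algebra; left; apply: sub_sigma_algebra.
by exists (s, q) => /=; [rewrite in_itv/=|exists A].
Qed.

Lemma chain_xG j : mfm (ell_noise (incr j) a b theta : g_sigma_algebraType (G j.+1) -> _).
Proof.
rewrite (_ : ell_noise _ _ _ _ = fun w => W (p j.+1) w - W (p j) w); last first.
  by apply/funext => w; exact: noise_incr.
apply: mfmD; first by apply: W_adapted; rewrite grid_ge0 lexx.
by apply: mfmN; apply: W_adapted; rewrite grid_ge0/= ltW.
Qed.

Variable S : simple_process P W.

(** Steps are open on the left, so the value on a cell is read at its right end. With no jump time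
    inside the cell, that value is a coefficient fixed at time [p j] or before. *)
Lemma sp_adapted j n : (forall i j, (i <= sp_size S)%N -> (j < n)%N -> ~ (p j < sp_time S i < p j.+1)) ->
  (j < n)%N -> mfm (sp_eval S (p j.+1) : g_sigma_algebraType (G j) -> _).
Proof.
move=> ref jn; apply: mfm_sum => i.
case E : (sp_time S i < p j.+1 <= sp_time S i.+1); last exact: mfm_cst.
move: E => /andP[h1 h2].
apply: mfm_of_sigma => A hA.
have hc := @sp_coef_adapted _ _ _ _ _ _ S i A hA; move: A hc {hA}.
apply: sub_smallest_sigma; apply: filtration_genS.
rewrite leNgt; apply/negP => h; apply: (ref i j) => //; last by rewrite h h1.
by rewrite ltnW.
Qed.

Lemma sp_integral_grid k n w : p 0%N = 0 ->
  (forall i j, (i <= sp_size S)%N -> (j < n)%N -> ~ (p j < sp_time S i < p j.+1)) -> (k <= n)%N ->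
  sp_integral S (p k) w =
  \sum_(j < k) sp_eval S (p j.+1) w *m ell_noise (incr j) a b theta w.
Proof.
move=> p00 ref; have tge0 i : 0 <= sp_time S i.
  elim: i => [|i IH]; first exact: sp_time_ge0.
  exact: le_trans IH (sp_time_le _ _).
elim: k => [|k IH] kn.
  rewrite big_ord0 /sp_integral big1// => i _; rewrite p00 !min_l ?tge0//.
  by rewrite subrr mulmx0.
rewrite big_ord_recr/= -IH ?(ltnW kn)// -[LHS](subrK (sp_integral S (p k) w)) addrC.
congr (_ + _); rewrite /sp_integral -sumrB /sp_eval mulmx_suml.
apply: eq_bigr => i _; rewrite -mulmxBr noise_incr.
(* A jump time is at most [p k] or at least [p k.+1], so stopping at it keeps the whole increment
   over the cell or none of it. *)
have F m : (m <= sp_size S)%N -> W (Num.min (p k.+1) (sp_time S m)) w - W (Num.min (p k) (sp_time S m)) w =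
    if p k.+1 <= sp_time S m then W (p k.+1) w - W (p k) w else 0.
  move=> ms; case: leP => h.
    by rewrite min_l// (le_trans _ h)// ltW.
  have h' : sp_time S m <= p k.
    by rewrite leNgt; apply/negP => h'; apply: (ref m k ms kn); rewrite h' h.
  by rewrite min_r ?(ltW h)// subrr.
have -> : W (Num.min (p k.+1) (sp_time S i.+1)) w - W (Num.min (p k.+1) (sp_time S i)) w -
    (W (Num.min (p k) (sp_time S i.+1)) w - W (Num.min (p k) (sp_time S i)) w) =
   (W (Num.min (p k.+1) (sp_time S i.+1)) w - W (Num.min (p k) (sp_time S i.+1)) w) -
   (W (Num.min (p k.+1) (sp_time S i)) w - W (Num.min (p k) (sp_time S i)) w).
  by rewrite !opprB addrACA [RHS]addrACA; congr (_ + _); rewrite addrC.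
rewrite !F ?(ltnW (ltn_ord i))//.
case: (leP (p k.+1) (sp_time S i.+1)) => h1; case: (leP (p k.+1) (sp_time S i)) => h2.
- by rewrite subrr mulmx0 mul0mx.
- by rewrite subr0.
- by move: (le_lt_trans (le_trans h2 (sp_time_le _ _)) h1); rewrite ltxx.
- by rewrite subrr mulmx0 mul0mx.
Qed.

Lemma sp_eval_grid j n s w :
  (forall i j, (i <= sp_size S)%N -> (j < n)%N -> ~ (p j < sp_time S i < p j.+1)) -> (j < n)%N ->
  p j < s -> s <= p j.+1 -> sp_eval S s w = sp_eval S (p j.+1) w.
Proof.
move=> ref jn ps sp; apply: eq_bigr => i _; congr (if _ then _ else _).
have h1 m : (m <= sp_size S)%N -> (sp_time S m < s) = (sp_time S m < p j.+1).
  move=> ms; apply/idP/idP => h; first exact: lt_le_trans sp.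
  apply: le_lt_trans ps; rewrite leNgt; apply/negP => h'.
  by apply: (ref m j ms jn); rewrite h' h.
rewrite h1 ?(ltnW (ltn_ord i))//; congr (_ && _).
by rewrite !leNgt h1.
Qed.

End Chain.

Section IntegralMeasurability.
Context d (T : measurableType d) (R : realType) (P : probability T R).
Variables (N : nat) (W : R -> T -> 'M[R[i]]_N).

Lemma sp_diff_measurable (S : simple_process P W) (B : R -> T -> 'M[R[i]]_N) (t : R) w :
  (forall q, {within `[0, +oo[, continuous (fun t => crd q (B t w))}) ->
  measurable_fun `[0, t] (fun s => fro (sp_eval S s w - B s w)).
Proof.
move=> cB; apply: measurable_sum => q; apply: measurable_funX.
rewrite (_ : (fun _ => _) = (fun s => \sum_(i < sp_size S)
    (crd q (sp_coef S i w) * \1_(`]sp_time S i, sp_time S i.+1]%classic) s) - crd q (B s w))); last first.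
  apply/funext => s; rewrite crdD crdN crd_sum; congr (_ - _); apply: eq_bigr => i _.
  rewrite indicE mem_setE in_itv/=; case: ifP => h; rewrite ?mulr1 ?mulr0//.
  exact: crd0.
apply: measurable_funB.
  apply: measurable_sum => i; apply: measurable_funM => //.
apply: subspace_continuous_measurable_fun => //.
apply: continuous_subspaceW (cB q) => x /=; rewrite !in_itv/= => /andP[-> _]//.
Qed.

End IntegralMeasurability.

Section Comparison.
Context d (T : measurableType d) (R : realType) (P : probability T R).
Variables (N : nat) (W : R -> T -> 'M[R[i]]_N) (a b theta : R).
Variable V : 'I_N * 'I_N * bool -> R -> T -> R.
Hypothesis WV : forall t w, 0 <= t -> W t w = \sum_k (V k t w)%:C%C *: ell_basis a b theta k.
Hypothesis gsV : forall u v, 0 <= u -> u < v ->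
  gaussian_step P (filtration_gen P W u) (fun k w => V k v w - V k u w) (v - u).
Variable B : R -> T -> 'M[R[i]]_N.
Hypothesis cB : {ae P, forall w, forall q, {within `[0, +oo[, continuous (fun t => crd q (B t w))}}.

Definition l2err (S : simple_process P W) t w : \bar R :=
  (\int[lebesgue_measure]_(s in `[0%R, t]) (hs2 (sp_eval S s w - B s w)%R)%:E)%E.

Definition refines (p : nat -> R) n (S : simple_process P W) :=
  forall i j, (i <= sp_size S)%N -> (j < n)%N -> ~ (p j < sp_time S i < p j.+1).

Lemma l2err_le (S : simple_process P W) u t w :
  (forall q, {within `[0, +oo[, continuous (fun t => crd q (B t w))}) -> u <= t ->
  (l2err S u w <= l2err S t w)%E.
Proof.
move=> cw ut; apply: ge0_subset_integral => //.
- by apply/measurable_EFinP; exact: sp_diff_measurable.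
- by move=> s _; rewrite lee_fin hs2E fro_ge0.
- by apply: subset_itvl; rewrite bnd_simp.
Qed.

(** Both processes are constant on the cells, so the sum is the integral of their squared distance;
    [B] is inserted between them. *)
Lemma step_energy (S S' : simple_process P W) (p : nat -> R) n w :
  (forall q, {within `[0, +oo[, continuous (fun t => crd q (B t w))}) ->
  (forall j, p j < p j.+1) -> p 0%N = 0 -> refines p n S -> refines p n S' ->
  ((\sum_(j < n) (p j.+1 - p j) * fro (sp_eval S (p j.+1) w - sp_eval S' (p j.+1) w))%:E <=
   2%:E * l2err S (p n) w + 2%:E * l2err S' (p n) w)%E.
Proof.
move=> cw pS p0 rS rS'.
have mm (U : simple_process P W) : measurable_fun `[0, p n] (fun s => fro (sp_eval U s w - B s w)).
  exact: sp_diff_measurable.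
have h := @step_integral R (fun s => 2 * fro (sp_eval S s w - B s w) + 2 * fro (sp_eval S' s w - B s w))
  p (fun j => fro (sp_eval S (p j.+1) w - sp_eval S' (p j.+1) w)) n pS.
rewrite p0 in h; apply: (le_trans (h _ _ _)).
- by apply: measurable_funD; apply: measurable_funM.
- by move=> s; rewrite addr_ge0// mulr_ge0 ?fro_ge0.
- move=> j s jn ps sp.
  rewrite -(sp_eval_grid w rS jn ps sp) -(sp_eval_grid w rS' jn ps sp).
  rewrite -[in leLHS](subrK (B s w) (sp_eval S s w)) -addrA.
  by apply: (le_trans (froD2 _ _)); rewrite lerD2l -[X in _ * X <= _]froN opprB.
under eq_integral do rewrite EFinD !EFinM.
rewrite ge0_integralD//; last 4 first.
- by move=> s _; rewrite -EFinM lee_fin mulr_ge0 ?fro_ge0.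
- by apply: measurable_funeM; apply/measurable_EFinP; exact: mm.
- by move=> s _; rewrite -EFinM lee_fin mulr_ge0 ?fro_ge0.
- by apply: measurable_funeM; apply/measurable_EFinP; exact: mm.
rewrite !ge0_integralZl//.
- by apply/measurable_EFinP; exact: mm.
- by move=> s _; rewrite lee_fin fro_ge0.
- by apply/measurable_EFinP; exact: mm.
- by move=> s _; rewrite lee_fin fro_ge0.
Qed.

(** On a common grid the difference of two simple integrals is a stochastic sum, controlled at all
    nodes by [lenglart_max]. The times of [L] are made nodes, and the bound does not depend on
    [L]. *)
Lemma sp_cmp (S S' : simple_process P W) t (L : seq R) dl eta e : 0 < t -> 0 < dl -> 0 < eta ->
  small P [set w | (dl%:E <= l2err S t w)%E] e -> small P [set w | (dl%:E <= l2err S' t w)%E] e ->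
  small P [set w | exists u, [/\ u \in L, 0 <= u <= t &
     eta <= fro (sp_integral S u w - sp_integral S' u w)]]
    (0 + (e + e) + basis_mass N a b theta * (4 * dl) / eta).
Proof.
move=> t0 dl0 eta0 h h'.
pose L' := L ++ [seq sp_time S i | i <- iota 0 (sp_size S).+1]
  ++ [seq sp_time S' i | i <- iota 0 (sp_size S').+1].
have [p [n [pS p0 pn ref pL]]] := grid_exists L' t0.
have rS : refines p n S.
  move=> i j iS jn; apply: ref => //; rewrite !mem_cat; apply/orP; right; apply/orP; left.
  by apply: map_f; rewrite mem_iota.
have rS' : refines p n S'.
  move=> i j iS jn; apply: ref => //; rewrite !mem_cat; apply/orP; right; apply/orP; right.
  by apply: map_f; rewrite mem_iota.
have p0' : 0 <= p 0%N by rewrite p0.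
pose a0 j w := if (j < n)%N then sp_eval S (p j.+1) w - sp_eval S' (p j.+1) w else 0.
have ma j : mfm (a0 j : g_sigma_algebraType (filtration_gen P W (p j)) -> _).
  rewrite /a0; case: ltnP => jn; last exact: mfm_cst.
  by apply: mfmD; [|apply: mfmN]; apply: sp_adapted jn.
have hs : small P [set w | 4 * dl < \sum_(j < n) (p j.+1 - p j) * fro (a0 j w)] (0 + (e + e)).
  apply: smallS (smallU (small_ae cB) (smallU h h')) => w /= hw.
  apply: contrapT => /not_orP[/contrapT cw /not_orP[/negP + /negP]].
  rewrite -!ltNge => h1 h2; have := step_energy cw pS p0 rS rS'.
  rewrite pn leNgt => /negP; apply.
  apply: (@le_lt_trans _ _ (4 * dl)%:E); last first.
    rewrite lte_fin; move: hw; congr (_ < _); apply: eq_bigr => j _.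
    by rewrite /a0 ltn_ord.
  have -> : (4 * dl)%:E = (2%:E * dl%:E + 2%:E * dl%:E)%E.
    by rewrite -!EFinM -EFinD; congr (_%:E); ring.
  have l2 : (0%R <= 2%:E :> \bar R)%E by rewrite lee_fin.
  by apply: leeD; apply: (lee_wpmul2l l2); exact: ltW.
have d4 : 0 <= 4 * dl by rewrite mulr_ge0// ltW.
have := lenglart_max (chain_gs gsV pS p0') (chain_D0 pS) (@chain_GG _ _ _ P _ W _ pS)
  (chain_xG WV pS p0') ma d4 eta0 hs.
apply: smallS => w /= [u [uL ut hu]].
have [k kn pk] : exists2 k, (k <= n)%N & p k = u by apply: pL => //; rewrite mem_cat uL.
exists k => //; move: hu; congr (_ <= fro _).
rewrite -pk (sp_integral_grid WV pS p0' _ p0 rS kn) (sp_integral_grid WV pS p0' _ p0 rS' kn).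
rewrite -sumrB; apply: eq_bigr => j _; rewrite -mulmxBl /a0 ifT//.
exact: leq_trans kn.
Qed.

Lemma smallW A (e e' : R) : e <= e' -> small P A e -> small P A e'.
Proof. by move=> ee [F [mF AF PF]]; exists F; split => //; apply: (le_trans PF); rewrite lee_fin. Qed.

Lemma l2err_mono (S : simple_process P W) t (dl dl' e e' : R) : dl <= dl' -> e <= e' ->
  small P [set w | (dl%:E <= l2err S t w)%E] e -> small P [set w | (dl'%:E <= l2err S t w)%E] e'.
Proof.
by move=> dd ee h; apply: smallW ee _; apply: smallS h => w /=; apply: le_trans; rewrite lee_fin.
Qed.

(** Chosen so that the last term of [sp_cmp], at level eta/4, is at most e/2. *)
Definition cmp_radius (eta e : R) := e * eta / (32 * (basis_mass N a b theta + 1)).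

Lemma cmp_radius_gt0 eta e : 0 < eta -> 0 < e -> 0 < cmp_radius eta e.
Proof.
move=> h1 h2; rewrite divr_gt0 ?mulr_gt0//.
by rewrite ltr_wpDl// basis_mass_ge0.
Qed.

Lemma sp_cmp_radius (S S' : simple_process P W) t (L : seq R) eta e : 0 < t -> 0 < eta -> 0 < e ->
  small P [set w | ((cmp_radius eta e)%:E <= l2err S t w)%E] (e / 8) ->
  small P [set w | ((cmp_radius eta e)%:E <= l2err S' t w)%E] (e / 8) ->
  small P [set w | exists u, [/\ u \in L, 0 <= u <= t &
     eta / 4 <= fro (sp_integral S u w - sp_integral S' u w)]] (e / 2 + e / 4).
Proof.
move=> t0 eta0 e0 h h'.
have e4 : 0 < eta / 4 by exact: divr_gt0.
apply: smallW (sp_cmp L t0 (cmp_radius_gt0 eta0 e0) e4 h h').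
set M := basis_mass _ _ _ _; have M0 : 0 <= M by exact: basis_mass_ge0.
have -> : M * (4 * cmp_radius eta e) / (eta / 4) = (e / 2) * (M / (M + 1)).
  rewrite /cmp_radius -/M; field.
  by rewrite (gt_eqF eta0) gt_eqF// ltr_wpDl.
rewrite add0r (_ : e / 8 + e / 8 = e / 4); last by field.
rewrite addrC lerD2r ler_piMr ?divr_ge0 ?(ltW e0)//.
by rewrite ler_pdivrMr ?mul1r ?lerDl// ltr_wpDl.
Qed.

Variable Z : R -> T -> 'M[R[i]]_N.
Hypothesis itoZ : forall t, 0 <= t -> is_ito_integral P W B t (Z t).

Lemma sp_near t (dl eta e : R) : 0 <= t -> 0 < dl -> 0 < eta -> 0 < e ->
  exists S : simple_process P W, small P [set w | (dl%:E <= l2err S t w)%E] e /\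
    small P [set w | eta <= fro (sp_integral S t w - Z t w)] e.
Proof.
move=> t0 dl0 eta0 e0; have [S [h1 h2]] := itoZ t0.
have [n1 H1] := cvg0_small h1 dl0 e0; have [n2 H2] := cvg0_small h2 eta0 e0.
exists (S (maxn n1 n2)); split; first by apply: H1; exact: leq_maxl.
by apply: smallS (H2 (maxn n1 n2) (leq_maxr _ _)) => w /=; rewrite lee_fin.
Qed.

Lemma fro_triangle (x y z : 'M[R[i]]_N) (eta : R) : eta <= fro (x - z) ->
  eta / 4 <= fro (x - y) \/ eta / 4 <= fro (y - z).
Proof.
move=> h; have [h1|h1] := leP (eta / 4) (fro (x - y)); first by left.
have [h2|h2] := leP (eta / 4) (fro (y - z)); first by right.
have := froD2 (x - y) (y - z); rewrite addrA subrK => h3; exfalso; lra.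
Qed.

Lemma sp_integral0 (S : simple_process P W) w : sp_integral S 0 w = 0.
Proof.
have tge0 i : 0 <= sp_time S i.
  elim: i => [|i IH]; first exact: sp_time_ge0.
  exact: le_trans IH (sp_time_le _ _).
by apply: big1 => i _; rewrite !min_l// subrr mulmx0.
Qed.

(** [Z u] comes with its own approximating sequence, a priori unrelated to that of [Z t]. A member
    of it is compared with [S] on [0, u], where [S] is as accurate as on [0, t]. *)
Lemma sp_pointwise (S : simple_process P W) t u (eta e : R) : 0 <= u <= t -> 0 < eta -> 0 < e ->
  small P [set w | ((cmp_radius eta e)%:E <= l2err S t w)%E] (e / 8) ->
  small P [set w | eta <= fro (sp_integral S u w - Z u w)] e.
Proof.
move=> /andP[u0 ut] eta0 e0 hS.
have e8 : 0 < e / 8 by exact: divr_gt0.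
have e4 : 0 < eta / 4 by exact: divr_gt0.
have [S' [h1 h2]] := sp_near u0 (cmp_radius_gt0 eta0 e0) e4 e8.
move: u0; rewrite le_eqVlt => /predU1P[u0|u0].
  apply: smallW (smallS _ h2); first by lra.
  by move=> w /=; rewrite -u0 !sp_integral0; apply: le_trans; lra.
have hS' : small P [set w | ((cmp_radius eta e)%:E <= l2err S u w)%E] (0 + e / 8).
  apply: smallS (smallU (small_ae cB) hS) => w /= h.
  have [cw|] := pselect (forall q, {within `[0, +oo[, continuous (fun t => crd q (B t w))}).
    by right; apply: (le_trans h); exact: l2err_le.
  by left.
rewrite add0r in hS'.
apply: smallW (smallS _ (smallU (sp_cmp_radius [:: u] u0 eta0 e0 hS' h1) h2)); first by lra.
move=> w /= /(fro_triangle (sp_integral S' u w))[h|h]; [left|by right].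
by exists u; split => //; rewrite ?inE// (ltW u0) lexx.
Qed.

(* The list is quantified after [S]: on a given list, [S] is compared along a
   common grid with a second simple process, so accurate that a union bound over
   the list is affordable. *)
Lemma sp_uniform t (dl eta e : R) : 0 < t -> 0 < dl -> 0 < eta -> 0 < e ->
  exists S : simple_process P W, small P [set w | (dl%:E <= l2err S t w)%E] e /\
    forall L : seq R, small P [set w | exists u, [/\ u \in L, 0 <= u <= t &
      eta <= fro (sp_integral S u w - Z u w)]] e.
Proof.
move=> t0 dl0 eta0 e0.
have e2 : 0 < e / 2 by exact: divr_gt0.
have e16 : 0 < e / 2 / 8 by exact: divr_gt0.
have r0 := cmp_radius_gt0 eta0 e2.
have m0 : 0 < Num.min dl (cmp_radius eta (e / 2)) by rewrite lt_min dl0.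
have [S [hS _]] := sp_near (ltW t0) m0 eta0 e16.
exists S; split; first by apply: l2err_mono hS; rewrite ?ge_min ?lexx//; lra.
move=> L; pose e1 := e / 4 / (size L).+1%:R.
have e10 : 0 < e1 by rewrite !divr_gt0.
have e18 : 0 < Num.min (e1 / 8) (e / 2 / 8) by rewrite lt_min e16 divr_gt0.
have e4 : 0 < eta / 4 by exact: divr_gt0.
have r1 : 0 < Num.min (cmp_radius (eta / 4) e1) (cmp_radius eta (e / 2)).
  by rewrite lt_min r0 cmp_radius_gt0.
have [S' [hS' _]] := sp_near (ltW t0) r1 eta0 e18.
have h1 : small P [set w | exists u, [/\ u \in L, 0 <= u <= t &
     eta / 4 <= fro (sp_integral S u w - sp_integral S' u w)]] (e / 2 / 2 + e / 2 / 4).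
  apply: (sp_cmp_radius L t0 eta0 e2); [apply: l2err_mono hS|apply: l2err_mono hS'];
    by rewrite ?ge_min ?lexx ?orbT.
have h2 : small P [set w | exists2 i, (i < size L)%N & 0 <= nth 0 L i <= t /\
     eta / 4 <= fro (sp_integral S' (nth 0 L i) w - Z (nth 0 L i) w)] ((size L)%:R * e1).
  apply: small_bigU => i iL.
  have [hi|hi] := boolP (0 <= nth 0 L i <= t).
    apply: smallS (@sp_pointwise S' t (nth 0 L i) (eta / 4) e1 hi e4 e10 _); first by move=> w /= [].
    by apply: l2err_mono hS'; rewrite ge_min lexx.
  have h0 : small P set0 e1 by apply: small_of_measure => //; rewrite measure0 lee_fin ltW.
  by apply: smallS h0 => w /= [].
apply: smallW (smallS _ (smallU h1 h2)).
  have : (size L)%:R * e1 <= e / 4; last by lra.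
  rewrite /e1 mulrCA ler_piMr ?divr_ge0 ?(ltW e0)//.
  by rewrite ler_pdivrMr// mul1r ler_nat.
move=> w /= [u [uL ut]] /(fro_triangle (sp_integral S' u w))[h|h]; [left|right].
  by exists u.
by exists (index u L); rewrite ?index_mem ?nth_index.
Qed.

End Comparison.

Section WeightedSum.
Variable R : realType.

(** Cauchy-Schwarz, each weight being split into two square roots. *)
Lemma fro_weighted_sum N n (D : nat -> R) (x : nat -> 'M[R[i]]_N) : (forall j, 0 <= D j) ->
  fro (\sum_(j < n) (D j)%:C%C *: x j) <= (\sum_(j < n) D j) * \sum_(j < n) D j * fro (x j).
Proof.
move=> D0; have sD j : Num.sqrt (D j) ^+ 2 = D j by rewrite sqr_sqrtr.
have -> : \sum_(j < n) D j * fro (x j) = \sum_q \sum_(j < n) D j * crd q (x j) ^+ 2.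
  by rewrite exchange_big/=; apply: eq_bigr => j _; rewrite /fro mulr_sumr.
rewrite mulr_sumr; apply: ler_sum => q _.
have := cauchy_schwarz (fun j : 'I_n => Num.sqrt (D j)) (fun j : 'I_n => Num.sqrt (D j) * crd q (x j)).
rewrite [X in _ <= X * _ -> _](eq_bigr (fun j : 'I_n => D j)) => [|j _]; last by rewrite sD.
rewrite [X in _ <= _ * X -> _](eq_bigr (fun j : 'I_n => D j * crd q (x j) ^+ 2)); last first.
  by move=> j _; rewrite exprMn sD.
congr (_ ^+ 2 <= _); rewrite crd_sum; apply: eq_bigr => j _.
by rewrite mulrA -expr2 sD crd_rZ.
Qed.

End WeightedSum.

(** * Stability of the Euler recursion *)

Section Recursion.
Context d (T : measurableType d) (R : realType) (P : probability T R).
Variables (N : nat) (G : nat -> set (set T)) (x : nat -> 'I_N * 'I_N * bool -> T -> R).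
Variables (D : nat -> R) (a b theta : R) (z : R[i]).
Local Notation C := R[i].
Hypothesis gs : forall j, gaussian_step P (G j) (x j) (D j).
Hypothesis D0 : forall j, 0 < D j.
Hypothesis GG : forall j, G j `<=` <<s G j.+1 >>.
Local Notation noise j := (ell_noise (x j) a b theta).
Hypothesis xG : forall j, mfm (noise j : g_sigma_algebraType (G j.+1) -> _).
Local Notation drift j := (z * (D j)%:C%C).
Local Notation mass := (basis_mass N a b theta).

Definition growth : R := 1 + 4 * sqm z + 2 * mass.

Lemma growth_ge0 : 0 <= growth.
Proof. by rewrite !addr_ge0// mulr_ge0 ?sqm_ge0 ?basis_mass_ge0. Qed.

(* [perturbed xi] is the difference between [euler_integral s] and the Euler
   product when [xi j] is [s j - euler_integral s j]. *)
Fixpoint perturbed (xi : nat -> T -> 'M[C]_N) j w : 'M[C]_N :=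
  if j is j'.+1 then
    perturbed xi j' w + drift j' *: (perturbed xi j' w + xi j' w)
      + (perturbed xi j' w + xi j' w) *m noise j' w
  else 0.

(** The discrete integral equation with [s] as integrand; a sequence equal to its own Euler integral
    is the Euler product. *)
Fixpoint euler_integral (s : nat -> T -> 'M[C]_N) j w : 'M[C]_N :=
  if j is j'.+1 then euler_integral s j' w + drift j' *: s j' w + s j' w *m noise j' w
  else 1%:M.

Lemma mfm_scale (z' : C) (f : T -> 'M[C]_N) j : mfm (f : g_sigma_algebraType (G j) -> _) ->
  mfm ((fun w => z' *: f w) : g_sigma_algebraType (G j) -> _).
Proof.
move=> mf; under eq_fun do rewrite -mul_scalar_mx; apply: mfmM => //; exact: mfm_cst.
Qed.

Lemma perturbed_adapted (xi : nat -> T -> 'M[C]_N) j : (forall j, mfm (xi j : g_sigma_algebraType (G j) -> _)) ->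
  mfm (perturbed xi j : g_sigma_algebraType (G j) -> _).
Proof.
move=> mx; elim: j => [|j IH]; first exact: mfm_cst.
have up f : mfm (f : g_sigma_algebraType (G j) -> 'M[C]_N) -> mfm (f : g_sigma_algebraType (G j.+1) -> _).
  by move=> mf q; apply: adapted_next.
apply: mfmD; last by apply: mfmM => //; apply: up; exact: mfmD.
by apply: up; apply: mfmD => //; apply: mfm_scale; exact: mfmD.
Qed.

Lemma euler_integral_adapted (s : nat -> T -> 'M[C]_N) j : (forall j, mfm (s j : g_sigma_algebraType (G j) -> _)) ->
  mfm (euler_integral s j : g_sigma_algebraType (G j) -> _).
Proof.
move=> mx; elim: j => [|j IH]; first exact: mfm_cst.
have up f : mfm (f : g_sigma_algebraType (G j) -> 'M[C]_N) -> mfm (f : g_sigma_algebraType (G j.+1) -> _).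
  by move=> mf q; apply: adapted_next.
apply: mfmD; last by apply: mfmM => //; apply: up.
by apply: up; apply: mfmD => //; apply: mfm_scale.
Qed.

(** Young's inequality with parameter [D j]: the squared drift is of order (D j)^2, so even divided
    by [D j] it costs only a factor 1 + O(D j). *)
Lemma perturbed_step_bound (f xi : 'M[C]_N) j : D j <= 1 ->
  fro (f + drift j *: (f + xi)) + D j * mass * fro (f + xi) <=
  (1 + growth * D j) * fro f + growth * (D j * fro xi).
Proof.
move=> D1; have M0 : 0 <= mass by exact: basis_mass_ge0.
have h1 := froD_le f (drift j *: (f + xi)) (D0 j).
have h2 := froD2 f xi.
rewrite froZ sqmM sqm_real in h1.
have E : (1 + (D j)^-1) * (sqm z * D j ^+ 2 * fro (f + xi)) = (1 + D j) * D j * sqm z * fro (f + xi).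
  by field; rewrite gt_eqF.
rewrite E {E} in h1.
have dj := D0 j; have zz := sqm_ge0 z.
have h3 : (1 + D j) * D j * sqm z * fro (f + xi) + D j * mass * fro (f + xi) <=
   D j * (2 * sqm z + mass) * (2 * fro f + 2 * fro xi).
  apply: (@le_trans _ _ (D j * (2 * sqm z + mass) * fro (f + xi))).
    have -> : D j * (2 * sqm z + mass) = 2 * D j * sqm z + D j * mass by ring.
    rewrite -mulrDl ler_wpM2r ?fro_ge0// lerD2r ler_wpM2r// ler_wpM2r ?(ltW dj)//.
    by lra.
  by rewrite ler_wpM2l// mulr_ge0 ?(ltW dj)// addr_ge0// mulr_ge0.
have F0 := fro_ge0 f; have X0 := fro_ge0 xi.
have X1 : 0 <= D j * fro xi by rewrite mulr_ge0// ltW.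
apply: (@le_trans _ _ ((1 + D j) * fro f + D j * (2 * sqm z + mass) * (2 * fro f + 2 * fro xi))).
  by move: h1 h3; lra.
rewrite /growth -subr_ge0; set F := fro f; set X := fro xi.
by rewrite [X in 0 <= X](_ : _ = D j * X) //; ring.
Qed.

(** Discrete Gronwall inequality: [ito_step], then [perturbed_step_bound]. The pathwise bound on the
    energy of [xi] also makes the expectations [X j] finite, so the induction runs in the reals. *)
Lemma perturbed_second_moment (xi : nat -> T -> 'M[C]_N) n (dl : R) :
  (forall j, mfm (xi j : g_sigma_algebraType (G j) -> _)) -> 0 <= dl ->
  (forall w, \sum_(j < n) D j * fro (xi j w) <= dl) -> (forall j, (j < n)%N -> D j <= 1) ->
  (\int[P]_w (fro (perturbed xi n w))%:E <=
   (expR (growth * \sum_(j < n) D j) * growth * dl)%:E)%E.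
Proof.
move=> mx dl0 hdl D1.
have mxT j : mfm (xi j) by have h := adapted_measurable gs (mx j); exact: h.
have mfT j : mfm (perturbed xi j) by exact: (adapted_measurable gs (@perturbed_adapted xi j mx)).
pose X j := (\int[P]_w (D j * fro (xi j w))%:E)%E.
have mDx j : measurable_fun setT (fun w => (D j * fro (xi j w))%:E).
  by apply/measurable_EFinP; apply: measurable_funM => //; exact: mfm_fro.
have Dx0 j w : (0 <= (D j * fro (xi j w))%:E)%E by rewrite lee_fin mulr_ge0 ?fro_ge0// ltW.
have X0 j : (0 <= X j)%E by exact: integral_ge0.
have sX : (\sum_(j < n) X j <= dl%:E)%E.
  rewrite /X -ge0_integral_sum//.
  apply: (@le_trans _ _ (\int[P]_w dl%:E)%E); last first.
    by rewrite integral_cst// -[leRHS]mule1 lee_wpmul2l ?probability_le1// lee_fin.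
  apply: ge0_le_integral => //.
  - by move=> w _; exact: sume_ge0.
  - exact: emeasurable_sum.
  - by move=> w _; rewrite sumEFin lee_fin.
have Xfin j : (j < n)%N -> (X j = (fine (X j))%:E)%E.
  move=> jn; rewrite fineK// ge0_fin_numE// (le_lt_trans _ (ltry dl))//.
  by apply: le_trans sX; rewrite (bigD1 (Ordinal jn))//= leeDl// sume_ge0.
have fX0 j : 0 <= fine (X j) by exact: fine_ge0.
have g0 := growth_ge0.
have key k : (k <= n)%N -> (\int[P]_w (fro (perturbed xi k w))%:E <=
   (expR (growth * \sum_(j < k) D j) * growth * \sum_(j < k) fine (X j))%:E)%E.
  elim: k => [|k IH] kn.
    under eq_integral do rewrite fro0.
    by rewrite integral0 !big_ord0 !mulr0.
  have mfr : measurable_fun setT (fun w => (fro (perturbed xi k w))%:E).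
    by apply/measurable_EFinP; exact: mfm_fro.
  have ma : mfm ((fun w => perturbed xi k w + xi k w) : g_sigma_algebraType (G k) -> _).
    by apply: mfmD => //; exact: perturbed_adapted.
  have mb : mfm ((fun w => perturbed xi k w + drift k *: (perturbed xi k w + xi k w)) : g_sigma_algebraType (G k) -> _).
    by apply: mfmD; [exact: perturbed_adapted|exact: mfm_scale].
  have h := @ito_step _ _ _ _ _ _ _ _ a b theta gs D0 k _ _ mb ma.
  apply: (le_trans h).
  apply: (@le_trans _ _ ((1 + growth * D k)%:E * (\int[P]_w (fro (perturbed xi k w))%:E) + growth%:E * X k)%E).
    have c0 : 0 <= 1 + growth * D k by rewrite addr_ge0// mulr_ge0// ltW.
    rewrite /X -!ge0_integralZl//; last by move=> w _; rewrite lee_fin fro_ge0.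
    rewrite -ge0_integralD//; last 4 first.
    - by move=> w _; rewrite -EFinM lee_fin mulr_ge0// fro_ge0.
    - exact: measurable_funeM.
    - by move=> w _; rewrite mule_ge0// lee_fin.
    - exact: measurable_funeM.
    apply: ge0_le_integral => //.
    - move=> w _; rewrite lee_fin addr_ge0 ?fro_ge0// !mulr_ge0 ?fro_ge0 ?basis_mass_ge0//.
      by rewrite ltW.
    - apply/measurable_EFinP; apply: measurable_funD.
        by have h' := adapted_measurable gs mb; apply: mfm_fro; exact: h'.
      by apply: measurable_funM => //; have h' := adapted_measurable gs ma; apply: mfm_fro; exact: h'.
    - by apply: emeasurable_funD; exact: measurable_funeM.
    - move=> w _; rewrite -!EFinM -EFinD lee_fin; apply: perturbed_step_bound; exact: D1.
  rewrite Xfin//.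
  apply: (@le_trans _ _ ((1 + growth * D k)%:E *
     (expR (growth * \sum_(j < k) D j) * growth * \sum_(j < k) fine (X j))%:E + growth%:E * (fine (X k))%:E)%E).
    rewrite leeD2r// lee_wpmul2l//; first by rewrite lee_fin addr_ge0// mulr_ge0// ltW.
    by apply: IH; exact: ltnW.
  rewrite -!EFinM -EFinD lee_fin !big_ord_recr/=.
  set F := \sum_(j < k) fine (X j); set S := \sum_(j < k) D j.
  have F0 : 0 <= F by exact: sumr_ge0.
  have S0 : 0 <= S by apply: sumr_ge0 => j _; exact: ltW.
  have Dk : 0 <= D k by exact: ltW.
  move: (fX0 k) g0 Dk; move: growth (fine (X k)) (D k) => g f u f0 g0 u0.
  have E1 : 1 <= expR (g * (S + u)) by apply: (le_trans _ (expR_ge1Dx _)); rewrite lerDl mulr_ge0// addr_ge0.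
  rewrite [leRHS]mulrDr; apply: lerD; last first.
    by rewrite ler_wpM2r// ler_peMl.
  rewrite mulrA ler_wpM2r// mulrA ler_wpM2r// mulrDr expRD mulrC ler_wpM2l ?expR_ge0//.
  exact: expR_ge1Dx.
apply: (le_trans (key n (leqnn n))).
rewrite lee_fin ler_wpM2l ?mulr_ge0 ?expR_ge0//.
rewrite -lee_fin -sumEFin; apply: le_trans sX; apply: lee_sum => j _.
by rewrite -Xfin.
Qed.

(** The gap obeys the recursion of [perturbed], driven by the defect [s j - euler_integral s j].
    Truncating the defect provides the pathwise energy bound, and where nothing has been truncated
    the two recursions coincide. *)
Lemma euler_gap (s : nat -> T -> 'M[C]_N) n (dl eta e : R) :
  (forall j, mfm (s j : g_sigma_algebraType (G j) -> _)) -> 0 <= dl -> 0 < eta ->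
  (forall j, (j < n)%N -> D j <= 1) ->
  small P [set w | dl < \sum_(j < n) D j * fro (s j w - euler_integral s j w)] e ->
  small P [set w | eta <= fro (euler_integral s n w - euler_prod x D a b theta z n w)]
    (e + expR (growth * \sum_(j < n) D j) * growth * dl / eta).
Proof.
move=> ms dl0 eta0 D1 he.
pose xi j w := s j w - euler_integral s j w.
have mxi j : mfm (xi j : g_sigma_algebraType (G j) -> _).
  by apply: mfmD => //; apply: mfmN; exact: euler_integral_adapted.
pose y := truncated D xi dl.
have my j : mfm (y j : g_sigma_algebraType (G j) -> _) by exact: truncated_adapted.
have hs : small P [set w | eta <= fro (perturbed y n w)]
    (expR (growth * \sum_(j < n) D j) * growth * dl / eta).
  apply: markov_small => //.
  - by apply: mfm_fro; exact: (adapted_measurable gs (@perturbed_adapted y n my)).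
  - by move=> w; exact: fro_ge0.
  - by apply: perturbed_second_moment => // w; exact: truncated_energy.
apply: smallS (smallU he hs) => w /= hw.
have [h|h] := leP (\sum_(j < n) D j * fro (s j w - euler_integral s j w)) dl; last by left.
right; move: hw; congr (_ <= fro _).
have key k : (k <= n)%N -> euler_integral s k w - euler_prod x D a b theta z k w = perturbed y k w.
  elim: k => [|k IH] kn; first by rewrite /= subrr.
  have -> : perturbed y k.+1 w = perturbed y k w + drift k *: (perturbed y k w + y k w)
      + (perturbed y k w + y k w) *m noise k w by [].
  rewrite -IH ?(ltnW kn)// /y (truncated_eq (n := n) D0)// /xi.
  set u := euler_integral s k w; set m := euler_prod x D a b theta z k w.
  have -> : u - m + (s k w - u) = s k w - m by rewrite addrC addrA subrK.
  have -> : euler_integral s k.+1 w = u + drift k *: s k w + s k w *m noise k w by [].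
  have -> : euler_prod x D a b theta z k.+1 w = m + m *m noise k w + drift k *: m.
    by rewrite /= /euler_step !mulmxDr mulmx1 mul_mx_scalar addrA.
  rewrite scalerBr mulmxBl !opprD !addrA.
  by rewrite -!addrA; congr (_ + _); rewrite !addrA;
    rewrite [LHS](ACl (3*1*5*2*4))/=.
exact: key.
Qed.

End Recursion.

Section EulerLimit.
Context d (T : measurableType d) (R : realType) (P : probability T R).
Variables (N : nat) (W : R -> T -> 'M[R[i]]_N) (a b theta : R).
Variable V : 'I_N * 'I_N * bool -> R -> T -> R.
Hypothesis WV : forall t w, 0 <= t -> W t w = \sum_k (V k t w)%:C%C *: ell_basis a b theta k.
Hypothesis gsV : forall u v, 0 <= u -> u < v ->
  gaussian_step P (filtration_gen P W u) (fun k w => V k v w - V k u w) (v - u).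
Variable B : R -> T -> 'M[R[i]]_N.
Hypothesis cB : {ae P, forall w, forall q, {within `[0, +oo[, continuous (fun t => crd q (B t w))}}.
Variables (Z : R -> T -> 'M[R[i]]_N) (z : R[i]).
Hypothesis itoZ : forall t, 0 <= t -> is_ito_integral P W B t (Z t).
Hypothesis eqB : forall t, 0 <= t ->
  {ae P, forall w, B t w = 1%:M + Z t w + z *: time_integral B t w}.
Hypothesis mB0 : forall t, 0 <= t -> mfm (B t).
Local Notation steps p := (fun j : nat => p j.+1 - p j).
Local Notation coords := (#|{: 'I_N * 'I_N * bool}|%:R : R).

Lemma time_integral_crd q t w : crd q (time_integral B t w) =
  Rintegral lebesgue_measure `[0, t] (fun s => crd q (B s w)).
Proof. by rewrite /crd !mxE; case: q.2. Qed.

Lemma fro_crd_le (A : 'M[R[i]]_N) (x : R) : 0 <= x -> (forall q, `|crd q A| <= x) ->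
  fro A <= coords * x ^+ 2.
Proof.
move=> x0 h; apply: (@le_trans _ _ (\sum_(q : 'I_N * 'I_N * bool) x ^+ 2)).
  by apply: ler_sum => q _; rewrite -real_normK ?num_real// lerXn2r ?nnegrE.
by rewrite sumr_const mulr_natl.
Qed.

Lemma riemann_gap (p : nat -> R) n w (om : R) q k :
  (forall q, {within `[0, +oo[, continuous (fun t => crd q (B t w))}) ->
  (forall j, p j < p j.+1) -> p 0%N = 0 ->
  (forall q j s, (j < n)%N -> p j <= s -> s <= p j.+1 -> `|crd q (B s w) - crd q (B (p j) w)| <= om) ->
  (k <= n)%N ->
  `|crd q (time_integral B (p k) w - \sum_(j < k) (p j.+1 - p j)%:C%C *: B (p j) w)| <= om * p k.
Proof.
move=> cw pS p0 hm; elim: k => [|k IH] kn.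
  rewrite big_ord0 subr0 time_integral_crd p0 set_itv1 Rintegral_set1 normr0 mulr0//.
have pk : 0 <= p k by rewrite -p0; exact: grid_le.
have := Rintegral_increment (e := om) (c := crd q (B (p k) w)) (cw q) pk (ltW (pS k)) (hm q k ^~ kn).
have := IH (ltnW kn); rewrite big_ord_recr/= !crdD !crdN crdD crd_rZ !time_integral_crd.
set A := Rintegral _ _ _; set A' := Rintegral _ _ _; set S := crd q _; set y := crd q _ => h1 h2.
have -> : A' - (S + (p k.+1 - p k) * y) = (A - S) + (A' - A - (p k.+1 - p k) * y) by ring.
apply: (le_trans (ler_normD _ _)).
have -> : om * p k.+1 = om * p k + om * (p k.+1 - p k) by ring.
exact: lerD.
Qed.

Lemma euler_integralE (x : nat -> 'I_N * 'I_N * bool -> T -> R) (D : nat -> R) s k w :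
  euler_integral x D a b theta z s k w = 1%:M + \sum_(j < k) s j w *m ell_noise (x j) a b theta w
    + z *: \sum_(j < k) (D j)%:C%C *: s j w.
Proof.
elim: k => [|k IH]; first by rewrite !big_ord0 scaler0 !addr0.
rewrite /= -/(euler_integral _ _ _ _ _ _ _ _ _) IH !big_ord_recr/= scalerDr scalerA.
by rewrite !addrA [LHS](ACl (1*2*5*3*4))/=.
Qed.

(** The leading 2 pays for the stochastic integral. In the drift, 2 t^2 is the Riemann sum error and
    4 t (1 + t) the replacement of B by the simple process. [energy_const] adds the distance of that
    process to B. *)
Definition gap_const (t : R) := 2 + 2 * sqm z * (2 * t ^+ 2 + 4 * t * (1 + t)).
Definition energy_const (t : R) := 4 * (1 + t) + 2 * t * gap_const t.

(** A pathwise statement, for outcomes outside the exceptional events. Comparing the integral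
    equation of B with its discrete version shows that [s], which is close to B, is also close to
    its own Euler integral. *)
Lemma euler_integral_gap (S : simple_process P W) p n w (ka om : R) :
  (forall q, {within `[0, +oo[, continuous (fun t => crd q (B t w))}) ->
  (forall j, p j < p j.+1) -> p 0%N = 0 -> refines p n S -> 0 <= om -> coords * om ^+ 2 <= ka ->
  (forall q j s, (j < n)%N -> p j <= s -> s <= p j.+1 -> `|crd q (B s w) - crd q (B (p j) w)| <= om) ->
  (l2err B S (p n) w <= ka%:E)%E ->
  (forall k, (k <= n)%N -> fro (sp_integral S (p k) w - Z (p k) w) <= ka) ->
  (forall k, (k <= n)%N -> B (p k) w = 1%:M + Z (p k) w + z *: time_integral B (p k) w) ->
  let s j w := if (j < n)%N then sp_eval S (p j.+1) w else 0 in
  fro (B (p n) w - euler_integral (incr V p) (steps p) a b theta z s n w) <= ka * gap_const (p n) /\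
  \sum_(j < n) (p j.+1 - p j) * fro (s j w - euler_integral (incr V p) (steps p) a b theta z s j w)
    <= ka * energy_const (p n).
Proof.
move=> cw pS p0 rS om0 hka hm hl hZ heq s.
have pge0 k : 0 <= p k by rewrite -p0; exact: grid_le.
have ple k : (k <= n)%N -> p k <= p n by exact: grid_le.
have D0 j : 0 <= p j.+1 - p j by rewrite subr_ge0 ltW.
have sumD k : \sum_(j < k) (p j.+1 - p j) = p k.
  elim: k => [|k IH]; first by rewrite big_ord0 p0.
  by rewrite big_ord_recr/= IH addrC subrK.
have ka0 : 0 <= ka by apply: le_trans hka; rewrite mulr_ge0 ?sqr_ge0.
set t := p n in hl *; have t0 : 0 <= t by exact: pge0.
have E1 : \sum_(j < n) (p j.+1 - p j) * fro (s j w - B (p j) w) <= ka * (2 * (1 + t)).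
  (* By [froD2] and the modulus of continuity, half the squared distance to the left-end value,
     minus [ka], is at most the squared distance at any time of the cell. *)
  have h := @step_integral R (fun s => fro (sp_eval S s w - B s w)) p
    (fun j => fro (sp_eval S (p j.+1) w - B (p j) w) / 2 - ka) n pS.
  rewrite p0 in h; have /(_ _ _ _)/le_trans/(_ hl) := h.
  rewrite lee_fin => /(_ _ _ _) h'.
  have : \sum_(j < n) (p j.+1 - p j) * (fro (sp_eval S (p j.+1) w - B (p j) w) / 2 - ka) <= ka.
    apply: h' => //; first exact: sp_diff_measurable.
      by move=> u; exact: fro_ge0.
    move=> j u jn ju uj; rewrite -(sp_eval_grid w rS jn ju uj).
    have hf : fro (B u w - B (p j) w) <= ka.
      apply: le_trans hka; apply: fro_crd_le => // q; rewrite crdD crdN.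
      by apply: hm => //; exact: ltW.
    have := froD2 (sp_eval S u w - B u w) (B u w - B (p j) w); rewrite addrA subrK.
    by move: hf; lra.
  rewrite (eq_bigr (fun j : 'I_n => 2^-1 * ((p j.+1 - p j) * fro (s j w - B (p j) w)) - ka * (p j.+1 - p j))).
    by rewrite sumrB -!mulr_sumr sumD -/t; lra.
  by move=> j _; rewrite /s ltn_ord; field.
have E1k k : (k <= n)%N -> \sum_(j < k) (p j.+1 - p j) * fro (s j w - B (p j) w) <= ka * (2 * (1 + t)).
  move=> kn; apply: le_trans E1.
  rewrite (big_ord_widen n (fun j => (p j.+1 - p j) * fro (s j w - B (p j) w)) kn) big_mkcond/=.
  by apply: ler_sum => j _; case: ifP => // _; rewrite mulr_ge0 ?fro_ge0.
have gap k : (k <= n)%N ->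
    fro (B (p k) w - euler_integral (incr V p) (steps p) a b theta z s k w) <= ka * gap_const t.
  move=> kn; rewrite euler_integralE.
  have -> : \sum_(j < k) s j w *m ell_noise (incr V p j) a b theta w = sp_integral S (p k) w.
    rewrite (sp_integral_grid WV pS _ w p0 rS kn) ?p0//; apply: eq_bigr => j _.
    by rewrite /s ifT//; exact: leq_trans kn.
  rewrite heq//.
  set I := sp_integral _ _ _; set Q := \sum_(j < k) _.
  have -> : 1%:M + Z (p k) w + z *: time_integral B (p k) w - (1%:M + I + z *: Q) =
     - (I - Z (p k) w) + z *: (time_integral B (p k) w - Q).
    rewrite scalerBr opprB opprD opprD !addrA [LHS](ACl (1*4*2*5*3*6))/= subrr add0r.
    by [].
  apply: (le_trans (froD2 _ _)); rewrite froN froZ.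
  have h1 := hZ k kn.
  suff h2 : fro (time_integral B (p k) w - Q) <= ka * (2 * t ^+ 2 + 4 * t * (1 + t)).
    have h3 : sqm z * fro (time_integral B (p k) w - Q) <= sqm z * (ka * (2 * t ^+ 2 + 4 * t * (1 + t))).
      by rewrite ler_wpM2l ?sqm_ge0.
    rewrite /gap_const; set u := 2 * t ^+ 2 + _ in h3 *.
    have -> : ka * (2 + 2 * sqm z * u) = 2 * ka + 2 * (sqm z * (ka * u)) by ring.
    by lra.
  set Q' := \sum_(j < k) (p j.+1 - p j)%:C%C *: B (p j) w.
  have -> : time_integral B (p k) w - Q = (time_integral B (p k) w - Q') + (Q' - Q) by rewrite addrA subrK.
  apply: (le_trans (froD2 _ _)).
  have g1 : fro (time_integral B (p k) w - Q') <= ka * t ^+ 2.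
    apply: (@le_trans _ _ (coords * (om * p k) ^+ 2)).
      apply: fro_crd_le => [|q]; first by rewrite mulr_ge0.
      exact: riemann_gap cw pS p0 hm kn.
    rewrite exprMn mulrA; apply: ler_pM; rewrite ?sqr_ge0 ?mulr_ge0 ?sqr_ge0//.
    by rewrite lerXn2r ?nnegrE// ple.
  have g2 : fro (Q' - Q) <= t * (ka * (2 * (1 + t))).
    have -> : Q' - Q = \sum_(j < k) (p j.+1 - p j)%:C%C *: (B (p j) w - s j w).
      by rewrite /Q' /Q -sumrB; apply: eq_bigr => j _; rewrite scalerBr.
    apply: (le_trans (@fro_weighted_sum _ _ k (steps p) (fun j => B (p j) w - s j w) D0)).
    rewrite sumD; apply: ler_pM => //; first by apply: sumr_ge0 => j _; rewrite mulr_ge0 ?fro_ge0.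
      exact: ple.
    apply: le_trans (E1k k kn); apply: ler_sum => j _.
    by rewrite -[X in _ * fro X <= _]opprB froN.
  have -> : ka * (2 * t ^+ 2 + 4 * t * (1 + t)) = 2 * (ka * t ^+ 2) + 2 * (t * (ka * (2 * (1 + t)))).
    by ring.
  lra.
split; first exact: gap.
apply: (@le_trans _ _ (\sum_(j < n) (2 * ((p j.+1 - p j) * fro (s j w - B (p j) w))
    + 2 * (ka * gap_const t) * (p j.+1 - p j)))).
  apply: ler_sum => j _; have g := gap j (ltnW (ltn_ord j)).
  set e := euler_integral _ _ _ _ _ _ _ _ _ in g *.
  have -> : s j w - e = (s j w - B (p j) w) + (B (p j) w - e) by rewrite addrA subrK.
  rewrite [2 * _ * (p _ - _)]mulrC !mulrA [2 * (p _ - _)]mulrC -!mulrA -mulrDr.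
  rewrite ler_wpM2l//; apply: (le_trans (froD2 _ _)); rewrite lerD2l.
  by rewrite ler_wpM2l.
rewrite big_split/= -!mulr_sumr sumD -/t /energy_const.
move: E1; set u := \sum_(j < n) _; set g := gap_const t.
have -> : ka * (4 * (1 + t) + 2 * t * g) = 2 * (ka * (2 * (1 + t))) + 2 * (ka * g) * t by ring.
lra.
Qed.

(** The grid must contain the jump times of [S], and [S] must be accurate at every node of the grid.
    This is no circle because [sp_uniform] provides [S] before the list of times.
    [euler_integral_gap] then feeds [euler_gap]. *)
Lemma euler_limit (L0 : seq R) t (eta eps : R) : 0 < t -> 0 < eta -> 0 < eps ->
  exists p n, [/\ forall j, p j < p j.+1, p 0%N = 0, p n = t,
    forall tau, tau \in L0 -> 0 <= tau <= t -> exists2 j, (j <= n)%N & p j = tau &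
    small P [set w | eta <= fro (B t w - euler_prod (incr V p) (steps p) a b theta z n w)] eps].
Proof.
move=> t0 eta0 eps0.
pose g := growth N a b theta z; have g0 : 0 <= g by exact: growth_ge0.
have eta4 : 0 < eta / 4 by exact: divr_gt0.
have eps4 : 0 < eps / 4 by exact: divr_gt0.
have eps8 : 0 < eps / 8 by exact: divr_gt0.
(* Makes the Gronwall term of [euler_gap], at level eta/4, at most eps/4. *)
pose dl := eps / 4 * (eta / 4) / (expR (g * t) * (g + 1)).
have dl0 : 0 < dl by rewrite divr_gt0 ?mulr_gt0 ?expR_gt0// ltr_wpDl.
have gc0 : 0 <= gap_const t.
  have sz := sqm_ge0 z; have t0' := ltW t0; rewrite /gap_const.
  have t2 : 0 <= 2 * t ^+ 2 by rewrite mulr_ge0 ?sqr_ge0.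
  have t3 : 0 <= 4 * t * (1 + t) by rewrite !mulr_ge0// addr_ge0.
  by rewrite addr_ge0// mulr_ge0 ?mulr_ge0// addr_ge0.
have ec0 : 0 <= energy_const t.
  by have t0' := ltW t0; rewrite /energy_const addr_ge0// ?mulr_ge0// ?addr_ge0// mulr_ge0.
pose ka := Num.min (eta / 8) dl / (gap_const t + energy_const t + 1).
have c1 : 0 < gap_const t + energy_const t + 1 by rewrite ltr_wpDl// addr_ge0.
have ka0 : 0 < ka by rewrite divr_gt0// lt_min dl0 divr_gt0.
have kag : ka * gap_const t < eta / 4.
  apply: (@le_lt_trans _ _ (eta / 8)); last by lra.
  rewrite /ka mulrAC ler_pdivrMr//; apply: ler_pM => //.
  - by rewrite le_min (ltW dl0) divr_ge0// ltW.
  - by rewrite ge_min lexx.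
  - by rewrite -addrA lerDl addr_ge0.
have kae : ka * energy_const t <= dl.
  rewrite /ka mulrAC ler_pdivrMr//; apply: ler_pM => //.
  - by rewrite le_min (ltW dl0) divr_ge0// ltW.
  - by rewrite ge_min lexx orbT.
  - by rewrite addrAC lerDr addr_ge0.
pose om := Num.min 1 (ka / (coords + 1)).
have om0 : 0 < om by rewrite lt_min ltr01 divr_gt0// ltr_wpDl.
have hka : coords * om ^+ 2 <= ka.
  have o1 : om <= 1 by rewrite ge_min lexx.
  have o2 : om <= ka / (coords + 1) by rewrite ge_min lexx orbT.
  apply: (@le_trans _ _ ((coords + 1) * om)).
    apply: ler_pM; rewrite ?sqr_ge0 ?lerDl//.
    by rewrite expr2 ler_piMl// ltW.
  by rewrite mulrC -ler_pdivlMr// ltr_wpDl.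
have mB s : 0 <= s -> mfm (B s) by exact: mB0.
have [h h0 hmod] := @modulus_small _ _ _ P N B mB0 cB t om (eps / 8) om0 eps8.
have [S [hS1 hS2]] := sp_uniform WV gsV cB itoZ t0 ka0 ka0 (divr_gt0 eps8 (ltr0n _ 2)).
(* Half of [h] gives the strict inequality asked by the modulus of continuity; the bound 1 on the
   steps is a hypothesis of [euler_gap]. *)
pose h' := Num.min (h / 2) 1.
have h'0 : 0 < h' by rewrite lt_min ltr01 divr_gt0.
pose M := (Num.truncn (t / h')).+1.
pose L := L0 ++ [seq sp_time S i | i <- iota 0 (sp_size S).+1] ++ [seq i%:R * h' | i <- iota 0 M.+1].
have [p [n [pS p0 pn ref pL]]] := grid_exists L t0.
have rS : refines p n S.
  move=> i j iS jn; apply: ref => //; rewrite !mem_cat; apply/orP; right; apply/orP; left.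
  by apply: map_f; rewrite mem_iota.
have pge0 j : 0 <= p j by rewrite -p0; exact: grid_le.
have ple j : (j <= n)%N -> p j <= t by move=> jn; rewrite -pn; exact: grid_le.
have mesh j : (j < n)%N -> p j.+1 - p j <= h'.
  move=> jn; rewrite leNgt; apply/negP => hj.
  pose i := (Num.truncn (p j / h')).+1.
  have pj0 : 0 <= p j / h' by rewrite divr_ge0// ltW.
  have /andP[i1 i2] := truncn_itv pj0.
  apply: (ref (i%:R * h') j) => //.
    rewrite !mem_cat; apply/orP; right; apply/orP; right; apply/mapP; exists i => //.
    rewrite mem_iota /= add0n ltnS /i /M ltnS; apply: le_truncn.
    by rewrite ler_pM2r ?invr_gt0// ple// ltnW.
  rewrite -ltr_pdivrMr// i2/=.
  apply: (@le_lt_trans _ _ (p j + h')); last by rewrite -ltrBrDl.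
  by rewrite /i -natr1 mulrDl mul1r lerD2r -ler_pdivlMr.
exists p, n; split => // [tau tL tt|]; first by apply: pL => //; rewrite mem_cat tL.
pose s j w := if (j < n)%N then sp_eval S (p j.+1) w else 0.
have p0' : 0 <= p 0%N by rewrite p0.
have ms j : mfm (s j : g_sigma_algebraType (filtration_gen P W (p j)) -> _).
  by rewrite /s; case: ltnP => jn; [exact: sp_adapted jn|exact: mfm_cst].
pose bad w := ~ [/\ (forall q, {within `[0, +oo[, continuous (fun t => crd q (B t w))}),
  fro (B t w - euler_integral (incr V p) (steps p) a b theta z s n w) <= ka * gap_const t &
  \sum_(j < n) (p j.+1 - p j) * fro (s j w - euler_integral (incr V p) (steps p) a b theta z s j w)
    <= ka * energy_const t].
have hbad : small P [set w | bad w] (eps / 4).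
  have hL := hS2 [seq p k | k <- iota 0 n.+1].
  have hE : small P [set w | exists2 k, (k < n.+1)%N &
      ~ (B (p k) w = 1%:M + Z (p k) w + z *: time_integral B (p k) w)] (n.+1%:R * 0).
    by apply: small_bigU => k _; apply: small_ae; exact: eqB.
  have := smallU hmod (smallU hS1 (smallU hL hE)).
  rewrite mulr0 addr0 (_ : eps / 8 + (eps / 8 / 2 + eps / 8 / 2) = eps / 4); last by field.
  apply: smallS => w /= hw; apply: contrapT => /not_orP[/contrapT[cw hm] /not_orP[/negP h1 /not_orP[h2 h3]]].
  apply: hw; have hg := @euler_integral_gap S p n w ka om cw pS p0 rS (ltW om0) hka.
  rewrite pn in hg; have [||||hg1 hg2] := hg _ _ _ _; last by split.
  - move=> q j u jn ju uj; rewrite distrC.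
    have uu : 0 <= u <= t by rewrite (le_trans (pge0 j) ju) (le_trans uj)// ple.
    apply: hm => //; first by rewrite pge0 ple// ltnW.
    rewrite ger0_norm ?subr_ge0//.
    apply: (@le_lt_trans _ _ (p j.+1 - p j)); first by rewrite lerD2r.
    apply: (le_lt_trans (mesh j jn)); rewrite gt_min ltr_pdivrMr// ltr_pMr// ltr1n.
    by [].
  - by move: h1; rewrite -ltNge => /ltW.
  - move=> k kn; rewrite leNgt; apply/negP => hk; apply: h2; exists (p k); split => //.
    + by rewrite -[_ :: _]/[seq p k | k <- iota 0 n.+1]; apply/mapP; exists k; rewrite ?mem_iota.
    + by rewrite pge0 ple.
    + exact: ltW.
  - by move=> k kn; apply: contrapT => hk; apply: h3; exists k.
have D1 j : (j < n)%N -> p j.+1 - p j <= 1.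
  by move=> jn; apply: (le_trans (mesh j jn)); rewrite ge_min lexx orbT.
have he : small P [set w | dl < \sum_(j < n) (p j.+1 - p j) *
    fro (s j w - euler_integral (incr V p) (steps p) a b theta z s j w)] (eps / 4).
  apply: smallS hbad => w /= hw [cw h1 h2]; move: hw; rewrite ltNge => /negP; apply.
  exact: le_trans kae.
have hgap := @euler_gap _ _ _ P N _ _ _ a b theta z (chain_gs gsV pS p0') (chain_D0 pS)
  (@chain_GG _ _ _ P _ W _ pS) (chain_xG WV pS p0') s n dl (eta / 4) (eps / 4) ms (ltW dl0) eta4 D1 he.
have sumD : \sum_(j < n) (p j.+1 - p j) = t.
  rewrite -pn; elim: (n) => [|k IH]; first by rewrite big_ord0 p0.
  by rewrite big_ord_recr/= IH addrC subrK.
have small2 : expR (g * t) * g * dl / (eta / 4) <= eps / 4.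
  have -> : expR (g * t) * g * dl / (eta / 4) = eps / 4 * (g / (g + 1)).
    rewrite /dl; field; rewrite (gt_eqF eta0) (gt_eqF (expR_gt0 _)) /= gt_eqF//.
    by rewrite ltr_wpDl.
  rewrite ler_piMr ?(ltW eps4)// ler_pdivrMr ?mul1r ?lerDl// ltr_wpDl//.
rewrite sumD -/g in hgap.
apply: smallW _ (smallS _ (smallU hbad hgap)); first by lra.
move=> w /= hw; have [hb|/contrapT[cw h1 h2]] := pselect (bad w); first by left.
right; have [h3|//] := @fro_triangle _ _ _ (euler_integral (incr V p) (steps p) a b theta z s n w) _ _ hw.
by move: (le_lt_trans (le_trans h3 h1) kag); rewrite ltxx.
Qed.

End EulerLimit.

(** * The bound for one index *)

Lemma add_gap (U : zmodType) (o x y : U) : o + x + (y - o - x) = y.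
Proof. by rewrite -[y - o - x]addrA -opprD addrCA subrr addr0. Qed.

Lemma lt_of_gaps (R : realType) (x y u n c q e : R) :
  x <= y + q -> y <= u + n -> n < e -> u < c - q - e -> x < c.
Proof. lra. Qed.

Section Assembly.
Context d (T : measurableType d) (R : realType) (P : probability T R).
Variables (N : nat) (W : R -> T -> 'M[R[i]]_N) (a b theta : R).
Variable V : 'I_N * 'I_N * bool -> R -> T -> R.
Hypothesis WV : forall t w, 0 <= t -> W t w = \sum_k (V k t w)%:C%C *: ell_basis a b theta k.
Hypothesis gsV : forall u v, 0 <= u -> u < v ->
  gaussian_step P (filtration_gen P W u) (fun k w => V k v w - V k u w) (v - u).
Variable B : R -> T -> 'M[R[i]]_N.
Hypothesis cB : {ae P, forall w, forall q, {within `[0, +oo[, continuous (fun t => crd q (B t w))}}.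
Variables (Z : R -> T -> 'M[R[i]]_N) (z : R[i]).
Hypothesis itoZ : forall t, 0 <= t -> is_ito_integral P W B t (Z t).
Hypothesis eqB : forall t, 0 <= t ->
  {ae P, forall w, B t w = 1%:M + Z t w + z *: time_integral B t w}.
Hypothesis mB0 : forall t, 0 <= t -> mfm (B t).
Local Notation rho := (a ^+ 2 + b ^+ 2).
Hypothesis N0 : (0 < N)%N.
Hypothesis rho0 : 0 < rho.
Hypothesis zrho : Num.sqrt (sqm z) <= rho / 2.
Local Notation steps p := (fun j : nat => p j.+1 - p j).

Definition block_prob (K : R) : R := 2 * (4096 ^+ N) ^+ 2 * expR (- (K * N%:R / 20)).

Lemma euler_prod_cat (x : nat -> 'I_N * 'I_N * bool -> T -> R) (D : nat -> R) m n w :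
  euler_prod x D a b theta z (m + n) w = euler_prod x D a b theta z m w *m
   euler_prod (fun j => x (m + j)%N) (fun j => D (m + j)%N) a b theta z n w.
Proof.
elim: n => [|n IH]; first by rewrite addn0 mulmx1.
by rewrite addnS /= IH mulmxA.
Qed.

Section Grid.
Variable p : nat -> R.
Hypothesis pS : forall j, p j < p j.+1.
Hypothesis p0 : 0 <= p 0%N.
Local Notation block i n := (euler_prod (fun k => incr V p (i + k)%N)
  (fun k => p (i + k).+1 - p (i + k)%N) a b theta z n).

Lemma chain_block i n (K : R) : 1 <= K -> 16 * (rho * K * (p (i + n.+1)%N - p i)) <= 1 ->
  exists2 F : set T, measurable F /\ (P F <= (block_prob K)%:E)%E & forall w, ~ F w ->
    (forall v : 'cV[R[i]]_N, nm ((block i n.+1 w - 1%:M) *m v) <= 2^-1 * nm v) /\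
    (forall v : 'cV[R[i]]_N, nm ((block i n.+1 w - 1%:M - (W (p (i + n.+1)%N) w - W (p i) w)) *m v)
        <= 6 * K * (rho * (p (i + n.+1)%N - p i)) * nm v).
Proof.
move=> K1 hs.
have tel (f : R -> 'M[R[i]]_N) m : \sum_(j < m) (f (p (i + j).+1) - f (p (i + j)%N)) = f (p (i + m)%N) - f (p i).
  elim: m => [|m IH]; first by rewrite big_ord0 addn0 subrr.
  by rewrite big_ord_recr/= IH addnS addrC addrA subrK.
have telR m : \sum_(j < m) (p (i + j).+1 - p (i + j)%N) = p (i + m)%N - p i.
  elim: m => [|m IH]; first by rewrite big_ord0 addn0 subrr.
  by rewrite big_ord_recr/= IH addnS addrC addrA subrK.
pose G k := filtration_gen P W (p (i + k)%N).
have gs k : gaussian_step P (G k) (incr V p (i + k)) (p (i + k).+1 - p (i + k)%N).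
  exact: (chain_gs gsV pS p0).
have D0 k : 0 < p (i + k).+1 - p (i + k)%N by exact: chain_D0.
have GG k : G k `<=` <<s G k.+1 >>.
  by rewrite /G addnS; exact: chain_GG.
have xG k : mfm (ell_noise (incr V p (i + k)) a b theta : g_sigma_algebraType (G k.+1) -> _).
  by rewrite /G addnS; exact: (chain_xG WV pS p0).
have := @block_bound _ _ _ P N G (fun k => incr V p (i + k)%N)
  (fun k => p (i + k).+1 - p (i + k)%N) a b theta z gs D0 N0 GG rho0 zrho xG n K K1.
rewrite telR => /(_ hs)[F hF hw]; exists F; first exact: hF.
move=> w Fw; have [h1 h2] := hw w Fw; split; first exact: h1.
move=> v; have := h2 v.
rewrite (eq_bigr (fun j : 'I_n.+1 => W (p (i + j).+1) w - W (p (i + j)%N) w)); last first.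
  by move=> j _; exact: (noise_incr WV pS p0).
by rewrite (tel (fun u => W u w)).
Qed.

Lemma nm_half (M : 'M[R[i]]_N) (v : 'cV[R[i]]_N) : nm ((M - 1%:M) *m v) <= 2^-1 * nm v ->
  2^-1 * nm v <= nm (M *m v) <= 2 * nm v.
Proof.
rewrite mulmxBl mul1mx => h; have v0 := nm_ge0 v; apply/andP; split.
  have E : v - (v - M *m v) = M *m v by rewrite opprB addrC subrK.
  by have := nmB v (v - M *m v); rewrite E -[nm (v - _)]nmN opprB; lra.
have := nmD (M *m v - v) v; rewrite subrK; lra.
Qed.

Lemma euler_prod_bounds (J : nat -> nat) bb w : J 0%N = 0%N ->
  (forall k, (k < bb)%N -> (J k < J k.+1)%N) ->
  (forall k, (k < bb)%N -> forall v : 'cV[R[i]]_N,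
     nm ((block (J k) (J k.+1 - J k) w - 1%:M) *m v) <= 2^-1 * nm v) ->
  forall v : 'cV[R[i]]_N, (2^-1) ^+ bb * nm v <=
     nm (euler_prod (incr V p) (steps p) a b theta z (J bb) w *m v) <= 2 ^+ bb * nm v.
Proof.
move=> J0; elim: bb => [|k IH] hJ hM v.
  by rewrite J0 /= mul1mx !expr0 mul1r lexx.
have IH' := IH (fun i hi => hJ i (ltnW hi)) (fun i hi => hM i (ltnW hi)).
rewrite -(subnKC (ltnW (hJ k (ltnSn k)))) euler_prod_cat -mulmxA.
have /andP[l1 u1] := IH' (block (J k) (J k.+1 - J k) w *m v).
have /andP[l2 u2] := nm_half (hM k (ltnSn k) v).
apply/andP; split; [apply: le_trans l1|apply: (le_trans u1)].
  by rewrite exprSr -mulrA ler_wpM2l// exprn_ge0.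
by rewrite exprSr -mulrA ler_wpM2l// exprn_ge0.
Qed.

End Grid.

(** The three losses in the level are the contraction by [Q], its norm times the second-order error
    of the last block, and the distance [eta] of B to the Euler product. The grid is chosen inside
    the proof, for the given [eta] and [eps], and leaves no trace in the bound. *)
Lemma fixed_rank (t s K e eta eps : R) (bb m l : nat) (A : 'M[R[i]]_N) :
  0 < s -> s < t -> (l < N)%N -> (m <= l)%N -> (0 < m)%N -> 1 <= K -> 16 * (rho * K * s) <= 1 ->
  16 * (rho * K * t) <= bb%:R -> 0 < e -> 0 < eta -> 0 < eps ->
  N%:R * e ^+ 2 < (l.+1 - m)%:R * (m%:R * (rho * s / N%:R) / (expR 3 - 1)) ->
  small P [set w | sigma (N - l) (B t w + A) < (2^-1) ^+ bb * e - 2 ^+ bb * (6 * K * (rho * s)) - eta]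
   (N%:R * expR (- 2 * m%:R) + bb.+1%:R * block_prob K + eps).
Proof.
move=> s0 st lN ml m0 K1 hs ht e0 eta0 eps0 hNe.
have t0 : 0 < t by exact: lt_trans st.
have K0 : 0 < K by exact: lt_le_trans K1.
have bb0 : 0 < bb%:R :> R by apply: lt_le_trans ht; rewrite !mulr_gt0.
pose r := t - s; have r0 : 0 < r by rewrite subr_gt0.
(* Equal cuts of [0, r], passed to [euler_limit] so that blocks begin and end at nodes; the node
   [tau bb = r] separates [Q] from the last block. *)
pose tau k := r * k%:R / bb%:R.
have [p [n [pS p0 pn pL hE]]] := euler_limit WV gsV cB itoZ eqB mB0
  [seq tau k | k <- iota 0 bb.+1] t0 (exprn_gt0 2 eta0) eps0.
have p0' : 0 <= p 0%N by rewrite p0.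
have [J hJ] : exists J : nat -> nat, forall k, (k <= bb)%N -> p (J k) = tau k.
  have : forall k : nat, exists j : nat, (k <= bb)%N -> p j = tau k.
    move=> k; have [kb|kb] := leqP k bb; last by exists 0%N.
    have [||j _ pj] := pL (tau k); last by exists j.
    - by apply/mapP; exists k; rewrite ?mem_iota.
    - rewrite /tau -mulrA mulr_ge0 ?divr_ge0 ?(ltW r0)//= (@le_trans _ _ r)//.
        by rewrite ler_piMr ?(ltW r0)// ler_pdivrMr// mul1r ler_nat.
      by rewrite lerBlDr lerDl ltW.
  by move=> /choice[f hf]; exists f.
have J0 : J 0%N = 0%N by apply: (grid_inj pS); rewrite hJ// p0 /tau mulr0 mul0r.
have JS k : (k < bb)%N -> (J k < J k.+1)%N.
  move=> kb; rewrite -(grid_lt_iff _ _ pS) !hJ// ?(ltnW kb)//.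
  by rewrite /tau ltr_pM2r ?invr_gt0// ltr_pM2l// ltr_nat.
have Jb : p (J bb) = r by rewrite hJ// /tau -mulrA divff ?mulr1// gt_eqF.
have Jn : (J bb < n)%N by rewrite -(grid_lt_iff _ _ pS) Jb pn ltrBlDr ltrDl.
pose M i j := euler_prod (fun k => incr V p (i + k)%N)
  (fun k => p (i + k).+1 - p (i + k)%N) a b theta z (j - i).
have hM i j : (i < j)%N -> 16 * (rho * K * (p j - p i)) <= 1 ->
  exists2 F : set T, measurable F /\ (P F <= (block_prob K)%:E)%E & forall w, ~ F w ->
    (forall v : 'cV[R[i]]_N, nm ((M i j w - 1%:M) *m v) <= 2^-1 * nm v) /\
    (forall v : 'cV[R[i]]_N, nm ((M i j w - 1%:M - (W (p j) w - W (p i) w)) *m v)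
        <= 6 * K * (rho * (p j - p i)) * nm v).
  move=> ij hij; have jE : j = (i + (j - i).-1.+1)%N.
    by rewrite prednK ?subn_gt0// subnKC// ltnW.
  have := @chain_block p pS p0' i (j - i).-1 K K1; rewrite -jE => /(_ hij).
  by rewrite prednK ?subn_gt0.
have hblk k : (k < bb)%N -> small P [set w | ~ forall v : 'cV[R[i]]_N,
    nm ((M (J k) (J k.+1) w - 1%:M) *m v) <= 2^-1 * nm v] (block_prob K).
  move=> kb; have [|F [mF PF] hF] := hM _ _ (JS k kb).
    rewrite !hJ// ?(ltnW kb)//.
    have -> : tau k.+1 - tau k = r / bb%:R by rewrite /tau -natr1; field; rewrite gt_eqF.
    rewrite !mulrA ler_pdivrMr// mul1r; apply: le_trans ht; rewrite -!mulrA.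
    by rewrite !ler_wpM2l ?(ltW rho0) ?(ltW K0)// lerBlDr lerDl ltW.
  exists F; split => // w /= hw; apply: contrapT => /hF[h _]; exact: hw.
have hlast : small P [set w | ~ forall v : 'cV[R[i]]_N,
    nm ((M (J bb) n w - 1%:M - (W t w - W r w)) *m v) <= 6 * K * (rho * s) * nm v] (block_prob K).
  have sE : t - r = s by rewrite /r opprB addrC subrK.
  have [|F [mF PF] hF] := hM _ _ Jn; first by rewrite pn Jb sE.
  exists F; split => // w /= hw; apply: contrapT => /hF[_ h]; apply: hw => v.
  by have := h v; rewrite pn Jb sE.
pose Q := euler_prod (incr V p) (steps p) a b theta z (J bb).
have mQ : mfm (Q : g_sigma_algebraType (filtration_gen P W r) -> _).
  rewrite -Jb; exact: (@euler_prod_adapted _ _ _ _ (fun j => filtration_gen P W (p j)) _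
    (steps p) _ _ _ z (@chain_GG _ _ _ P _ W _ pS) (chain_xG WV pS p0')).
have rt : r < t by rewrite ltrBlDr ltrDl.
have gs := gsV (ltW r0) rt; rewrite (_ : t - r = s) in gs; last by rewrite opprB addrC subrK.
have c0 : 0 < (2^-1 : R) ^+ bb by rewrite exprn_gt0.
have [U [mU PU] hU] := small_ball_sigma_mul theta gs s0 N0 rho0 A mQ lN ml m0 e0 c0 hNe.
have hsmall : small P U (N%:R * expR (- 2 * m%:R)) by exists U; split.
have noiseE w : ell_noise (fun k w => V k t w - V k r w) a b theta w = W t w - W r w.
  rewrite !WV ?(ltW t0) ?(ltW r0)// -sumrB; apply: eq_bigr => k _.
  by rewrite -scalerBl rmorphB.
have hblocks := small_bigU (fun k hk => hblk k hk).
apply: smallS (smallW _ (smallU hsmall (smallU (smallU hblocks hlast) hE))); last first.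
  by rewrite -[bb.+1%:R]natr1 mulrDl mul1r !addrA.
move=> w /= hw; apply: contrapT => /not_orP[h1 /not_orP[/not_orP[h2 /contrapT h3] /negP]].
rewrite -ltNge => h4.
have kN : (0 < N - l <= N)%N by rewrite subn_gt0 lN leq_subr.
have hQ := @euler_prod_bounds p J bb w J0 JS.
have {hQ} /(_ _)/andP hQ := hQ (fun k hk => contrapT (fun h => h2 (ex_intro2 _ _ k hk h))).
apply: h1; apply: hU; first by move=> v; have [] := hQ v.
rewrite noiseE.
set X := Q w *m (1%:M + (W t w - W r w)) + A.
(* The drift of the last block is part of this error, so the matrix to which the small ball estimate
   applies contains the Gaussian increment alone. *)
set E := M (J bb) n w - 1%:M - (W t w - W r w) in h3.
have pe0 : 0 <= 2 ^+ bb * (6 * K * (rho * s)).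
  by rewrite mulr_ge0 ?exprn_ge0// !mulr_ge0// ?(ltW rho0) ?(ltW K0) ?(ltW s0).
have g1 : sigma (N - l) X <= sigma (N - l) (X + Q w *m E) + 2 ^+ bb * (6 * K * (rho * s)).
  apply: sigma_perturb => // v; rewrite -mulmxA; have [_ h] := hQ (E *m v).
  by apply: (le_trans h); rewrite -mulrA ler_wpM2l// exprn_ge0.
have XE : X + Q w *m E = euler_prod (incr V p) (steps p) a b theta z n w + A.
  rewrite /X addrAC -mulmxDr -(subnKC (ltnW Jn)) euler_prod_cat -/Q; congr (_ *m _ + _).
  by rewrite /E -/(M (J bb) n w) add_gap.
rewrite XE in g1.
have g2 := @sigma_lipschitz R N (N - l) (euler_prod (incr V p) (steps p) a b theta z n w + A) (B t w + A) kN.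
have g3 : nm (euler_prod (incr V p) (steps p) a b theta z n w + A - (B t w + A)) < eta.
  rewrite opprD addrACA subrr addr0 -nmN opprB nm_lt ?(ltW eta0)//.
exact: (lt_of_gaps g1 g2 g3 hw).
Qed.

End Assembly.

(** * Choice of the constants *)

Section Constants.
Variable R : realType.

(** The number of events, 2^(24 N + 1), is at most exp(25 N). With K = 20 (y + 29) the exponent is
    (y + 29) N, of which y N + 4 N is left. *)
Lemma block_prob_le (N : nat) (y : R) : (0 < N)%N -> 0 <= y ->
  block_prob N (20 * (y + 29)) <= expR (- y) * expR (- (4 * N%:R)).
Proof.
move=> N0 y0; have e2 : 2 <= expR 1 :> R by have := expR_ge1Dx (1 : R).
have N1 : 1 <= N%:R :> R by rewrite ler1n.
have h : 2 * (4096 ^+ N) ^+ 2 <= expR (25 * N%:R) :> R.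
  have -> : 4096 = 2 ^+ 12 :> R by rewrite -natrX.
  rewrite -!exprM -exprS.
  apply: (@le_trans _ _ (2 ^+ (25 * N))).
    by rewrite ler_eXn2l ?ltr1n//; lia.
  have -> : 25 * N%:R = (25 * N)%:R * 1 :> R by rewrite natrM mulr1.
  rewrite expRM_natl.
  by rewrite lerXn2r ?nnegrE ?expR_ge0.
rewrite /block_prob; apply: (le_trans (ler_wpM2r (expR_ge0 _) h)).
rewrite -!expRD ler_expR.
have -> : 20 * (y + 29) * N%:R / 20 = y * N%:R + 29 * N%:R by field.
have : y <= y * N%:R by rewrite ler_peMr.
lra.
Qed.

(** exp 3 - 1 comes from the Laplace parameter of [small_ball_vector]. With m about l/2, m (l + 1 -
    m) is at least l^2/4, and 8 instead of 4 gives the strict inequality. *)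
Definition ball_const (rho : R) : R := Num.sqrt (rho / (8 * (expR 3 - 1))).

Lemma ball_const_gt0 rho : 0 < rho -> 0 < ball_const rho.
Proof.
move=> rho0; rewrite sqrtr_gt0 divr_gt0// mulr_gt0// subr_gt0 expR_gt1//.
Qed.

(** [bb] has to exceed 16 rho K T, while a union over [bb + 1] blocks requires K to be large. The
    circle closes because [bb] grows linearly in y, whereas the failure probability carries exp(-y).
    [dl] is chosen last, given [bb]. *)
Lemma constants (rho T : R) : 0 < rho -> 0 < T -> exists K (bb : nat) dl,
  [/\ 1 <= K, 16 * (rho * K * T) <= bb%:R,
    forall N, (0 < N)%N -> bb.+1%:R * block_prob N K <= expR (- (4 * N%:R)) &
    [/\ 0 < dl, dl <= 2^-1, 16 * (rho * K * dl ^+ 2) <= 1 &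
    2 ^+ bb * (6 * K * (rho * dl ^+ 2)) <= 2^-1 * ((2^-1) ^+ bb * (ball_const rho * dl))]].
Proof.
move=> rho0 T0; pose q := 320 * (rho * T).
have q0 : 0 < q by rewrite /q mulr_gt0 ?ltr0n// mulr_gt0.
(* Then 16 rho K T = q (y + 29), and (1 + y/2)^2 = 1 + y + (q + 30) y dominates it by enough to
   absorb [bb + 1]. *)
pose y := 4 * (q + 30); pose K := 20 * (y + 29).
have y0 : 0 < y by rewrite mulr_gt0// addr_gt0.
have K1 : 1 <= K by rewrite /K; lra.
have K0 : 0 < K by exact: lt_le_trans K1.
have KE : K = 20 * (y + 29) by [].
have yE : y = 4 * (q + 30) by [].
clearbody K y.
pose bb := (Num.truncn (16 * (rho * K * T))).+1.
have u0 : 0 <= 16 * (rho * K * T) by apply: ltW; rewrite !mulr_gt0.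
have /andP[b1 b2] := truncn_itv u0.
pose g := ball_const rho; have g0 : 0 < g by exact: ball_const_gt0.
have gE : ball_const rho = g by [].
pose A := 12 * 2 ^+ bb * 2 ^+ bb * K * rho.
have A0 : 0 < A by rewrite !mulr_gt0// ?exprn_gt0.
(* The three bounds make the last interval shorter than t, make it an admissible block, and make its
   second-order error at most half of the gain. *)
pose dl := Num.min 2^-1 (Num.min (16 * rho * K)^-1 (g / A)).
have rK0 : 0 < 16 * rho * K by rewrite !mulr_gt0.
have gA : 0 < g / A by exact: divr_gt0.
have AE : A = 12 * 2 ^+ bb * 2 ^+ bb * K * rho by [].
clearbody A.
have dl0 : 0 < dl by rewrite !lt_min !invr_gt0 ltr0n rK0 gA.
have d1 : dl <= 2^-1 by rewrite ge_min lexx.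
have d2 : dl <= (16 * rho * K)^-1 by rewrite !ge_min lexx orbT.
have d3 : dl <= g / A by rewrite !ge_min lexx !orbT.
exists K, bb, dl; rewrite gE; split => //; first exact: ltW.
  move=> N N0; rewrite KE; apply: (le_trans (ler_wpM2l _ (block_prob_le N0 (ltW y0)))) => //.
  rewrite mulrA ler_piMl ?expR_ge0//.
  rewrite expRN ler_pdivrMr ?expR_gt0// mul1r.
  have e1 : 1 + y / 2 <= expR (y / 2) by exact: expR_ge1Dx.
  have -> : expR y = expR (y / 2) ^+ 2 by rewrite expr2 -expRD; congr expR; field.
  apply: (@le_trans _ _ ((1 + y / 2) ^+ 2)).
    have : bb%:R <= 16 * (rho * K * T) + 1 by rewrite /bb -natr1 lerD2r.
    rewrite -natr1 => hb; apply: (@le_trans _ _ (16 * (rho * K * T) + 2)); first lra.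
    have -> : 16 * (rho * K * T) = q * (y + 29) by rewrite KE /q; ring.
    have -> : (1 + y / 2) ^+ 2 = 1 + y + (q + 30) * y by rewrite yE; field.
    rewrite mulrDr mulrDl.
    have : 29 * q <= 30 * y by rewrite yE; lra.
    by move: y0; lra.
  by rewrite lerXn2r ?nnegrE ?expR_ge0// addr_ge0// divr_ge0// ltW.
split => //.
  have : 16 * rho * K * dl <= 1 by rewrite mulrC -ler_pdivlMr ?mul1r// !mulr_gt0.
  have : dl <= 1 by apply: (le_trans d1); rewrite invf_le1// ler1n.
  move=> dl1 h; have -> : 16 * (rho * K * dl ^+ 2) = 16 * rho * K * dl * dl by ring.
  by rewrite -[leRHS]mulr1; apply: ler_pM => //; rewrite ?(ltW dl0)// !mulr_ge0// ltW.
have hA : A * dl <= g by rewrite mulrC -ler_pdivlMr.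
have E : 2 ^+ bb * (2^-1 : R) ^+ bb = 1 by rewrite -exprMn divff ?expr1n.
have p0 : 0 < (2^-1 : R) ^+ bb by rewrite exprn_gt0.
have -> : 2 ^+ bb * (6 * K * (rho * dl ^+ 2)) = 2^-1 * ((2^-1) ^+ bb * (A * dl * dl)).
  rewrite AE; transitivity (2 ^+ bb * (2^-1 : R) ^+ bb * (2 ^+ bb * (6 * K * (rho * dl ^+ 2)))).
    by rewrite E mul1r.
  by set u := 2 ^+ bb; set v := (2^-1) ^+ bb; field.
by rewrite !ler_pM2l// ler_pM2r.
Qed.

Lemma rank_threshold (N l : nat) (rho dl : R) : 0 < rho -> 0 < dl -> (0 < N)%N -> (0 < l)%N ->
  N%:R * (ball_const rho * dl * (l%:R / N%:R) ^+ 2) ^+ 2 <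
  (l.+1 - uphalf l)%:R * ((uphalf l)%:R * (rho * (dl ^+ 2 * (l%:R / N%:R) ^+ 2) / N%:R) / (expR 3 - 1)).
Proof.
move=> rho0 dl0 N0 l0.
have E0 : 0 < expR 3 - 1 :> R by rewrite subr_gt0 expR_gt1.
have NR : 0 < N%:R :> R by rewrite ltr0n.
have LR : 0 < l%:R :> R by rewrite ltr0n.
have g2 : ball_const rho ^+ 2 = rho / (8 * (expR 3 - 1)).
  by rewrite sqr_sqrtr// divr_ge0// ?(ltW rho0)// mulr_ge0// ltW.
have m1 : l%:R <= 2 * (uphalf l)%:R :> R.
  by rewrite -natrM ler_nat; lia.
have m2 : l%:R <= 2 * (l.+1 - uphalf l)%:R :> R.
  by rewrite -natrM ler_nat; lia.
have m3 : l%:R ^+ 2 < 8 * ((l.+1 - uphalf l)%:R * (uphalf l)%:R) :> R.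
  have : l%:R * l%:R <= (2 * (uphalf l)%:R) * (2 * (l.+1 - uphalf l)%:R) :> R.
    by apply: ler_pM => //; exact: ltW.
  have : 0 < l%:R * l%:R :> R by rewrite mulr_gt0.
  rewrite expr2; lra.
rewrite !exprMn g2; set m := (uphalf l)%:R in m3 *; set m' := (l.+1 - uphalf l)%:R in m3 *.
set Y := expR 3 - 1 in E0 *; set L := l%:R in m3 LR *; set n := N%:R in NR *.
rewrite -subr_gt0.
have -> : m' * (m * (rho * (dl ^+ 2 * (L ^+ 2 * n^-1 ^+ 2)) / n) / Y) -
   n * (rho / (8 * Y) * dl ^+ 2 * ((L ^+ 2 * n^-1 ^+ 2) ^+ 2)) =
   rho * dl ^+ 2 * L ^+ 2 / (8 * Y * n ^+ 3) * (8 * (m' * m) - L ^+ 2).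
  by field; rewrite !gt_eqF.
by rewrite mulr_gt0 ?subr_gt0// divr_gt0 ?mulr_gt0 ?exprn_gt0.
Qed.

End Constants.

(** * Random A and the union bound *)

Section PerRank.
Context d (T : measurableType d) (R : realType) (P : probability T R).
Variables (N : nat) (W : R -> T -> 'M[R[i]]_N) (a b theta : R).
Variable V : 'I_N * 'I_N * bool -> R -> T -> R.
Hypothesis WV : forall t w, 0 <= t -> W t w = \sum_k (V k t w)%:C%C *: ell_basis a b theta k.
Hypothesis gsV : forall u v, 0 <= u -> u < v ->
  gaussian_step P (filtration_gen P W u) (fun k w => V k v w - V k u w) (v - u).
Variable B : R -> T -> 'M[R[i]]_N.
Hypothesis cB : {ae P, forall w, forall q, {within `[0, +oo[, continuous (fun t => crd q (B t w))}}.
Variables (Z : R -> T -> 'M[R[i]]_N) (z : R[i]).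
Hypothesis itoZ : forall t, 0 <= t -> is_ito_integral P W B t (Z t).
Hypothesis eqB : forall t, 0 <= t ->
  {ae P, forall w, B t w = 1%:M + Z t w + z *: time_integral B t w}.
Hypothesis mB0 : forall t, 0 <= t -> mfm (B t).
Local Notation rho := (a ^+ 2 + b ^+ 2).
Hypothesis rho0 : 0 < rho.
Hypothesis zrho : Num.sqrt (sqm z) <= rho / 2.

(** [fixed_rank] with s = dl^2 (l/N)^2 and m = [uphalf l], for which 2 m >= l. Of the level c1
    (l/N)^2, half goes to the second-order error and a quarter to the Euler approximation; each of
    the three failure probabilities is at most N exp(-l), as l < N. *)
Lemma per_rank (T' K dl t : R) (bb l : nat) (A : 'M[R[i]]_N) :
  1 <= K -> 16 * (rho * K * T') <= bb%:R ->
  bb.+1%:R * block_prob N K <= expR (- (4 * N%:R)) ->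
  0 < dl -> dl <= 2^-1 -> 16 * (rho * K * dl ^+ 2) <= 1 ->
  2 ^+ bb * (6 * K * (rho * dl ^+ 2)) <= 2^-1 * ((2^-1) ^+ bb * (ball_const rho * dl)) ->
  0 < t -> t <= T' -> (0 < l)%N -> (l < N)%N -> l%:R <= Num.sqrt t * N%:R ->
  small P [set w | sigma (N - l) (B t w + A) <
      (2^-1) ^+ bb * (ball_const rho * dl) / 4 * (l%:R / N%:R) ^+ 2] (3 * N%:R * expR (- l%:R)).
Proof.
move=> K1 hT hp dl0 dl2 hdl hpert t0 tT l0 lN lt.
have N0 : (0 < N)%N by exact: leq_trans lN.
have NR : 0 < N%:R :> R by rewrite ltr0n.
have LR : 0 < l%:R :> R by rewrite ltr0n.
have K0 : 0 < K by exact: lt_le_trans K1.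
have g0 := ball_const_gt0 rho0.
set x := (l%:R / N%:R) ^+ 2.
have x0 : 0 < x by rewrite exprn_gt0// divr_gt0.
have x1 : x <= 1 by rewrite expr_le1// ?divr_ge0// ler_pdivrMr// mul1r ler_nat ltnW.
(* This is where l <= sqrt(t) N enters: with dl^2 < 1, the last interval is strictly shorter than
   t. *)
have xt : x <= t.
  rewrite -(sqr_sqrtr (ltW t0)) lerXn2r ?nnegrE ?sqrtr_ge0 ?divr_ge0//.
  by rewrite ler_pdivrMr.
have s0 : 0 < dl ^+ 2 * x by rewrite mulr_gt0// exprn_gt0.
have d4 : dl ^+ 2 < 1.
  apply: (@le_lt_trans _ _ (2^-1 ^+ 2)); first by rewrite lerXn2r ?nnegrE// ltW.
  by rewrite expr2; lra.
have st : dl ^+ 2 * x < t by apply: (lt_le_trans _ xt); rewrite gtr_pMl.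
have p0 : 0 < (2^-1 : R) ^+ bb by rewrite exprn_gt0.
set c1 := (2^-1) ^+ bb * (ball_const rho * dl).
have c10 : 0 < c1 by rewrite mulr_gt0// mulr_gt0.
have ml : (uphalf l <= l)%N by rewrite leq_uphalf_double -addnn leq_addr.
have m0 : (0 < uphalf l)%N by rewrite uphalf_gt0.
have h := @fixed_rank _ _ _ P N W a b theta V WV gsV B cB Z z itoZ eqB mB0 N0 rho0 zrho
  t (dl ^+ 2 * x) K (ball_const rho * dl * x) (c1 / 4 * x) (expR (- (4 * N%:R))) bb (uphalf l) l A
  s0 st lN ml m0 K1.
apply: smallW (smallS _ (h _ _ _ _ _ _)).
- have e1 : expR (- 2 * (uphalf l)%:R) <= expR (- l%:R) :> R.
    rewrite ler_expR mulNr lerN2 -natrM ler_nat mul2n.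
    by rewrite -[X in (X <= _)%N]odd_double_half uphalf_half doubleD; case: (odd l).
  have e2 : expR (- (4 * N%:R)) <= expR (- l%:R) :> R.
    rewrite ler_expR lerN2; apply: (@le_trans _ _ N%:R); first by rewrite ler_nat ltnW.
    by rewrite ler_peMl// ler1n.
  have e3 : expR (- l%:R) <= N%:R * expR (- l%:R) :> R.
    by rewrite ler_peMl ?expR_ge0// ler1n.
  have e4 : N%:R * expR (- 2 * (uphalf l)%:R) <= N%:R * expR (- l%:R) :> R by rewrite ler_pM2l.
  move: hp; lra.
- move=> w /= /lt_le_trans; apply.
  have -> : 2 ^+ bb * (6 * K * (rho * (dl ^+ 2 * x))) = 2 ^+ bb * (6 * K * (rho * dl ^+ 2)) * x.
    by set u := 2 ^+ bb; ring.
  have -> : (2^-1) ^+ bb * (ball_const rho * dl * x) = c1 * x by rewrite /c1 mulrA.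
  rewrite -!mulrBl ler_pM2r//.
  by move: hpert; rewrite -/c1; lra.
- apply: (le_trans _ hdl); rewrite ler_pM2l// ler_pM2l ?mulr_gt0//.
  by rewrite ler_piMr// sqr_ge0.
- by apply: (le_trans _ hT); rewrite ler_pM2l// ler_pM2l ?mulr_gt0.
- exact: mulr_gt0 (mulr_gt0 g0 dl0) x0.
- exact: mulr_gt0 (divr_gt0 c10 _) x0.
- exact: expR_gt0.
- exact: rank_threshold.
Qed.

End PerRank.

Section Freeze.
Context d (T : measurableType d) (R : realType) (P : probability T R) (N : nat).
Variables (A : T -> 'M[R[i]]_N) (B : R -> T -> 'M[R[i]]_N).
Hypothesis rA : random_matrix A.
Hypothesis AB : independent2 P (sigma_mx1 A) (sigma_mx `[0, +oo[ B).
Hypothesis mB : forall t, 0 <= t -> mfm (B t).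

(** A bound that is uniform over constant matrices can be integrated over the law of the independent
    matrix [A]. *)
Lemma freeze_sigma t k c p : 0 <= t -> (0 < k <= N)%N -> 0 <= p ->
  (forall A0, small P [set w | sigma k (B t w + A0) < c] p) ->
  small P [set w | sigma k (B t w + A w) < c] p.
Proof.
move=> t0 kN p0 h.
pose G1 := \bigcup_(k in [set tt] `*` [set: 'I_N * 'I_N * bool])
  preimage_set_system setT (fun w => mx_coord k.2 (A w)) measurable.
pose G2 := \bigcup_(k in `[0, +oo[ `*` [set: 'I_N * 'I_N * bool])
  preimage_set_system setT (fun w => mx_coord k.2 (B k.1 w)) measurable.
have sG1 : <<s G1 >> `<=` measurable by exact: rA.
have sG2 : <<s G2 >> `<=` measurable.
  apply: smallest_sub; first exact: sigma_algebra_measurable.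
  move=> E [[u q] [/= + _]] [U mU <-]; rewrite in_itv/= andbT => u0.
  exact: mB.
have ind : independent2 P <<s G1 >> <<s G2 >> by exact: AB.
have [S mS SE] : exists2 S : set (g_sigma_algebraType G1 * g_sigma_algebraType G2),
    measurable S & forall w w', S (w, w') <-> sigma k (B t w' + A w) < c.
  pose X (y : g_sigma_algebraType G1 * g_sigma_algebraType G2) := B t y.2 + A y.1.
  have mX : mfm X.
    apply: mfmD => q.
      apply: (measurableT_comp (f := (fun w => crd q (B t w)) : g_sigma_algebraType G2 -> R)) => //.
      move=> _ U mU; apply: sub_sigma_algebra; exists (t, q) => /=; last by exists U.
      by split => //=; rewrite in_itv/= t0.
    apply: (measurableT_comp (f := (fun w => crd q (A w)) : g_sigma_algebraType G1 -> R)) => //.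
    by move=> _ U mU; apply: sub_sigma_algebra; exists (tt, q) => //=; exists U.
  exists [set y | sigma k (X y) < c]; last by [].
  rewrite -[X in measurable X]setTI.
  apply: (measurable_fun_ltr (f := fun y => sigma k (X y)) (g := cst c)) => //.
  exact: sigma_measurable.
have m1 : measurable_fun setT (fun w : T => (w, w) : g_sigma_algebraType G1 * g_sigma_algebraType G2).
  apply: measurable_fun_pair.
    by move=> _ U mU; rewrite setTI; exact: sG1.
  by move=> _ U mU; rewrite setTI; exact: sG2.
set U := [set w | _].
have UE : U = (fun w : T => (w, w) : g_sigma_algebraType G1 * g_sigma_algebraType G2) @^-1` S.
  by apply/seteqP; split => w /SE.
have mU : measurable U by rewrite UE; have := m1 measurableT _ mS; rewrite setTI.
apply: small_of_measure; first exact: mU.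
have mS1 : measurable_fun setT (fun y : g_sigma_algebraType G1 * g_sigma_algebraType G2 => (\1_S y)%:E : \bar R).
  by apply/measurable_EFinP; exact: measurable_indic.
have -> : P U = (\int[P]_w (\1_S (w, w))%:E)%E.
  transitivity (\int[P]_w (\1_U w)%:E)%E.
    by rewrite integral_indic; [rewrite setIT|exact: measurableT|exact: mU].
  by apply: eq_integral => w _; rewrite UE indicE.
rewrite (freezing_sub (f := fun y => (\1_S y)%:E) sG1 sG2 ind); last 2 first.
- exact: mS1.
- by move=> y; rewrite lee_fin.
apply: (le_trans (y := \int[P]_w p%:E)%E); last first.
  by rewrite integral_cst// [X in (_ * X)%E]probability_setT mule1.
apply: ge0_le_integral => //.
- by move=> w _; apply: integral_ge0 => w' _; rewrite lee_fin.
- apply: (@measurable_freezing _ _ _ P _ _ (g_sigma_algebraType G1)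
    (g_sigma_algebraType G2) id id (fun y => (\1_S y)%:E)).
  + exact: g_sigma_id_measurable.
  + exact: g_sigma_id_measurable.
  + exact: mS1.
  + by move=> y; rewrite lee_fin.
move=> w _; set V := [set w' | sigma k (B t w' + A w) < c].
have mV : measurable V.
  rewrite -[X in measurable X]setTI.
  apply: (measurable_fun_ltr (f := fun w' => sigma k (B t w' + A w)) (g := cst c)) => //.
  by apply: sigma_measurable => //; apply: mfmD; [exact: mB|exact: mfm_cst].
have -> : (\int[P]_w' (\1_S (w, w'))%:E = P V)%E.
  rewrite -[RHS](_ : \int[P]_w' (\1_V w')%:E = _)%E.
    apply: eq_integral => w' _; rewrite !indicE; congr (_%:R%:E); congr nat_of_bool.
    by apply/idP/idP; rewrite !inE => /SE.
  by rewrite integral_indic; [rewrite setIT|exact: measurableT|exact: mV].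
exact: small_measure (h _).
Qed.

End Freeze.

Lemma sqrt_sqm_half (R : realType) (zeta : R[i]) (rho : R) : `|zeta| <= rho%:C%C ->
  Num.sqrt (sqm (zeta / 2)) <= rho / 2.
Proof.
case: zeta => x y; rewrite normc_def lecR => h.
have -> : sqm (Complex x y / 2) = 2^-1 ^+ 2 * (x ^+ 2 + y ^+ 2).
  rewrite sqmM mulrC; congr (_ * _).
  by rewrite (_ : 2^-1 = (2^-1 : R)%:C%C) ?sqm_real// rmorphV ?unitfE// rmorph_nat.
by rewrite sqrtrM ?sqr_ge0// sqrtr_sqr ger0_norm// mulrC ler_pM2r.
Qed.

(** For N >= 2 the prefactor 3 N^2 is at most N^4 = exp(4 ln N), which is at most exp(k/3); this
    leaves more than the rate k/4. *)
Lemma union_bound (R : realType) (N : nat) (k : R) : (1 < N)%N -> 12 * ln N%:R <= k ->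
  N%:R * (3 * N%:R * expR (- k)) <= expR (- (4^-1 * k)).
Proof.
move=> N1 hk; have NR : 0 < N%:R :> R by rewrite ltr0n ltnW.
have L0 : 0 <= ln N%:R :> R by rewrite ln_ge0// ler1n ltnW.
have NE : N%:R = expR (ln N%:R) :> R by rewrite lnK.
have N2 : 2 <= N%:R :> R by rewrite ler_nat.
have h3 : 3 <= N%:R * N%:R :> R.
  have : 2 * 2 <= N%:R * N%:R :> R by apply: ler_pM.
  lra.
apply: (@le_trans _ _ (N%:R * N%:R * (N%:R * N%:R) * expR (- k))).
  have -> : N%:R * (3 * N%:R * expR (- k)) = 3 * (N%:R * N%:R) * expR (- k) by ring.
  by rewrite ler_pM2r ?expR_gt0// ler_pM2r ?mulr_gt0.
rewrite {1 2 3 4}NE -!expRD ler_expR; lra.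
Qed.

Theorem proposition5p2 (R : realType) :
  exists C c : R, [/\ 0 < C, 0 < c &
  forall (rho : R) (zeta : R[i]) (T : R),
    0 < rho -> `|zeta| <= rho%:C%C -> 0 < T ->
  exists2 c' : R, 0 < c' &
  forall (N : nat) (t : R), (1 <= N)%N -> 0 < t -> t <= T ->
  forall (d : measure_display) (Omega : measurableType d)
    (P : probability Omega R) (B : R -> Omega -> 'M[R[i]]_N)
    (A : Omega -> 'M[R[i]]_N),
    GL_brownian_motion P rho zeta B ->
    random_matrix A ->
    independent2 P (sigma_mx1 A) (sigma_mx `[0, +oo[ B) ->
  forall k : R, C * ln N%:R <= k ->
    ((1 - expR (- Num.min (c * k) (N%:R `^ (2 / 3))))%R%:E <=
     P [set w | forall l : nat, k <= l%:R ->
          l%:R <= Num.min (Num.sqrt t * N%:R) N.-1%:R ->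
          c' * (l%:R / N%:R) ^+ 2 <= sigma (N - l) (B t w + A w)]%R)%E].
Proof.
exists 12, 4^-1; split=> // rho zeta T rho0 hzeta T0.
have [K [bb [dl [K1 hT hp [dl0 dl2 hdl hpert]]]]] := constants rho0 T0.
pose c' := (2^-1) ^+ bb * (ball_const rho * dl) / 4.
have c'0 : 0 < c'.
  by rewrite divr_gt0// mulr_gt0 ?exprn_gt0// mulr_gt0// ball_const_gt0.
exists c' => // N t N1 t0 tT d Omega P B A [W ellW [adB cB solB]] rA AB k hk.
have [a [b [theta [V [abE WV mV gsV]]]]] := elliptical_gaussian_step N1 ellW.
have mW u : 0 <= u -> mfm (W u).
  move=> u0 q; rewrite (_ : (fun w => _) = (fun w => crd q (\sum_k (V k u w)%:C%C *: ell_basis a b theta k))).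
    have : mfm (fun w => \sum_k (V k u w)%:C%C *: ell_basis a b theta k).
      by apply: mfm_sum => k'; apply: mfm_rZ; [exact: mV|exact: mfm_cst].
    exact.
  by apply/funext => w; rewrite WV.
have mB u : 0 <= u -> mfm (B u).
  move=> u0 q _ U mU; suff : filtration P W u (setT `&` (fun w => crd q (B u w)) @^-1` U).
    apply: smallest_sub; first exact: sigma_algebra_measurable.
    move=> E [|[]//]; apply: smallest_sub; first exact: sigma_algebra_measurable.
    move=> {}E [[v q'] [/= + _]] [U' mU' <-]; rewrite in_itv/= => /andP[v0 _].
    exact: mW.
  by apply: adB => //; apply: sub_sigma_algebra; exists (tt, q) => //=; exists U.
have [Z hZ] : exists Z : R -> Omega -> 'M[R[i]]_N, forall u, 0 <= u -> is_ito_integral P W B u (Z u) /\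
    {ae P, forall w, B u w = 1%:M + Z u w + (zeta / 2) *: time_integral B u w}.
  have : forall u : R, exists Zu : Omega -> 'M[R[i]]_N, 0 <= u -> is_ito_integral P W B u Zu /\
    {ae P, forall w, B u w = 1%:M + Zu w + (zeta / 2) *: time_integral B u w}.
    move=> u; have [u0|u0] := leP 0 u; first by have [Zu h1 h2] := solB u u0; exists Zu.
    by exists (fun=> 0).
  by move=> /choice[f hf]; exists f.
have itoZ u : 0 <= u -> is_ito_integral P W B u (Z u) by move=> /hZ[].
have eqB u : 0 <= u -> {ae P, forall w, B u w = 1%:M + Z u w + (zeta / 2) *: time_integral B u w}.
  by move=> /hZ[].
have zrho : Num.sqrt (sqm (zeta / 2)) <= (a ^+ 2 + b ^+ 2) / 2 by rewrite abE; exact: sqrt_sqm_half.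
subst rho.
set G := [set w | _].
have N1R : 1 <= N%:R :> R by rewrite ler1n.
have k0 : 0 <= k by apply: le_trans hk; rewrite mulr_ge0// ln_ge0.
pose bad l := [set w | [/\ k <= l%:R, (0 < l)%N, l%:R <= Num.sqrt t * N%:R, (l < N)%N &
  sigma (N - l) (B t w + A w) < c' * (l%:R / N%:R) ^+ 2]].
(* The index l = 0 cannot fail, as its lower bound is zero; [per_rank] requires l > 0. *)
have nG w : ~ G w -> exists2 l, (l < N)%N & bad l w.
  move=> /existsNP[l /not_implyP[kl /not_implyP[+ /negP]]]; rewrite -ltNge le_min => /andP[lt1 lN] hs.
  have lN' : (l < N)%N by rewrite -(prednK N1) ltnS -(ler_nat R).
  exists l => //; split => //; rewrite lt0n; apply/eqP => l0.
  by move: hs; rewrite l0 mul0r expr0n mulr0 ltNge sigma_ge0.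
have small0 (e : R) : 0 <= e -> small P set0 e.
  by move=> e0; apply: small_of_measure => //; rewrite measure0 lee_fin.
have hbad : small P (~` G) (expR (- (4^-1 * k))).
  (* For N = 1 only l = 0 is allowed, so no index can be bad; the union bound needs N >= 2. *)
  have [N2|N2] := leqP N 1.
    apply: smallS (small0 _ (expR_ge0 _)) => w /nG[l lN [_ l0 _ _ _]].
    by move: (leq_trans lN N2); rewrite ltnS leqn0 eqn0Ngt l0.
  apply: smallW (smallS _ (small_bigU (A := bad) (n := N) (e := 3 * N%:R * expR (- k)) _)).
  - exact: union_bound.
  - by move=> w /nG[l lN hl]; exists l.
  move=> l lN; have e0 : 0 <= 3 * N%:R * expR (- k) by rewrite !mulr_ge0 ?expR_ge0.
  have [[kl l0 lt]|h] := pselect ([/\ k <= l%:R, (0 < l)%N & l%:R <= Num.sqrt t * N%:R]); last first.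
    by apply: smallS (small0 _ e0) => w [h1 h2 h3 _ _]; apply: h.
  apply: (@smallS _ _ _ _ _ [set w | sigma (N - l) (B t w + A w) < c' * (l%:R / N%:R) ^+ 2]).
    by move=> w [].
  apply: (freeze_sigma rA AB mB (ltW t0)) => //; first by rewrite subn_gt0 lN leq_subr.
  move=> A0; apply: smallW (per_rank WV gsV cB itoZ eqB mB rho0 zrho A0 K1 hT (hp N N1) dl0 dl2
    hdl hpert t0 tT l0 lN lt).
  by rewrite ler_pM2l ?mulr_gt0// ?(lt_le_trans ltr01)// ler_expR lerN2.
(* The estimates bound an outer probability; measurability turns them into a bound for [P]. *)
have mG : measurable G.
  have -> : G = \bigcap_l [set w | k <= l%:R -> l%:R <= Num.min (Num.sqrt t * N%:R) N.-1%:R ->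
          c' * (l%:R / N%:R) ^+ 2 <= sigma (N - l) (B t w + A w)].
    by apply/seteqP; split => w /= h l; [move=> _|]; exact: h.
  apply: bigcap_measurable => // l _.
  have [h1|h1] := pselect (k <= l%:R); last first.
    by rewrite (_ : [set w | _] = setT)//; apply/seteqP; split => // w _ /= /h1.
  have [h2|h2] := pselect (l%:R <= Num.min (Num.sqrt t * N%:R) N.-1%:R); last first.
    by rewrite (_ : [set w | _] = setT)//; apply/seteqP; split => // w _ /= _ /h2.
  rewrite (_ : [set w | _] = [set w | c' * (l%:R / N%:R) ^+ 2 <= sigma (N - l) (B t w + A w)]); last first.
    by apply/seteqP; split => w /=; [exact|].
  rewrite -[X in measurable X]setTI.
  apply: (measurable_fun_ler (f := cst _) (g := fun w => sigma (N - l) (B t w + A w))) => //.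
  apply: sigma_measurable.
    have lN : (l < N)%N.
      by move: h2; rewrite le_min => /andP[_]; rewrite ler_nat -ltnS prednK.
    by rewrite subn_gt0 lN leq_subr.
  apply: mfmD; first exact: mB (ltW t0).
  move=> q _ U mU; apply: rA; apply: sub_sigma_algebra.
  by exists (tt, q) => //; exists U.
have PnG : (P (~` G) <= (expR (- (4^-1 * k)))%:E)%E.
  by apply: small_measure hbad; exact: measurableC.
have -> : P G = (1 - P (~` G))%E by rewrite -{1}[G]setCK probability_setC//; exact: measurableC.
rewrite EFinB; apply: leeB => //; apply: (le_trans PnG).
by rewrite lee_fin ler_expR lerN2 ge_min lexx.
Qed.
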